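(* Let $1\le k\le j\le\infty$, let $\mathcal F\in\mathrm{Op}^{\mathrm{un}}_{\le j}$ be a unital $j$-restricted $\infty$-operad, and let $\mathrm{R}_k\colon\mathrm{Op}^{\mathrm{un}}_{\le k}\to\mathrm{Op}^{\mathrm{un}}_{\le j}$ be the fully faithful functor given by right Kan extension along $i_k\colon\Omega^c_{\le k}\hookrightarrow\Omega^c_{\le j}$. The following are equivalent: (1) $\mathcal F$ is in the (essential) image of $\mathrm{R}_k$. (2) For any integer $n$ with $k<n\le j$, the canonical map $\mathcal F(\overline{C_n})\to\lim_{I\in(\mathcal P_{\le k}(v(r)))^{\mathrm{op}}}\mathcal F(\overline{C_I})$ is an equivalence, where $r$ is the root of $\overline{C_n}$. (3) For any integer $n$ with $k<n\le j$ and colours $X_1,\dots,X_n,Y$ in $\mathcal F$, the canonical map $$\mathrm{Mul}_{\mathcal F}(X_1,\dots,X_n;Y)\to\lim_{(i_1,\dots,i_l)\in(\mathcal P_{\le k}(v(r)))^{\mathrm{op}}}\mathrm{Mul}_{\mathcal F}(X_{i_1},\dots,X_{i_l};Y)$$ is an equivalence.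
   Context: **Trees.** A (dendroidal) tree $(T,L)$, often written $T$, is a finite poset $T$ with a minimal element (a least element, called the root) such that $\{y\le x\}$ is linearly ordered for every $x\in T$, together with a subset $L$ of the maximal elements of $T$ (the leaves). Elements of $T$ are called edges. For an edge $e$, $v(e)$ is the set of minimal elements of $T_{>e}$, and $|v(e)|$ is the valence of $e$. The edge $\eta$ is $(\{r\},\{r\})$; the $n$-corolla $C_n$ ($n\ge1$) is $\{0,1,\dots,n\}$ with $0$ least, $1,\dots,n$ pairwise incomparable and $L=\{1,\dots,n\}$; $C_0=(\{0\},\varnothing)$. **Category $\Omega$.** Objects are trees; $\mathrm{Hom}_\Omega(T,T')$ is the set of operad maps $\mathrm{Free}(T)\to\mathrm{Free}(T')$, where $\mathrm{Free}(T)$ is the coloured symmetric operad in sets with colours the edges of $T$, freely generated by one operation $v(e)\to e$ for each non-leaf edge $e$. **Closed trees.** A tree is closed if $L=\varnothing$; $\Omega^c\subset\Omega$ is the full subcategory of closed trees. (Explicitly: objects are finite rooted trees and morphisms are order-preserving maps that preserve independence, i.e. send incomparable pairs to incomparable pairs.) The inclusion $\Omega^c\hookrightarrow \Omega$ has left adjoint $(T,L)^c=(T,\varnothing)$; $\overline{C_n}:=C_n^c$. A tree is $k$-dendroidal if all its edges have valence $\le k$ (no condition if $k=\infty$); $\Omega^c_{\le k}\subset\Omega^c$ is the full subcategory of closed $k$-dendroidal trees, $\Omega^c_{\le\infty}=\Omega^c$. **Segal presheaves.** $\mathcal S$ is the $\infty$-category of spaces and $\mathcal P(\mathcal C)=\mathrm{Fun}(\mathcal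 C^{\mathrm{op}},\mathcal S)$. A morphism $f\colon T\to T'$ is a subtree inclusion if it is injective on edges and whenever $f(e_0)\le e'\le f(e_2)$ with $e'\in T'$, $e'$ lies in the image of $f$. For a tree $T$, $(\Omega^{\mathrm{el}})_{/T}\subset\Omega_{/T}$ is the full subcategory of subtree inclusions $f\colon X\to T$ with $X=\eta$ or $X=C_n$ for some $n$, where, if $X=C_n$ has root $x$, the edge $f(x)$ must also have valence $n$. A presheaf $\mathcal F$ on $\Omega^c_{\le k}$ is Segal if for every closed $k$-dendroidal $T$ the canonical map $\mathcal F(T)\to\lim_{X\in((\Omega^{\mathrm{el}})_{/T})^{\mathrm{op}}}\mathcal F(X^c)$ is an equivalence. Let $r\colon\Delta\to\Omega^c_{\le k}$ send $[n]$ to the closure of $(\{0\le1\le\dots\le n\},\{n\})$. A Segal presheaf $\mathcal F$ is complete if $r^*\mathcal F$ is a complete Segal space in the sense of Rezk. $\mathrm{Op}^{\mathrm{un}}_{\le k}$ is the full subcategory of $\mathcal P(\Omega^c_{\le k})$ on complete Segal presheaves; its objects are called unital $k$-restricted $\infty$-operads (same with $j$). Right Kan extension along $i_k$ sends $\mathrm{Op}^{\mathrm{un}}_{\le k}$ to $\mathrm{Op}^{\mathrm{un}}_{\le j}$. **Colours and multimorphisms.** $\mathcal F(\overline{C_0})$ is the space of colours of $\mathcal F$; for colours $X_1,\dots,X_n,Y$, $\mathrm{Mul}_{\mathcal F}(X_1,\dots,X_n;Y)=\mathcal F(\overline{C_n})\times_{\mathcal F(\overline{C_0})^{n+1}}\{(X_1,\dots,X_n,Y)\}$;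 for the empty list $\mathrm{Mul}_{\mathcal F}(\varnothing;Y)$ is a point. **Power sets.** $\mathcal P_{\le k}(S)$ is the poset (under inclusion, viewed as a category) of subsets $I\subset S$ with $|I|\le k$. For $I\subset v(r)$, $\overline{C_I}=\{r\}\cup I\subset\overline{C_n}$ is the closed sub-$|I|$-corolla (so $\overline{C_\varnothing}=\overline{C_0}$), and the functor $I\mapsto\mathcal F(\overline{C_I})$ and the canonical maps use restriction along the inclusions $\overline{C_I}\hookrightarrow\overline{C_{I'}}$ ($I\subset I'$) and $\overline{C_I}\hookrightarrow\overline{C_n}$. In (3) $v(r)$ is identified with $\{1,\dots,n\}$ and $(i_1,\dots,i_l)$ denotes the subset $\{i_1,\dots,i_l\}$ of $v(r)$, $l\le k$. *)

(* Defs.v *)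
(* MathComp, with function extensionality and proof irrelevance from boolp.

   The infinity-category of spaces is modelled by Kan complexes.  For a small
   category C, every object of Fun(C^op, S) is represented by a strict functor
   from C^op to Kan complexes, equivalences are represented by (spans of)
   levelwise homotopy equivalences, and limits in S are computed by the
   Bousfield-Kan homotopy limit of such strict diagrams. *)
From HB Require Import structures.
Set Warnings "-notation-overridden,-redundant-canonical-projection".
From mathcomp Require Import all_boot all_order boolp.
Set Implicit Arguments.
Unset Strict Implicit.
Unset Printing Implicit Defensive.
Import Order.TTheory.

Declare Scope cat_scope.
Delimit Scope cat_scope with cat.
Local Open Scope cat_scope.

Record category := Category {
  ob :> Type;
  hom : ob -> ob -> Type;
  idm : forall a, hom a a;
  comp : forall a b c, hom b c -> hom a b -> hom a c;
  comp1m : forall a b (f : hom a b), comp (idm b) f = f;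
  compm1 : forall a b (f : hom a b), comp f (idm a) = f;
  compA : forall a b c d (h : hom c d) (g : hom b c) (f : hom a b),
    comp h (comp g f) = comp (comp h g) f }.
Arguments idm {C} a : rename.
Arguments comp {C x y z} g f : rename.
Notation "g \c f" := (comp g f)
  (at level 40, left associativity) : cat_scope.

Record functor (C D : category) := Functor {
  fob :> C -> D;
  fmap : forall a b, hom a b -> hom (fob a) (fob b);
  fmap1 : forall a, fmap (idm a) = idm (fob a);
  fmapM : forall a b c (g : hom b c) (f : hom a b),
    fmap (g \c f) = fmap g \c fmap f }.
Arguments fmap {C D} f {a b} _ : rename.

Definition idf (C : category) : functor C C :=
  @Functor C C id (fun _ _ u => u) (fun _ => erefl) (fun _ _ _ _ _ => erefl).

Section CompF.
Variables (C D E : category) (G : functor D E) (F : functor C D).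

Lemma compf1 a : fmap G (fmap F (idm a)) = idm (G (F a)).
Proof. by rewrite !fmap1. Qed.

Lemma compfM a b c (v : hom b c) (u : hom a b) :
  fmap G (fmap F (v \c u)) = fmap G (fmap F v) \c fmap G (fmap F u).
Proof. by rewrite !fmapM. Qed.

Definition compf : functor C E :=
  @Functor C E (fun a => G (F a)) (fun a b u => fmap G (fmap F u)) compf1 compfM.
End CompF.

Definition op (C : category) : category :=
  @Category C (fun a b => hom b a) idm (fun a b c g f => f \c g)
    (fun a b f => compm1 f) (fun a b f => comp1m f)
    (fun a b c d h g f => esym (compA f g h)).

Definition opf (C D : category) (F : functor C D) : functor (op C) (op D) :=
  @Functor (op C) (op D) F (fun a b u => fmap F u) (fmap1 F)
    (fun a b c g f => fmapM F f g).

Definition full (C : category) (A : Type) (f : A -> C) : category :=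
  @Category A (fun a b => hom (f a) (f b)) (fun a => idm (f a))
    (fun a b c g h => g \c h)
    (fun a b u => comp1m u) (fun a b u => compm1 u)
    (fun a b c d h g u => compA h g u).

Definition fullf (C : category) (A : Type) (f : A -> C) : functor (full f) C :=
  @Functor (full f) C f (fun _ _ u => u) (fun _ => erefl) (fun _ _ _ _ _ => erefl).

Definition precat (T : Type) (le : rel T) (le_refl : reflexive le)
    (le_trans : transitive le) : category :=
  @Category T (fun x y => le x y) le_refl
    (fun x y z yz xy => @le_trans y x z xy yz)
    (fun _ _ _ => bool_irrelevance _ _) (fun _ _ _ => bool_irrelevance _ _)
    (fun _ _ _ _ _ _ _ => bool_irrelevance _ _).

#[projections(primitive)]
Record commaOb (C D : category) (i : functor C D) (d : D) :=
  CommaOb { csrc : C; carr : hom (i csrc) d }.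

#[projections(primitive)]
Record commaHom (C D : category) (i : functor C D) (d : D)
    (x y : commaOb i d) := CommaHom {
  chom : hom (csrc x) (csrc y);
  chomP : carr y \c fmap i chom = carr x }.

Section Comma.
Variables (C D : category) (i : functor C D) (d : D).

Lemma commaHom_ext (x y : commaOb i d) (u v : commaHom x y) :
  chom u = chom v -> u = v.
Proof.
case: u v => [u uP] [v vP] /= E; case: _ / E vP => vP.
by rewrite (Prop_irrelevance uP vP).
Qed.

Lemma comma1P (x : commaOb i d) : carr x \c fmap i (idm (csrc x)) = carr x.
Proof. by rewrite fmap1 compm1. Qed.

Lemma commaMP (x y z : commaOb i d) (v : commaHom y z) (u : commaHom x y) :
  carr z \c fmap i (chom v \c chom u) = carr x.
Proof. by rewrite fmapM compA !chomP. Qed.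

Definition comma : category.
refine (@Category (commaOb i d) (@commaHom C D i d)
  (fun x => CommaHom (comma1P x)) (fun x y z v u => CommaHom (commaMP v u)) _ _ _).
- by move=> *; apply: commaHom_ext; apply: comp1m.
- by move=> *; apply: commaHom_ext; apply: compm1.
- by move=> *; apply: commaHom_ext; apply: compA.
Defined.

Definition comma_src : functor comma C :=
  @Functor comma C (fun x => csrc x) (fun _ _ u => chom u)
    (fun _ => erefl) (fun _ _ _ _ _ => erefl).
End Comma.

Section CommaPost.
Variables (C D : category) (i : functor C D) (d d' : D) (w : hom d d').

Lemma comma_postP (x y : commaOb i d) (u : commaHom x y) :
  (w \c carr y) \c fmap i (chom u) = w \c carr x.
Proof. by rewrite -compA chomP. Qed.

Definition comma_post : functor (comma i d) (comma i d').
refine (@Functor (comma i d) (comma i d')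
  (fun x => CommaOb (w \c carr x))
  (fun x y u => @CommaHom _ _ i d' (CommaOb (w \c carr x)) (CommaOb (w \c carr y))
     (chom u) (comma_postP u)) _ _).
- by move=> a; apply: commaHom_ext.
- by move=> a b c g f; apply: commaHom_ext.
Defined.
End CommaPost.

(* [n]; functors between these categories are exactly monotone maps. *)
Definition lin (n : nat) : category :=
  @precat 'I_n.+1 <=%O le_refl le_trans.

Lemma pre_functor_ext (C : category) (T : Type) (le : rel T)
  (rr : reflexive le) (rt : transitive le) (F G : functor C (precat rr rt)) :
  F =1 G -> F = G.
Proof.
case: F G => [f fm f1 fM] [g gm g1 gM] /= /funext E.
case: _ / E gm g1 gM => gm g1 gM.
have Em : fm = gm by do 3 apply: functional_extensionality_dep => ?; apply: bool_irrelevance.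
case: _ / Em g1 gM => g1 gM.
by rewrite (Prop_irrelevance f1 g1) (Prop_irrelevance fM gM).
Qed.

Definition Delta : category.
refine (@Category nat (fun m n => functor (lin m) (lin n)) (fun n => idf (lin n))
  (fun m n p g f => compf g f) _ _ _).
- by move=> *; apply: pre_functor_ext.
- by move=> *; apply: pre_functor_ext.
- by move=> *; apply: pre_functor_ext.
Defined.

Section MonoMap.
Variables (m n : nat) (f : 'I_m.+1 -> 'I_n.+1).
Hypothesis fP : {homo f : x y / (x <= y)%O}.

Definition mono : @hom Delta m n :=
  @Functor (lin m) (lin n) f (fun x y xy => fP xy)
    (fun _ => bool_irrelevance _ _) (fun _ _ _ _ _ => bool_irrelevance _ _).
End MonoMap.

Lemma cstP (m n : nat) (i : 'I_n.+1) : {homo (fun _ : 'I_m.+1 => i) : x y / (x <= y)%O}.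
Proof. by []. Qed.
Definition cst (m n : nat) (i : 'I_n.+1) : @hom Delta m n := mono (@cstP m n i).

Lemma cofaceP n (i : 'I_n.+2) : {homo (lift i : 'I_n.+1 -> 'I_n.+2) : x y / (x <= y)%O}.
Proof. by move=> x y; rewrite !leEord /= leq_bump2. Qed.
Definition coface n (i : 'I_n.+2) : @hom Delta n n.+1 := mono (cofaceP i).

Record sset := SSet {
  simp :> nat -> Type;
  act : forall m n, @hom Delta m n -> simp n -> simp m;
  act1 : forall n (x : simp n), act (@idm Delta n) x = x;
  actM : forall m n p (b : @hom Delta n p) (a : @hom Delta m n) x,
    act (b \c a) x = act a (act b x) }.
Arguments act {s m n} _ _ : rename.

Record smap (X Y : sset) := SMap {
  sfun :> forall n, X n -> Y n;
  sfunP : forall m n (a : @hom Delta m n) x,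
    sfun (act a x) = act a (sfun x) }.
Arguments sfun {X Y} s n _ : rename.

Lemma smap_ext (X Y : sset) (f g : smap X Y) :
  (forall n (x : X n), f n x = g n x) -> f = g.
Proof.
case: f g => [f fP] [g gP] /= E.
have {}E : f = g by do 2 apply: functional_extensionality_dep => ?.
by case: _ / E gP => gP; rewrite (Prop_irrelevance fP gP).
Qed.

Definition sid (X : sset) : smap X X := @SMap X X (fun _ x => x) (fun _ _ _ _ => erefl).

Lemma scompP (X Y Z : sset) (g : smap Y Z) (f : smap X Y) m n
  (a : @hom Delta m n) x : g m (f m (act a x)) = act a (g n (f n x)).
Proof. by rewrite !sfunP. Qed.
Definition scomp (X Y Z : sset) (g : smap Y Z) (f : smap X Y) : smap X Z :=
  SMap (scompP g f).

Definition splx (n : nat) : sset.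
refine (@SSet (fun p => @hom Delta p n) (fun p q a x => x \c a) _ _).
- by move=> p x; apply: compm1.
- by move=> *; apply: compA.
Defined.

Definition sprod (X Y : sset) : sset.
refine (@SSet (fun n => X n * Y n)%type (fun m n a x => (act a x.1, act a x.2)) _ _).
- by move=> n [x y] /=; rewrite !act1.
- by move=> *; rewrite /= !actM.
Defined.

Definition spow (I : Type) (X : sset) : sset.
refine (@SSet (fun n => I -> X n) (fun m n a x i => act a (x i)) _ _).
- by move=> n x; apply: funext => i; rewrite act1.
- by move=> *; apply: funext => i; rewrite actM.
Defined.

Lemma spreP (K X : sset) m n (a : @hom Delta m n)
  (h : smap (sprod (splx n) K) X) p q (b : @hom Delta p q)
  (x : sprod (splx m) K q) :
  h p (a \c (act b x).1, (act b x).2) = act b (h q (a \c x.1, x.2)).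
Proof. by rewrite -sfunP /=; congr (h p (_, _)); apply: (@compA Delta). Qed.

Definition maps (K X : sset) : sset.
refine (@SSet (fun m => smap (sprod (splx m) K) X)
  (fun m n a h => SMap (spreP a h)) _ _).
- move=> n h; apply: smap_ext => p [x y] /=; congr (h p (_, _)).
  exact: (@comp1m Delta).
- move=> m n p b a h; apply: smap_ext => q [x y] /=; congr (h q (_, _)).
  exact/esym/(@compA Delta).
Defined.

(* The simplices of the horn Lambda^(n+1)_i: those in some face other than the
   i-th one. *)
Definition in_horn n (i : 'I_n.+2) p (a : splx n.+1 p) : Prop :=
  exists2 j : 'I_n.+2, j <> i & forall x, a x <> j.

Lemma in_horn_act n (i : 'I_n.+2) p q (b : @hom Delta p q) (a : splx n.+1 q) :
  in_horn i a -> in_horn i (act b a).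
Proof. by case=> j ji aj; exists j => // x; apply: aj. Qed.

Definition horn n (i : 'I_n.+2) : sset.
refine (@SSet (fun p => {a : splx n.+1 p | in_horn i a})
  (fun p q b a => exist _ (act b (sval a)) (in_horn_act b (svalP a))) _ _).
- by move=> p [a aP]; apply: eq_exist; apply: (act1 (s := splx n.+1)).
- by move=> m p q b c [a aP]; apply: eq_exist; apply: (actM (s := splx n.+1)).
Defined.

Definition kan (X : sset) : Prop :=
  forall n (i : 'I_n.+2) (h : smap (horn i) X),
  exists x : X n.+1, forall p (a : horn i p), h p a = act (sval a) x.

Definition homotopic (X Y : sset) (f g : smap X Y) : Prop :=
  exists H : smap (sprod X (splx 1)) Y,
    forall n (x : X n), H n (x, cst n ord0) = f n x /\ H n (x, cst n ord_max) = g n x.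

(* Homotopy equivalence; this is the notion of equivalence of spaces when X and
   Y are Kan complexes, the only case in which it is used. *)
Definition sequiv (X Y : sset) (f : smap X Y) : Prop :=
  exists g : smap Y X,
    homotopic (scomp g f) (sid X) /\ homotopic (scomp f g) (sid Y).

Record diagram (J : category) := Diagram {
  dob :> J -> sset;
  dmap : forall a b, hom a b -> smap (dob a) (dob b);
  dmap1 : forall a n (x : dob a n), dmap (idm a) n x = x;
  dmapM : forall a b c (g : hom b c) (f : hom a b) n (x : dob a n),
    dmap (g \c f) n x = dmap g n (dmap f n x) }.
Arguments dmap {J} d {a b} _ : rename.

Notation presheaf C := (diagram (op C)).

Definition dcomp (I J : category) (F : diagram J) (p : functor I J) : diagram I.
refine (@Diagram I (fun a => F (p a)) (fun a b u => dmap F (fmap p u)) _ _).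
- by move=> *; rewrite fmap1 dmap1.
- by move=> *; rewrite fmapM dmapM.
Defined.

Definition pullback (C D : category) (i : functor C D) (F : presheaf D) : presheaf C :=
  dcomp F (opf i).

Record dmor (J : category) (F G : diagram J) := DMor {
  dfun :> forall a, smap (F a) (G a);
  dfunP : forall a b (u : hom a b) n (x : F a n),
    dfun b n (dmap F u n x) = dmap G u n (dfun a n x) }.

Lemma le_max n (i : 'I_n.+1) : (i <= ord_max :> 'I_n.+1)%O.
Proof. by rewrite leEord /= leq_ord. Qed.

(* Bousfield-Kan: the totalization of the cosimplicial replacement.  A simplex
   assigns to each chain c : [n] -> J a simplex of F(c_n)^(Delta^n), compatibly
   with all simplicial operators; equivalently, it is a natural transformation
   Delta^m x N(J/-) -> F. *)
Definition holim_compat (J : category) (F : diagram J) m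
    (s : forall n (c : functor (lin n) J), maps (splx n) (F (c ord_max)) m) :=
  forall n' n (al : @hom Delta n' n) (c : functor (lin n) J) q
    (x : splx m q) (y : splx n' q),
  dmap F (fmap c (le_max (al ord_max))) q (s n' (compf c al) q (x, y))
  = s n c q (x, al \c y).

Record holimSimp (J : category) (F : diagram J) m := HolimSimp {
  hsim :> forall n (c : functor (lin n) J), maps (splx n) (F (c ord_max)) m;
  hsimP : holim_compat hsim }.

Lemma holimSimp_ext (J : category) (F : diagram J) m (s t : holimSimp F m) :
  (forall n c q x y, s n c q (x, y) = t n c q (x, y)) -> s = t.
Proof.
case: s t => [s sP] [t tP] /= E.
have {}E : s = t.
  do 2 apply: functional_extensionality_dep => ?.
  by apply: smap_ext => q [x y]; apply: E.
by case: _ / E tP => tP; rewrite (Prop_irrelevance sP tP).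
Qed.

Lemma holim_actP (J : category) (F : diagram J) m p (a : @hom Delta m p)
  (s : holimSimp F p) : holim_compat (fun n c => act a (s n c)).
Proof. by move=> n' n al c q x y; apply: hsimP. Qed.

Definition holim (J : category) (F : diagram J) : sset.
refine (@SSet (holimSimp F) (fun m p a s => HolimSimp (holim_actP a s)) _ _).
- move=> m s; apply: holimSimp_ext => n c q x y /=; congr (s n c q (_, _)).
  exact: (@comp1m Delta).
- move=> m p r b a s; apply: holimSimp_ext => n c q x y /=.
  congr (s n c q (_, _)); exact/esym/(@compA Delta).
Defined.

Record cone (J : category) (X : sset) (F : diagram J) := Cone {
  leg :> forall j, smap X (F j);
  legP : forall a b (u : hom a b) n (x : X n),
    dmap F u n (leg a n x) = leg b n x }.
Arguments leg {J X F} c j : rename.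

Section Canonical.
Variables (J : category) (X : sset) (F : diagram J) (l : cone X F).

Lemma canon_mapP m (x : X m) n (c : functor (lin n) J) p q
  (b : @hom Delta p q) (z : sprod (splx m) (splx n) q) :
  leg l (c ord_max) p (act (act b z.1) x)
  = act b (leg l (c ord_max) q (act z.1 x)).
Proof. by rewrite /= actM sfunP. Qed.

Definition canon_simp m (x : X m) n (c : functor (lin n) J) :
    maps (splx n) (F (c ord_max)) m :=
  SMap (canon_mapP x c).

Lemma canon_compat m (x : X m) : holim_compat (canon_simp x).
Proof. by move=> n' n al c q y z /=; rewrite legP. Qed.

(* The canonical map induced by a strict cone. *)
Definition canon : smap X (holim F).
refine (@SMap X (holim F) (fun m x => HolimSimp (canon_compat x)) _).
by move=> *; apply: holimSimp_ext => n c q x y /=; rewrite actM.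
Defined.
End Canonical.

Lemma hsim_cast (J : category) (F : diagram J) m (s : holimSimp F m) n
    (c c' : functor (lin n) J) (E : c = c') (Eo : c ord_max = c' ord_max) q z :
  eq_rect _ (fun o => F o q) (s n c q z) _ Eo = s n c' q z.
Proof. by case: _ / E Eo => Eo; rewrite (Prop_irrelevance Eo erefl). Qed.

Lemma compfA (A B C D : category) (h : functor C D) (g : functor B C)
  (f : functor A B) : compf (compf h g) f = compf h (compf g f).
Proof. by rewrite /compf /=; congr Functor; apply: Prop_irrelevance. Qed.

Section HolimPull.
Variables (I J : category) (p : functor I J) (F : diagram J) (G : diagram I).
Variable f : forall i, smap (F (p i)) (G i).
Hypothesis fP : forall i i' (u : hom i i') n (x : F (p i) n),
  f i' n (dmap F (fmap p u) n x) = dmap G u n (f i n x).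

Definition hpull_simp m (s : holimSimp F m) n (c : functor (lin n) I) :
    maps (splx n) (G (c ord_max)) m :=
  scomp (f (c ord_max)) (s n (compf p c)).

Lemma hpull_compat m (s : holimSimp F m) : holim_compat (hpull_simp s).
Proof.
move=> n' n al c q x y /=; rewrite -fP; congr (f _ _ _).
rewrite -(hsimP s al (compf p c) x y) /=; congr (dmap F _ q _).
exact/esym/(hsim_cast s (compfA p c al) erefl (x, y)).
Qed.

Definition hpull : smap (holim F) (holim G).
refine (@SMap (holim F) (holim G) (fun m s => HolimSimp (hpull_compat s)) _).
by move=> *; apply: holimSimp_ext.
Defined.
End HolimPull.

Section ChainEq.
Variables (C D : category) (i : functor C D) (d : D) (K : category).
Variables (o : K -> C) (m : forall a b, hom a b -> hom (o b) (o a)).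
Hypotheses (m1 : forall a, m (idm a) = idm (o a))
  (mM : forall x y z (g : hom y z) (f : hom x y), m (g \c f) = m f \c m g).

Lemma functor_ext (A B : category) (fo : A -> B)
  (fm fm' : forall a b, hom a b -> hom (fo a) (fo b)) f1 fM f1' fM' :
  (forall a b u, fm a b u = fm' a b u) ->
  @Functor A B fo fm f1 fM = @Functor A B fo fm' f1' fM'.
Proof.
move=> E; have {}E : fm = fm' by do 3 apply: functional_extensionality_dep => ?.
case: _ / E f1' fM' => f1' fM'.
by rewrite (Prop_irrelevance f1 f1') (Prop_irrelevance fM fM').
Qed.

Definition chain (g : forall k, hom (i (o k)) d)
  (H : forall a b (u : hom a b), g a \c fmap i (m u) = g b) :
  functor K (op (comma i d)).
refine (@Functor K (op (comma i d)) (fun k => CommaOb (g k))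
  (fun a b u => @CommaHom _ _ i d (CommaOb (g b)) (CommaOb (g a)) (m u) (H a b u)) _ _).
- by move=> a; apply: commaHom_ext; apply: m1.
- by move=> x y z g' f; apply: commaHom_ext; apply: mM.
Defined.

Lemma chain_eq g g' H H' : (forall k, g k = g' k) -> @chain g H = @chain g' H'.
Proof.
move=> E; have {}E : g = g' by apply: functional_extensionality_dep.
by case: _ / E H' => H'; rewrite (Prop_irrelevance H H').
Qed.
End ChainEq.

Section PostEq.
Variables (C D : category) (i : functor C D) (K : category).

Lemma comma_post1 d (c : functor K (op (comma i d))) :
  compf (opf (comma_post i (idm d))) c = c.
Proof.
have m1 a : chom (fmap c (idm a)) = idm (csrc (c a)) by rewrite fmap1.
have mM x y z (g : hom y z) (f : hom x y) :
  chom (fmap c (g \c f)) = chom (fmap c f) \c chom (fmap c g) by rewrite fmapM.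
have H a b (u : hom a b) :
  carr (c a) \c fmap i (chom (fmap c u)) = carr (c b) by apply: chomP.
have H' a b (u : hom a b) : (idm d \c carr (c a)) \c fmap i (chom (fmap c u))
  = idm d \c carr (c b) by rewrite !comp1m H.
transitivity (chain m1 mM H').
  by apply: functor_ext => a b u; apply: commaHom_ext.
transitivity (chain m1 mM H).
  by apply: chain_eq => k; rewrite comp1m.
case: c m1 mM H H' => o m o1 oM m1 mM H H'.
by apply: functor_ext => a b u; apply: commaHom_ext.
Qed.

Lemma comma_postM d d' d'' (w' : hom d' d'') (w : hom d d')
    (c : functor K (op (comma i d))) :
  compf (opf (comma_post i (w' \c w))) c =
  compf (opf (comma_post i w')) (compf (opf (comma_post i w)) c).
Proof.
have m1 a : chom (fmap c (idm a)) = idm (csrc (c a)) by rewrite fmap1.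
have mM x y z (g : hom y z) (f : hom x y) :
  chom (fmap c (g \c f)) = chom (fmap c f) \c chom (fmap c g) by rewrite fmapM.
have H a b (u : hom a b) : (w' \c w \c carr (c a)) \c fmap i (chom (fmap c u))
  = w' \c w \c carr (c b) by rewrite -compA chomP.
have H' a b (u : hom a b) : (w' \c (w \c carr (c a))) \c fmap i (chom (fmap c u))
  = w' \c (w \c carr (c b)) by rewrite !compA.
transitivity (chain m1 mM H).
  by apply: functor_ext => a b u; apply: commaHom_ext.
transitivity (chain m1 mM H').
  by apply: chain_eq => k; rewrite compA.
by apply: functor_ext => a b u; apply: commaHom_ext.
Qed.
End PostEq.

Section Ran.
Variables (C D : category) (i : functor C D) (G : presheaf C).

Definition ran_diag (d : D) : diagram (op (comma i d)) := pullback (comma_src i d) G.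

Definition ran_map d d' (w : hom d d') :
    smap (holim (ran_diag d')) (holim (ran_diag d)) :=
  @hpull (op (comma i d)) (op (comma i d')) (opf (comma_post i w))
    (ran_diag d') (ran_diag d) (fun x => sid (G (csrc x))) (fun _ _ _ _ _ => erefl).

Lemma ran_cast d m (s : holimSimp (ran_diag d) m) n
    (c c' : functor (lin n) (op (comma i d))) (E : c = c')
    (Eo : csrc (c ord_max) = csrc (c' ord_max)) q z :
  eq_rect _ (fun o => G o q) (s n c q z) _ Eo = s n c' q z.
Proof. by case: _ / E Eo => Eo; rewrite (Prop_irrelevance Eo erefl). Qed.

(* Pointwise homotopy right Kan extension along i^op. *)
Definition ran : presheaf D.
refine (@Diagram (op D) (fun d => holim (ran_diag d)) (fun a b w => ran_map w) _ _).
- move=> d m s; apply: holimSimp_ext => n c q x y /=.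
  exact: (ran_cast s (comma_post1 c) erefl (x, y)).
- move=> a b c g f m s; apply: holimSimp_ext => n k q x y /=.
  exact: (ran_cast s (comma_postM (i := i) f g k) erefl (x, y)).
Defined.
End Ran.

Definition kan_valued (J : category) (F : diagram J) : Prop := forall a, kan (F a).

Definition levelwise (J : category) (F G : diagram J) (f : dmor F G) : Prop :=
  forall a, sequiv (f a).

(* F and G are equivalent objects of Fun(J, S): since the levelwise Kan diagrams
   are the fibrant objects of the projective model structure, this amounts to
   the existence of a span of levelwise equivalences. *)
Definition dequiv (J : category) (F G : diagram J) : Prop :=
  exists H : diagram J, kan_valued H /\
  (exists f : dmor H F, levelwise f) /\ (exists g : dmor H G, levelwise g).

(* The maps [m] -> [n] with m <= 1 that are inclusions of intervals. *)
Definition spine (n : nat) : category :=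
  full (fun x : {x : comma (idf Delta) n |
      (csrc x <= 1)%N /\ forall t, carr x t = carr x ord0 + t :> nat} => sval x).

Definition spine_src n : functor (spine n) Delta :=
  compf (comma_src (idf Delta) n) (fullf _).

Section SpineCone.
Variables (X : presheaf Delta) (n : nat).

Lemma spine_coneP (a b : op (spine n)) (u : hom a b) p (x : X n p) :
  dmap (pullback (spine_src n) X) u p (dmap X (carr (sval a)) p x)
  = dmap X (carr (sval b)) p x.
Proof. by rewrite -(chomP u); apply/esym/(@dmapM _ X). Qed.

Definition spine_cone : cone (X n) (pullback (spine_src n) X) :=
  @Cone (op (spine n)) (X n) (pullback (spine_src n) X)
    (fun x => dmap X (a := n) (carr (sval x))) spine_coneP.
End SpineCone.

Definition path_connected (X : sset) (x y : X 0) : Prop :=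
  exists p : X 1, act (cst 0 (ord0 : 'I_2)) p = x /\ act (cst 0 (ord_max : 'I_2)) p = y.

Section Rezk.
Variable X : presheaf Delta.

Definition face n (i : 'I_n.+2) : smap (X n.+1) (X n) :=
  dmap X (a := n.+1) (b := n) (coface i).
Definition degen0 : smap (X 0) (X 1) := dmap X (a := 0) (b := 1) (cst 1 ord0).

(* A point of X_2 with edges d2, d0 and d1 exhibits d1 as a composite of d2 and
   d0.  So g has a right and a left homotopy inverse. *)
Definition hoequiv (g : X 1 0) : Prop :=
  (exists (s : X 2 0) (x : X 0 0),
     path_connected (face (inord 0) 0 s) g /\
     path_connected (face (inord 1) 0 s) (degen0 0 x)) /\
  (exists (s : X 2 0) (x : X 0 0),
     path_connected (face (inord 2) 0 s) g /\
     path_connected (face (inord 1) 0 s) (degen0 0 x)).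

Lemma hoequiv_degen (x : X 0 0) : hoequiv (degen0 0 x).
Proof.
have conn (y : X 1 0) : path_connected y y.
  have E (j : 'I_2) : act (cst 0 j) (act (cst 1 ord0) y) = y.
    rewrite -[RHS](@act1 (X 1)) -(@actM (X 1) _ _ _ (cst 1 (ord0 : 'I_1)) (cst 0 j) y).
    congr (@act (X 1) 0 0 _ y).
    by apply: pre_functor_ext => t; rewrite [LHS]ord1 [RHS]ord1.
  by exists (act (cst 1 ord0) y); split; apply: E.
have d (i : 'I_3) : face i 0 (dmap X (a := 0) (b := 2) (cst 2 ord0) 0 x) = degen0 0 x.
  rewrite /face /degen0 -(@dmapM _ X); congr (dmap X _ 0 x).
  by apply: pre_functor_ext.
by split; exists (dmap X (a := 0) (b := 2) (cst 2 ord0) 0 x), x; rewrite !d.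
Qed.

Lemma hoequiv_act m n (a : @hom Delta m n) (x : X 1 n) :
  (forall v : @hom Delta 0 n, hoequiv (act v x)) ->
  forall v : @hom Delta 0 m, hoequiv (act v (act a x)).
Proof. by move=> H v; rewrite -(@actM (X 1) _ _ _ a v); apply: H. Qed.

(* The union of the components of X_1 that consist of homotopy equivalences. *)
Definition hoequivs : sset.
refine (@SSet (fun m => {x : X 1 m | forall v : @hom Delta 0 m, hoequiv (act v x)})
  (fun m n a x => exist _ (act a (sval x)) (hoequiv_act a (svalP x))) _ _).
- by move=> n [x xP]; apply: eq_exist; apply: act1.
- by move=> m n p b a [x xP]; apply: eq_exist; apply: actM.
Defined.

Lemma degen_hoequivs m (x : X 0 m) (v : @hom Delta 0 m) :
  hoequiv (act v (degen0 m x)).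
Proof. by rewrite -sfunP; apply: hoequiv_degen. Qed.

Definition to_hoequivs : smap (X 0) hoequivs.
refine (@SMap (X 0) hoequivs (fun m x => exist _ (degen0 m x) (degen_hoequivs x)) _).
by move=> *; apply: eq_exist; apply: sfunP.
Defined.

(* Rezk's Reedy fibrancy only serves to compute the fibre products of the Segal
   condition; here they are homotopy limits. *)
Definition complete_segal_space : Prop :=
  (forall n, sequiv (canon (spine_cone X n))) /\ sequiv to_hoequivs.
End Rezk.

Local Open Scope order_scope.

Record tree := Tree {
  tdisp : Order.disp_t;
  edge :> finPOrderType tdisp;
  root : edge;
  rootP : forall x, root <= x;
  tlinP : forall x y z : edge, y <= x -> z <= x -> (y <= z) || (z <= y);
  leaves : {set edge};
  leavesP : forall l x : edge, l \in leaves -> l <= x -> x = l }.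
Arguments leaves : clear implicits.
Arguments root : clear implicits.

(* v(e), the minimal elements of T_{>e}. *)
Definition above (T : tree) (e : T) : {set T} :=
  [set x | (e < x) && [forall y : T, (e < y) && (y <= x) ==> (y == x)]].

(* There is at most one operation s -> e in Free(T) for each list of inputs s,
   so Free(T) is determined by the set of profiles of its operations, which is
   generated from the generators v(e) -> e under the operad structure. *)
Inductive free_op (T : tree) : seq T -> T -> Prop :=
| free_id e : free_op [:: e] e
| free_gen e : e \notin leaves T -> free_op (enum (above e)) e
| free_perm s t e : perm_eq s t -> free_op s e -> free_op t e
| free_comp s t x e : free_op (x :: s) e -> free_op t x -> free_op (t ++ s) e.

(* An operad map out of Free(T) is determined by its effect on colours and on
   generators, and the latter is determined by the former. *)
Record treemap (T T' : tree) := TreeMap {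
  ofun :> T -> T';
  ofunP : forall e, e \notin leaves T ->
    free_op [seq ofun x | x <- enum (above e)] (ofun e) }.

Lemma treemap_ext (T T' : tree) (f g : treemap T T') : f =1 g -> f = g.
Proof.
case: f g => [f fP] [g gP] /= /funext E.
by case: _ / E gP => gP; rewrite (Prop_irrelevance fP gP).
Qed.

Lemma treemap_free (T T' : tree) (f : treemap T T') s e :
  free_op s e -> free_op (map f s) (f e).
Proof.
elim=> [{}e | {}e /ofunP//| {}s t {}e st _ | {}s t x {}e _ se _ tx].
- exact: free_id.
- by apply: free_perm; apply: perm_map.
- by rewrite map_cat; apply: free_comp tx.
Qed.

Lemma oidP (T : tree) e : e \notin leaves T ->
  free_op [seq x | x <- enum (above e)] e.
Proof. by rewrite map_id => /free_gen. Qed.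

Lemma ocompP (T1 T2 T3 : tree) (g : treemap T2 T3) (f : treemap T1 T2) e :
  e \notin leaves T1 -> free_op [seq g (f x) | x <- enum (above e)] (g (f e)).
Proof. by move=> /(ofunP f) /(treemap_free g); rewrite -map_comp. Qed.

Definition Omega : category.
refine (@Category tree treemap (fun T => TreeMap (@oidP T))
  (fun T1 T2 T3 g f => TreeMap (@ocompP T1 T2 T3 g f)) _ _ _).
- by move=> *; apply: treemap_ext.
- by move=> *; apply: treemap_ext.
- by move=> *; apply: treemap_ext.
Defined.

Definition closed (T : tree) : bool := leaves T == set0.

Lemma above_ex (T : tree) (e x : T) : e < x -> exists2 y, y \in above e & y <= x.
Proof.
have [n] := ubnP #|[set y : T | e < y & y <= x]|.
elim: n x => // n IH x; rewrite ltnS => le_n ex.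
have [ax | ] := boolP (x \in above e); first by exists x.
rewrite inE ex /= negb_forall => /existsP[y]; rewrite negb_imply -andbA.
case/and3P=> ey yx nyx; have [| |z az zy] := IH y; [|by []|].
- apply: leq_trans le_n; apply: proper_card; apply/properP; split.
    apply/subsetP => z; rewrite !inE => /andP[-> /= zy]; exact: le_trans yx.
  exists x; rewrite inE ?ex ?lexx //= .
  by apply/negP => xy; move/negP: nyx; apply; rewrite eq_le yx.
- by exists z => //; apply: le_trans yx.
Qed.

Lemma free_flatten (T : tree) (l : T -> seq T) w u e :
  free_op (w ++ u) e -> (forall x, x \in w -> free_op (l x) x) ->
  free_op (flatten (map l w) ++ u) e.
Proof.
elim: w u => [|x w IH] u //= H lP.
have {}H := free_comp H (lP x (mem_head _ _)).
rewrite -catA; apply: free_perm (_ : free_op (flatten (map l w) ++ (l x ++ u)) e).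
  by rewrite perm_catCA.
apply: IH => [|y yw]; last by apply: lP; rewrite inE yw orbT.
by apply: free_perm H; rewrite perm_catCA.
Qed.

Lemma free_antichain (T : tree) (s : seq T) (e : T) : closed T -> uniq s ->
  {in s, forall x, e <= x} -> {in s &, forall x y, x <= y -> x = y} ->
  free_op s e.
Proof.
move=> /eqP T0; have [n] := ubnP #|[set y : T | e <= y]|.
elim: n s e => // n IH s e; rewrite ltnS => le_n Us s_e s_anti.
have [es | nes] := boolP (e \in s).
  have s1 : s =i [:: e].
    move=> x; rewrite inE; apply/idP/eqP => [xs | -> //].
    by apply/esym/s_anti => //; apply: s_e.
  apply: free_perm (free_id e); rewrite perm_sym.
  by apply: uniq_perm.
pose l y := [seq x <- s | y <= x].
have aboveP y : y \in above e -> e < y /\ forall z, e < z -> z <= y -> z = y.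
  rewrite inE => /andP[ey /forallP H]; split=> // z ez zy.
  by apply/eqP; move: (H z); rewrite ez zy.
have E : perm_eq (flatten (map l (enum (above e)))) s.
  apply: uniq_perm => //; last first.
    move=> x; apply/flatten_mapP/idP => [[y _]|xs].
      by rewrite mem_filter => /andP[].
    have [|y ye yx] := @above_ex T e x.
      rewrite lt_neqAle s_e // andbT; apply: contraNneq nes => -> //.
    by exists y; rewrite ?mem_enum // mem_filter yx.
  suff: uniq [seq z | y <- enum (above e), z <- l y].
    by congr (uniq (flatten _)); apply: eq_map => y; rewrite map_id.
  apply: allpairs_uniq_dep => [|y _|]; rewrite ?enum_uniq ?filter_uniq //.
  move=> _ _ /allpairsPdep[y1 [z1 [+ + ->]]] /allpairsPdep[y2 [z2 [+ + ->]]] /= E.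
  rewrite -{}E !mem_enum !mem_filter => /aboveP[e1 m1] /andP[y1z _].
  move=> /aboveP[e2 m2] /andP[y2z _]; have [y12|y21] := orP (tlinP y1z y2z).
    by rewrite (m2 _ e1 y12).
  by rewrite (m1 _ e2 y21).
apply: free_perm E _; rewrite -[flatten _]cats0.
apply: free_flatten => [|y]; first by rewrite cats0; apply: free_gen; rewrite T0 inE.
rewrite mem_enum => ye; have [ey _] := aboveP _ ye; apply: IH.
- apply: leq_trans le_n; apply: proper_card; apply/properP; split.
    by apply/subsetP => z; rewrite !inE; apply: le_trans; apply: ltW.
  by exists e; rewrite !inE ?lexx // lt_geF.
- exact: filter_uniq.
- by move=> x; rewrite mem_filter => /andP[].
- move=> x x'; rewrite !mem_filter => /andP[_ xs] /andP[_ x's]; exact: s_anti.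
Qed.

(* When T is closed too, these are all the morphisms T -> T'; only this half of
   the explicit description of closed trees is needed here. *)
Section ClosedMap.
Variables (T T' : tree) (f : T -> T').
Hypotheses (T'c : closed T') (f_homo : {homo f : x y / x <= y})
  (f_indep : forall x y, x >< y -> f x >< f y).

Lemma cmapP e : free_op [seq f x | x <- enum (above e)] (f e).
Proof.
have anti : {in enum (above e) &, forall x y, f x <= f y -> x = y}.
  move=> x y; rewrite !mem_enum !inE => /andP[ex /forallP mx] /andP[ey /forallP my] xy.
  have : x >=< y.
    by apply: contraT => /f_indep; rewrite /Order.comparable xy.
  case/orP => [le_xy | le_yx].
    by apply/eqP; move: (my x); rewrite ex le_xy.
  by apply/esym/eqP; move: (mx y); rewrite ey le_yx.
apply: free_antichain => //.
- rewrite map_inj_in_uniq ?enum_uniq // => x y xe ye E.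
  by apply: anti; rewrite ?E.
- move=> _ /mapP[x + ->]; rewrite mem_enum inE => /andP[/ltW ex _].
  exact: f_homo.
- move=> _ _ /mapP[x xe ->] /mapP[y ye ->] xy.
  by rewrite (anti x y).
Qed.

Definition cmap : treemap T T' := TreeMap (fun e _ => cmapP e).
End ClosedMap.

Lemma clP (T : tree) (l x : T) : l \in (set0 : {set T}) -> l <= x -> x = l.
Proof. by rewrite inE. Qed.

(* The closure (T, L)^c = (T, 0) and its adjunction. *)
Definition cl (T : tree) : tree := @Tree (tdisp T) (edge T) (root T) (@rootP T) (@tlinP T) set0 (@clP T).

Lemma cl_closed (T : tree) : closed (cl T).
Proof. exact: eqxx. Qed.

Lemma cl_unitP (T : tree) e : e \notin leaves T ->
  free_op (T := cl T) [seq x | x <- enum (above e)] e.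
Proof. by rewrite map_id => _; apply: (@free_gen (cl T)); rewrite inE. Qed.
Definition cl_unit (T : tree) : treemap T (cl T) := TreeMap (T' := cl T) (@cl_unitP T).

Lemma cl_adjP (X T : tree) (f : treemap X T) : closed T -> forall e : cl X,
  e \notin leaves (cl X) -> free_op [seq f x | x <- enum (above e)] (f e).
Proof.
move=> Tc e _; have [eL | eNL] := boolP (e \in leaves X); last exact: ofunP.
suff -> : enum (above e) = [::] by apply: free_antichain.
apply/eqP; rewrite -size_eq0 -cardE cards_eq0; apply/eqP/setP => x; rewrite !inE.
apply/negbTE; rewrite negb_and; apply/orP; left; apply/negP => ex.
by move: (ex); rewrite (leavesP eL (ltW ex)) ltxx.
Qed.
Definition cl_adj (X T : tree) (Tc : closed T) (f : treemap X T) : treemap (cl X) T :=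
  TreeMap (T := cl X) (cl_adjP f Tc).

Definition cl_map (X Y : tree) (f : treemap X Y) : treemap (cl X) (cl Y) :=
  cl_adj (cl_closed Y) (TreeMap (ocompP (cl_unit Y) f)).

(* None stands for infinity. *)
Definition nle (n : nat) (k : option nat) : bool := if k is Some m then (n <= m)%N else true.
Definition kle (k j : option nat) : bool := if k is Some m then nle m j else j == None.

Lemma nle_trans n k j : nle n k -> kle k j -> nle n j.
Proof. by case: k j => [k|] [j|] //=; apply: leq_trans. Qed.

Lemma leq_nle m n k : (m <= n)%N -> nle n k -> nle m k.
Proof. by case: k => [k|] //=; apply: leq_trans. Qed.

Definition dendroidal (k : option nat) (T : tree) : bool :=
  [forall e : T, nle #|above e| k].

Record ctree (k : option nat) := CTree {
  ctr :> tree;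
  ctr_closed : closed ctr;
  ctr_dendr : dendroidal k ctr }.

Definition Omegac (k : option nat) : category := full (ctr (k := k) : _ -> Omega).

Lemma dendr_kle k j (T : tree) : kle k j -> dendroidal k T -> dendroidal j T.
Proof. by move=> kj /forallP H; apply/forallP => e; apply: nle_trans kj. Qed.

Definition incl k j (kj : kle k j) : functor (Omegac k) (Omegac j) :=
  @Functor (Omegac k) (Omegac j)
    (fun T => CTree (ctr_closed T) (dendr_kle kj (ctr_dendr T)))
    (fun _ _ u => u) (fun _ => erefl) (fun _ _ _ _ _ => erefl).

(* Corollas with set of leaves S; the root is None. *)
Definition star (S : finType) : Type := option S.
Fact star_display : Order.disp_t. Proof. exact: Order.Disp. Qed.

Section Star.
Variable S : finType.
HB.instance Definition _ := Finite.copy (star S) (option S).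
Definition star_le (x y : star S) : bool := (x == None) || (x == y).
Lemma star_refl : reflexive star_le.
Proof. by move=> x; rewrite /star_le eqxx orbT. Qed.
Lemma star_anti : antisymmetric star_le.
Proof. by move=> [x|] [y|] // /andP[/eqP]. Qed.
Lemma star_trans : transitive star_le.
Proof. by move=> [y|] [x|] [z|] //= /eqP[->]. Qed.
HB.instance Definition _ := Order.Le_isPOrder.Build star_display (star S)
  star_refl star_anti star_trans.
Lemma star_le0 (x : star S) : (None : star S) <= x.
Proof. by []. Qed.

Lemma star_leE (x y : star S) : (x <= y) = (x == None) || (x == y).
Proof. by []. Qed.

Lemma star_lin (x y z : star S) : y <= x -> z <= x -> (y <= z) || (z <= y).
Proof.
by rewrite !star_leE; case: x y z => [x|] [y|] [z|] //= /eqP[->] /eqP[->]; rewrite eqxx.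
Qed.

Lemma star_leaves (l x : star S) : l \in [set Some s | s : S] -> l <= x -> x = l.
Proof. by case/imsetP=> s _ ->; rewrite star_leE /= => /eqP. Qed.

Definition corolla_on : tree :=
  @Tree _ (star S) None star_le0 star_lin [set Some s | s : S] star_leaves.
End Star.

Definition corolla (n : nat) : tree := corolla_on 'I_n.

Lemma ord_ge0 n (x : 'I_n.+1) : ord0 <= x.
Proof. by rewrite leEord. Qed.
Lemma ord_lin n (x y z : 'I_n.+1) : y <= x -> z <= x -> (y <= z) || (z <= y).
Proof. by move=> _ _; apply: le_total. Qed.
Lemma eta_leaves (l x : 'I_1) : l \in [set: 'I_1] -> l <= x -> x = l.
Proof. by rewrite [l]ord1 [x]ord1. Qed.
Definition eta : tree := @Tree _ 'I_1 ord0 (@ord_ge0 0) (@ord_lin 0) setT eta_leaves.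

Inductive elem := El_eta | El_corolla of nat.
Definition elem_tree (X : elem) : Omega :=
  if X is El_corolla n then corolla n else eta.

Definition subtree_inclusion (T T' : tree) (f : treemap T T') : Prop :=
  injective f /\
  forall (e0 e2 : T) (e' : T'), f e0 <= e' -> e' <= f e2 -> exists e, f e = e'.

(* (Omega^el)_{/T} *)
Definition elOb (T : tree) (x : comma (fullf elem_tree) T) : Prop :=
  let f : treemap (elem_tree (csrc x)) T := carr x in
  subtree_inclusion f /\
  (if csrc x is El_corolla n then #|above (f (root _))| = n else True).

Definition elOver (T : tree) : category :=
  full (fun x : {x : comma (fullf elem_tree) T | elOb x} => sval x).

Section Segal.
Variables (k : option nat).

Lemma card_star_above (S : finType) (e : star S) :
  (#|above (T := corolla_on S) e| <= #|S|)%N.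
Proof.
apply: (@leq_trans #|[set Some s | s : S]|); last exact: leq_imset_card.
apply: subset_leq_card; apply/subsetP => x; rewrite inE => /andP[ex _].
apply/imsetP; case: x ex => [s _|ex]; first by exists s.
by case: (elimF idP (lt_geF ex)); apply: star_le0.
Qed.

Lemma dendr_star (S : finType) : nle #|S| k -> dendroidal k (cl (corolla_on S)).
Proof. by move=> Sk; apply/forallP => e; apply: leq_nle Sk; apply: card_star_above. Qed.

Lemma el_dendr (T : ctree k) (x : elOver T) :
  dendroidal k (cl (elem_tree (csrc (sval x)))).
Proof.
case: x => [[[|n] f] [/= _ H]].
  apply/forallP => e; apply: (@leq_nle _ 0); last by case: (k).
  rewrite leqn0 cards_eq0; apply/eqP/setP => y; rewrite !inE.
  by rewrite [y]ord1 [e]ord1 ltxx.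
by apply: dendr_star; rewrite card_ord -[X in nle X _]H; apply: (forallP (ctr_dendr T)).
Qed.

Definition el_cl (T : ctree k) : functor (elOver T) (Omegac k).
refine (@Functor (elOver T) (Omegac k)
  (fun x => CTree (cl_closed (elem_tree (csrc (sval x)))) (el_dendr x))
  (fun _ _ u => cl_map (chom u)) _ _).
- by move=> *; apply: treemap_ext.
- by move=> *; apply: treemap_ext.
Defined.

Variable F : presheaf (Omegac k).

Definition segal_leg (T : ctree k) (x : op (elOver T)) :
    smap (F T) (pullback (el_cl T) F x) :=
  dmap F (a := T) (b := el_cl T x) (cl_adj (ctr_closed T) (carr (sval x))).

Lemma segal_coneP (T : ctree k) (x y : op (elOver T)) (u : hom x y) n (z : F T n) :
  dmap (pullback (el_cl T) F) u n (segal_leg x n z) = segal_leg y n z.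
Proof.
rewrite /segal_leg -[LHS](@dmapM _ F); congr (dmap F _ n z).
by apply: treemap_ext => e /=; rewrite -(chomP u).
Qed.

Definition segal_cone (T : ctree k) : cone (F T) (pullback (el_cl T) F) :=
  Cone (@segal_coneP T).

Definition segal : Prop := forall T : ctree k, sequiv (canon (segal_cone T)).
End Segal.

Lemma lin_leaves n (l x : 'I_n.+1) : l \in [set ord_max : 'I_n.+1] -> l <= x -> x = l.
Proof. by rewrite inE => /eqP-> mx; apply: le_anti; rewrite mx le_max. Qed.

(* ({0 <= 1 <= ... <= n}, {n}) *)
Definition lintree (n : nat) : tree :=
  @Tree _ 'I_n.+1 ord0 (@ord_ge0 n) (@ord_lin n) [set ord_max] (@lin_leaves n).

Section Complete.
Variables (k : option nat) (hk : nle 1 k).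

Lemma lin_dendr n : dendroidal k (cl (lintree n)).
Proof.
apply/forallP => e; apply: leq_nle hk; apply/card_le1_eqP => x y.
rewrite !inE => /andP[ex /forallP mx] /andP[ey /forallP my].
case/orP: (le_total x y) => xy.
  by move/eqP: (implyP (my x) (introT andP (conj ex xy))).
by apply/esym; move/eqP: (implyP (mx y) (introT andP (conj ey xy))).
Qed.

Lemma lin_indep m n (f : 'I_m.+1 -> 'I_n.+1) x y : x >< y -> f x >< f y.
Proof. by rewrite /Order.comparable le_total. Qed.

Definition r_map m n (f : @hom Delta m n) : treemap (cl (lintree m)) (cl (lintree n)) :=
  @cmap (cl (lintree m)) (cl (lintree n)) f (cl_closed _)
    (fun x y xy => fmap f xy) (@lin_indep m n f).

Definition r : functor Delta (Omegac k).
refine (@Functor Delta (Omegac k)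
  (fun n => CTree (cl_closed (lintree n)) (lin_dendr n)) (fun m n f => r_map f) _ _).
- by move=> *; apply: treemap_ext.
- by move=> *; apply: treemap_ext.
Defined.
End Complete.

Record Op_un k (hk : nle 1 k) (F : presheaf (Omegac k)) : Prop := {
  op_un_kan : kan_valued F;
  op_un_segal : segal F;
  op_un_complete : complete_segal_space (pullback (r hk) F) }.

Section Corollas.
Variable j : option nat.

Definition cbar (S : finType) (hS : nle #|S| j) : ctree j :=
  CTree (cl_closed (corolla_on S)) (dendr_star hS).

Section StarMap.
Variables (S S' : finType) (f : S -> S').
Hypothesis f_inj : injective f.

Lemma star_homo : {homo (omap f : star S -> star S') : x y / x <= y}.
Proof.
by move=> [x|] [y|] //; rewrite !star_leE /= => /eqP[->]; rewrite eqxx.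
Qed.

Lemma star_indep (x y : star S) : x >< y -> (omap f x : star S') >< (omap f y : star S').
Proof.
rewrite /Order.comparable !star_leE; case: x y => [x|] [y|] //=.
by rewrite !(inj_eq Some_inj) !(inj_eq f_inj).
Qed.

Definition star_map : treemap (cl (corolla_on S)) (cl (corolla_on S')) :=
  @cmap (cl (corolla_on S)) (cl (corolla_on S')) (omap f) (cl_closed _)
    star_homo star_indep.
End StarMap.

Lemma card_ord0_nle : nle #|'I_0| j.
Proof. by rewrite card_ord; case: (j). Qed.
Definition cbar0 : ctree j := cbar card_ord0_nle.

Lemma edge_homo (T : ctree j) (e : T) :
  {homo ((fun _ => e) : cbar0 -> T) : x y / x <= y}.
Proof. by move=> *; apply: lexx. Qed.
Lemma edge_indep (T : ctree j) (e : T) (x y : cbar0) : x >< y -> e >< e.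
Proof.
by case: x y => [[]//|] [[]//|]; rewrite /Order.comparable !lexx.
Qed.
Definition edge_map (T : ctree j) (e : T) : @hom (Omegac j) cbar0 T :=
  @cmap cbar0 T (fun _ => e) (ctr_closed T) (edge_homo e) (@edge_indep T e).
End Corollas.

Record hofibSimp (X Y : sset) (f : smap X Y) (y : Y 0) m := HofibSimp {
  hf_pt : X m;
  hf_path : maps (splx 1) Y m;
  hf_src : forall p (t : splx m p), hf_path p (t, cst p ord0) = f p (act t hf_pt);
  hf_tgt : forall p (t : splx m p), hf_path p (t, cst p ord_max) = act (cst p ord0) y }.

Section Hofib.
Variables (X Y : sset) (f : smap X Y) (y : Y 0).

Lemma hofib_ext m (s t : hofibSimp f y m) :
  hf_pt s = hf_pt t -> (forall p z, hf_path s p z = hf_path t p z) -> s = t.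
Proof.
case: s t => [x g s0 s1] [x' g' s0' s1'] /= E E'.
have {}E' : g = g' := @smap_ext (sprod (splx m) (splx 1)) Y g g' E'.
case: _ / E s0' => s0'; case: _ / E' s0' s1' => s0' s1'.
by rewrite (Prop_irrelevance s0 s0') (Prop_irrelevance s1 s1').
Qed.

Lemma hofib_src m n (a : @hom Delta m n) (s : hofibSimp f y n) p (t : splx m p) :
  act a (hf_path s) p (t, cst p ord0) = f p (act t (act a (hf_pt s))).
Proof. by rewrite /= hf_src; congr (f p _); apply: (actM (s := X)). Qed.

Lemma hofib_tgt m n (a : @hom Delta m n) (s : hofibSimp f y n) p (t : splx m p) :
  act a (hf_path s) p (t, cst p ord_max) = act (cst p ord0) y.
Proof. exact: hf_tgt. Qed.

Definition hofib : sset.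
refine (@SSet (hofibSimp f y)
  (fun m n a s => HofibSimp (hofib_src a s) (hofib_tgt a s)) _ _).
- move=> n s; apply: hofib_ext => [|p z]; first exact: (@act1 X).
  by congr (sfun _ p z); apply: (@act1 (maps (splx 1) Y)).
- move=> m n p b a s; apply: hofib_ext => [|q z]; first exact: (@actM X).
  by congr (sfun _ q z); apply: (@actM (maps (splx 1) Y)).
Defined.
End Hofib.

Section Mul.
Variables (j : option nat) (F : presheaf (Omegac j)).

Definition colour : Type := F (cbar0 j) 0.

Definition to_edges (T : ctree j) : smap (F T) (spow T (F (cbar0 j))).
refine (@SMap (F T) (spow T (F (cbar0 j)))
  (fun n x e => dmap F (a := T) (b := cbar0 j) (edge_map e) n x) _).
by move=> m n a x; apply: funext => e; rewrite sfunP.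
Defined.

Section MulS.
Variables (S : finType) (hS : nle #|S| j) (X : S -> colour) (Y : colour).

Definition colours (e : cbar hS) : colour := if e is Some s then X s else Y.

(* Mul_F((X_s)_(s in S); Y).  For empty S this is the homotopy fibre of the
   identity of F(C_0), hence contractible, as required of Mul_F(0; Y). *)
Definition mul : sset := hofib (to_edges (cbar hS)) (colours : spow (cbar hS) _ 0).
End MulS.

Section MulRes.
Variables (S S' : finType) (hS : nle #|S| j) (hS' : nle #|S'| j).
Variables (f : S -> S') (f_inj : injective f).
Variables (X : S -> colour) (X' : S' -> colour) (Y : colour).
Hypothesis XE : forall s, X s = X' (f s).

Let u : @hom (Omegac j) (cbar hS) (cbar hS') := star_map f_inj.
Let res : smap (F (cbar hS')) (F (cbar hS)) := dmap F (a := cbar hS') (b := cbar hS) u.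

Definition mul_res_path m (s : mul hS' X' Y m) :
  maps (splx 1) (spow (cbar hS) (F (cbar0 j))) m.
refine (@SMap (sprod (splx m) (splx 1)) (spow (cbar hS) (F (cbar0 j)))
  (fun p z e => hf_path s p z (u e)) _).
by move=> *; rewrite sfunP.
Defined.

Lemma mul_res_src m (s : mul hS' X' Y m) p (t : splx m p) :
  mul_res_path s p (t, cst p ord0) = to_edges (cbar hS) p (act t (res m (hf_pt s))).
Proof.
rewrite /= hf_src; apply: funext => e /=; rewrite -sfunP /res -[RHS](@dmapM _ F).
by congr (dmap F _ p _); apply: treemap_ext.
Qed.

Lemma mul_res_tgt m (s : mul hS' X' Y m) p (t : splx m p) :
  mul_res_path s p (t, cst p ord_max)
  = act (cst p ord0) (@colours S hS X Y : spow (cbar hS) _ 0).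
Proof. by rewrite /= hf_tgt; apply: funext => -[e|] //=; rewrite XE. Qed.

Definition mul_res : smap (mul hS' X' Y) (mul hS X Y).
refine (@SMap (mul hS' X' Y) (mul hS X Y)
  (fun m s => HofibSimp (mul_res_src s) (mul_res_tgt s)) _).
by move=> m n a s; apply: hofib_ext => //=; apply: sfunP.
Defined.
End MulRes.
End Mul.

(* P_{<= k}(v(r)), where v(r) = {Some i | i : 'I_n} is identified with 'I_n. *)
Definition powerset_le (k : option nat) (n : nat) : category :=
  full (C := @precat {set 'I_n} (fun I I' => I \subset I')
               (@subxx _ _) (fun I' I I'' => @subset_trans _ I I' I''))
    (fun I : {I : {set 'I_n} | nle #|I| k} => sval I).

Section SubCorolla.
Variables (k j : option nat) (kj : kle k j) (n : nat) (hn : nle n j).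

Definition leaves_of (I : powerset_le k n) : finType := {i : 'I_n | i \in sval I}.

Lemma card_leaves (I : powerset_le k n) : nle #|leaves_of I| j.
Proof. by rewrite card_sig; apply: nle_trans kj; apply: svalP I. Qed.

Lemma card_corolla : nle #|'I_n| j.
Proof. by rewrite card_ord. Qed.

Definition cbarn : ctree j := cbar card_corolla.
Definition cbarI (I : powerset_le k n) : ctree j := cbar (card_leaves I).

Definition leaf_incl (I I' : powerset_le k n) (H : hom I I') (i : leaves_of I) :
    leaves_of I' :=
  exist _ (sval i) (subsetP H _ (svalP i)).

Lemma leaf_incl_inj (I I' : powerset_le k n) (H : hom I I') : injective (leaf_incl H).
Proof. by move=> x y /(congr1 val) E; apply: val_inj. Qed.

Lemma leaf_val_inj (I : powerset_le k n) : injective (fun i : leaves_of I => val i).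
Proof. exact: val_inj. Qed.

Definition cbarI_functor : functor (powerset_le k n) (Omegac j).
refine (@Functor (powerset_le k n) (Omegac j) cbarI
  (fun I I' H => star_map (leaf_incl_inj (H := H))) _ _).
- by move=> I; apply: treemap_ext => -[e|] //=; congr Some; apply: val_inj.
- by move=> I I' I'' H H'; apply: treemap_ext => -[e|] //=; congr Some; apply: val_inj.
Defined.

Variable F : presheaf (Omegac j).

Definition corolla_diag : diagram (op (powerset_le k n)) := pullback cbarI_functor F.

Definition corolla_leg (I : op (powerset_le k n)) : smap (F cbarn) (corolla_diag I) :=
  dmap F (a := cbarn) (b := cbarI I) (star_map (leaf_val_inj (I := I))).

Lemma corolla_coneP (I I' : op (powerset_le k n)) (H : hom I I') m (x : F cbarn m) :
  dmap corolla_diag H m (corolla_leg I m x) = corolla_leg I' m x.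
Proof.
rewrite /corolla_leg -[LHS](@dmapM _ F); congr (dmap F _ m x).
by apply: treemap_ext => -[e|].
Qed.

Definition corolla_cone : cone (F cbarn) corolla_diag := Cone corolla_coneP.

Variables (X : 'I_n -> colour F) (Y : colour F).

Definition mulI (I : powerset_le k n) : sset :=
  mul (card_leaves I) (fun i => X (val i)) Y.

Definition mulI_res (I I' : powerset_le k n) (H : hom I I') : smap (mulI I') (mulI I) :=
  mul_res (card_leaves I) (card_leaves I') (leaf_incl_inj (H := H)) Y
    (fun _ => erefl (X _)).

Definition mul_diag : diagram (op (powerset_le k n)).
refine (@Diagram (op (powerset_le k n)) mulI (fun I I' H => mulI_res H) _ _).
- move=> I m s; apply: hofib_ext => [|p z].
    rewrite -[RHS](@dmap1 _ F); congr (dmap F _ m _).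
    by apply: treemap_ext => -[e|] //=; congr Some; apply: val_inj.
  apply: funext => e; congr (hf_path s p z _).
  by case: e => [e|] //=; congr Some; apply: val_inj.
- move=> I I' I'' H H' m s; apply: hofib_ext => [|p z].
    rewrite -[RHS](@dmapM _ F); congr (dmap F _ m _).
    by apply: treemap_ext => -[e|] //=; congr Some; apply: val_inj.
  apply: funext => e; congr (hf_path s p z _).
  by case: e => [e|] //=; congr Some; apply: val_inj.
Defined.

Definition mul_leg (I : op (powerset_le k n)) : smap (mul card_corolla X Y) (mul_diag I) :=
  mul_res (card_leaves I) card_corolla (leaf_val_inj (I := I)) Y
    (fun _ => erefl (X _)).

Lemma mul_coneP (I I' : op (powerset_le k n)) (H : hom I I') m
  (x : mul card_corolla X Y m) :
  dmap mul_diag H m (mul_leg I m x) = mul_leg I' m x.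
Proof.
apply: hofib_ext => [|p z].
  rewrite -[LHS](@dmapM _ F); congr (dmap F _ m _).
  by apply: treemap_ext => -[e|].
by apply: funext => e; congr (hf_path x p z _); case: e.
Qed.

Definition mul_cone : cone (mul card_corolla X Y) mul_diag := Cone mul_coneP.
End SubCorolla.

(* Main.v *)
(* Write Rk for the homotopy right Kan extension along i : Omega^c_{<=k} -> Omega^c_{<=j}.
   Since i is fully faithful, F lies in the image of Rk iff the unit
   F(T) -> holim_{S -> T, S k-dendroidal} F(S) is an equivalence for every T.
   A map f : S -> T factors through the convex hull of its image, which is again
   k-dendroidal, so the homotopy limit may be taken over the poset of
   k-dendroidal convex subtrees of T.  Hence the unit is an equivalence as soon as
   F(A) -> holim_{A' < A} F(A') is one for every convex subtree A that is not
   k-dendroidal.  By induction on the number of edges, A' may be restricted to the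
   subtrees of height at most one when A has height at least two, where the
   claim is the Segal condition, and to the k-dendroidal subtrees when A is a
   corolla, where it is the condition on corollas.  Conversely, for T a corolla
   the unit is the map in the condition on corollas.  For the multimorphisms, the
   edge maps F(C_n) -> F(C_0)^(n+1) present both sides as total spaces over
   equivalent bases (this uses k >= 1), and Mul is the fibre. *)
Set Warnings "-notation-overridden,-redundant-canonical-projection".
From HB Require Import structures.
From mathcomp Require Import all_boot all_order boolp zify.
Import Order.TTheory.
Require Import Defs.
Set Implicit Arguments.
Unset Strict Implicit.
Unset Printing Implicit Defensive.
Local Open Scope cat_scope.

(** * Simplicial maps and boundary lifting *)

(** Homotopy inverses chosen object by object are not natural, so a levelwise equivalence of
    diagrams cannot be inverted directly. Equivalences are therefore traded for a lifting property:
    the endpoint map of the mapping path space lifts simplices relative to their boundary ([weq]).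
    Lifting properties do pass to homotopy limits, because a map from [B] to [holim F] is a natural
    map out of [W J B], a diagram freely built from cells. The same cells serve to remove an object
    [a] from an indexing poset: a section is extended over the chains that start at [a]. Kan fillers
    enter only through [kan_hep]; everything later rests on the extension property [hep]. Homotopy
    limits over different categories are compared by pairs of functors with natural transformations,
    which become explicit homotopies on glued chains. For the passage from (1) to (2), [F] is only
    joined to [ran i G] by a span, so the unit is first inverted on [ran i G] itself and the result
    is carried along the span. *)

Section DeltaMaps.

Definition surj m n (a : @hom Delta m n) : Prop :=
  forall j : 'I_n.+1, exists i : 'I_m.+1, a i = j.

Lemma Dext m n (a b : @hom Delta m n) : (forall i : 'I_m.+1, a i = b i) -> a = b.
Proof. by move=> E; apply: pre_functor_ext. Qed.

Lemma Dmono m n (a : @hom Delta m n) (i j : 'I_m.+1) :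
  (i <= j)%N -> ((a i : 'I_n.+1) <= (a j : 'I_n.+1))%N.
Proof. by move=> ij; have := fmap a (ij : @hom (lin m) i j). Qed.

Lemma DmonoV m n (a : @hom Delta m n) (i j : 'I_m.+1) :
  ((a i : 'I_n.+1) < (a j : 'I_n.+1))%N -> (i < j)%N.
Proof. by rewrite !ltnNge; apply: contra; apply: Dmono. Qed.

Lemma surj_compl m n p (b : @hom Delta n p) (a : @hom Delta m n) :
  surj (b \c a) -> surj b.
Proof. by move=> s j; case: (s j) => i <-; exists (a i). Qed.

Lemma surj_max m n (a : @hom Delta m n) : surj a -> a ord_max = ord_max :> 'I_n.+1.
Proof.
move=> sa; apply/val_inj/eqP; rewrite eqn_leq leq_ord /=.
by case: (sa ord_max) => i E; rewrite -[X in (X <= _)%N]/(val (@ord_max n)) -E Dmono // leq_ord.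
Qed.

Lemma surj0 m (a : @hom Delta m 0) : surj a.
Proof. by move=> j; exists ord0; rewrite [LHS]ord1 [RHS]ord1. Qed.

Lemma nonsurjP m n (a : @hom Delta m n) :
  ~ surj a -> exists j : 'I_n.+1, forall i : 'I_m.+1, a i <> j.
Proof.
move=> na; apply: contrapT => H; apply: na => j; apply: contrapT => Hj.
by apply: H; exists j => i E; apply: Hj; exists i.
Qed.

Lemma nonsurj_factor m n (a : @hom Delta m n.+1) : ~ surj a ->
  exists (j : 'I_n.+2) (a' : @hom Delta m n), a = (coface j : @hom Delta n n.+1) \c a'.
Proof.
case/nonsurjP => j aj.
have E i : {x : 'I_n.+1 | lift j x = a i}.
  case: (unliftP j (a i)) => [x ->|E]; first by exists x.
  by case: (aj i).
have P : {homo (fun i => sval (E i)) : x y / (x <= y)%O}.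
  move=> x y xy; rewrite leEord /= -(leq_bump2 j).
  have := svalP (E x); have := svalP (E y) => /(congr1 val) /= -> /(congr1 val) /= ->.
  exact: Dmono.
exists j, (mono P); apply: Dext => i /=; exact/esym/(svalP (E i)).
Qed.

(** The freedom to send the section through a prescribed point is what makes a surjection
    recoverable from its sections in [ez_uniq]. *)
Lemma surj_section m n (a : @hom Delta m n) (i0 : 'I_m.+1) : surj a ->
  exists d : @hom Delta n m, a \c d = idm _ /\ d (a i0) = i0.
Proof.
move=> sa; pose c j := sval (cid (sa j)).
have cE j : a (c j) = j by apply: (svalP (cid (sa j))).
pose d (j : 'I_n.+1) : 'I_m.+1 := if j == a i0 then i0 else c j.
have dE j : a (d j) = j by rewrite /d; case: eqP => [->|_].
have P : {homo d : x y / (x <= y)%O}.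
  move=> x y; rewrite le_eqVlt => /orP[/eqP-> //|xy].
  by apply/ltnW/(@DmonoV _ _ a); rewrite !dE.
exists (mono P); split; first by apply: Dext => i; apply: dE.
by rewrite /= /d eqxx.
Qed.

Lemma surj_endo n (a : @hom Delta n n) : surj a -> a = idm _.
Proof.
move=> sa; have [d [ad _]] := surj_section ord0 sa.
have dE (j : 'I_n.+1) : a (d j) = j by rewrite -[RHS]/(idf (lin n) j) -[idf _]ad.
have dlt (x y : 'I_n.+1) : (x < y)%N -> ((d x : 'I_n.+1) < (d y : 'I_n.+1))%N.
  by move=> xy; apply: (@DmonoV _ _ a); rewrite !dE.
have H m : forall i j : 'I_n.+1, j = i + m :> nat -> ((d i : 'I__) + m <= (d j : 'I__))%N.
  elim: m => [|m IH] i j E; first by rewrite addn0 Dmono // E addn0.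
  have lt : (i + m < n.+1)%N by apply: ltn_trans (ltn_ord j); rewrite E addnS.
  rewrite addnS; apply: leq_ltn_trans (IH i (Ordinal lt) erefl) _.
  by apply: dlt; rewrite E /= addnS.
have di (i : 'I_n.+1) : d i = i.
  apply/val_inj/eqP; rewrite eqn_leq; apply/andP; split.
    have /= := H (n - i)%N i ord_max; rewrite subnKC ?leq_ord // => /(_ erefl).
    move=> h; have := leq_trans h (leq_ord (d ord_max : 'I_n.+1)).
    by rewrite -[X in (_ <= X)%N](subnKC (leq_ord i)) leq_add2r.
  by have := H i ord0 i (esym (add0n _)); apply: leq_trans; rewrite leq_addl.
by apply: Dext => i; rewrite -[in LHS](di i) dE.
Qed.
End DeltaMaps.

Section EZ.
Variable K : sset.

(** Membership in the skeleton of dimension [N - 1]. *)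
Definition gend N p (k : K p) : Prop :=
  exists q (a : @hom Delta p q) (y : K q), (q < N)%N /\ k = act a y.

Lemma gend_act N p q (a : @hom Delta p q) (k : K q) : gend N k -> gend N (act a k).
Proof.
by case=> r [b [y [rN ->]]]; exists r, (b \c a), y; rewrite -(@actM K).
Qed.

Lemma gend_self p (k : K p) : gend p.+1 k.
Proof. by exists p, (idm _), k; rewrite act1. Qed.

Lemma gendW M N p (k : K p) : (M <= N)%N -> gend M k -> gend N k.
Proof. by move=> MN [q [a [y [qM ->]]]]; exists q, a, y; rewrite (leq_trans qM). Qed.

Lemma nonsurj_gend p q (a : @hom Delta p q) (y : K q) : ~ surj a -> gend q (act a y).
Proof.
case: q a y => [|q] a y na; first by case: na; apply: surj0.
have [j [a' ->]] := nonsurj_factor na.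
by exists q, a', (act (coface j) y); rewrite -(@actM K).
Qed.

(** The uniqueness half of the Eilenberg-Zilber lemma. A section [d] of [a] gives $y=(b d)^*z$; as
    [y] is not in a lower skeleton, $bd$ is a surjective endomorphism, hence the identity. Sections
    through every point then give [a = b]. *)
Lemma ez_uniq p q (a b : @hom Delta p q) (y z : K q) :
  surj a -> ~ gend q y -> act a y = act b z -> a = b /\ y = z.
Proof.
move=> sa ny E.
have H (d : @hom Delta q p) : a \c d = idm _ -> b \c d = idm _ /\ y = z.
  move=> ad; have yE : y = act (b \c d) z.
    by rewrite (@actM K) -E -(@actM K) ad act1.
  have bd : b \c d = idm _.
    apply: surj_endo; apply: contrapT => /(@nonsurj_gend _ _ (b \c d) z).
    by rewrite -yE.
  by rewrite yE bd act1.
split; last by have [d [ad _]] := surj_section ord0 sa; case: (H d ad).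
apply: Dext => i; have [d [/H[bd _] di]] := surj_section i sa.
have: (b \c d) (a i) = (a i : 'I__) by rewrite bd.
by rewrite /= di => ->.
Qed.
End EZ.

(* Partial simplicial maps are encoded by their graphs. *)
Record pfun (K X : sset) (R : forall p, K p -> X p -> Prop) : Prop := PFun {
  pfun_uniq : forall p k x x', R p k x -> R p k x' -> x = x';
  pfun_act : forall p q (a : @hom Delta p q) k x, R q k x -> R p (act a k) (act a x) }.

(* Trivial fibrations: [R] is the graph of a map on the boundary of the n-simplex. *)
Definition tfib (X Y : sset) (f : smap X Y) : Prop :=
  forall n (R : forall p, splx n p -> X p -> Prop) (y : Y n), pfun R ->
    (forall p a x, R p a x -> ~ surj a) ->
    (forall p (a : splx n p), ~ surj a -> exists x, R p a x) ->
    (forall p a x, R p a x -> f p x = act a y) ->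
  exists x : X n, f n x = y /\ forall p a t, R p a t -> act a x = t.

(** * Free diagrams and lifting over their cells *)

Definition nerve (J : category) : sset.
refine (@SSet (fun p => functor (lin p) J) (fun p q a c => compf c a) _ _).
- by move=> n [fo fm f1 fM]; apply: functor_ext.
- by move=> m n p b a c; rewrite -(@compfA _ _ _ _ c b a).
Defined.

(* [W J B j] is [B x N(J/j)], so that the natural maps [W J B -> F] are the maps
   from [B] to the homotopy limit of [F]. *)
Section W.
Variables (J : category) (B : sset).

Record wsimp (j : J) (p : nat) := WS {
  wb : B p; wc : functor (lin p) J; wu : hom (wc ord_max) j }.

Lemma ws_eq (j : J) p (b b' : B p) (fo : lin p -> J)
  (fm fm' : forall x y, hom x y -> hom (fo x) (fo y)) f1 fM f1' fM'
  (u u' : hom (fo ord_max) j) :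
  b = b' -> (forall x y h, fm x y h = fm' x y h) -> u = u' ->
  @WS j p b (@Functor _ _ fo fm f1 fM) u = @WS j p b' (@Functor _ _ fo fm' f1' fM') u'.
Proof.
move=> -> E ->; have {}E : fm = fm' by do 3 apply: functional_extensionality_dep => ?.
case: _ / E f1' fM' => f1' fM'.
by rewrite (Prop_irrelevance f1 f1') (Prop_irrelevance fM fM').
Qed.

Definition wact j p q (a : @hom Delta p q) (w : wsimp j q) : wsimp j p :=
  @WS j p (act a (wb w)) (compf (wc w) a) (wu w \c fmap (wc w) (le_max (a ord_max))).

Definition wpush j j' (v : hom j j') p (w : wsimp j p) : wsimp j' p :=
  @WS j' p (wb w) (wc w) (v \c wu w).

Lemma fmap_id (c : category) p (F : functor (lin p) c) (i : 'I_p.+1)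
  (h : @hom (lin p) i i) : fmap F h = idm _.
Proof. by rewrite (_ : h = idm _) ?fmap1 //; apply: bool_irrelevance. Qed.

Definition Wsset (j : J) : sset.
refine (@SSet (wsimp j) (@wact j) _ _).
- move=> n [b [fo fm f1 fM] u]; apply: ws_eq => //=; first exact: act1.
  rewrite -[RHS]compm1; congr (u \c _); exact: (@fmap_id _ _ (Functor f1 fM)).
- move=> m n p b a [x c u]; apply: ws_eq => //=; first exact: actM.
  rewrite -compA -fmapM; congr (u \c fmap c _); exact: bool_irrelevance.
Defined.

Lemma wpushP j j' (v : hom j j') p q (a : @hom Delta p q) (w : wsimp j q) :
  wpush v (wact a w) = wact a (wpush v w).
Proof. by rewrite /wpush /wact /= compA. Qed.

Definition W : diagram J.
refine (@Diagram J Wsset (fun a b u => @SMap (Wsset a) (Wsset b) (@wpush a b u)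
   (fun m n x w => wpushP u x w)) _ _).
- by move=> a n [b c u]; rewrite /= /wpush /= comp1m.
- by move=> a b c g f n [x d u]; rewrite /= /wpush /= compA.
Defined.

Definition wk j p (w : wsimp j p) : sprod B (nerve J) p := (wb w, wc w).

Lemma wk_act j p q (a : @hom Delta p q) (w : wsimp j q) :
  wk (wact a w) = act a (wk w).
Proof. by []. Qed.

(** A surjection preserves the last vertex, so the arrow [wu w] descends along the degeneracy.
    Degeneracy in [W] can therefore be read off the underlying cell of $B\times N(J)$. *)
Lemma wrep j p q (w : wsimp j p) (a : @hom Delta p q) (y : sprod B (nerve J) q) :
  surj a -> wk w = act a y -> exists w0 : wsimp j q, wk w0 = y /\ w = wact a w0.
Proof.
case: w y => [b c u] [b0 c0] sa [Eb Ec].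
case: _ / (esym Ec) u => u; rewrite {b}Eb.
have h : @hom (lin q) ord_max (a ord_max) by rewrite /= (surj_max sa).
exists (@WS j q b0 c0 (u \c fmap c0 h)); split=> //; apply: ws_eq => //=.
by rewrite -compA -fmapM fmap_id compm1.
Qed.

(** Freeness of [W]: the generating cells sit at the last object of their chain, with an identity
    arrow. *)
Lemma wrep0 j p (w : wsimp j p) : w = wpush (wu w) (@WS (wc w ord_max) p (wb w) (wc w) (idm _)).
Proof. by case: w => b c u; rewrite /wpush /= compm1. Qed.
End W.

Section Lift.
Variables (J : category) (F G : diagram J) (f : dmor F G).
Hypothesis tf : forall j, tfib (f j).
Variables (B : sset) (psi : dmor (W J B) G).

Notation K := (sprod B (nerve J)).
Notation wrel := (forall j p, wsimp B j p -> F j p -> Prop).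

(* [R] is the graph of a partial lift, defined on the free cells over [Q]. *)
Record good (Q : forall p, K p -> Prop) (R : wrel) : Prop := Good {
  good_Qact : forall p q (a : @hom Delta p q) k, Q q k -> Q p (act a k);
  good_RQ : forall j p (w : wsimp B j p) x, R j p w x -> Q p (wk w);
  good_QR : forall j p (w : wsimp B j p), Q p (wk w) -> exists x, R j p w x;
  good_uniq : forall j p (w : wsimp B j p) x x', R j p w x -> R j p w x' -> x = x';
  good_act : forall j p q (a : @hom Delta p q) (w : wsimp B j q) x,
    R j q w x -> R j p (wact a w) (act a x);
  good_push : forall j j' (v : hom j j') p (w : wsimp B j p) x,
    R j p w x -> R j' p (wpush v w) (dmap F v p x);
  good_over : forall j p (w : wsimp B j p) x, R j p w x -> f j p x = psi j p w }.

(** Since [W] is free, one filler for each [N]-cell outside [Q], chosen at the last object of its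
    chain and pushed forward along arrows, gives a lift that is natural by construction. *)
Lemma lift_step N Q R : good Q R -> (forall p (k : K p), gend N k -> Q p k) ->
  exists R' : wrel, good (fun p k => Q p k \/ gend N.+1 k) R' /\
    forall j p w x, R j p w x -> R' j p w x.
Proof.
move=> gR QN.
pose w1 (y : K N) : wsimp B (y.2 ord_max) N := @WS J B _ N y.1 y.2 (idm _).
have fill (y : K N) : ~ Q N y -> exists x : F (y.2 ord_max) N,
    f _ N x = psi _ N (w1 y) /\
    forall p (a : @hom Delta p N) t, R _ p (wact a (w1 y)) t -> act a x = t.
  move=> ny; apply: (tf (R := fun p a t => R _ p (wact a (w1 y)) t)).
  - split=> [p a x x'|p q a b x]; first exact: (good_uniq gR).
    move/(good_act gR a).
    by rewrite (_ : wact a (wact b _) = wact (b \c a) (w1 y)) //; exact/esym/(@actM (Wsset B (y.2 ord_max))).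
  (* A surjective [a] has a section, which would put the cell itself into [Q]. *)
  - move=> p a x /(good_RQ gR); rewrite wk_act => Qa sa; apply: ny.
    have [d [ad _]] := surj_section ord0 sa.
    have := good_Qact gR d Qa; rewrite -(@actM K _ _ _ a d) ad act1.
    by case: (y).
  - move=> p a na; apply: (good_QR gR); rewrite wk_act.
    by case: (y) => b c; apply/QN/nonsurj_gend.
  - move=> p a x /(good_over gR) ->.
    exact: (sfunP (psi _) a (w1 y)).
pose X (y : K N) (ny : ~ Q N y) := sval (cid (fill y ny)).
have XP (y : K N) (ny : ~ Q N y) := svalP (cid (fill y ny)).
pose XW j (w : wsimp B j N) (nw : ~ Q N (wk w)) : F j N := dmap F (wu w) N (X _ nw).
have XW_over j (w : wsimp B j N) nw : f j N (XW j w nw) = psi j N w.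
  by rewrite /XW dfunP (XP _ nw).1 [in RHS](wrep0 w) -(@dfunP J _ _ psi).
have XW_bd j (w : wsimp B j N) nw p (a : @hom Delta p N) t :
    R j p (wact a w) t -> act a (XW j w nw) = t.
  move=> Rt; have [t0 Rt0] := good_QR gR (good_RQ gR Rt : Q p (wk (wact a (w1 (wk w))))).
  rewrite /XW -sfunP ((XP _ nw).2 _ _ _ Rt0); apply: (good_uniq gR) Rt.
  by move/(good_push gR (wu w)): Rt0; rewrite wpushP -wrep0.
have XW_irr j (w w' : wsimp B j N) nw nw' : w = w' -> XW j w nw = XW j w' nw'.
  by move=> E; case: _ / E nw' => nw'; rewrite (Prop_irrelevance nw nw').
have nd j (w : wsimp B j N) : ~ Q N (wk w) -> ~ gend N (w : Wsset B j N).
  move=> nw [q [a [y [qN E]]]]; apply/nw/QN; exists q, a, (wk y); split=> //.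
  by rewrite E wk_act.
(* The new values are the degeneracies of the fillers. [ez_uniq] makes such a presentation unique,
   and every proper face falls back on [R]. *)
pose new j p (w : wsimp B j p) (x : F j p) := exists (a : @hom Delta p N)
  (w0 : wsimp B j N) (nw : ~ Q N (wk w0)), [/\ surj a, w = wact a w0 & x = act a (XW j w0 nw)].
have new_notQ j p (w : wsimp B j p) x : new j p w x -> ~ Q p (wk w).
  move=> [a [w0 [nw [sa -> _]]]] Qw; apply: nw.
  have [d [ad _]] := surj_section ord0 sa.
  have := good_Qact gR d Qw; rewrite wk_act -(@actM K _ _ _ a d) ad.
  by rewrite act1.
exists (fun j p w x => R j p w x \/ new j p w x); split=> [|j p w x Rx]; last by left.
split.
- move=> p q a k [/(good_Qact gR a)|/(@gend_act K)]; by [left|right].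
- move=> j p w x [/(good_RQ gR)|[a [w0 [nw [_ -> _]]]]]; first by left.
  right; rewrite wk_act; apply: gend_act; exact: gend_self.
- move=> j p w; have [Qw _|nQ [//|[q [a [y [qN E]]]]]] := pselect (Q p (wk w)).
    by have [x Rx] := good_QR gR Qw; exists x; left.
  have Eq : q = N.
    apply/eqP; rewrite eqn_leq -ltnS qN leqNgt; apply/negP => ltq.
    by apply/nQ/QN; exists q, a, y.
  subst q.
  have sa : surj a.
    by apply: contrapT => na; apply/nQ/QN; rewrite E; apply: nonsurj_gend.
  have [w0 [Ew0 Ew]] := wrep sa E.
  have nw : ~ Q N (wk w0).
    by move/(good_Qact gR a); rewrite Ew0 -E.
  by exists (act a (XW j w0 nw)); right; exists a, w0, nw.
- move=> j p w x x' [Rx|nx] [Rx'|nx'].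
  + exact: (good_uniq gR) Rx Rx'.
  + by case: (new_notQ _ _ _ _ nx'); apply: (good_RQ gR) Rx.
  + by case: (new_notQ _ _ _ _ nx); apply: (good_RQ gR) Rx'.
  + case: nx nx' => [a [w0 [nw [sa E ->]]]] [a' [w0' [nw' [sa' E' ->]]]].
    have := @ez_uniq (Wsset B j) p N a a' w0 w0' sa (nd _ _ nw) (etrans (esym E) E').
    by case=> Ea Ew; rewrite Ea (XW_irr _ _ _ nw nw' Ew).
- move=> j p q b w x [/(good_act gR b)|[a [w0 [nw [sa -> ->]]]]]; first by left.
  rewrite -[wact b _](@actM (Wsset B j) _ _ _ a b w0) -actM.
  have [sab|nab] := pselect (surj (a \c b)).
    by right; exists (a \c b), w0, nw.
  left; have [t Rt] : exists x, R j p (wact (a \c b) w0) x.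
    by apply/(good_QR gR)/QN; rewrite wk_act; apply: nonsurj_gend.
  by rewrite (XW_bd _ _ _ _ _ _ Rt).
- move=> j j' v p w x [/(good_push gR v)|[a [w0 [nw [sa -> ->]]]]]; first by left.
  right; exists a, (wpush v w0), nw; split=> //; first exact: wpushP.
  by rewrite /XW sfunP -dmapM.
- move=> j p w x [/(good_over gR) //|[a [w0 [nw [sa -> ->]]]]].
  by rewrite sfunP XW_over -(sfunP (psi j)).
Qed.

(** Union of the skeletal extensions: a [p]-simplex has its value from stage [p.+1] on, and later
    stages do not change it. *)
Lemma dmor_lift Q R : good Q R -> exists chi : dmor (W J B) F,
  (forall j p w x, R j p w x -> chi j p w = x) /\ forall j p w, f j p (chi j p w) = psi j p w.
Proof.
move=> gR.
pose QN N p (k : K p) := Q p k \/ gend N k.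
have step N (R0 : {R0 | good (QN N) R0}) : {R' : {R0 | good (QN N.+1) R0} |
    forall j p w x, sval R0 j p w x -> sval R' j p w x}.
  case: R0 => R0 gR0; apply: cid => /=.
  have [|R' [gR' sub]] := lift_step (N := N) gR0; first by move=> p k; right.
  have QE p k : (QN N p k \/ gend N.+1 k) <-> QN N.+1 p k.
    split; last by case; [left; left | right].
    by case=> [[|/(gendW (leqnSn N))]|]; [left | right | right].
  have g' : good (QN N.+1) R'.
    case: gR' => h1 h2 h3 h4 h5 h6 h7; split=> //.
    - by move=> p q a k /QE/(h1 _ _ a)/QE.
    - by move=> j p w x /h2/QE.
    - by move=> j p w /QE/h3.
  by exists (exist _ R' g').
have g0 : good (QN 0) R.
  have QE p k : Q p k <-> QN 0 p k.
    by split=> [|[//|[q [a [y []]]]]]; first by left.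
  case: gR => h1 h2 h3 h4 h5 h6 h7; split=> //.
  - by move=> p q a k /QE/(h1 _ _ a)/QE.
  - by move=> j p w x /h2/QE.
  - by move=> j p w /QE/h3.
pose RR := nat_rect (fun N => {R0 | good (QN N) R0}) (exist _ R g0)
  (fun N R0 => sval (step N R0)).
have RS N j p w x : sval (RR N) j p w x -> sval (RR N.+1) j p w x.
  exact: (svalP (step N (RR N))).
have RM N M j p w x : (N <= M)%N -> sval (RR N) j p w x -> sval (RR M) j p w x.
  by move=> /subnKC <-; elim: (M - N)%N => [|m IH]; rewrite ?addn0 // addnS => /IH/RS.
have tot j p w : exists x, sval (RR p.+1) j p w x.
  by apply: (good_QR (svalP (RR p.+1))); right; apply: gend_self.
pose chi j p w := sval (cid (tot j p w)).
have chiR j p w : sval (RR p.+1) j p w (chi j p w) := svalP (cid (tot j p w)).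
have chiE N j p w x : sval (RR N) j p w x -> chi j p w = x.
  move=> h; apply: (good_uniq (svalP (RR (maxn N p.+1)))).
    by apply: RM (chiR j p w); rewrite leq_maxr.
  by apply: RM h; rewrite leq_maxl.
have chiP j m n (a : @hom Delta m n) (w : W J B j n) : chi j m (act a w) = act a (chi j n w).
  exact/chiE/(good_act (svalP (RR n.+1)))/chiR.
have chiQ j j' (v : hom j j') n (w : W J B j n) :
    chi j' n (dmap (W J B) v n w) = dmap F v n (chi j n w).
  exact/chiE/(good_push (svalP (RR n.+1)))/chiR.
exists (@DMor J (W J B) F (fun j => SMap (chiP j)) chiQ); split=> /=.
- by move=> j p w x; apply: (chiE 0).
- move=> j p w; exact: (good_over (svalP (RR p.+1)) (chiR j p w)).
Qed.
End Lift.

Section PlainLift.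
Variables (X Y : sset) (f : smap X Y) (tf : tfib f).

Definition cdiag (Z : sset) : diagram (lin 0) :=
  @Diagram (lin 0) (fun _ => Z) (fun _ _ _ => sid Z) (fun _ _ _ => erefl) (fun _ _ _ _ _ _ _ => erefl).

(** The case of the one-object category [lin 0], where a constant chain and an identity arrow add
    nothing to a simplex of [K]. *)
Lemma lift_plain (K : sset) (R : forall p, K p -> X p -> Prop) (psi : smap K Y) :
  pfun R -> (forall p k x, R p k x -> f p x = psi p k) ->
  exists chi : smap K X, (forall p k x, R p k x -> chi p k = x) /\
    forall p k, f p (chi p k) = psi p k.
Proof.
move=> [Ru Ra] Rpsi.
pose fd : dmor (cdiag X) (cdiag Y) := @DMor (lin 0) (cdiag X) (cdiag Y) (fun _ => f) (fun _ _ _ _ _ => erefl).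
have pdP j m n (a : @hom Delta m n) (w : Wsset (J := lin 0) K j n) :
    psi m (wb (wact a w)) = act a (psi n (wb w)) by rewrite sfunP.
pose pd : dmor (W (lin 0) K) (cdiag Y) :=
  @DMor (lin 0) (W (lin 0) K) (cdiag Y)
   (fun j => @SMap (Wsset (J := lin 0) K j) Y (fun p w => psi p (wb w)) (pdP j))
   (fun _ _ _ _ _ => erefl).
pose c0 p : functor (lin p) (lin 0) := cst p ord0.
have [||chi [chiR chiO]] := @dmor_lift (lin 0) (cdiag X) (cdiag Y) fd _ K pd
   (fun p k => exists x, R p k.1 x) (fun j p w x => R p (wb w) x); first by [].
  split=> //=.
  - by move=> p q a k [x /(Ra _ _ a)]; exists (act a x).
  - by move=> j p w x; exists x.
  - by move=> j p w; apply: Ru.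
  - by move=> j p q a w x /Ra.
  - by move=> j p w x /Rpsi.
have P m n (a : @hom Delta m n) (k : K n) :
    chi (ord0 : lin 0) m (@WS (lin 0) K ord0 m (act a k) (c0 m) (idm _))
    = act a (chi (ord0 : lin 0) n (@WS (lin 0) K ord0 n k (c0 n) (idm _))).
  rewrite -sfunP; congr (chi _ m _).
  rewrite /= /wact /=; apply: (@ws_eq (lin 0)) => // *; exact: bool_irrelevance.
exists (SMap P); split=> p k.
  by move=> x Rx /=; apply: chiR.
exact: (chiO ord0 p).
Qed.
End PlainLift.

(* The extension property for the inclusions of [D^n x {e} u bd D^n x D^1] into
   [D^n x D^1].  It holds for Kan complexes and, unlike the Kan condition, it passes
   directly to homotopy limits. *)
Definition hep (X : sset) : Prop :=
  forall n (e : 'I_2) (R : forall p, sprod (splx n) (splx 1) p -> X p -> Prop), pfun R ->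
    (forall p z x, R p z x -> z.2 = cst p e \/ ~ surj z.1) ->
    (forall p (z : sprod (splx n) (splx 1) p), (z.2 = cst p e \/ ~ surj z.1) -> exists x, R p z x) ->
  exists H : smap (sprod (splx n) (splx 1)) X, forall p z x, R p z x -> H p z = x.

(** * Filling the prism by horns *)

Section Prism.
Variables (X : sset) (kX : kan X).

(** One attachment of a simplex along a horn. As [s] is embedded, the filler defines a function on
    its simplices, and [dom] says that it meets the old domain exactly in the horn. *)
Lemma horn_step (K : sset) (R : forall p, K p -> X p -> Prop) n (s : K n.+1) (i : 'I_n.+2) :
  pfun R -> (forall p (a b : splx n.+1 p), act a s = act b s -> a = b) ->
  (forall p (a : splx n.+1 p), (exists x, R p (act a s) x) <-> in_horn i a) ->
  exists R' : forall p, K p -> X p -> Prop, [/\ pfun R',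
    forall p k x, R p k x -> R' p k x &
    forall p k, (exists x, R' p k x) <->
      (exists x, R p k x) \/ exists a : splx n.+1 p, k = act a s].
Proof.
move=> [Ru Ra] inj dom.
pose h0 p (a : horn i p) : X p := sval (cid ((dom p (sval a)).2 (svalP a))).
have h0P p (a : horn i p) : R p (act (sval a) s) (h0 p a).
  exact: (svalP (cid ((dom p (sval a)).2 (svalP a)))).
have hP m n' (a : @hom Delta m n') (b : horn i n') : h0 m (act a b) = act a (h0 n' b).
  apply: Ru (h0P m (act a b)) _ => /=.
  by rewrite (@actM K _ _ _ (sval b) a s); apply: Ra.
have [x xP] := kX (SMap hP).
exists (fun p k t => R p k t \/ exists a : splx n.+1 p, k = act a s /\ t = act a x).
have agree p (a : splx n.+1 p) t : R p (act a s) t -> t = act a x.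
  move=> Rt; have ha : in_horn i a by apply/dom; exists t.
  by rewrite -(xP p (exist _ a ha)); apply: Ru Rt (h0P _ (exist _ a ha)).
split; last 1 first.
- move=> p k; split=> [[t [Rt|[a [-> _]]]]|[[t Rt]|[a ->]]].
  + by left; exists t.
  + by right; exists a.
  + by exists t; left.
  + by exists (act a x); right; exists a.
- split=> [p k t t'|p q a k t].
    move=> [Rt|[a [E ->]]] [Rt'|[b [E' ->]]].
    + exact: Ru Rt Rt'.
    + by apply: agree; rewrite -E'.
    + by apply/esym/agree; rewrite -E.
    + by rewrite (inj p a b) // -E.
  case=> [Rt|[b [-> ->]]]; first by left; apply: Ra.
  by right; exists (b \c a); rewrite -!actM.
- by move=> p k t; left.
Qed.

Variables (n : nat) (e : 'I_2).
Notation M := (sprod (splx n) (splx 1)).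

(* [sig l] is the l-th nondegenerate (n+1)-simplex of the prism, and [insig l z]
   says that [z] lies in it. *)
Definition insig (l : nat) p (z : M p) : Prop :=
  forall v : 'I_p.+1, if (z.2 v : 'I_2) == ord0 then ((z.1 v : 'I_n.+1) <= l)%N
    else (l <= (z.1 v : 'I_n.+1))%N.

Definition sig1 (i : nat) (j : 'I_n.+2) : 'I_n.+1 := inord (if (j <= i)%N then (j : nat) else j.-1).
Definition sig2 (i : nat) (j : 'I_n.+2) : 'I_2 := inord (i < j)%N.

Lemma sig1E i (j : 'I_n.+2) : (i <= n)%N -> sig1 i j = (if (j <= i)%N then (j : nat) else j.-1) :> nat.
Proof. by move=> ilt; rewrite inordK //; case: ifP; have := ltn_ord j; lia. Qed.
Lemma sig2E i (j : 'I_n.+2) : sig2 i j = (i < j)%N :> nat.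
Proof. by rewrite inordK //; case: (i < j)%N. Qed.

Lemma sig1P i : (i <= n)%N -> {homo sig1 i : x y / (x <= y)%O}.
Proof. by move=> ilt x y; rewrite !leEord /= => xy; rewrite !sig1E //; do 2 case: ifP; lia. Qed.
Lemma sig2P i : {homo sig2 i : x y / (x <= y)%O}.
Proof. by move=> x y; rewrite !leEord /= => xy; rewrite !sig2E; lia. Qed.

Definition sig i (ilt : (i <= n)%N) : M n.+1 := (mono (sig1P ilt), mono (@sig2P i)).

Lemma I2_val (t : 'I_2) : (t : nat) = (t != ord0).
Proof. by case: t => [[|[|]]]. Qed.

Lemma sig_inj i (ilt : (i <= n)%N) p (a b : splx n.+1 p) :
  act a (sig ilt) = act b (sig ilt) -> a = b.
Proof.
move=> E; have E1 := congr1 fst E; have E2 := congr1 snd E; apply: Dext => v; apply: val_inj => /=.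
have /(congr1 val) /= := congr1 (fun c : @hom Delta p n => c v : 'I__) E1.
have /(congr1 val) /= := congr1 (fun c : @hom Delta p 1 => c v : 'I__) E2.
by rewrite !sig1E // !sig2E; do 2 case: ifP; lia.
Qed.

Lemma insigP i (ilt : (i <= n)%N) p (z : M p) :
  insig i z <-> exists a : splx n.+1 p, z = act a (sig ilt).
Proof.
split=> [zi|[a ->] v]; last first.
  by rewrite /= -val_eqE /= sig2E sig1E //; case: ifP; case: ifP; lia.
case: z zi => z1 z2 zi.
have lt v : ((z1 v : 'I_n.+1) + (z2 v : 'I_2) < n.+2)%N.
  by have := ltn_ord (z1 v : 'I_n.+1); have := ltn_ord (z2 v : 'I_2); lia.
have P : {homo (fun v => Ordinal (lt v)) : x y / (x <= y)%O}.
  by move=> x y; rewrite !leEord /= => xy; apply: leq_add; apply: Dmono.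
exists (mono P); congr (_, _); apply: Dext => v; apply: val_inj => /=.
  rewrite sig1E //=; have := zi v; rewrite /= I2_val; case: eqP => /=; case: ifP; lia.
rewrite sig2E /=; have := zi v; rewrite /= I2_val; case: eqP => /=; lia.
Qed.

(** The order of attachment. The shuffle that contains the prescribed end of the prism must come
    first: the last one if [e] is [0], the first one if [e] is [1]. *)
Definition idx (m : nat) := if e == ord0 then (n - m)%N else m.
Definition done (m l : nat) : Prop := if e == ord0 then (n < l + m)%N else (l < m)%N.

Definition stage m p (z : M p) : Prop :=
  z.2 = cst p e \/ ~ surj z.1 \/ exists2 l, (l <= n)%N /\ done m l & insig l z.

(** Omitting vertex [i] or [i.+1] of the [i]-th shuffle gives the face shared with the previous or
    the next shuffle, or an end of the prism. The missing face of the horn is the one turned towards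
    the shuffle that is attached next. *)
Definition idx_ord (m : nat) : 'I_n.+2 := inord (if e == ord0 then idx m else (idx m).+1).

Lemma stage_horn m (mn : (m <= n)%N) (ilt : (idx m <= n)%N) p (a : splx n.+1 p) :
  stage m (act a (sig ilt)) <-> in_horn (idx_ord m) a.
Proof.
have e1 : e != ord0 -> e = ord_max.
  by move=> ne; apply: val_inj; rewrite /= I2_val ne.
have iE : idx_ord m = (if e == ord0 then idx m else (idx m).+1) :> nat.
  by rewrite inordK //; case: ifP; lia.
set i := idx m in ilt iE *.
split=> [st|[j ji aj]].
  apply: contrapT => nh.
  (* Outside the horn, [a] hits every vertex except possibly that of the missing face. *)
  have hit j : j <> (if e == ord0 then i else i.+1) -> (j <= n.+1)%N -> exists v : 'I_p.+1, a v = j :> nat.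
    move=> ji jn; apply: contrapT => H; apply: nh; exists (inord j).
      by move=> E; apply: ji; rewrite -iE -E inordK.
    by move=> v E; apply: H; exists v; rewrite E inordK.
  case: st => [/= E|[ns|[l [ln dl] lz]]].
  - case: (altP (e =P ord0)) hit => e0 hit.
      have [||v av] := hit i.+1; [lia | lia |].
      have /(congr1 val) := congr1 (fun c : @hom Delta p 1 => c v : 'I__) E.
      by rewrite /= sig2E av e0 /=; lia.
    have [||v av] := hit i; [lia | lia |].
    have /(congr1 val) := congr1 (fun c : @hom Delta p 1 => c v : 'I__) E.
    by rewrite /= sig2E av (e1 e0) /=; lia.
  - apply: ns => j /=.
    have [v av] : exists v : 'I_p.+1, (a v = j :> nat /\ (j <= i)%N) \/ (a v = j.+1 :> nat /\ (i < j.+1)%N).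
      have := ltn_ord j; case: (altP (e =P ord0)) hit => e0 hit jn.
        case: (ltnP j i) => ji.
          by have [||v av] := hit j; [lia | lia | exists v; left; lia].
        by have [||v av] := hit j.+1; [lia | lia | exists v; right; lia].
      case: (leqP j i) => ji.
        by have [||v av] := hit j; [lia | lia | exists v; left; lia].
      by have [||v av] := hit j.+1; [lia | lia | exists v; right; lia].
    exists v; apply: val_inj; rewrite /= sig1E //; case: ifP; lia.
  - case: (altP (e =P ord0)) hit => e0 hit.
      have [||v av] := hit i.+1; [lia | lia |].
      have := lz v; rewrite -val_eqE /= sig2E sig1E // av.
      by move: dl; rewrite /done /i /idx e0 eqxx; do 2 case: ifP; lia.
    have [||v av] := hit i; [lia | lia |].
    have := lz v; rewrite -val_eqE /= sig2E sig1E // av.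
    by move: dl; rewrite /done /i /idx (negbTE e0); do 2 case: ifP; lia.
have aj' (v : 'I_p.+1) : a v <> j :> nat by move=> E; apply: (aj v); apply: val_inj.
have {}ji : j <> (if e == ord0 then i else i.+1) :> nat by rewrite -iE => E; apply: ji; apply: val_inj.
have jn := ltn_ord j.
have [lt|ge] := ltnP j i.
  right; left => /(_ (inord j)) [v] /(congr1 val); rewrite /= sig1E // inordK; last by lia.
  by have := aj' v; case: ifP; lia.
have [gt|le] := ltnP i.+1 j.
  right; left => /(_ (inord j.-1)) [v] /(congr1 val); rewrite /= sig1E // inordK; last by lia.
  by have := aj' v; case: ifP; lia.
(* The omitted vertex is now the other one of [i] and [i.+1]: the face lies in the neighbour
   attached before, or in the prescribed end if there is no such neighbour. *)
case: (altP (e =P ord0)) ji => e0 ji.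
  have [iN|iN] := eqVneq i n.
    left; apply: Dext => v; apply: val_inj; rewrite /= sig2E e0 /=.
    by have := aj' v; have := ltn_ord (a v : 'I__); lia.
  right; right; exists i.+1; first by rewrite /done e0 eqxx; move: iN; rewrite /i /idx e0 eqxx; lia.
  move=> v; rewrite -val_eqE /= sig2E sig1E //; have := aj' v; do 2 case: ifP; lia.
have [i0|i0] := eqVneq i 0%N.
  left; apply: Dext => v; apply: val_inj; rewrite /= sig2E (e1 e0) /=.
  by have := aj' v; lia.
right; right; exists i.-1; first by rewrite /done (negbTE e0); move: i0; rewrite /i /idx (negbTE e0); lia.
move=> v; rewrite -val_eqE /= sig2E sig1E //; have := aj' v; do 2 case: ifP; lia.
Qed.

Lemma stage_all p (z : M p) : stage n.+1 z.
Proof.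
have dn l : (l <= n)%N -> done n.+1 l by rewrite /done; case: ifP; lia.
have [z0|_] := pselect (z.2 = cst p e); first by left.
right; right.
have [H|H] := pselect (exists v : 'I_p.+1, (z.2 v : 'I_2) != ord0).
  (* The shuffle turns where the second coordinate first becomes [1]. *)
  have [v vP vm] := arg_minnP (fun v : 'I_p.+1 => (v : nat)) (svalP (cid H) : (fun v => (z.2 v : 'I_2) != ord0) (sval (cid H))).
  exists (z.1 v : 'I_n.+1); first by rewrite -ltnS ltn_ord; split=> //; apply: dn; rewrite -ltnS ltn_ord.
  move=> u; case: ifP => u0.
    apply: Dmono; rewrite leqNgt; apply/negP => vu; move: vP; rewrite -lt0n.
    have := Dmono z.2 (ltnW vu); rewrite (eqP u0) /=; by case: (val (z.2 v : 'I_2)).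
  by apply/Dmono/vm; rewrite u0.
exists n; first by split=> //; apply: dn.
move=> u; case: ifP => u0; first by rewrite -ltnS ltn_ord.
by case: H; exists u; rewrite u0.
Qed.
End Prism.

(** Stage [0] is the given domain, each of the [n.+1] shuffles is one horn filling, and the last
    stage is the whole prism. *)
Lemma kan_hep X : kan X -> hep X.
Proof.
move=> kX n e R pR RQ QR.
have H m : (m <= n.+1)%N -> exists R' : forall p, sprod (splx n) (splx 1) p -> X p -> Prop,
   [/\ pfun R', forall p z x, R p z x -> R' p z x & forall p z, (exists x, R' p z x) <-> stage e m z].
  elim: m => [|m IH] mn.
    exists R; split=> // p z; split=> [[x /RQ]|].
      by case; [left | right; left].
    case=> [E|[E|[l [ln dl] _]]]; first by apply: QR; left.
      by apply: QR; right.
    by move: dl; rewrite /done; case: ifP; lia.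
  have [R1 [p1 s1 d1]] := IH (ltnW mn).
  have ilt : (idx n e m <= n)%N by rewrite /idx; case: ifP; lia.
  have [|R2 [p2 s2 d2]] := @horn_step X kX _ R1 n (sig ilt) (idx_ord n e m) p1 (@sig_inj n _ ilt).
  - by move=> p a; rewrite d1; apply: stage_horn.
  - exists R2; split=> // [p z x /s1/s2//|p z].
    rewrite d2 d1 -insigP.
    have dE l : (l <= n)%N -> done n e m.+1 l <-> done n e m l \/ l = idx n e m.
      by rewrite /done /idx; case: ifP; lia.
    split=> [[[E|[E|[l [ln dl] lz]]]|iz]|[E|[E|[l [ln dl] lz]]]].
    + by left.
    + by right; left.
    + by right; right; exists l => //; split=> //; apply/dE => //; left.
    + by right; right; exists (idx n e m) => //; split=> //; apply/dE => //; right.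
    + by left; left.
    + by left; right; left.
    + case/dE: dl => // [dl|El]; last by right; rewrite -El.
      by left; right; right; exists l.
have [R' [p' s' d']] := H _ (leqnn _).
have tot p z : exists x, R' p z x by apply/d'; apply: stage_all.
pose h p z := sval (cid (tot p z)).
have hR p z : R' p z (h p z) := svalP (cid (tot p z)).
have hP a b (u : @hom Delta a b) z : h a (act u z) = act u (h b z).
  exact: (pfun_uniq p' (hR _ _) (pfun_act p' u (hR _ _))).
by exists (SMap hP) => p z x /s'; apply: (pfun_uniq p').
Qed.

Notation I1 := (splx 1).
Notation cyl X := (sprod X I1).
Notation c0 p := (cst p (ord0 : 'I_2)).
Notation c1 p := (cst p (ord_max : 'I_2)).

Lemma cst_act m n (a : @hom Delta m n) (e : 'I_2) : act a (cst n e : I1 n) = cst m e.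
Proof. exact: Dext. Qed.

Lemma c0_neq_c1 p : c0 p <> c1 p.
Proof. by move/(congr1 (fun c : @hom Delta p 1 => c ord0 : 'I_2)). Qed.

Section Curry.
Variables (K X : sset).

Lemma curryP (H : smap (cyl K) X) m (k : K m) p q (b : @hom Delta p q) (z : sprod (splx m) I1 q) :
  H p (act (act b z).1 k, (act b z).2) = act b (H q (act z.1 k, z.2)).
Proof. by rewrite -sfunP /= -(@actM K). Qed.

Lemma curry_act (H : smap (cyl K) X) m n (a : @hom Delta m n) (k : K n) :
  SMap (curryP H (act a k)) = act a (SMap (curryP H k) : maps I1 X n).
Proof. by apply: smap_ext => p [x t] /=; rewrite -(@actM K). Qed.

Definition curry (H : smap (cyl K) X) : smap K (maps I1 X) :=
  @SMap K (maps I1 X) (fun m k => SMap (curryP H k)) (curry_act H).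

Lemma uncurryP (h : smap K (maps I1 X)) m n (a : @hom Delta m n) (z : cyl K n) :
  h m (act a z).1 m (idm _, (act a z).2) = act a (h n z.1 n (idm _, z.2)).
Proof.
rewrite -sfunP /= sfunP /=; congr (h n z.1 m (_, _)); exact: Dext.
Qed.

Definition uncurry (h : smap K (maps I1 X)) : smap (cyl K) X := SMap (uncurryP h).
End Curry.

Definition ev (e : 'I_2) (X : sset) : smap (maps I1 X) X.
refine (@SMap (maps I1 X) X (fun n h => h n (idm _, cst n e)) _).
move=> m n a h; rewrite -sfunP /=; congr (h m (_, _)); exact: Dext.
Defined.

Lemma maps_at X n (h : maps I1 X n) p (x : splx n p) t : h p (x, t) = act x h p (idm _, t).
Proof. by rewrite /=; congr (h p (_, _)); apply: Dext. Qed.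

(** After currying, boundary lifting for [ev e] is exactly the extension problem in [hep]. *)
Lemma tfib_ev e X : hep X -> tfib (ev e X).
Proof.
move=> hX n R y [Ru Ra] RS SR Ry.
have [|||H HP] := hX n e (fun p z x => (z.2 = cst p e /\ x = act z.1 y) \/
    exists2 h, R p z.1 h & x = h p (idm _, z.2)).
- split=> [p z x x'|p q a z x].
    have mix h v v' : R p z.1 h -> v = h p (idm _, z.2) -> z.2 = cst p e -> v' = act z.1 y -> v = v'.
      by move=> Rh -> -> ->; rewrite -(Ry _ _ _ Rh).
    move=> [[E1 E2]|[h Rh E]] [[E1' E2']|[h' Rh' E']].
    + by rewrite E2 E2'.
    + exact/esym/(mix _ _ _ Rh').
    + exact: (mix _ _ _ Rh).
    + by rewrite E E' (Ru _ _ _ _ Rh Rh').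
  move=> [[E ->]|[h Rh ->]]; [left|right].
    by rewrite /= E; split; [exact: Dext | rewrite -actM].
  exists (act a h); first exact: Ra.
  by rewrite -sfunP /=; congr (h p (_, _)); apply: Dext.
- by move=> p z x [[]|[h /RS]]; [left|right].
- move=> p z [E|/SR[h Rh]]; first by exists (act z.1 y); left.
  by exists (h p (idm _, z.2)); right; exists h.
exists H; split; first by rewrite /= (HP _ _ y) //; left; rewrite act1.
move=> p a h Rh; apply: smap_ext => q [x t] /=.
apply: HP; right; exists (act x h); first exact: Ra.
by rewrite [LHS]maps_at.
Qed.

(** Extension from $K\times\{e\}\cup A\times\Delta^1$ for an arbitrary pair: transposed, it is a
    lifting problem for [ev e], which is solved cell by cell. *)
Lemma hepK X : hep X -> forall (K : sset) (A : forall p, K p -> Prop) (e : 'I_2)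
    (R : forall p, cyl K p -> X p -> Prop), pfun R ->
  (forall p q (a : @hom Delta p q) k, A q k -> A p (act a k)) ->
  (forall p k t x, R p (k, t) x -> t = cst p e \/ A p k) ->
  (forall p k, exists x, R p (k, cst p e) x) ->
  (forall p k t, A p k -> exists x, R p (k, t) x) ->
  exists H : smap (cyl K) X, forall p z x, R p z x -> H p z = x.
Proof.
move=> hX K A e R [Ru Ra] Aact RA Re AR.
pose y p k := sval (cid (Re p k)).
have yR p k : R p (k, cst p e) (y p k) := svalP (cid (Re p k)).
have yP m n (a : @hom Delta m n) k : y m (act a k) = act a (y n k).
  apply: Ru (yR _ _) _; have := Ra _ _ a _ _ (yR n k).
  by congr (R m (_, _) _); apply: cst_act.
pose R' p (k : K p) (h : maps I1 X p) := A p k /\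
  forall q (a : splx p q) t, R q (act a k, t) (h q (a, t)).
have [||chi [chiR chiO]] := @lift_plain _ _ _ (@tfib_ev e _ hX) K R' (SMap yP).
- split=> [p k h h' [_ Rh] [_ Rh']|p q a k h [Ak Rh]].
    by apply: smap_ext => q [x t]; apply: Ru (Rh _ _ _) (Rh' _ _ _).
  by split=> [|r b t]; [exact: Aact | rewrite /= -(@actM K); apply: Rh].
- move=> p k h [_ Rh] /=; apply: Ru (yR _ _); have := Rh p (idm _) (cst p e).
  by rewrite act1.
exists (uncurry chi) => p [k t] x Rx /=.
have [E|Ak] := RA _ _ _ _ Rx; last first.
  have tot q z : exists x, R q (act z.1 k, z.2) x.
    by apply: AR; apply: Aact.
  pose h q (z : sprod (splx p) I1 q) := sval (cid (tot q z)).
  have hR q z : R q (act z.1 k, z.2) (h q z) := svalP (cid (tot q z)).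
  have hP m n (a : @hom Delta m n) z : h m (act a z) = act a (h n z).
    apply: Ru (hR m _) _; have := Ra _ _ a _ _ (hR n z).
    by rewrite /= -(@actM K).
  have /chiR -> : R' p k (SMap hP) by split=> // q a u; apply: (hR q (a, u)).
  have := hR p (idm _, t); rewrite act1 => hR'; exact: Ru hR' Rx.
have := chiO p k; rewrite /= E => ->; apply: Ru (yR _ _) _; by rewrite -E.
Qed.

(** * Homotopy equivalences and path spaces *)

Section Htpy.

Lemma cylP (X Y Z : sset) (f : smap X Y) (H : smap (cyl Y) Z) m n (a : @hom Delta m n) (z : cyl X n) :
  H m (f m (act a z).1, (act a z).2) = act a (H n (f n z.1, z.2)).
Proof. by rewrite -sfunP /= sfunP. Qed.
Definition cyl_pre (X Y Z : sset) (f : smap X Y) (H : smap (cyl Y) Z) : smap (cyl X) Z :=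
  SMap (cylP f H).

Lemma cyl_endP (X Y : sset) (e : 'I_2) (H : smap (cyl X) Y) m n (a : @hom Delta m n) (x : X n) :
  H m (act a x, cst m e) = act a (H n (x, cst n e)).
Proof. by rewrite -sfunP; congr (H m (_, _)); apply/esym/cst_act. Qed.
Definition cyl_end (X Y : sset) (e : 'I_2) (H : smap (cyl X) Y) : smap X Y := SMap (cyl_endP e H).

Lemma htpy_ext (X Y : sset) (f f' g g' : smap X Y) :
  (forall n x, f n x = f' n x) -> (forall n x, g n x = g' n x) ->
  homotopic f g -> homotopic f' g'.
Proof. by move=> Ef Eg [H HP]; exists H => n x; rewrite -Ef -Eg. Qed.

Lemma fst_cylP (X : sset) m n (a : @hom Delta m n) (z : cyl X n) : (act a z).1 = act a z.1.
Proof. by []. Qed.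
Definition fst_cyl (X : sset) : smap (cyl X) X := SMap (@fst_cylP X).

Lemma htpy_refl (X Y : sset) (f g : smap X Y) : (forall n x, f n x = g n x) -> homotopic f g.
Proof. by move=> E; exists (scomp f (fst_cyl X)) => n x /=; rewrite E. Qed.

Lemma htpy_post (X Y Z : sset) (h : smap Y Z) (f g : smap X Y) :
  homotopic f g -> homotopic (scomp h f) (scomp h g).
Proof. by case=> H HP; exists (scomp h H) => n x /=; rewrite (HP n x).1 (HP n x).2. Qed.

Lemma htpy_pre (X Y Z : sset) (f g : smap Y Z) (h : smap X Y) :
  homotopic f g -> homotopic (scomp f h) (scomp g h).
Proof. by case=> H HP; exists (cyl_pre h H) => n x /=; rewrite (HP n (h n x)).1 (HP n (h n x)).2. Qed.

(** In a square whose bottom is constant at [f] and whose sides are the two homotopies, the top edge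
    joins [g] to [h]. Symmetry and transitivity both follow from this form. *)
Lemma htpy_eucl (X Y : sset) (f g h : smap X Y) : hep Y ->
  homotopic f g -> homotopic f h -> homotopic g h.
Proof.
move=> hY [H HP] [H' HP'].
have n01 p := @c0_neq_c1 p.
have [|||||Q QP] := @hepK Y hY (cyl X) (fun p k => k.2 = c0 p \/ k.2 = c1 p) ord0
  (fun p z y => [\/ z.2 = c0 p /\ y = f p z.1.1,
     z.1.2 = c0 p /\ y = H p (z.1.1, z.2) | z.1.2 = c1 p /\ y = H' p (z.1.1, z.2)]).
- split=> [p [[x s] t] y y' /=|p q a [[x s] t] y].
    have [HP0 HP0'] := (fun n x => (HP n x).1, fun n x => (HP' n x).1).
    by case=> [[E ->]|[E ->]|[E ->]] [[E' ->]|[E' ->]|[E' ->]] //;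
      rewrite ?E ?E' ?HP0 ?HP0' //; case: (n01 p); rewrite -E -E'.
  case=> [[/= -> ->]|[/= -> ->]|[/= -> ->]]; rewrite /= -sfunP.
  + by constructor 1; rewrite [LHS]cst_act.
  + by constructor 2; rewrite [LHS]cst_act.
  + by constructor 3; rewrite [LHS]cst_act.
- by move=> p q a [x s] /= [->|->]; [left|right]; apply: cst_act.
- by move=> p [x s] t y /= [[-> _]|[-> _]|[-> _]]; [left|right; left|right; right].
- by move=> p [x s]; exists (f p x); constructor 1.
- move=> p [x s] t /= [->|->].
    by exists (H p (x, t)); constructor 2.
  by exists (H' p (x, t)); constructor 3.
exists (cyl_end ord_max Q) => n x /=; split.
  by apply: QP; constructor 2; rewrite /= (HP n x).2.
by apply: QP; constructor 3; rewrite /= (HP' n x).2.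
Qed.

Lemma htpy_sym (X Y : sset) (f g : smap X Y) : hep Y -> homotopic f g -> homotopic g f.
Proof. by move=> hY fg; apply: htpy_eucl fg _ => //; apply: htpy_refl. Qed.

Lemma htpy_trans (X Y : sset) (f g h : smap X Y) : hep Y ->
  homotopic f g -> homotopic g h -> homotopic f h.
Proof. by move=> hY /(htpy_sym hY); apply: htpy_eucl. Qed.

Lemma sequiv_inv (X Y : sset) (f : smap X Y) (g : smap Y X) :
  homotopic (scomp g f) (sid X) -> homotopic (scomp f g) (sid Y) -> sequiv f.
Proof. by exists g. Qed.

Lemma sequiv_htpy (X Y : sset) (f f' : smap X Y) : hep X -> hep Y ->
  homotopic f f' -> sequiv f -> sequiv f'.
Proof.
move=> hX hY ff' [g [gf fg]]; exists g; split.
  by apply: htpy_eucl gf => //; apply: htpy_post.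
by apply: htpy_eucl fg => //; apply: htpy_pre.
Qed.

Lemma sequiv_ext (X Y : sset) (f f' : smap X Y) :
  (forall n x, f n x = f' n x) -> sequiv f -> sequiv f'.
Proof. by move=> /smap_ext ->. Qed.

Lemma sequiv_comp (X Y Z : sset) (f : smap X Y) (g : smap Y Z) : hep X -> hep Z ->
  sequiv f -> sequiv g -> sequiv (scomp g f).
Proof.
move=> hX hZ [f' [f'f ff']] [g' [g'g gg']]; exists (scomp f' g'); split.
  apply: htpy_trans f'f => //.
  exact: (htpy_ext _ _ (htpy_post f' (htpy_pre f g'g))).
apply: htpy_trans gg' => //.
exact: (htpy_ext _ _ (htpy_post g (htpy_pre g' ff'))).
Qed.

Lemma sequiv_cancel_post (X Y Z : sset) (f : smap X Y) (g : smap Y Z) : hep Y ->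
  sequiv g -> sequiv (scomp g f) -> sequiv f.
Proof.
move=> hY [g' [g'g gg']] [h [hgf gfh]]; exists (scomp h g); split.
  exact: htpy_ext hgf.
have e1 : homotopic (scomp (scomp g' g) (scomp f (scomp h g))) (scomp f (scomp h g)).
  exact: (htpy_ext _ _ (htpy_pre (scomp f (scomp h g)) g'g)).
apply: htpy_eucl e1 _ => //; apply: htpy_trans g'g => //.
exact: (htpy_ext _ _ (htpy_post g' (htpy_pre g gfh))).
Qed.

Lemma sequiv_cancel_pre (X Y Z : sset) (f : smap X Y) (g : smap Y Z) : hep Y ->
  sequiv f -> sequiv (scomp g f) -> sequiv g.
Proof.
move=> hY [f' [f'f ff']] [h [hgf gfh]]; exists (scomp f h); split; last first.
  exact: htpy_ext gfh.
have e1 : homotopic (scomp (scomp f (scomp h g)) (scomp f f')) (scomp f (scomp h g)).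
  exact: (htpy_ext _ _ (htpy_post (scomp f (scomp h g)) ff')).
apply: htpy_eucl e1 _ => //; apply: htpy_trans ff' => //.
exact: (htpy_ext _ _ (htpy_post f (htpy_pre f' hgf))).
Qed.

Lemma tfib_sequiv (X Y : sset) (f : smap X Y) : tfib f -> sequiv f.
Proof.
move=> tf.
have [||s [_ fs]] := lift_plain tf (K := Y) (R := fun _ _ _ => False) (psi := sid Y) => //.
have [||H [HP _]] := lift_plain tf (K := cyl X) (psi := scomp f (fst_cyl X))
  (R := fun p z x => (z.2 = c0 p /\ x = s p (f p z.1)) \/ (z.2 = c1 p /\ x = z.1)).
- split=> [p [x t] y y' /=|p q a [x t] y].
    by move=> [[E ->]|[E ->]] [[E' ->]|[E' ->]] //; case: (@c0_neq_c1 p); rewrite -E -E'.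
  move=> [[/= -> ->]|[/= -> ->]]; rewrite /= -?sfunP.
    by left; rewrite [LHS]cst_act.
  by right; rewrite [LHS]cst_act.
- by move=> p [x t] y [[/= _ ->]|[/= _ ->]] //; apply: fs.
apply: (@sequiv_inv _ _ _ s); last by apply: htpy_refl => n x; apply: fs.
by exists H => n x; split; apply: HP; [left|right].
Qed.
End Htpy.

(** * Mapping path spaces and equivalences as a lifting property *)

Section Psp.
Variables (X Y : sset) (f : smap X Y).

(** The condition cuts out the mapping path space $X\times_Y Y^{\Delta^1}$: the path starts at the
    image of the point. *)
Definition psp_ok n (z : X n * maps I1 Y n) : Prop :=
  forall p (x : splx n p), z.2 p (x, c0 p) = f p (act x z.1).

Lemma psp_act m n (a : @hom Delta m n) z : psp_ok z -> psp_ok (act a z.1, act a z.2).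
Proof. by move=> ok p x; rewrite /= ok -(@actM X). Qed.

Definition psp : sset.
refine (@SSet (fun n => {z : X n * maps I1 Y n | psp_ok z})
  (fun m n a z => exist _ (act a (sval z).1, act a (sval z).2) (psp_act a (svalP z))) _ _).
- move=> n [[x g] zP]; apply: eq_exist; congr (_, _); [exact: act1|exact: (@act1 (maps I1 Y))].
- move=> m n p b a [[x g] zP]; apply: eq_exist; congr (_, _); [exact: actM|exact: (@actM (maps I1 Y))].
Defined.

Definition ppt : smap psp X := @SMap psp X (fun n z => (sval z).1) (fun _ _ _ _ => erefl).

Definition ppath : smap psp (maps I1 Y) :=
  @SMap psp (maps I1 Y) (fun n z => (sval z).2) (fun _ _ _ _ => erefl).

Definition pend : smap psp Y := scomp (ev ord_max Y) ppath.

Lemma psp_ext n (z z' : psp n) : ppt n z = ppt n z' ->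
  (forall p x t, ppath n z p (x, t) = ppath n z' p (x, t)) -> z = z'.
Proof.
case: z z' => [[x g] zP] [[x' g'] zP'] /= Ex E.
apply: eq_exist; congr (_, _); rewrite ?Ex //; apply: smap_ext => p [y t]; exact: E.
Qed.

Section Mk.
Variables (K : sset) (u : smap K X) (H : smap (cyl K) Y).
Hypothesis H0 : forall p k, H p (k, c0 p) = f p (u p k).

Lemma mkpspP n (k : K n) : psp_ok (u n k, curry H n k).
Proof. by move=> p x; rewrite /= H0 sfunP. Qed.

Definition mkpsp : smap K psp.
refine (@SMap K psp (fun n k => exist _ (u n k, curry H n k) (mkpspP k)) _).
move=> m n a k; apply: psp_ext => [|p x t]; first exact: sfunP.
by rewrite /= -(@actM K).
Defined.

Lemma mkpsp_pt n k : ppt n (mkpsp n k) = u n k. Proof. by []. Qed.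
Lemma mkpsp_end n k : pend n (mkpsp n k) = H n (k, c1 n).
Proof. by rewrite /= act1. Qed.
End Mk.

Lemma psp_start n (z : psp n) : ppath n z n (idm _, c0 n) = f n (ppt n z).
Proof. by rewrite /= (svalP z) act1. Qed.

(* A lifting form of being an equivalence; it can be tested on homotopy fibres. *)
Definition weq : Prop := tfib pend.

Lemma tfib_ppt : hep Y -> tfib ppt.
Proof.
move=> hY n R x [Ru Ra] RS SR Rx.
have [|||H HP] := hY n ord0 (fun p z y => (z.2 = c0 p /\ y = f p (act z.1 x)) \/
    exists2 h, R p z.1 h & y = ppath p h p (idm _, z.2)).
- split=> [p z y y'|p q a z y].
    have mix h v v' : R p z.1 h -> v = ppath p h p (idm _, z.2) -> z.2 = c0 p ->
        v' = f p (act z.1 x) -> v = v'.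
      by move=> Rh -> -> ->; rewrite psp_start -(Rx _ _ _ Rh).
    move=> [[E1 E2]|[h Rh E]] [[E1' E2']|[h' Rh' E']].
    + by rewrite E2 E2'.
    + exact/esym/(mix _ _ _ Rh').
    + exact: (mix _ _ _ Rh).
    + by rewrite E E' (Ru _ _ _ _ Rh Rh').
  move=> [[E ->]|[h Rh ->]]; [left|right].
    by rewrite /= E -sfunP -actM; split=> //; apply: cst_act.
  exists (act a h); first exact: Ra.
  by rewrite -sfunP /=; congr (sfun (sval h).2 p (_, _)); apply: Dext.
- by move=> p z y [[]|[h /RS]]; [left|right].
- move=> p z [E|/SR[h Rh]]; first by exists (f p (act z.1 x)); left.
  by exists (ppath p h p (idm _, z.2)); right; exists h.
have H0 : psp_ok (x, H : maps I1 Y n).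
  by move=> p a /=; apply: HP; left.
exists (exist _ (x, H : maps I1 Y n) H0); split=> // p a h Rh.
apply: psp_ext => [|q b t]; first by rewrite [RHS](Rx _ _ _ Rh).
rewrite /=; apply: HP; right; exists (act b h); first exact: Ra.
by rewrite /=; congr (sfun (sval h).2 q (_, _)); apply: Dext.
Qed.

Lemma const_pathP m n (a : @hom Delta m n) (z : cyl X n) : f m (act a z).1 = act a (f n z.1).
Proof. by rewrite /= sfunP. Qed.

Definition pconst : smap X psp := @mkpsp X (sid X) (SMap const_pathP) (fun _ _ => erefl).

Lemma pconst_end n x : pend n (pconst n x) = f n x.
Proof. by rewrite /pconst mkpsp_end. Qed.

Lemma hep_tfib (E : sset) (p : smap E X) : tfib p -> hep X -> hep E.
Proof.
move=> tp hX n e R [Ru Ra] RA AR.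
have [|||H HP] := hX n e (fun q z x => exists2 y, R q z y & x = p q y).
- split=> [q z x x' [y Ry ->] [y' Ry' ->]|m q a z x [y Ry ->]].
    by rewrite (Ru _ _ _ _ Ry Ry').
  by exists (act a y); [exact: Ra | rewrite sfunP].
- by move=> q z x [y /RA].
- by move=> q z /AR[y Ry]; exists (p q y), y.
have [||H' [H'P _]] := @lift_plain _ _ _ tp _ R H => //.
  by move=> q z y Ry; apply/esym/HP; exists y.
by exists H'.
Qed.

(** [f] is [pend] after [pconst]; the former is a trivial fibration by assumption, the latter a
    section of the trivial fibration [ppt]. *)
Lemma weq_sequiv : hep X -> hep Y -> weq -> sequiv f.
Proof.
move=> hX hY Sf.
have tp := tfib_ppt hY.
have hP : hep psp := hep_tfib tp hX.
have sc : sequiv pconst.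
  apply: (sequiv_cancel_post hP (tfib_sequiv tp)).
  by apply: (@sequiv_inv _ _ _ (sid X)); apply: htpy_refl.
apply: sequiv_ext (sequiv_comp hX hY sc (tfib_sequiv Sf)) => n x.
exact: pconst_end.
Qed.
End Psp.

Section Bdry.
Variable n : nat.

Lemma nonsurj_act p q (a : @hom Delta p q) (k : splx n q) : ~ surj k -> ~ surj (act a k : splx n p).
Proof. by move=> nk /surj_compl. Qed.

Definition bdry : sset.
refine (@SSet (fun p => {a : splx n p | ~ surj a})
  (fun p q b a => exist _ (act b (sval a)) (@nonsurj_act p q b (sval a) (svalP a))) _ _).
- by move=> p [a aP]; apply: eq_exist; apply: (act1 (s := splx n)).
- by move=> m p q b c [a aP]; apply: eq_exist; apply: (actM (s := splx n)).
Defined.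

Lemma bdry_map (X : sset) (R : forall p, splx n p -> X p -> Prop) : pfun R ->
  (forall p (a : splx n p), ~ surj a -> exists x, R p a x) ->
  exists h : smap bdry X, forall p (k : bdry p), R p (sval k) (h p k).
Proof.
move=> [Ru Ra] tot.
pose h p (k : bdry p) := sval (cid (tot p (sval k) (svalP k))).
have hR p (k : bdry p) : R p (sval k) (h p k) := svalP (cid (tot p (sval k) (svalP k))).
have hP m p (a : @hom Delta m p) (k : bdry p) : h m (act a k) = act a (h p k).
  exact: (Ru _ _ _ _ (hR m (act a k)) (Ra _ _ a _ _ (hR p k))).
by exists (SMap hP).
Qed.

Lemma bdry_eq p (k k' : bdry p) : sval k = sval k' -> k = k'.
Proof. by case: k k' => [a aP] [b bP] /= E; apply: eq_exist. Qed.
End Bdry.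

Lemma path_at (X Y : sset) (f : smap X Y) n (z : psp f n) p (x : splx n p) t :
  ppath f n z p (x, t) = ppath f p (act x z) p (idm _, t).
Proof. by rewrite /=; congr (sfun (sval z).2 p (_, _)); apply: Dext. Qed.

(** The homotopy [H] converts boundary paths from $f(x)$ to [y] into paths from $x$ to [y]. These
    extend to the whole simplex, and the extension is converted back. *)
Lemma weq_htpy_id (X : sset) (f : smap X X) : hep X -> homotopic f (sid X) -> weq f.
Proof.
move=> hX [H HP] n R y [Ru Ra] RS SR Ry.
have [H0 H1] := (fun n x => (HP n x).1, fun n x => (HP n x).2).
have [zA zAR] := bdry_map (PFun Ru Ra) SR.
have zA1 p k : ppath f p (zA p k) p (idm _, c1 p) = act (sval k) y by apply: Ry (zAR p k).
have zAu p k z : R p (sval k) z -> z = zA p k by move=> h; apply: Ru h (zAR p k).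
(* [z.1.2] runs along the given paths and [z.2] along [H]: the bottom is the given path, the sides
   are [H] and the constant at [y]. The top is a path from $x$ to [y]. *)
have [|||||Q QP] := @hepK X hX (cyl (bdry n)) (fun p k => k.2 = c0 p \/ k.2 = c1 p) ord0
  (fun p z x => [\/ z.2 = c0 p /\ x = ppath f p (zA p z.1.1) p (idm _, z.1.2),
     z.1.2 = c0 p /\ x = H p (ppt f p (zA p z.1.1), z.2) |
     z.1.2 = c1 p /\ x = act (sval z.1.1) y]).
- split=> [p [[k t] s] x x' /=|p q a [[k t] s] x].
    by case=> [[E ->]|[E ->]|[E ->]] [[E' ->]|[E' ->]|[E' ->]] //;
      rewrite ?E ?E' ?H0 ?H1 -?psp_start ?zA1 //; case: (@c0_neq_c1 p); rewrite -E -E'.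
  case=> [[/= -> ->]|[/= -> ->]|[/= -> ->]].
  + constructor 1; split; first exact: cst_act.
    transitivity (ppath f p (act a (zA q k)) p (idm _, act a t)); last by rewrite -(sfunP zA).
    by rewrite -sfunP /=; congr (sfun (sval (zA q k)).2 p (_, _)); apply: Dext.
  + constructor 2; split; first exact: cst_act.
    by rewrite -sfunP /= -(sfunP (ppt f)) -(sfunP zA).
  + by constructor 3; split; [exact: cst_act | rewrite -actM].
- by move=> p q a [k s] /= [->|->]; [left|right]; apply: cst_act.
- by move=> p [k t] s x /= [[-> _]|[-> _]|[-> _]]; [left|right; left|right; right].
- by move=> p [k t]; exists (ppath f p (zA p k) p (idm _, t)); constructor 1.
- move=> p [k t] s /= [->|->].
    by exists (H p (ppt f p (zA p k), s)); constructor 2.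
  by exists (act (sval k) y); constructor 3.
have Q1 p k t : Q p ((k, t), c0 p) = ppath f p (zA p k) p (idm _, t).
  by apply: QP; constructor 1.
have Q2 p k s : Q p ((k, c0 p), s) = H p (ppt f p (zA p k), s).
  by apply: QP; constructor 2.
have Q3 p k s : Q p ((k, c1 p), s) = act (sval k) y.
  by apply: QP; constructor 3.
have bact p q (a : @hom Delta p q) (k : splx n q) (nk : ~ surj k) (nak : ~ surj (act a k : splx n p)) :
    exist _ (act a k) nak = act a (exist _ k nk : bdry n q) :> bdry n p.
  exact: bdry_eq.
have birr p (k k' : splx n p) (nk : ~ surj k) (nk' : ~ surj k') : k = k' ->
    exist _ k nk = exist _ k' nk' :> bdry n p.
  by move=> E; apply: bdry_eq.
(* Extending backwards from the end [y] produces the [n]-simplex of points, [D] at time [0]. *)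
have [|||||D DP] := @hepK X hX (splx n) (fun p k => ~ surj k) ord_max
  (fun p z x => (z.2 = c1 p /\ x = act z.1 y) \/
     exists nk : ~ surj z.1, x = Q p ((exist _ z.1 nk, z.2), c1 p)).
- split=> [p [k t] x x' /=|p q a [k t] x].
    by move=> [[E ->]|[nk ->]] [[E' ->]|[nk' ->]] //; rewrite ?E ?E' ?Q3 //; rewrite (birr _ k k nk nk').
  case=> [[/= -> ->]|[/= nk ->]].
    by left; split; [exact: cst_act | rewrite -actM].
  by right; exists (nonsurj_act (a := a) nk); rewrite -(cst_act a ord_max) -sfunP (bact _ _ a k nk).
- by move=> p q a k; apply: nonsurj_act.
- by move=> p k t x [[/= -> _]|[/= nk _]]; [left|right].
- by move=> p k; exists (act k y); left.
- by move=> p k t nk; exists (Q p ((exist _ k nk, t), c1 p)); right; exists nk.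
have D1 p k : D p (k, c1 p) = act k y by apply: DP; left.
have D2 p k nk t : D p (k, t) = Q p ((exist _ k nk, t), c1 p) by apply: DP; right; exists nk.
have D3 p k nk : D p (k, c0 p) = ppt f p (zA p (exist _ k nk)) by rewrite (D2 _ _ nk) Q2 H1.
(* The same square over the whole simplex, filled from its top [D] downwards; its bottom is the
   required path, which starts at the image under [f]. *)
have [|||||P PP] := @hepK X hX (cyl (splx n))
  (fun p k => [\/ k.2 = c0 p, k.2 = c1 p | ~ surj k.1]) ord_max
  (fun p z x => [\/ z.2 = c1 p /\ x = D p z.1, z.1.2 = c0 p /\ x = H p (D p (z.1.1, c0 p), z.2),
     z.1.2 = c1 p /\ x = act z.1.1 y |
     exists nk : ~ surj z.1.1, x = Q p ((exist _ z.1.1 nk, z.1.2), z.2)]).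
- split=> [p [[k t] s] x x' /=|p q a [[k t] s] x].
    case=> [[E ->]|[E ->]|[E ->]|[nk ->]] [[E' ->]|[E' ->]|[E' ->]|[nk' ->]] //;
      rewrite ?E ?E' ?H1 ?D1 -?D2 ?Q2 ?Q3 -?D3 //; try by case: (@c0_neq_c1 p); rewrite -E -E'.
    by rewrite (birr _ k k nk nk').
  case=> [[/= -> ->]|[/= -> ->]|[/= -> ->]|[/= nk ->]].
  + by constructor 1; split; [exact: cst_act | rewrite -sfunP].
  + constructor 2; split; first exact: cst_act.
    by rewrite -(cst_act a ord0) -sfunP /= -(sfunP D).
  + by constructor 3; split; [exact: cst_act | rewrite -actM].
  + by constructor 4; exists (nonsurj_act (a := a) nk); rewrite -sfunP (bact _ _ a k nk).
- move=> p q a [k s] /= [->|->|nk]; [constructor 1|constructor 2|constructor 3]; try exact: cst_act.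
  exact: nonsurj_act.
- by move=> p [k t] s x /= [[-> _]|[-> _]|[-> _]|[nk _]]; [left|right; constructor 1|right; constructor 2|right; constructor 3].
- by move=> p [k t]; exists (D p (k, t)); constructor 1.
- move=> p [k t] s /= [->|->|nk].
  + by exists (H p (D p (k, c0 p), s)); constructor 2.
  + by exists (act k y); constructor 3.
  + by exists (Q p ((exist _ k nk, t), s)); constructor 4; exists nk.
have H0' p k : cyl_end ord0 P p (k, c0 p) = f p (cyl_end ord0 D p k).
  by rewrite /= -H0; apply: PP; constructor 2.
exists (mkpsp H0' n (idm _)); split.
  by rewrite mkpsp_end /= (PP _ _ (act (idm _ : splx n n) y)) ?act1 //; constructor 3.
move=> p a z Rz; have na := RS _ _ _ Rz.
rewrite -sfunP; apply: psp_ext => [|q x t].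
  by rewrite mkpsp_pt (zAu _ (exist _ a na) _ Rz) -D3 /=; congr (D p (_, _)); apply: Dext.
have na' := @nonsurj_act n q p x a na.
have -> : ppath f p (mkpsp H0' p (act a (idm _ : splx n n))) q (x, t) = P q ((act x a, t), c0 q).
  by rewrite /=; congr (P q (_, _, _)); apply: Dext.
rewrite [RHS]path_at (PP _ _ (Q q ((exist _ (act x a) na', t), c0 q))).
  by rewrite Q1; congr (sfun (sval _).2 q _); apply/esym/zAu/Ra.
by constructor 4; exists na'.
Qed.

Section TwoOfSix.
Variables (X Y Z : sset) (f : smap X Y) (g : smap Y Z).

Lemma psp_postP n (z : psp f n) : @psp_ok X Z (scomp g f) n ((sval z).1, scomp g (sval z).2 : maps I1 Z n).
Proof. by move=> p x; rewrite /= (svalP z). Qed.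

Definition psp_post : smap (psp f) (psp (scomp g f)).
refine (@SMap (psp f) (psp (scomp g f)) (fun n z => exist _ _ (psp_postP z)) _).
by move=> m n a z; apply: psp_ext.
Defined.
End TwoOfSix.

(** The composite [g] after [f] supplies the point [u] and a path in [X] from $gfu$ to $gy$. The
    composite [f] after [g] then supplies the path in [Y] from $fu$ to $y$. *)
Lemma weq_2of6 (X Y : sset) (f : smap X Y) (g : smap Y X) :
  weq (scomp g f) -> weq (scomp f g) -> weq f.
Proof.
move=> Sgf Sfg n R y [Ru Ra] RS SR Ry.
have [|||| z1 [z1e z1R]] := Sgf n (fun p a z1 => exists2 z, R p a z & z1 = psp_post f g p z) (g n y).
- split=> [p k z z' [w Rw ->] [w' Rw' ->]|p q a k z [w Rw ->]]; first by rewrite (Ru _ _ _ _ Rw Rw').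
  by exists (act a w); [exact: Ra | rewrite sfunP].
- by move=> p a z [w /RS].
- by move=> p a /SR[z Rz]; exists (psp_post f g p z), z.
- by move=> p a z [w /Ry E ->]; rewrite -sfunP -E.
pose u := ppt _ n z1.
have dlt p (a : splx n p) z t : R p a z ->
    ppath _ n z1 p (a, t) = g p (ppath f p z p (idm _, t)).
  by move=> Rz; rewrite path_at (z1R _ _ (psp_post f g p z)) //; exists z.
have ptu p (a : splx n p) z : R p a z -> ppt f p z = act a u.
  by move=> Rz; rewrite /u -sfunP (z1R _ _ (psp_post f g p z)) //; exists z.
(* The part of the path in [Y] that is prescribed: both ends, and the given paths over the
   boundary. *)
pose beta p (k : cyl (splx n) p) w := [\/ k.2 = c0 p /\ w = f p (act k.1 u),
  k.2 = c1 p /\ w = act k.1 y | exists2 z, R p k.1 z & w = ppath f p z p (idm _, k.2)].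
have bu p k w w' : beta p k w -> beta p k w' -> w = w'.
  have mix0 z : k.2 = c0 p -> R p k.1 z -> f p (act k.1 u) = ppath f p z p (idm _, k.2).
    by move=> -> Rz; rewrite psp_start (ptu _ _ _ Rz).
  have mix1 z : k.2 = c1 p -> R p k.1 z -> act k.1 y = ppath f p z p (idm _, k.2).
    by move=> -> /Ry <-.
  have n01 : k.2 = c0 p -> k.2 = c1 p -> False by move=> -> /c0_neq_c1.
  case=> [[E ->]|[E ->]|[z Rz ->]] [[E' ->]|[E' ->]|[z' Rz' ->]] //; try by case: n01.
  - exact: mix0.
  - exact: mix1.
  - exact/esym/mix0.
  - exact/esym/mix1.
  - by rewrite (Ru _ _ _ _ Rz Rz').
have ba p q (a : @hom Delta p q) k w : beta q k w -> beta p (act a k) (act a w).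
  case=> [[E ->]|[E ->]|[z Rz ->]].
  - by constructor 1; rewrite /= E -sfunP -actM; split=> //; apply: cst_act.
  - by constructor 2; rewrite /= E -actM; split=> //; apply: cst_act.
  - constructor 3; exists (act a z); first exact: Ra.
    by rewrite -sfunP /=; congr (sfun (sval z).2 p (_, _)); apply: Dext.
(* The path in [X] is mapped by [f] into [Y] and lifted there. Over the prescribed part $f g$
   already gives this image on the nose, so constant paths serve as the partial lift. *)
have [||chi [chiR _]] := lift_plain Sfg
  (R := fun p k z => exists2 w, beta p k w & z = pconst (scomp f g) p w)
  (psi := scomp f (ppath _ n z1 : smap (cyl (splx n)) X)).
- split=> [p k z z' [w bw ->] [w' bw' ->]|p q a k z [w bw ->]]; first by rewrite (bu _ _ _ _ bw bw').
  by exists (act a w); [exact: ba | rewrite sfunP].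
- move=> p [k t] z [w bw ->]; rewrite pconst_end /=; congr (f p _).
  case: bw => [[/= -> ->]|[/= -> ->]|[w' Rw' ->]] /=.
  + by rewrite -/(ppath _ n z1) (svalP z1).
  + apply/esym; rewrite -[LHS]/(ppath _ n z1 p (k, c1 p)) path_at -[LHS]/(pend _ p (act k z1)).
    by rewrite (sfunP (pend _)) z1e sfunP.
  + by rewrite [RHS](dlt _ _ _ t Rw').
pose ga : smap (cyl (splx n)) Y := scomp (ppt _) chi.
have gaP p k w : beta p k w -> ga p k = w.
  by move=> bw; rewrite /ga /= (chiR _ _ (pconst (scomp f g) p w)) //; exists w.
have ok : @psp_ok X Y f n (u, ga : maps I1 Y n).
  by move=> p a; apply: gaP; constructor 1.
exists (exist _ (u, ga : maps I1 Y n) ok); split.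
  by rewrite -[RHS](@act1 Y); apply: gaP; constructor 2.
move=> p a z Rz; apply: psp_ext => [|q x t]; first by rewrite (ptu _ _ _ Rz).
rewrite [RHS]path_at; apply: gaP; constructor 3; exists (act x z) => //; exact: Ra.
Qed.

Lemma sequiv_weq (X Y : sset) (f : smap X Y) : hep X -> hep Y -> sequiv f -> weq f.
Proof.
by move=> hX hY [g [gf fg]]; apply: weq_2of6; apply: weq_htpy_id; [|exact: gf| |exact: fg].
Qed.

(** * Homotopy fibres *)

(* The homotopy lifting property for simplices, relative to their boundary. *)
Definition fib0 (E Y : sset) (p : smap E Y) : Prop :=
  forall n (R : forall q, cyl (splx n) q -> E q -> Prop) (psi : smap (cyl (splx n)) Y), pfun R ->
    (forall q z x, R q z x -> z.2 = c0 q \/ ~ surj z.1) ->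
    (forall q z, (z.2 = c0 q \/ ~ surj z.1) -> exists x, R q z x) ->
    (forall q z x, R q z x -> p q x = psi q z) ->
  exists H : smap (cyl (splx n)) E, (forall q z x, R q z x -> H q z = x) /\
    forall q z, p q (H q z) = psi q z.

Lemma cyl_idE n q (a : splx n q) (e : 'I_2) :
  act a ((idm _, cst n e) : cyl (splx n) n) = (a, cst q e).
Proof. by congr (_, _); apply: Dext. Qed.

(** [weq] gives a point whose image is joined to [y] by a path that is constant on the boundary;
    lifting this path from the point, relative to the boundary, ends strictly over [y]. *)
Lemma fib0_tfib (E Y : sset) (p : smap E Y) : fib0 p -> weq p -> tfib p.
Proof.
move=> fp Sp n R y [Ru Ra] RS SR Ry.
have [||||z [ze zR]] := Sp n (fun q a z => exists2 x, R q a x & z = pconst p q x) y.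
- split=> [q k z z' [w Rw ->] [w' Rw' ->]|m q a k z [w Rw ->]]; first by rewrite (Ru _ _ _ _ Rw Rw').
  by exists (act a w); [exact: Ra | rewrite sfunP].
- by move=> q a z [w /RS].
- by move=> q a /SR[x Rx]; exists (pconst p q x), x.
- by move=> q a z [x /Ry <- ->]; rewrite pconst_end.
have zR' q a x : R q a x -> act a z = pconst p q x by move=> Rx; apply: zR; exists x.
have [||||H [HP HO]] := fp n (fun q k x => (k.2 = c0 q /\ x = act k.1 (ppt p n z)) \/ R q k.1 x)
   (ppath p n z : smap (cyl (splx n)) Y).
- have mix q k x x' : x = act k (ppt p n z) -> R q k x' -> x = x'.
    by move=> -> /zR' E'; rewrite -sfunP E'.
  split=> [q k x x'|m q a k x].
    move=> [[E1 E2]|Rx] [[E1' E2']|Rx'].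
    + by rewrite E2 E2'.
    + exact: mix E2 Rx'.
    + exact/esym/(mix _ _ _ _ E2' Rx).
    + exact: Ru Rx Rx'.
  move=> [[k0 ->]|Rx]; [left|right; exact: Ra].
  by rewrite /= k0 -actM; split=> //; apply: cst_act.
- by move=> q k x [[->]|/RS]; [left|right].
- by move=> q k [k0|/SR[x Rx]]; [exists (act k.1 (ppt p n z)); left | exists x; right].
- move=> q [a t] x [[/= -> ->]|/= Rx].
    by rewrite (svalP z) .
  by rewrite path_at (zR' _ _ _ Rx) /= act1.
exists (H n (idm _, c1 n)); split; first by rewrite HO -ze.
by move=> q a x Rx; rewrite -sfunP cyl_idE; apply: HP; right.
Qed.

Section PspFib.
Variables (X Y : sset) (f : smap X Y) (hX : hep X) (hY : hep Y).

Lemma swapP (K Z : sset) (H : smap (cyl (cyl K)) Z) m n (a : @hom Delta m n) (z : cyl (cyl K) n) :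
  H m (((act a z).1.1, (act a z).2), (act a z).1.2) = act a (H n ((z.1.1, z.2), z.1.2)).
Proof. by rewrite -sfunP. Qed.
Definition swap (K Z : sset) (H : smap (cyl (cyl K)) Z) : smap (cyl (cyl K)) Z := SMap (swapP H).

(** The endpoint map is a fibration for arbitrary [f]: first the point in [X] is extended freely,
    then the path in [Y], with both of its ends prescribed. *)
Lemma psp_fib (K : sset) (A : forall p, K p -> Prop) (e : 'I_2)
    (R : forall p, cyl K p -> psp f p -> Prop) (psi : smap (cyl K) Y) : pfun R ->
  (forall p q (a : @hom Delta p q) k, A q k -> A p (act a k)) ->
  (forall p k t x, R p (k, t) x -> t = cst p e \/ A p k) ->
  (forall p k, exists x, R p (k, cst p e) x) ->
  (forall p k t, A p k -> exists x, R p (k, t) x) ->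
  (forall p k z, R p k z -> pend f p z = psi p k) ->
  exists H : smap (cyl K) (psp f), (forall p z x, R p z x -> H p z = x) /\
    forall p k, pend f p (H p k) = psi p k.
Proof.
move=> [Ru Ra] Aact RA Re AR Rpsi.
have [|||||G GP] := @hepK X hX K A e (fun p k x => exists2 z, R p k z & x = ppt f p z) => //.
- split=> [q k z z' [w Rw ->] [w' Rw' ->]|m q a k z [w Rw ->]]; first by rewrite (Ru _ _ _ _ Rw Rw').
  by exists (act a w); [exact: Ra | rewrite sfunP].
- by move=> p k t x [z /RA].
- by move=> p k; have [z Rz] := Re p k; exists (ppt f p z), z.
- by move=> p k t /(AR _ _ t)[z Rz]; exists (ppt f p z), z.
have GR p k z : R p k z -> ppt f p z = G p k by move=> Rz; apply/esym/GP; exists z.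
have [|||||Q QP] := @hepK Y hY (cyl K) (fun p k => [\/ k.2 = c0 p, k.2 = c1 p | A p k.1]) e
  (fun p k v => [\/ k.1.2 = c0 p /\ v = f p (G p (k.1.1, k.2)),
     k.1.2 = c1 p /\ v = psi p (k.1.1, k.2) |
     exists2 z, R p (k.1.1, k.2) z & v = ppath f p z p (idm _, k.1.2)]).
- split=> [p [[k s] t] v v' /=|p q a [[k s] t] v].
    have n01 : s = c0 p -> s = c1 p -> False by move=> -> /c0_neq_c1.
    have mix0 z : s = c0 p -> R p (k, t) z -> f p (G p (k, t)) = ppath f p z p (idm _, s).
      by move=> -> Rz; rewrite psp_start (GR _ _ _ Rz).
    have mix1 z : s = c1 p -> R p (k, t) z -> psi p (k, t) = ppath f p z p (idm _, s).
      by move=> -> /Rpsi <-.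
    case=> [[E ->]|[E ->]|[z Rz ->]] [[E' ->]|[E' ->]|[z' Rz' ->]] //; try by case: n01.
    + exact: mix0.
    + exact: mix1.
    + exact/esym/mix0.
    + exact/esym/mix1.
    + by rewrite (Ru _ _ _ _ Rz Rz').
  case=> [[/= -> ->]|[/= -> ->]|[z /= Rz ->]].
  + by constructor 1; split; [exact: cst_act | rewrite -sfunP -(sfunP G)].
  + by constructor 2; split; [exact: cst_act | rewrite -sfunP].
  + constructor 3; exists (act a z); first exact: (Ra _ _ a _ _ Rz).
    by rewrite -sfunP /=; congr (sfun (sval z).2 p (_, _)); apply: Dext.
- move=> p q a [k s] /= [->|->|Ak]; [constructor 1|constructor 2|constructor 3]; try exact: cst_act.
  exact: Aact.
- move=> p [k s] t v /= [[-> _]|[-> _]|[z /RA[->|Ak] _]]; [right|right|left|right] => //.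
  + by constructor 1.
  + by constructor 2.
  + by constructor 3.
- by move=> p [k s]; have [z Rz] := Re p k; exists (ppath f p z p (idm _, s)); constructor 3; exists z.
- move=> p [k s] t /= [->|->|/(AR _ _ t)[z Rz]].
  + by exists (f p (G p (k, t))); constructor 1.
  + by exists (psi p (k, t)); constructor 2.
  + by exists (ppath f p z p (idm _, s)); constructor 3; exists z.
have H0 p k : swap Q p (k, c0 p) = f p (G p k).
  by case: k => k t; apply: QP; constructor 1.
exists (mkpsp H0); split=> [p k z Rz|p [k t]].
  apply: psp_ext => [|q x t]; first by rewrite mkpsp_pt (GR _ _ _ Rz).
  rewrite [RHS]path_at /=; apply: QP; constructor 3.
  exists (act x z) => //; rewrite (_ : (_, _) = act x k) //; exact: Ra.
by rewrite mkpsp_end; apply: QP; constructor 2.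
Qed.
End PspFib.

(** Contractibility as a filling property; for [n] equal to [0] the boundary is empty, so that a
    point is provided. *)
Definition contr (X : sset) : Prop :=
  forall n (R : forall p, splx n p -> X p -> Prop), pfun R ->
    (forall p a x, R p a x -> ~ surj a) ->
    (forall p (a : splx n p), ~ surj a -> exists x, R p a x) ->
  exists x : X n, forall p a t, R p a t -> act a x = t.

Section Hofib.
Variables (X Y : sset) (f : smap X Y).

Definition atp (y : Y 0) n : Y n := act (cst n (ord0 : 'I_1)) y.

Lemma atp_act (y : Y 0) m n (a : @hom Delta m n) : act a (atp y n) = atp y m.
Proof. by rewrite /atp -actM; congr (act _ y); apply: Dext. Qed.

Lemma hofib_okP (y : Y 0) n (h : hofib f y n) : @psp_ok X Y f n (hf_pt h, hf_path h).
Proof. by move=> p x; rewrite /= hf_src. Qed.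

Definition hofib_psp (y : Y 0) : smap (hofib f y) (psp f).
refine (@SMap (hofib f y) (psp f) (fun n h => exist _ _ (hofib_okP h)) _).
by move=> m n a h; apply: psp_ext.
Defined.

Lemma hofib_psp_end y n (h : hofib f y n) : pend f n (hofib_psp y n h) = atp y n.
Proof. exact: hf_tgt. Qed.

Lemma hofib_psp_inj y n (h h' : hofib f y n) : hofib_psp y n h = hofib_psp y n h' -> h = h'.
Proof.
move=> E; apply: hofib_ext => [|p z]; first exact: (congr1 (ppt f n) E).
exact: (congr1 (fun w => ppath f n w p z) E).
Qed.

Lemma psp_hofib y n (z : psp f n) : pend f n z = atp y n ->
  exists h : hofib f y n, hofib_psp y n h = z.
Proof.
move=> ze.
have src p (t : splx n p) : ppath f n z p (t, c0 p) = f p (act t (ppt f n z)) := svalP z p t.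
have tgt p (t : splx n p) : ppath f n z p (t, c1 p) = act (cst p (ord0 : 'I_1)) y.
  rewrite path_at -[LHS]/(pend f p (act t z)) (sfunP (pend f)) ze; exact: atp_act.
by exists (HofibSimp src tgt); apply: psp_ext.
Qed.

Lemma weq_contr : weq f -> forall y : Y 0, contr (hofib f y).
Proof.
move=> Sf y n R [Ru Ra] RS SR.
have [||||z [ze zR]] := Sf n (fun p a z => exists2 h, R p a h & z = hofib_psp y p h) (atp y n).
- split=> [q k z z' [w Rw ->] [w' Rw' ->]|m q a k z [w Rw ->]]; first by rewrite (Ru _ _ _ _ Rw Rw').
  by exists (act a w); [exact: Ra | rewrite sfunP].
- by move=> q a z [w /RS].
- by move=> q a /SR[x Rx]; exists (hofib_psp y q x), x.
- by move=> p a z [h _ ->]; rewrite hofib_psp_end atp_act.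
have [h hz] := psp_hofib ze; exists h => p a t Rt; apply: hofib_psp_inj.
by rewrite sfunP hz; apply: zR; exists t.
Qed.

Lemma contract_homo n p (k : cyl (splx n) p) :
  {homo (fun i => if (k.2 i : 'I_2) == ord0 then ord0 else (k.1 i : 'I_n.+1)) : i j / (i <= j)%O}.
Proof.
case: k => [a t] i j /= ij; rewrite !leEord; case: eqP => //= ti; case: eqP => //= tj.
  case: ti; apply: val_inj; apply/eqP; rewrite /= -leqn0.
  by apply: leq_trans (Dmono t ij) _; rewrite tj.
exact: (Dmono a ij).
Qed.

Definition contract n : smap (cyl (splx n)) (splx n).
refine (@SMap (cyl (splx n)) (splx n) (fun p k => mono (@contract_homo n p k)) _).
by move=> m p a k; apply: Dext.
Defined.

Lemma sact_P n (y : Y n) p q (a : @hom Delta p q) (b : splx n q) : act (act a b) y = act a (act b y).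
Proof. by rewrite /= actM. Qed.
Definition yon n (y : Y n) : smap (splx n) Y := SMap (@sact_P n y).

(** Contracting the simplex [y] to its first vertex transports the boundary data into one homotopy
    fibre, where they can be filled. *)
Lemma contr_weq : hep X -> hep Y -> (forall y : Y 0, contr (hofib f y)) -> weq f.
Proof.
move=> hX hY cf n R y [Ru Ra] RS SR Ry.
have [zA zAR] := bdry_map (PFun Ru Ra) SR.
pose y0 : Y 0 := act (cst 0 (ord0 : 'I_n.+1)) y.
pose psi : smap (cyl (splx n)) Y := scomp (yon y) (contract n).
have psi1 p (k : splx n p) : psi p (k, c1 p) = act k y.
  by rewrite /psi /=; congr (act _ y); apply: Dext.
have psi0 p (k : splx n p) : psi p (k, c0 p) = atp y0 p.
  by rewrite /psi /= /atp /y0 -actM; congr (act _ y); apply: Dext.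
pose inc : smap (bdry n) (splx n) := @SMap (bdry n) (splx n) (fun p k => sval k) (fun _ _ _ _ => erefl).
(* Transport of the boundary from [y] at time [1] to the vertex [y0] at time [0]. *)
have [||||||H1 [H1P H1O]] := @psp_fib _ _ f hX hY (bdry n) (fun _ _ => False) ord_max
   (fun p k z => k.2 = c1 p /\ z = zA p k.1) (cyl_pre inc psi) => //.
- split=> [p k z z' [_ ->] [_ ->]//|p q a k z [E ->]].
  by rewrite /= E (sfunP zA); split=> //; apply: cst_act.
- by move=> p k t x [/= -> _]; left.
- by move=> p k; exists (zA p k).
- by move=> p [k t] z [/= -> ->]; rewrite [LHS](Ry _ _ _ (zAR p k)) -psi1.
have [|||h0 h0P] := cf y0 n (fun p a h => exists na : ~ surj a, hofib_psp y0 p h = H1 p (exist _ a na, c0 p)).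
- split=> [p a h h' [na E] [na' E']|p q a k h [nk E]].
    by apply: hofib_psp_inj; rewrite E E' (Prop_irrelevance na na').
  exists (nonsurj_act (a := a) nk); rewrite sfunP E -sfunP; congr (H1 p _).
  by congr (_, _); [apply: bdry_eq | exact: cst_act].
- by move=> p a x [].
- move=> p a na; have [|h hE] := @psp_hofib y0 p (H1 p (exist _ a na, c0 p)).
    by rewrite H1O /= -[LHS]/(psi p (a, c0 p)) psi0.
  by exists h, na.
(* Transport of the filled simplex back to [y], relative to the transport of its boundary. *)
have [||||||H3 [H3P H3O]] := @psp_fib _ _ f hX hY (splx n) (fun p k => ~ surj k) ord0
   (fun p k z => (k.2 = c0 p /\ z = act k.1 (hofib_psp y0 n h0)) \/
      exists nk : ~ surj k.1, z = H1 p (exist _ k.1 nk, k.2)) psi.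
- have mix p (k : cyl (splx n) p) (nk : ~ surj k.1) : k.2 = c0 p ->
      act k.1 (hofib_psp y0 n h0) = H1 p (exist _ k.1 nk, k.2).
    move=> E; have [|h hE] := @psp_hofib y0 p (H1 p (exist _ k.1 nk, k.2)).
      by rewrite H1O /= -[LHS]/(psi p (k.1, k.2)) E psi0.
    by rewrite -hE -sfunP; congr (hofib_psp y0 p _); apply: h0P; exists nk; rewrite hE E.
  split=> [p k z z'|p q a k z].
    move=> [[E ->]|[nk ->]] [[E' ->]|[nk' ->]] //.
    + exact: mix.
    + exact/esym/mix.
    + by rewrite (Prop_irrelevance nk nk').
  case: k => k t [[k0 ->]|[nk ->]]; [left|right].
    by split; [rewrite (k0 : t = _); exact: cst_act | exact: (esym (@actM (psp f) _ _ _ k a _))].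
  exists (nonsurj_act (a := a) nk); rewrite -sfunP; congr (H1 p _).
  by congr (_, _); apply: bdry_eq.
- by move=> p q a k; apply: nonsurj_act.
- by move=> p k t x [[/= -> _]|[/= nk _]]; [left|right].
- by move=> p k; exists (act k (hofib_psp y0 n h0)); left.
- by move=> p k t nk; exists (H1 p (exist _ k nk, t)); right; exists nk.
- move=> p [k t] z [[k0 ->]|[nk ->]].
    by rewrite (sfunP (pend f)) hofib_psp_end (k0 : t = _) psi0 atp_act.
  by rewrite H1O.
exists (H3 n (idm _, c1 n)); split; first by rewrite H3O psi1 act1.
move=> p a z Rz; have na := RS _ _ _ Rz.
rewrite -sfunP cyl_idE.
rewrite (H3P _ _ z) //; right; exists na => /=.
rewrite (H1P _ _ (zA p (exist _ a na))) //; exact: (Ru _ _ _ _ Rz (zAR p (exist _ a na))).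
Qed.
End Hofib.

(** * Homotopy limits *)

Section Hval.
Variables (J : category) (F : diagram J).

(* The value of a section of the homotopy limit at a simplex of [N(J/j)]. *)
Definition hval p (s : holim F p) (c : functor (lin p) J) j (u : hom (c ord_max) j) : F j p :=
  dmap F u p (hsim s c p (idm _, idm _)).

Lemma hval_push p (s : holim F p) (c : functor (lin p) J) j j' (u : hom (c ord_max) j) (v : hom j j') :
  dmap F v p (hval s u) = hval s (v \c u).
Proof. by rewrite /hval dmapM. Qed.

(** Compatibility with [y] reduces every component to a diagonal one, so sections are determined by
    [hval]. *)
Lemma hsim_hval m (s : holim F m) n (c : functor (lin n) J) q (x : @hom Delta q m) (y : @hom Delta q n) :
  hsim s c q (x, y) = hval (p := q) (act x s) (c := compf c y) (fmap c (le_max (y ord_max))).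
Proof.
rewrite /hval /=; have := hsimP s (n' := q) (n := n) y c (x \c idm _) (idm q).
by move=> ->; congr (hsim s c q (_, _)); apply: Dext.
Qed.

Lemma hval_act p q (a : @hom Delta q p) (s : holim F p) (c : functor (lin p) J) j (u : hom (c ord_max) j) :
  act a (hval s u) = hval (p := q) (act a s) (c := compf c a) (u \c fmap c (le_max (a ord_max))).
Proof.
rewrite /hval dmapM -sfunP -sfunP; congr (dmap F u q _).
have -> : act a ((idm _, idm _) : sprod (splx p) (splx p) p) = (a, a).
  by congr (_, _); apply: Dext.
rewrite [LHS]hsim_hval /hval; congr (dmap F _ q _).
Qed.

Lemma hval_eq p (s : holim F p) (fo : lin p -> J) (fm fm' : forall x y, hom x y -> hom (fo x) (fo y))
  f1 fM f1' fM' j (u u' : hom (fo ord_max) j) :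
  (forall x y h, fm x y h = fm' x y h) -> u = u' ->
  hval s (c := @Functor _ _ fo fm f1 fM) u = hval s (c := @Functor _ _ fo fm' f1' fM') u'.
Proof.
move=> E ->; have {}E : fm = fm' by do 3 apply: functional_extensionality_dep => ?.
case: _ / E f1' fM' => f1' fM'.
by rewrite (Prop_irrelevance f1 f1') (Prop_irrelevance fM fM').
Qed.

Lemma holim_ext m (s t : holim F m) :
  (forall q (x : splx m q) (c : functor (lin q) J),
     hval (p := q) (act x s) (idm (c ord_max)) = hval (p := q) (act x t) (idm (c ord_max))) -> s = t.
Proof.
move=> E; apply: holimSimp_ext => n c q x y; rewrite !hsim_hval.
rewrite -[fmap c _](@compm1 J).
by rewrite -(hval_push (p := q) (act x s) (c := compf c y)) -(hval_push (p := q) (act x t) (c := compf c y)) E.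
Qed.

Section Of.
Variables (B : sset) (phi : dmor (W J B) F).

Lemma holim_of_simpP m (b : B m) n (c : functor (lin n) J) p q (a : @hom Delta p q)
    (z : sprod (splx m) (splx n) q) :
  phi (c ord_max) p (@WS J B _ p (act (act a z.1) b) (compf c (act a z.2)) (fmap c (le_max (z.2 (a ord_max)))))
  = act a (phi (c ord_max) q (@WS J B _ q (act z.1 b) (compf c z.2) (fmap c (le_max (z.2 ord_max))))).
Proof.
rewrite -sfunP; congr (phi _ p _); apply: ws_eq => //=; first exact: actM.
by rewrite -fmapM; congr (fmap c _); apply: bool_irrelevance.
Qed.

Definition holim_of_simp m (b : B m) n (c : functor (lin n) J) : maps (splx n) (F (c ord_max)) m :=
  @SMap (sprod (splx m) (splx n)) (F (c ord_max))
   (fun q z => phi (c ord_max) q (@WS J B _ q (act z.1 b) (compf c z.2) (fmap c (le_max (z.2 ord_max)))))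
   (@holim_of_simpP m b n c).

Lemma holim_of_compat m (b : B m) : holim_compat (holim_of_simp b).
Proof.
move=> n' n al c q x y /=; rewrite -(dfunP phi); congr (phi _ q _).
apply: ws_eq => //=; rewrite -fmapM; congr (fmap c _); exact: bool_irrelevance.
Qed.

(** [holim_of] and [to_sec] are the two directions of the correspondence between natural maps out of
    [W J B] and maps from [B] to the homotopy limit. *)
Definition holim_of : smap B (holim F).
refine (@SMap B (holim F) (fun m b => HolimSimp (@holim_of_compat m b)) _).
move=> m n a b; apply: holimSimp_ext => p c q x y /=; congr (phi _ q _).
by apply: ws_eq => //=; rewrite -actM.
Defined.

Lemma hval_of p (b : B p) (c : functor (lin p) J) j (u : hom (c ord_max) j) :
  hval (holim_of p b) u = phi j p (@WS J B j p b c u).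
Proof.
rewrite /hval /= -(dfunP phi) /=; congr (phi _ p _); case: c u => fo fm f1 fM u.
apply: ws_eq => //=; first by rewrite act1.
by rewrite -[RHS]compm1; congr (u \c _); apply: (fmap_id (Functor f1 fM)).
Qed.
End Of.

Section To.
Variables (B : sset) (s : smap B (holim F)).

Lemma to_secP j m n (a : @hom Delta m n) (w : W J B j n) :
  hval (s m (wb (wact a w))) (wu (wact a w)) = act a (hval (s n (wb w)) (wu w)).
Proof. by rewrite hval_act /= sfunP. Qed.

Definition to_sec : dmor (W J B) F.
refine (@DMor J (W J B) F (fun j => @SMap (W J B j) (F j) (fun p w => hval (s p (wb w)) (wu w)) (@to_secP j)) _).
by move=> a b u n x /=; rewrite hval_push.
Defined.
End To.
End Hval.

Section HvalRel.
Variables (J : category) (F : diagram J) (B : sset) (R : forall p, B p -> holim F p -> Prop).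

Definition hrel j p (w : wsimp B j p) (x : F j p) : Prop :=
  exists2 s, R (wb w) s & x = hval s (wu w).

Hypothesis pR : pfun R.

Lemma hrel_uniq j p (w : wsimp B j p) x x' : hrel w x -> hrel w x' -> x = x'.
Proof. by move=> [s Rs ->] [s' Rs' ->]; rewrite (pfun_uniq pR Rs Rs'). Qed.

Lemma hrel_act j p q (a : @hom Delta p q) (w : wsimp B j q) x :
  hrel w x -> hrel (wact a w) (act a x).
Proof.
move=> [s Rs ->]; exists (act a s); first exact: (pfun_act pR).
by rewrite hval_act.
Qed.

Lemma hrel_push j j' (v : hom j j') p (w : wsimp B j p) x :
  hrel w x -> hrel (wpush v w) (dmap F v p x).
Proof. by move=> [s Rs ->]; exists s => //; rewrite hval_push. Qed.

Lemma hrel_ext (chi : dmor (W J B) F) :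
  (forall j p (w : wsimp B j p) x, hrel w x -> chi j p w = x) ->
  forall p b s, R b s -> holim_of chi p b = s.
Proof.
move=> chiR p b s Rs; apply: holim_ext => q x c.
rewrite -(sfunP (holim_of chi)) hval_of; apply: chiR.
by exists (act x s) => //; apply: (pfun_act pR).
Qed.
End HvalRel.

Section Hmap.
Variables (J : category) (F G : diagram J) (f : dmor F G).

Lemma hmap_compat m (s : holimSimp F m) : holim_compat (fun n c => scomp (f (c ord_max)) (hsim s c) : maps (splx n) (G (c ord_max)) m).
Proof. by move=> n' n al c q x y /=; rewrite -dfunP -hsimP. Qed.

Definition hmap : smap (holim F) (holim G).
refine (@SMap (holim F) (holim G) (fun m s => HolimSimp (hmap_compat s)) _).
by move=> *; apply: holimSimp_ext.
Defined.

Lemma hval_hmap p (s : holim F p) (c : functor (lin p) J) j (u : hom (c ord_max) j) :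
  hval (hmap p s) u = f j p (hval s u).
Proof. by rewrite /hval /= -dfunP. Qed.

Lemma tfib_hmap : (forall j, tfib (f j)) -> tfib hmap.
Proof.
move=> tf n R y pR RS SR Ry.
have [|chi [chiR chiO]] := dmor_lift tf (B := splx n) (psi := to_sec (yon y)) (Q := fun p k => ~ surj k.1)
  (R := fun j p w x => hrel R w x).
  split.
  - by move=> p q a k; apply: nonsurj_act.
  - by move=> j p w x [s /RS].
  - by move=> j p w /SR[s Rs]; exists (hval s (wu w)), s.
  - by move=> j p w x x'; apply: hrel_uniq.
  - by move=> j p q a w x; apply: hrel_act.
  - by move=> j j' v p w x; apply: hrel_push.
  - by move=> j p w x [s Rs ->]; rewrite -hval_hmap (Ry _ _ _ Rs).
exists (holim_of chi n (idm _)); split.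
  apply: holim_ext => q x c; rewrite -!sfunP hval_hmap.
  have -> : act x (idm _ : splx n n) = x by apply: Dext.
  by rewrite hval_of chiO.
move=> p a t Rt; rewrite -(sfunP (holim_of chi)) (_ : act a (idm _ : splx n n) = a); last exact: Dext.
exact: (hrel_ext pR).
Qed.
End Hmap.

Section Mapsd.
Variables (J : category) (F : diagram J).

Lemma mpostP (X Y : sset) (f : smap X Y) m n (a : @hom Delta m n) (h : maps I1 X n) :
  scomp f (act a h) = act a (scomp f h : maps I1 Y n) :> maps I1 Y m.
Proof. exact: smap_ext. Qed.
Definition mpost (X Y : sset) (f : smap X Y) : smap (maps I1 X) (maps I1 Y) :=
  @SMap (maps I1 X) (maps I1 Y) (fun n h => scomp f h) (@mpostP X Y f).

Definition mapsd : diagram J.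
refine (@Diagram J (fun j => maps I1 (F j)) (fun a b u => mpost (dmap F u)) _ _).
- by move=> a n x; apply: smap_ext => p z /=; rewrite dmap1.
- by move=> a b c g f n x; apply: smap_ext => p z /=; rewrite dmapM.
Defined.

Definition evd (e : 'I_2) : dmor mapsd F :=
  @DMor J mapsd F (fun j => ev e (F j)) (fun _ _ _ _ _ => erefl).

Definition wcyl (B : sset) j p (w : wsimp B j p) (t : I1 p) : wsimp (cyl B) j p :=
  @WS J (cyl B) j p (wb w, t) (wc w) (wu w).

(** The natural form of [hepK]: a lift through the levelwise trivial fibrations [evd e], built on
    the cells of [W J B], so that the extended homotopy is natural in [J]. *)
Lemma lift_hep (hF : forall j, hep (F j)) (B : sset) (e : 'I_2)
    (Q : forall p, sprod B (nerve J) p -> Prop)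
    (R : forall j p, wsimp (cyl B) j p -> F j p -> Prop) :
  (forall p q (a : @hom Delta p q) k, Q q k -> Q p (act a k)) ->
  (forall j p (w : wsimp B j p) t x, R j p (wcyl w t) x -> t = cst p e \/ Q p (wk w)) ->
  (forall j p (w : wsimp B j p), exists x, R j p (wcyl w (cst p e)) x) ->
  (forall j p (w : wsimp B j p) t, Q p (wk w) -> exists x, R j p (wcyl w t) x) ->
  (forall j p (w : wsimp (cyl B) j p) x x', R j p w x -> R j p w x' -> x = x') ->
  (forall j p q (a : @hom Delta p q) (w : wsimp (cyl B) j q) x,
    R j q w x -> R j p (wact a w) (act a x)) ->
  (forall j j' (v : hom j j') p (w : wsimp (cyl B) j p) x,
    R j p w x -> R j' p (wpush v w) (dmap F v p x)) ->
  exists chi : dmor (W J (cyl B)) F, forall j p w x, R j p w x -> chi j p w = x.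
Proof.
move=> Qact RQ Re QR Ru Ra Rp.
have wcylA j p q (a : @hom Delta p q) (w : wsimp B j q) t :
    wact a (wcyl w t) = wcyl (wact a w) (act a t) by [].
pose y j p (w : wsimp B j p) := sval (cid (Re j p w)).
have yR j p (w : wsimp B j p) : R j p (wcyl w (cst p e)) (y j p w) := svalP (cid (Re j p w)).
have yP j m n (a : @hom Delta m n) (w : W J B j n) : y j m (wact a w) = act a (y j n w).
  apply: Ru (yR _ _ _) _; have := Ra _ _ _ a _ _ (yR _ _ w).
  by rewrite wcylA cst_act.
have yp j j' (v : hom j j') n (w : W J B j n) : y j' n (wpush v w) = dmap F v n (y j n w).
  exact: (Ru _ _ _ _ _ (yR j' n (wpush v w)) (Rp _ _ v _ _ _ (yR j n w))).
pose psi : dmor (W J B) F := @DMor J (W J B) F (fun j => @SMap (W J B j) (F j) (y j) (@yP j)) yp.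
pose R' j p (w : wsimp B j p) (h : mapsd j p) := Q p (wk w) /\
  forall q (a : splx p q) t, R j q (wcyl (wact a w) t) (h q (a, t)).
have [|chi [chiR chiO]] := dmor_lift (fun j => tfib_ev (e := e) (hF j)) (f := evd e) (psi := psi)
    (Q := Q) (R := R').
  split=> //.
  - by move=> j p w h [].
  - move=> j p w Qw.
    have tot q z : exists x, R j q (wcyl (wact z.1 w) z.2) x.
      by apply: QR; rewrite wk_act; apply: Qact.
    pose h q (z : sprod (splx p) I1 q) := sval (cid (tot q z)).
    have hR q z : R j q (wcyl (wact z.1 w) z.2) (h q z) := svalP (cid (tot q z)).
    have hP m n (a : @hom Delta m n) z : h m (act a z) = act a (h n z).
      apply: Ru (hR m _) _; have := Ra _ _ _ a _ _ (hR n z).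
      by rewrite wcylA /= -[wact a _](@actM (Wsset B j) _ _ _ z.1 a w).
    by exists (SMap hP); split=> // q a t; apply: (hR q (a, t)).
  - move=> j p w h h' [_ Rh] [_ Rh']; apply: smap_ext => q [a t].
    exact: Ru (Rh _ _ _) (Rh' _ _ _).
  - move=> j p q a w h [Qw Rh]; split=> [|r b t]; first exact: (Qact _ _ a _ Qw).
    by rewrite -[wact b _](@actM (Wsset B j) _ _ _ a b w); apply: Rh.
  - move=> j j' v p w h [Qw Rh]; split=> // q a t.
    by rewrite -wpushP; apply: Rp (Rh q a t).
  - move=> j p w h [_ Rh] /=; apply: Ru (yR _ _ _); have := Rh p (idm _) (cst p e).
    by rewrite [wact _ _](@act1 (Wsset B j)).
(* Uncurrying: a map from [W J B] to path spaces becomes a map out of [W J (cyl B)]. *)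
pose ch j p (w : wsimp (cyl B) j p) : F j p :=
  chi j p (@WS J B j p (wb w).1 (wc w) (wu w)) p (idm _, (wb w).2).
have chP j m n (a : @hom Delta m n) (w : W J (cyl B) j n) : ch j m (act a w) = act a (ch j n w).
  rewrite -sfunP; pose w' : W J B j n := @WS J B j n (wb w).1 (wc w) (wu w).
  have E : chi j m (act a w') = act a (chi j n w') := sfunP (chi j) a w'.
  transitivity (sfun (chi j m (act a w')) m (idm _, act a (wb w).2)) => //.
  by rewrite E /=; congr (sfun (chi j n _) m (_, _)); apply: Dext.
have chp j j' (v : hom j j') n (w : W J (cyl B) j n) :
    ch j' n (dmap (W J (cyl B)) v n w) = dmap F v n (ch j n w).
  pose w' : W J B j n := @WS J B j n (wb w).1 (wc w) (wu w).
  have E : chi j' n (dmap (W J B) v n w') = dmap (mapsd) v n (chi j n w') := dfunP chi v w'.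
  transitivity (sfun (chi j' n (dmap (W J B) v n w')) n (idm _, (wb w).2)) => //.
  by rewrite E.
exists (@DMor J (W J (cyl B)) F (fun j => @SMap (W J (cyl B) j) (F j) (ch j) (@chP j)) chp).
move=> j p [[b t] c u] x Rx; rewrite /= /ch /=.
pose w := @WS J B j p b c u; change (R j p (wcyl w t) x) in Rx.
have [E|Qw] := RQ _ _ _ _ _ Rx.
  have := chiO j p w; rewrite /= -E => ->; apply: Ru (yR _ _ _) _; by rewrite -E.
have [h R'h] : exists h, R' j p w h.
  have tot q z : exists x, R j q (wcyl (wact z.1 w) z.2) x.
    by apply: QR; rewrite wk_act; apply: Qact.
  pose h q (z : sprod (splx p) I1 q) := sval (cid (tot q z)).
  have hR q z : R j q (wcyl (wact z.1 w) z.2) (h q z) := svalP (cid (tot q z)).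
  have hP m n (a : @hom Delta m n) z : h m (act a z) = act a (h n z).
    apply: Ru (hR m _) _; have := Ra _ _ _ a _ _ (hR n z).
    by rewrite wcylA /= -[wact a _](@actM (Wsset B j) _ _ _ z.1 a w).
  by exists (SMap hP); split=> // q a v; apply: (hR q (a, v)).
rewrite -/w (chiR _ _ _ _ R'h); have := R'h.2 p (idm _) t.
by rewrite [wact _ _](@act1 (Wsset B j)) => h'; apply: Ru h' Rx.
Qed.

Lemma hep_holim : (forall j, hep (F j)) -> hep (holim F).
Proof.
move=> hF n e R pR RS SR.
have [|||||||chi chiR] := lift_hep hF (B := splx n) (e := e) (Q := fun p k => ~ surj k.1)
  (R := fun j p w x => hrel R w x).
- by move=> p q a k; apply: nonsurj_act.
- by move=> j p w t x [s /RS].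
- by move=> j p w; have [|s Rs] := SR p (wb w, cst p e); [left | exists (hval s (wu w)), s].
- by move=> j p w t nw; have [|s Rs] := SR p (wb w, t); [right | exists (hval s (wu w)), s].
- by move=> j p w x x'; apply: hrel_uniq.
- by move=> j p q a w x; apply: hrel_act.
- by move=> j j' v p w x; apply: hrel_push.
by exists (holim_of chi) => p z x; apply: (hrel_ext pR).
Qed.
End Mapsd.

Section Pspd.
Variables (J : category) (F G : diagram J) (f : dmor F G).

Lemma psp_mapP a b (u : hom a b) n (z : psp (f a) n) :
  @psp_ok _ _ (f b) n (dmap F u n (sval z).1, scomp (dmap G u) (sval z).2 : maps I1 (G b) n).
Proof. by move=> p x; rewrite /= (svalP z) -sfunP dfunP. Qed.

Definition psp_map a b (u : hom a b) : smap (psp (f a)) (psp (f b)).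
refine (@SMap (psp (f a)) (psp (f b)) (fun n z => exist _ _ (psp_mapP u z)) _).
by move=> m n c z; apply: psp_ext => //=; rewrite sfunP.
Defined.

Definition pspd : diagram J.
refine (@Diagram J (fun j => psp (f j)) psp_map _ _).
- by move=> a n z; apply: psp_ext => /= *; rewrite dmap1.
- by move=> a b c v u n z; apply: psp_ext => /= *; rewrite dmapM.
Defined.

Definition pptd : dmor pspd F := @DMor J pspd F (fun j => ppt (f j)) (fun _ _ _ _ _ => erefl).
Definition pendd : dmor pspd G := @DMor J pspd G (fun j => pend (f j)) (fun _ _ _ _ _ => erefl).
Definition pconstd : dmor F pspd.
refine (@DMor J F pspd (fun j => pconst (f j)) _).
by move=> a b u n x; apply: psp_ext => //= *; rewrite -sfunP dfunP.
Defined.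

(** Objectwise inverses need not assemble to a map of diagrams. The mapping path spaces do form a
    diagram, and its endpoint maps are levelwise trivial fibrations, a property that survives
    [holim]. *)
Lemma hmap_sequiv : (forall j, hep (F j)) -> (forall j, hep (G j)) ->
  (forall j, sequiv (f j)) -> sequiv (hmap f).
Proof.
move=> hF hG ef.
have tp : tfib (hmap pptd) by apply: tfib_hmap => j; apply: tfib_ppt.
have te : tfib (hmap pendd) by apply: tfib_hmap => j; apply: sequiv_weq.
have hHF := hep_holim hF; have hHG := hep_holim hG.
have hP : hep (holim pspd) := hep_tfib tp hHF.
have sc : sequiv (hmap pconstd).
  apply: (sequiv_cancel_post hP (tfib_sequiv tp)).
  by apply: (@sequiv_inv _ _ _ (sid _)); apply: htpy_refl => n s; apply: holimSimp_ext.
apply: sequiv_ext (sequiv_comp hHF hHG sc (tfib_sequiv te)) => n s.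
by apply: holimSimp_ext => m c q x y /=; rewrite act1.
Qed.
End Pspd.

(* For a natural map [d1 => d2] of chains and [t : [q] -> [1]], [glue] is the chain
   equal to [d1] where [t = 0] and to [d2] where [t = 1].  It turns natural
   transformations into homotopies. *)
Section Glue.
Variables (J : category) (q : nat) (d1 d2 : functor (lin q) J).
Variable tau : forall i : lin q, hom (d1 i) (d2 i).
Hypothesis tauN : forall (i i' : lin q) (h : hom i i'), fmap d2 h \c tau i = tau i' \c fmap d1 h.

Definition gob (i : lin q) (a : nat) : J := match a with 0 => d1 i | S _ => d2 i end.

Definition gm (i i' : lin q) (h : hom i i') (a b : nat) : (a <= b)%N -> hom (gob i a) (gob i' b) :=
  match a, b return (a <= b)%N -> hom (gob i a) (gob i' b) with
  | 0, 0 => fun _ => fmap d1 h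
  | 0, S _ => fun _ => fmap d2 h \c tau i
  | S _, S _ => fun _ => fmap d2 h
  | S _, 0 => fun E => False_rect _ (Bool.diff_false_true E)
  end.

Lemma gm1 (i : lin q) a (E : (a <= a)%N) : gm (idm i) E = idm (gob i a).
Proof. by case: a E => [|a] E /=; rewrite fmap1. Qed.

Lemma gmM (i i' i'' : lin q) (h' : hom i' i'') (h : hom i i') a b c
  (ab : (a <= b)%N) (bc : (b <= c)%N) (ac : (a <= c)%N) :
  gm (h' \c h) ac = gm h' bc \c gm h ab.
Proof.
case: a b c ab bc ac => [|a] [|b] [|c] //= _ _ _; rewrite ?fmapM //.
- by rewrite -!compA tauN.
- by rewrite -compA.
Qed.

Definition gto j (i : lin q) (a : nat) (v : hom (d2 i) j) : hom (gob i a) j :=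
  match a return hom (gob i a) j with 0 => v \c tau i | S _ => v end.

Lemma gto_gm j (i i' : lin q) (h : hom i i') a b (ab : (a <= b)%N) (v : hom (d2 i') j) :
  gto b v \c gm h ab = gto a (v \c fmap d2 h).
Proof.
case: a b ab => [|a] [|b] //= _; first by rewrite -!compA tauN.
by rewrite -compA.
Qed.

Lemma gto_push j j' (w : hom j j') (i : lin q) a (v : hom (d2 i) j) :
  w \c gto a v = gto a (w \c v).
Proof. by case: a => //=; rewrite compA. Qed.

Variable t : functor (lin q) (lin 1).

Lemma glue1 (i : lin q) : gm (idm i) (fmap t (idm i)) = idm (gob i (t i : 'I_2)).
Proof. exact: gm1. Qed.

Lemma glueM (i i' i'' : lin q) (h' : hom i' i'') (h : hom i i') :
  gm (h' \c h) (fmap t (h' \c h)) = gm h' (fmap t h') \c gm h (fmap t h).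
Proof. exact: gmM. Qed.

Definition glue : functor (lin q) J :=
  @Functor (lin q) J (fun i => gob i (t i : 'I_2)) (fun i i' h => gm h (fmap t h)) glue1 glueM.

Definition gval (F : diagram J) (s : holim F q) j (v : hom (d2 ord_max) j) : F j q :=
  hval s (c := glue) (gto (t ord_max : 'I_2) v).

Lemma gval_push (F : diagram J) (s : holim F q) j j' (w : hom j j') (v : hom (d2 ord_max) j) :
  dmap F w q (gval s v) = gval s (w \c v).
Proof. by rewrite /gval hval_push; congr (hval s _); apply: gto_push. Qed.
End Glue.

Section GlueAct.
Variables (J : category) (F : diagram J) (q : nat) (d1 d2 : functor (lin q) J).
Variable tau : forall i : lin q, hom (d1 i) (d2 i).
Hypothesis tauN : forall (i i' : lin q) (h : hom i i'), fmap d2 h \c tau i = tau i' \c fmap d1 h.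

Lemma gm_act r (a : @hom Delta r q) (x y : lin r) (h : hom x y) A B (E E' : (A <= B)%N) :
  gm tau (fmap a h) E =
  @gm J r (compf d1 a) (compf d2 a) (fun i => tau (a i)) x y h A B E'.
Proof. by case: A B E E' => [|A] [|B]. Qed.

Lemma gval_act r (a : @hom Delta r q) (t : functor (lin q) (lin 1)) (s : holim F q) j (v : hom (d2 ord_max) j)
    (tauN' : forall (i i' : lin r) (h : hom i i'),
       fmap (compf d2 a) h \c tau (a i) = tau (a i') \c fmap (compf d1 a) h) :
  act a (gval tauN t s v) =
  @gval J r (compf d1 a) (compf d2 a) (fun i => tau (a i)) tauN' (compf t a) F (act a s) j
    (v \c fmap d2 (le_max (a ord_max))).
Proof.
rewrite /gval hval_act; apply: hval_eq => /=.
  by move=> x y h; apply: gm_act.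
exact: gto_gm.
Qed.

Lemma gval0 (s : holim F q) j (v : hom (d2 ord_max) j) :
  gval tauN (c0 q) s v = hval s (c := d1) (v \c tau ord_max).
Proof. by rewrite /gval; case: (d1) tau tauN => *; apply: hval_eq. Qed.

Lemma gval1 (s : holim F q) j (v : hom (d2 ord_max) j) :
  gval tauN (c1 q) s v = hval s (c := d2) v.
Proof. by rewrite /gval; case: (d2) tau tauN v => *; apply: hval_eq. Qed.
End GlueAct.

Lemma hval_hpull (I J : category) (p : functor I J) (F : diagram J) (G : diagram I)
  (f : forall i, smap (F (p i)) (G i))
  (fP : forall i i' (u : hom i i') n (x : F (p i) n), f i' n (dmap F (fmap p u) n x) = dmap G u n (f i n x))
  m (s : holim F m) (c : functor (lin m) I) j (u : hom (c ord_max) j) :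
  hval (hpull fP m s) u = f j m (hval s (c := compf p c) (fmap p u)).
Proof. by rewrite /hval /= fP. Qed.

Lemma hval_canon (J : category) (X : sset) (F : diagram J) (l : cone X F) m (x : X m)
  (c : functor (lin m) J) j (u : hom (c ord_max) j) :
  hval (canon l m x) u = leg l j m x.
Proof. by rewrite /hval /= act1 legP. Qed.

Section NatHtpy.
Variables (I J : category) (p q : functor I J) (F : diagram J) (G : diagram I).
Variable tau : forall i, hom (p i) (q i).
Hypothesis tauN : forall i i' (u : hom i i'), fmap q u \c tau i = tau i' \c fmap p u.
Variable f : forall i, smap (F (q i)) (G i).
Hypothesis fP : forall i i' (u : hom i i') n (x : F (q i) n),
  f i' n (dmap F (fmap q u) n x) = dmap G u n (f i n x).
Variable g : forall i, smap (F (p i)) (G i).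
Hypothesis gP : forall i i' (u : hom i i') n (x : F (p i) n),
  g i' n (dmap F (fmap p u) n x) = dmap G u n (g i n x).
Hypothesis gE : forall i n (x : F (p i) n), g i n x = f i n (dmap F (tau i) n x).

Lemma nat_chain n (c : functor (lin n) I) (i i' : lin n) (h : hom i i') :
  fmap (compf q c) h \c tau (c i) = tau (c i') \c fmap (compf p c) h.
Proof. exact: tauN. Qed.

Definition nval n (c : functor (lin n) I) (t : functor (lin n) (lin 1)) (s : holim F n) j
    (v : hom (q (c ord_max)) j) : F j n :=
  @gval J n (compf p c) (compf q c) (fun i => tau (c i)) (@nat_chain n c) t F s j v.

Arguments nval {n} c t s {j} v.

Lemma nat_htpyP j m n (a : @hom Delta m n) (w : W I (cyl (holim F)) j n) :
  f j m (nval (wc (wact a w)) (wb (wact a w)).2 (wb (wact a w)).1 (fmap q (wu (wact a w))))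
  = act a (f j n (nval (wc w) (wb w).2 (wb w).1 (fmap q (wu w)))).
Proof.
case: w => [[s t] c u] /=; rewrite -sfunP; congr (f j m _).
rewrite /nval (@gval_act J F n (compf p c) (compf q c) _ _ m a t s _ (fmap q u) (nat_chain (compf c a))).
rewrite /gval /=; apply: hval_eq => //=.
by rewrite fmapM.
Qed.

Lemma hpull_htpy : homotopic (hpull gP) (hpull fP).
Proof.
pose ph j n (w : W I (cyl (holim F)) j n) : G j n :=
  f j n (nval (wc w) (wb w).2 (wb w).1 (fmap q (wu w))).
have phQ j j' (v : hom j j') n (w : W I (cyl (holim F)) j n) :
    ph j' n (dmap (W I (cyl (holim F))) v n w) = dmap G v n (ph j n w).
  by rewrite /ph -fP /nval gval_push /= fmapM.
pose phi : dmor (W I (cyl (holim F))) G :=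
  @DMor I (W I (cyl (holim F))) G (fun j => @SMap (W I (cyl (holim F)) j) (G j) (ph j) (@nat_htpyP j)) phQ.
exists (holim_of phi) => n s; split; apply: holim_ext => m x c.
  rewrite -!sfunP hval_of hval_hpull /= gE /ph /= /nval (_ : compf _ x = c0 m); last exact: cst_act.
  by rewrite gval0 !fmap1 comp1m hval_push compm1.
rewrite -!sfunP hval_of hval_hpull /= /ph /= /nval (_ : compf _ x = c1 m); last exact: cst_act.
by rewrite gval1.
Qed.
End NatHtpy.

Section Adj.
Variables (I J : category) (R : functor I J) (L : functor J I) (D : diagram J) (E : diagram I).
Variable f : forall i, smap (D (R i)) (E i).
Hypothesis fP : forall i i' (u : hom i i') n (x : D (R i) n),
  f i' n (dmap D (fmap R u) n x) = dmap E u n (f i n x).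
Variable g : forall j, smap (E (L j)) (D j).
Hypothesis gP : forall j j' (u : hom j j') n (x : E (L j) n),
  g j' n (dmap E (fmap L u) n x) = dmap D u n (g j n x).
Variable tau : forall j, hom (R (L j)) j.
Hypothesis tauN : forall j j' (u : hom j j'), u \c tau j = tau j' \c fmap R (fmap L u).
Hypothesis gfE : forall j n (x : D (R (L j)) n), g j n (f (L j) n x) = dmap D (tau j) n x.

Lemma hpull_idf (K : category) (H : diagram K)
  (h : forall i : K, smap (H (idf K i)) (H i))
  (hP : forall i i' (u : hom i i') n (x : H i n), h i' n (dmap H u n x) = dmap H u n (h i n x)) :
  (forall i n x, h i n x = x) ->
  forall n s, @hpull K K (idf K) H H h hP n s = s.
Proof.
move=> hE n s; apply: holim_ext => m x c; rewrite -!sfunP hval_hpull hE.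
by case: c => *; apply: hval_eq.
Qed.

Lemma gfP j j' (u : hom j j') n (x : D (compf R L j) n) :
  scomp (g j') (f (L j')) n (dmap D (fmap (compf R L) u) n x) = dmap D u n (scomp (g j) (f (L j)) n x).
Proof. by rewrite /= fP gP. Qed.

Lemma fgP i i' (u : hom i i') n (x : E (compf L R i) n) :
  scomp (f i') (g (R i')) n (dmap E (fmap (compf L R) u) n x) = dmap E u n (scomp (f i) (g (R i)) n x).
Proof. by rewrite /= gP fP. Qed.

Lemma hpull_gf : homotopic (scomp (hpull gP) (hpull fP)) (sid (holim D)).
Proof.
have := @hpull_htpy J J (compf R L) (idf J) D D tau tauN (fun j => sid (D j))
   (fun _ _ _ _ _ => erefl) (fun j => scomp (g j) (f (L j))) gfP gfE.
apply: htpy_ext => n s; last exact: hpull_idf.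
apply: holim_ext => m x c; rewrite -!sfunP /= !hval_hpull /=; congr (g _ m (f _ m _)).
exact: hval_eq.
Qed.

(** Restriction along [R] is inverted by restriction along [L]; [tau] and [ep] turn into the two
    homotopies by [hpull_htpy]. *)
Lemma holim_adj (ep : forall i, hom (L (R i)) i) :
  (forall i i' (u : hom i i'), u \c ep i = ep i' \c fmap L (fmap R u)) ->
  (forall i n (x : E (L (R i)) n), f i n (g (R i) n x) = dmap E (ep i) n x) ->
  sequiv (hpull fP).
Proof.
move=> epN fgE; apply: (@sequiv_inv _ _ _ (hpull gP)); first exact: hpull_gf.
have := @hpull_htpy I I (compf L R) (idf I) E E ep epN (fun j => sid (E j))
   (fun _ _ _ _ _ => erefl) (fun i => scomp (f i) (g (R i))) fgP fgE.
apply: htpy_ext => n s; last exact: hpull_idf.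
apply: holim_ext => m x c; rewrite -!sfunP /= !hval_hpull /=; congr (f _ m (g _ m _)).
exact: hval_eq.
Qed.

(** Here [ep] points the other way, so its homotopy leaves the identity and has to be reversed; [hE]
    allows this. *)
Lemma holim_adj_op (hE : forall i, hep (E i)) (ep : forall i, hom i (L (R i))) :
  (forall i i' (u : hom i i'), fmap L (fmap R u) \c ep i = ep i' \c u) ->
  (forall i n (x : E i n), f i n (g (R i) n (dmap E (ep i) n x)) = x) ->
  sequiv (hpull fP).
Proof.
move=> epN fgE; apply: (@sequiv_inv _ _ _ (hpull gP)); first exact: hpull_gf.
apply: htpy_sym; first exact: hep_holim.
have := @hpull_htpy I I (idf I) (compf L R) E E ep epN (fun i => scomp (f i) (g (R i))) fgP
  (fun j => sid (E j)) (fun _ _ _ _ _ => erefl) (fun i n x => esym (fgE i n x)).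
apply: htpy_ext => n s; first exact: hpull_idf.
apply: holim_ext => m x c; rewrite -!sfunP /= !hval_hpull /=; congr (f _ m (g _ m _)).
exact: hval_eq.
Qed.
End Adj.

Section Initial.
Variables (J : category) (D : diagram J) (a : J) (ini : forall j, hom a j).
Hypothesis iniP : forall j (u : hom a j), u = ini j.

Definition constf (K : category) : functor K J :=
  @Functor K J (fun _ => a) (fun _ _ _ => idm a) (fun _ => erefl) (fun _ _ _ _ _ => esym (comp1m (idm a))).

Lemma ini_chain n (c : functor (lin n) J) (i i' : lin n) (h : hom i i') :
  fmap c h \c ini (c i) = ini (c i') \c fmap (constf (lin n)) h.
Proof. by rewrite (iniP (_ \c ini _)) compm1. Qed.

Definition ival n (c : functor (lin n) J) (t : functor (lin n) (lin 1)) (s : holim D n) j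
    (v : hom (c ord_max) j) : D j n :=
  @gval J n (constf (lin n)) c (fun i => ini (c i)) (@ini_chain n c) t D s j v.

Arguments ival {n} c t s {j} v.

(** The inverse evaluates at the constant chain at [a]; the homotopy puts [a] in front of each chain
    by gluing. *)
Lemma canon_init (l : cone (D a) D) :
  (forall j n x, leg l j n x = dmap D (ini j) n x) -> sequiv (canon l).
Proof.
move=> lE.
have eP m n (b : @hom Delta m n) (s : holim D n) :
    hval (p := m) (act b s) (c := constf (lin m)) (idm a) = act b (hval s (c := constf (lin n)) (idm a)).
  by rewrite hval_act; apply: hval_eq => //=; rewrite comp1m.
pose e : smap (holim D) (D a) :=
  @SMap (holim D) (D a) (fun n s => hval s (c := constf (lin n)) (idm a)) eP.
apply: (@sequiv_inv _ _ _ e).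
  apply: htpy_refl => n x /=; rewrite hval_canon lE -(iniP (idm a)); exact: dmap1.
pose ph j n (w : W J (cyl (holim D)) j n) : D j n :=
  ival (wc w) (wb w).2 (wb w).1 (wu w).
have phP j m n (b : @hom Delta m n) (w : W J (cyl (holim D)) j n) : ph j m (act b w) = act b (ph j n w).
  case: w => [[s t] c u]; rewrite /ph /= /ival.
  rewrite (@gval_act J D n (constf (lin n)) c _ _ m b t s _ u (ini_chain (compf c b))).
  by rewrite /gval; apply: hval_eq => //=.
have phQ j j' (v : hom j j') n (w : W J (cyl (holim D)) j n) :
    ph j' n (dmap (W J (cyl (holim D))) v n w) = dmap D v n (ph j n w).
  by rewrite /ph /ival gval_push.
pose phi : dmor (W J (cyl (holim D))) D :=
  @DMor J (W J (cyl (holim D))) D (fun j => @SMap (W J (cyl (holim D)) j) (D j) (ph j) (@phP j)) phQ.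
exists (holim_of phi) => n s; split; apply: holim_ext => m x c.
  rewrite -!sfunP hval_of hval_canon lE /= /ph /= /ival (_ : compf _ x = c0 m); last exact: cst_act.
  by rewrite gval0 comp1m hval_push compm1.
rewrite -!sfunP hval_of /= /ph /= /ival (_ : compf _ x = c1 m); last exact: cst_act.
by rewrite gval1.
Qed.
End Initial.

(** * Homotopy limits over posets *)

Section Subc.
Variables (J : category) (D : diagram J).

Definition subc (U : J -> Prop) : category := full (C := J) (fun x : {x : J | U x} => sval x).
Definition sinc (U : J -> Prop) : functor (subc U) J := fullf (C := J) (fun x : {x : J | U x} => sval x).
Definition hU (U : J -> Prop) : sset := holim (dcomp D (sinc U)).

Section OneU.
Variable U : J -> Prop.

Definition clift p (c : functor (lin p) J) (Uc : forall i, U (c i)) : functor (lin p) (subc U) :=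
  @Functor (lin p) (subc U) (fun i => exist _ (c i) (Uc i)) (fun _ _ h => fmap c h)
    (fmap1 c) (fun _ _ _ g f => fmapM c g f).

(** Sections over subcategories are evaluated on chains of [J] together with a proof that they stay
    in [U], so that sections over different [U] live on the same chains. *)
Definition uval p (s : hU U p) (c : functor (lin p) J) (Uc : forall i, U (c i)) j (u : hom (c ord_max) j) : D j p :=
  dmap D u p (hval s (c := clift Uc) (idm (clift Uc ord_max))).

Lemma uval_irr p (s : hU U p) (c : functor (lin p) J) (Uc Uc' : forall i, U (c i)) j (u : hom (c ord_max) j) :
  uval s Uc u = uval s Uc' u.
Proof. by rewrite (Prop_irrelevance Uc Uc'). Qed.

Lemma uval_eq p (s : hU U p) (fo : lin p -> J) (fm fm' : forall x y, hom x y -> hom (fo x) (fo y))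
    f1 fM f1' fM' (Uc Uc' : forall i, U (fo i)) j (u u' : hom (fo ord_max) j) :
  (forall x y h, fm x y h = fm' x y h) -> u = u' ->
  uval s (c := @Functor _ _ fo fm f1 fM) Uc u = uval s (c := @Functor _ _ fo fm' f1' fM') Uc' u'.
Proof.
move=> E ->; have {}E : fm = fm' by do 3 apply: functional_extensionality_dep => ?.
case: _ / E f1' fM' => f1' fM'.
by rewrite (Prop_irrelevance f1 f1') (Prop_irrelevance fM fM') (Prop_irrelevance Uc Uc').
Qed.

Lemma uval_push p (s : hU U p) (c : functor (lin p) J) (Uc : forall i, U (c i)) j j'
  (u : hom (c ord_max) j) (v : hom j j') : dmap D v p (uval s Uc u) = uval s Uc (v \c u).
Proof. by rewrite /uval dmapM. Qed.

Lemma uval_act p q (a : @hom Delta q p) (s : hU U p) (c : functor (lin p) J) (Uc : forall i, U (c i))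
    (Uc' : forall i, U (compf c a i)) j (u : hom (c ord_max) j) :
  act a (uval s Uc u) = uval (p := q) (act a s) Uc' (u \c fmap c (le_max (a ord_max))).
Proof.
rewrite /uval -sfunP dmapM; congr (dmap D u q _).
rewrite [LHS](@hval_act (subc U) (dcomp D (sinc U)) p q a s (clift Uc)).
rewrite [RHS](@hval_push (subc U) (dcomp D (sinc U)) q (act a s) (clift Uc')
   (clift Uc' ord_max) (clift Uc ord_max) (idm _) (fmap c (le_max (a ord_max)))).
rewrite (Prop_irrelevance Uc' (fun i => Uc (a i))).
refine (@hval_eq (subc U) (dcomp D (sinc U)) q (act a s)
  (fun i => exist _ (c (a i)) (Uc (a i))) (fun x y h => fmap c (fmap a h))
  (fun x y h => fmap c (fmap a h)) _ _ _ _ (clift Uc ord_max) _ _ _ _) => //.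
by rewrite [LHS](@comp1m J) [RHS](@compm1 J).
Qed.

(** Puts a chain in the form for which [clift] of its underlying chain gives it back by
    computation. *)
Lemma subc_functor_ind (K : category) (P : functor K (subc U) -> Prop) :
  (forall (o1 : K -> J) (o2 : forall i, U (o1 i)) m f1 fM,
     P (@Functor K (subc U) (fun i => exist _ (o1 i) (o2 i)) m f1 fM)) -> forall c, P c.
Proof.
move=> H [o m f1 fM].
have [o1 [o2 E]] : exists (o1 : K -> J) (o2 : forall i, U (o1 i)), o = fun i => exist _ (o1 i) (o2 i).
  exists (fun i => sval (o i)), (fun i => svalP (o i)).
  by apply: functional_extensionality_dep => i; case: (o i) => x u; apply: eq_exist.
by subst o; apply: H.
Qed.

Lemma hval_uval p (s : hU U p) (c : functor (lin p) (subc U)) (Uc : forall i, U (compf (sinc U) c i)) j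
    (u : hom (c ord_max) j) :
  hval s u = uval (c := compf (sinc U) c) s Uc (j := sval j) u.
Proof.
move: c j u Uc; apply: subc_functor_ind => o1 o2 m f1 fM j u Uc.
rewrite /uval (hval_push s (idm (clift Uc ord_max)) (j' := j) u).
have E : Uc = o2 :> (forall i, U (o1 i)) by apply: Prop_irrelevance.
by subst Uc; apply: hval_eq => //; rewrite compm1.
Qed.

Lemma hU_ext p (s t : hU U p) :
  (forall q (x : splx p q) (c : functor (lin q) J) (Uc : forall i, U (c i)),
     uval (p := q) (act x s) Uc (idm (c ord_max)) = uval (p := q) (act x t) Uc (idm (c ord_max))) ->
  s = t.
Proof.
move=> E; apply: holim_ext => q x c.
rewrite !(@hval_uval q _ c (fun i => svalP (c i))); exact: (E q x (compf (sinc U) c) (fun i => svalP (c i))).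
Qed.

Definition wup (B : sset) (j : subc U) p (w : wsimp B j p) : wsimp B (sval j) p :=
  @WS J B (sval j) p (wb w) (compf (sinc U) (wc w)) (wu w).

Lemma wup_act (B : sset) (j : subc U) p q (a : @hom Delta p q) (w : wsimp B j q) :
  wup (wact a w) = wact a (wup w).
Proof. by rewrite /wup /wact /=; case: w => b c u; apply: ws_eq. Qed.

Lemma wup_push (B : sset) (j j' : subc U) (v : hom j j') p (w : wsimp B j p) :
  wup (wpush v w) = wpush (v : hom (sval j) (sval j')) (wup w).
Proof. by []. Qed.

(** Turns a graph on the cells of [W J B] that is total on chains in [U] into a family of sections
    over [U]. *)
Lemma hU_of (B : sset) (R : forall j p, wsimp B j p -> D j p -> Prop) :
  (forall j p (w : wsimp B j p) x x', R j p w x -> R j p w x' -> x = x') ->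
  (forall j p q (a : @hom Delta p q) (w : wsimp B j q) x, R j q w x -> R j p (wact a w) (act a x)) ->
  (forall j j' (v : hom j j') p (w : wsimp B j p) x, R j p w x -> R j' p (wpush v w) (dmap D v p x)) ->
  (forall j p (w : wsimp B j p), (forall i, U (wc w i)) -> exists x, R j p w x) ->
  exists h : smap B (hU U), forall j p (w : wsimp B j p) (Uc : forall i, U (wc w i)),
    R j p w (uval (h p (wb w)) Uc (wu w)).
Proof.
move=> Ru Ra Rp Rt.
have tot (j : subc U) p (w : wsimp B j p) : exists x, R (sval j) p (wup w) x.
  by apply: Rt => i; apply: (svalP (wc w i)).
pose y (j : subc U) p (w : wsimp B j p) := sval (cid (tot j p w)).
have yR (j : subc U) p (w : wsimp B j p) : R (sval j) p (wup w) (y j p w) := svalP (cid (tot j p w)).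
have yP (j : subc U) m n (a : @hom Delta m n) (w : W (subc U) B j n) : y j m (act a w) = act a (y j n w).
  by apply: Ru (yR _ _ _) _; rewrite wup_act; apply: Ra.
have yQ (j j' : subc U) (v : hom j j') n (w : W (subc U) B j n) :
    y j' n (dmap (W (subc U) B) v n w) = dmap (dcomp D (sinc U)) v n (y j n w).
  by apply: Ru (yR _ _ _) _; rewrite wup_push; apply: Rp.
pose phi : dmor (W (subc U) B) (dcomp D (sinc U)) :=
  @DMor (subc U) (W (subc U) B) (dcomp D (sinc U)) (fun j => @SMap (W (subc U) B j) (D (sval j)) (y j) (@yP j)) yQ.
exists (holim_of phi) => j p [b c u] Uc /=.
rewrite /uval hval_of /=.
have := Rp _ _ u _ _ _ (yR _ _ (@WS (subc U) B (clift Uc ord_max) p b (clift Uc) (idm _))).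
rewrite /wpush /= /wup /=; congr (R _ _ _ _); case: (c) u Uc => *; apply: ws_eq => //=.
by rewrite compm1.
Qed.
End OneU.

Section Res.
Variables (U V : J -> Prop) (VU : forall x, V x -> U x).

Definition restr : functor (subc V) (subc U) :=
  @Functor (subc V) (subc U) (fun x => exist _ (sval x) (VU (proj2_sig x))) (fun _ _ u => u)
    (fun _ => erefl) (fun _ _ _ _ _ => erefl).

Definition res : smap (hU U) (hU V) :=
  @hpull (subc V) (subc U) restr (dcomp D (sinc U)) (dcomp D (sinc V))
    (fun i => sid (D (sval i))) (fun _ _ _ _ _ => erefl).

Lemma uval_res p (s : hU U p) (c : functor (lin p) J) (Vc : forall i, V (c i)) (Uc : forall i, U (c i)) j
    (u : hom (c ord_max) j) : uval (res p s) Vc u = uval s Uc u.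
Proof.
rewrite /uval hval_hpull /=; congr (dmap D u p _).
rewrite (Prop_irrelevance Uc (fun i => VU (Vc i))).
exact: (@hval_eq (subc U) (dcomp D (sinc U)) p s (fun i => exist _ (c i) (VU (Vc i)))
  (fun x y h => fmap c h) (fun x y h => fmap c h) _ _ _ _ (exist _ (c ord_max) (VU (Vc ord_max))) _ _
  (fun _ _ _ => erefl) erefl).
Qed.

(** The values prescribed over the boundary and those prescribed on chains inside [V] agree where
    both exist and together cover a closed set of cells, from which [lift_hep] extends. *)
Lemma fib0_res : (forall j, hep (D j)) -> fib0 res.
Proof.
move=> hD n R psi [Ru Ra] RA AR Rpsi.
have pR : pfun R by [].
pose inV p (c : functor (lin p) (subc U)) := forall i, V (sval (c i)).
pose R2 (j : subc U) p (w : wsimp (cyl (splx n)) j p) (x : dcomp D (sinc U) j p) :=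
  exists Vc : (forall i, V (compf (sinc U) (wc w) i)),
    x = uval (psi p (wb w)) Vc (j := sval j) (wu w).
have mix (j : subc U) p (w : wsimp (cyl (splx n)) j p) x x' : hrel R w x -> R2 j p w x' -> x = x'.
  move=> [s Rs ->] [Vc ->]; rewrite -(Rpsi _ _ _ Rs).
  rewrite (uval_res s Vc (fun i => svalP (wc w i))); exact: hval_uval.
have [|||||||chi chiR] := @lift_hep (subc U) (dcomp D (sinc U)) (fun j => hD (sval j)) (splx n) ord0
  (fun p k => ~ surj k.1 \/ inV p k.2) (fun j p w x => hrel R w x \/ R2 j p w x).
- move=> p q a k [nk|Vk]; [left; exact: nonsurj_act | right => i; exact: Vk].
- by move=> j p w t x [[s /RA[]]|[Vc _]]; [left|right; left|right; right].
- move=> j p w; have [|s Rs] := AR p (wb w, cst p ord0); first by left.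
  by exists (hval s (wu w)); left; exists s.
- move=> j p w t [nw|Vw].
    have [|s Rs] := AR p (wb w, t); first by right.
    by exists (hval s (wu w)); left; exists s.
  by exists (uval (c := compf (sinc U) (wc w)) (psi p (wb w, t)) Vw (j := sval j) (wu w)); right; exists Vw.
- move=> j p w x x' [Rx|Rx] [Rx'|Rx'].
  + exact: (hrel_uniq pR Rx).
  + exact: mix Rx Rx'.
  + exact/esym/(mix _ _ _ _ _ Rx').
  + by case: Rx Rx' => [Vc ->] [Vc' ->]; apply: uval_irr.
- move=> j p q a w x [Rx|[Vc ->]]; first by left; apply: (hrel_act pR).
  right; exists (fun i => Vc (a i)).
  by rewrite (@uval_act V q p a (psi q (wb w)) _ Vc (fun i => Vc (a i))) -(sfunP psi); apply: uval_eq.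
- move=> j j' v p w x [Rx|[Vc ->]]; first by left; apply: hrel_push.
  by right; exists Vc; rewrite /= uval_push.
exists (holim_of chi); split=> [p z x Rz|p z].
  by apply: (hrel_ext pR) Rz => j q w y Ry; apply: chiR; left.
apply: hU_ext => q x c Vc.
rewrite -!sfunP (uval_res _ Vc (fun i => VU (Vc i))) [LHS]/uval dmap1 hval_of.
pose cU := clift (fun i => VU (Vc i)).
have E := chiR (cU ord_max) q (@WS (subc U) (cyl (splx n)) (cU ord_max) q (act x z) cU (idm _))
  (uval (psi q (act x z)) Vc (idm (c ord_max))).
apply: E; right; exists Vc; rewrite {}/cU.
by case: c Vc => *; apply: uval_eq.
Qed.
End Res.
End Subc.

(* If [D a -> holim_{x > a} D x] is an equivalence for every object [a] of [U] outside
   [V], then these objects do not contribute to the homotopy limit over [U]. *)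
Section AddObjects.
Variables (J : category) (D : diagram J).
Hypothesis hD : forall j, hep (D j).
Hypothesis thin : forall (x y : J) (u v : hom x y), u = v.
Variable r : J -> nat.
Hypothesis rlt : forall (x y : J), hom x y -> x = y \/ (r y < r x)%N.

Definition cge (a b : J) : Prop := exists u : hom a b, True.
Definition cgt (a b : J) : Prop := cge a b /\ a <> b.
Definition arr (a b : J) (h : cge a b) : hom a b := sval (cid h).

Section UCone.
Variables (a : J) (U : J -> Prop) (Ua : forall x, U x -> cge a x).

Lemma ucone_P (x y : subc U) (u : hom x y) n (z : D a n) :
  dmap (dcomp D (sinc U)) u n (dmap D (arr (Ua (proj2_sig x))) n z) = dmap D (arr (Ua (proj2_sig y))) n z.
Proof. by rewrite -[LHS](@dmapM _ D); congr (dmap D _ n z); apply: thin. Qed.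

Definition ucone : cone (D a) (dcomp D (sinc U)) :=
  @Cone (subc U) (D a) (dcomp D (sinc U)) (fun x => dmap D (arr (Ua (proj2_sig x)))) ucone_P.
End UCone.

Lemma ge_equiv (a : J) : sequiv (canon (@ucone a (cge a) (fun _ h => h))).
Proof.
have aa : cge a a by exists (idm a).
apply: (@canon_init (subc (cge a)) (dcomp D (sinc (cge a))) (exist _ a aa) (fun x => arr (proj2_sig x))).
  by move=> x u; apply: thin.
by move=> x n z /=; congr (dmap D _ n z); apply: thin.
Qed.

Lemma gt_ge a x : cgt a x -> cge a x. Proof. by case. Qed.

Definition obj_equiv (a : J) : Prop := sequiv (canon (@ucone a (cgt a) (@gt_ge a))).

Lemma hD_hU U : hep (hU D U).
Proof. by apply: hep_holim => j; apply: hD. Qed.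

Lemma canon_res a (U V : J -> Prop) (VU : forall x, V x -> U x) (Ua : forall x, U x -> cge a x)
    (Va : forall x, V x -> cge a x) n x :
  res D VU n (canon (ucone Ua) n x) = canon (ucone Va) n x.
Proof.
apply: holim_ext => q y c; rewrite -!sfunP hval_hpull !hval_canon /=.
by congr (dmap D _ q _); apply: thin.
Qed.

(** Since [a] is initial among the objects that it maps to, [obj_equiv a] says that dropping [a] is
    an equivalence; being a fibration as well, this restriction has strict lifts. *)
Lemma tfib_ge_gt a : obj_equiv a -> tfib (res D (@gt_ge a)).
Proof.
move=> ea; apply: fib0_tfib; first exact: fib0_res.
apply: sequiv_weq; [exact: hD_hU | exact: hD_hU |].
refine (@sequiv_cancel_pre _ _ _ _ _ (@hD_hU (cge a)) (ge_equiv a) _).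
apply: sequiv_ext ea => n x; apply/esym; exact: canon_res.
Qed.

Variables (U V : J -> Prop) (VU : forall x, V x -> U x).
Hypothesis Uup : forall x y, U x -> hom x y -> U y.
Hypothesis Vup : forall x y, V x -> hom x y -> V y.
Variable M : nat.
Hypothesis rM : forall x, U x -> (r x < M)%N.
Hypothesis eUV : forall a, U a -> ~ V a -> obj_equiv a.

Section Fill.
Variables (n : nat) (R0 : forall p, splx n p -> hU D U p -> Prop) (y : hU D V n).
Hypothesis pR0 : pfun R0.
Hypothesis RS0 : forall p a x, R0 a x -> ~ surj (a : splx n p).
Hypothesis SR0 : forall p (a : splx n p), ~ surj a -> exists x, R0 a x.
Hypothesis Ry0 : forall p a x, R0 a x -> res D VU p x = act (a : splx n p) y.
Notation B := (splx n).
Notation wrel := (forall j p, wsimp B j p -> D j p -> Prop).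

(* The cells over which a lift has been built once the objects of rank less than
   [N] have been treated. *)
Definition dom N p (b : B p) (c : functor (lin p) J) : Prop :=
  (forall i, U (c i)) /\ (~ surj b \/ forall i, V (c i) \/ (r (c i) < N)%N).

Record okrel N (R : wrel) : Prop := OkRel {
  ok_dom : forall j p (w : wsimp B j p) x, R j p w x -> dom N (wb w) (wc w);
  ok_tot : forall j p (w : wsimp B j p), dom N (wb w) (wc w) -> exists x, R j p w x;
  ok_uniq : forall j p (w : wsimp B j p) x x', R j p w x -> R j p w x' -> x = x';
  ok_act : forall j p q (a : @hom Delta p q) (w : wsimp B j q) x,
    R j q w x -> R j p (wact a w) (act a x);
  ok_push : forall j j' (v : hom j j') p (w : wsimp B j p) x,
    R j p w x -> R j' p (wpush v w) (dmap D v p x) }.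

Definition start : wrel := fun j p w x =>
  (exists (s : hU D U p) (Uc : forall i, U (wc w i)), R0 (wb w) s /\ x = uval s Uc (wu w)) \/
  (exists Vc : (forall i, V (wc w i)), x = uval (p := p) (act (wb w) y) Vc (wu w)).

Lemma start_ok : okrel 0 start.
Proof.
have mix j p (w : wsimp B j p) (s : hU D U p) (Uc : forall i, U (wc w i)) (Vc : forall i, V (wc w i)) :
    R0 (wb w) s -> uval s Uc (wu w) = uval (p := p) (act (wb w) y) Vc (wu w).
  by move=> Rs; rewrite -(Ry0 Rs) (uval_res VU s Vc Uc).
split.
- move=> j p w x [[s [Uc [Rs _]]]|[Vc _]]; first by split=> //; left; apply: RS0 Rs.
  by split=> [i|]; [exact: VU | right => i; left].
- move=> j p w [Uc [nb|Vc]].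
    by have [s Rs] := SR0 nb; exists (uval s Uc (wu w)); left; exists s, Uc.
  have {}Vc i : V (wc w i) by case: (Vc i).
  by exists (uval (p := p) (act (wb w) y) Vc (wu w)); right; exists Vc.
- move=> j p w x x' [[s [Uc [Rs ->]]]|[Vc ->]] [[s' [Uc' [Rs' ->]]]|[Vc' ->]].
  + by rewrite (pfun_uniq pR0 Rs Rs') (Prop_irrelevance Uc Uc').
  + exact: mix.
  + exact/esym/mix.
  + exact: uval_irr.
- move=> j p q a w x [[s [Uc [Rs ->]]]|[Vc ->]].
    left; exists (act a s), (fun i => Uc (a i)); split; first exact: (pfun_act pR0).
    exact: uval_act.
  right; exists (fun i => Vc (a i)).
  have -> : act (wb (wact a w)) y = act a (act (wb w) y) := @actM (hU D V) _ _ _ (wb w) a y.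
  exact: uval_act.
- move=> j j' v p w x [[s [Uc [Rs ->]]]|[Vc ->]]; [left|right].
    by exists s, Uc; rewrite /= uval_push.
  by exists Vc; rewrite /= uval_push.
Qed.

(** Ranks forbid a chain to leave and re-enter [a]. *)
Lemma chain_gt p (c : functor (lin p) J) a :
  (forall i, cge a (c i)) -> c ord0 <> a -> forall i, cgt a (c i).
Proof.
move=> Gc nc i; split=> // E; apply: nc.
have h : hom (c ord0) (c i) by apply: (fmap c (leq0n i : @hom (lin p) ord0 i)).
have [->//|lt1] := rlt h.
have [u _] := Gc ord0; have [//|lt2] := rlt u.
by move: (ltn_trans lt1 lt2); rewrite -E ltnn.
Qed.

(** All chains beginning at [a] are treated at once, as a single lifting problem for the restriction
    that drops [a]. *)
Lemma fill_obj N (R : wrel) (a : J) : okrel N R -> U a -> ~ V a -> r a = N ->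
  exists z : hU D (cge a) n, forall j p (w : wsimp B j p) (Gc : forall i, cge a (wc w i)),
    (~ surj (wb w) \/ forall i, cgt a (wc w i)) ->
    R j p w (uval (p := p) (act (wb w) z) Gc (wu w)).
Proof.
move=> oR Ua nVa ra.
have Uge x : cge a x -> U x by case=> u _; apply: Uup u.
have rgt x : cgt a x -> (r x < N)%N.
  by case=> [[u _] ne]; case: (rlt u) => [E|]; [case: ne | rewrite ra].
(* The other objects reached from [a] have rank below [N], so [R] already holds a section over
   them. *)
have [|ht htP] := hU_of (U := cgt a) (ok_uniq oR) (ok_act oR) (ok_push oR).
  move=> j p w Gc; apply: (ok_tot oR); split=> [i|]; first exact/Uge/gt_ge/Gc.
  by right => i; right; apply/rgt/Gc.
pose ya := ht n (idm _ : splx n n).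
have yaP j p (w : wsimp B j p) (Gc : forall i, cgt a (wc w i)) :
    R j p w (uval (p := p) (act (wb w) ya) Gc (wu w)).
  have := htP j p w Gc; rewrite /ya -sfunP.
  by rewrite (_ : act (wb w) (idm _ : splx n n) = wb w) //; apply: Dext.
(* The boundary data: over a proper face of the simplex, [R] is defined on every chain in [U], in
   particular on those that contain [a]. *)
pose R' p (b : splx n p) (s : hU D (cge a) p) := ~ surj b /\
  forall q (x : splx p q) (c : functor (lin q) J) (Gc : forall i, cge a (c i)) j (u : hom (c ord_max) j),
    R j q (@WS J B j q (act x b) c u) (uval (p := q) (act x s) Gc u).
have R'tot p (b : splx n p) : ~ surj b -> exists s, R' p b s.
  move=> nb.
  pose Rb j q (w : wsimp (splx p) j q) x := R j q (@WS J B j q (act (wb w) b) (wc w) (wu w)) x.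
  have [||||h hP] := hU_of (U := cge a) (B := splx p) (R := Rb).
  + by move=> j q w x x'; apply: (ok_uniq oR).
  + move=> j q q' d w x /(ok_act oR d); rewrite /Rb.
    have -> : act (wb (wact d w)) b = act d (act (wb w) b) := @actM (splx n) _ _ _ (wb w) d b.
    by [].
  + by move=> j j' v q w x /(ok_push oR v).
  + move=> j q w Gc; apply: (ok_tot oR); split=> [i|]; first exact/Uge/Gc.
    by left; apply: nonsurj_act.
  exists (h p (idm _)); split=> // q x c Gc j u.
  have -> : act x (h p (idm _)) = h q x by rewrite -sfunP; congr (h q _); apply: Dext.
  exact: (hP j q (@WS J (splx p) j q x c u) Gc).
have [||||z [ze zR]] := tfib_ge_gt (eUV Ua nVa) (R := R') (y := ya).
- split=> [p b s s' [_ Rs] [_ Rs']|p q d b s [nb Rs]].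
    by apply: hU_ext => q x c Gc; apply: (ok_uniq oR) (Rs _ _ _ _ _ _) (Rs' _ _ _ _ _ _).
  split=> [|m x c Gc j u]; first exact: nonsurj_act.
  by rewrite -(@actM (hU D (cge a))) -(@actM (splx n) _ _ _ d x b); apply: Rs.
- by move=> p b s [].
- exact: R'tot.
- move=> p b s [nb Rs]; apply: hU_ext => q x c Gc.
  rewrite -(sfunP (res D (@gt_ge a))) (uval_res (@gt_ge a) _ Gc (fun i => gt_ge (Gc i))).
  have E : act (act x b : splx n q) ya = act x (act b ya) := @actM (hU D (cgt a)) _ _ _ b x ya.
  have h : R _ q (@WS J B _ q (act x b) c (idm _)) (uval (p := q) (act x (act b ya)) Gc (idm (c ord_max))).
    by rewrite -E; apply: (yaP _ q (@WS J B _ q (act x b) c (idm _)) Gc).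
  refine (ok_uniq oR _ h); exact: Rs.
exists z => j p w Gc [nb|Gtc].
  have [s Rs] := R'tot _ _ nb.
  have := Rs.2 p (idm _) (wc w) Gc j (wu w).
  rewrite -(zR _ _ _ Rs) (@act1 (hU D (cge a))).
  by have -> : @WS J B j p (act (idm _) (wb w)) (wc w) (wu w) = w by rewrite (@act1 (splx n)); case: (w).
have := yaP _ _ w Gtc; rewrite -ze -sfunP (uval_res (@gt_ge a) _ Gtc Gc); exact.
Qed.

(** The new cells are chains whose first object has rank [N] and lies outside [V]. Different first
    objects give different chains, so the fillers do not interact. *)
Lemma fill_step N (R : wrel) : okrel N R ->
  exists R' : wrel, okrel N.+1 R' /\ forall j p w x, R j p w x -> R' j p w x.
Proof.
move=> oR.
pose good a := [/\ U a, ~ V a & r a = N].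
have zex a : good a -> exists z : hU D (cge a) n, forall j p (w : wsimp B j p) (Gc : forall i, cge a (wc w i)),
    (~ surj (wb w) \/ forall i, cgt a (wc w i)) ->
    R j p w (uval (p := p) (act (wb w) z) Gc (wu w)).
  by case=> Ua nVa ra; exact: (fill_obj oR).
pose z a (ga : good a) := sval (cid (zex a ga)).
have zP a (ga : good a) j p (w : wsimp B j p) (Gc : forall i, cge a (wc w i)) :
    (~ surj (wb w) \/ forall i, cgt a (wc w i)) ->
    R j p w (uval (p := p) (act (wb w) (z a ga)) Gc (wu w)).
  exact: (svalP (cid (zex a ga))).
pose new j p (w : wsimp B j p) (x : D j p) := exists a (ga : good a) (Gc : forall i, cge a (wc w i)),
  wc w ord0 = a /\ x = uval (p := p) (act (wb w) (z a ga)) Gc (wu w).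
have domS p (b : B p) (c : functor (lin p) J) : dom N b c -> dom N.+1 b c.
  case=> Uc [nb|H]; split=> //; first by left.
  by right => i; case: (H i) => [|lt]; [left | right; apply: ltnW].
have mix j p (w : wsimp B j p) x x' : R j p w x -> new j p w x' -> x = x'.
  move=> Rx [a [ga [Gc [E ->]]]]; have [Ua nVa ra] := ga.
  have [_ [nb|H]] := ok_dom oR Rx.
    by apply: (ok_uniq oR) Rx _; apply: (zP a ga); left.
  by case: (H ord0); rewrite E // ra ltnn.
exists (fun j p w x => R j p w x \/ new j p w x); split; last by move=> *; left.
split.
- move=> j p w x [/(ok_dom oR)/domS//|[a [ga [Gc [E _]]]]].
  case: ga => Ua nVa ra; split=> [i|]; first by case: (Gc i) => u _; apply: Uup u.
  right => i; right; case: (Gc i) => u _.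
  by case: (rlt u) => [<-|]; rewrite ra // => /ltnW.
- move=> j p w [Uc H].
  have [d|nd] := pselect (dom N (wb w) (wc w)).
    by have [x Rx] := ok_tot oR d; exists x; left.
  have {}H : forall i, V (wc w i) \/ (r (wc w i) < N.+1)%N.
    by case: H => // nb; case: nd; split=> //; left.
  have [i [nVi ri]] : exists i, ~ V (wc w i) /\ r (wc w i) = N.
    apply: contrapT => H'; apply: nd; split=> //; right => i.
    case: (H i) => [|lt]; first by left.
    have [|nVi] := pselect (V (wc w i)); first by left.
    right; rewrite ltn_neqAle -ltnS lt andbT; apply/eqP => E.
    by apply: H'; exists i.
  (* Ranks drop along arrows that change the object, and targets of objects of [V] are in [V]; an
     object of rank [N] outside [V] is therefore the first one. *)
  have E : wc w ord0 = wc w i.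
    have u : hom (wc w ord0) (wc w i) := fmap (wc w) (leq0n i : @hom (lin p) ord0 i).
    have [//|lt] := rlt u.
    case: (H ord0) => [V0|lt0]; first by case: nVi; apply: Vup V0 u.
    by move: (leq_trans lt lt0); rewrite ri ltnn.
  have ga : good (wc w ord0) by rewrite E.
  have Gc l : cge (wc w ord0) (wc w l).
    by exists (fmap (wc w) (leq0n l : @hom (lin p) ord0 l)).
  by exists (uval (p := p) (act (wb w) (z _ ga)) Gc (wu w)); right; exists (wc w ord0), ga, Gc.
- move=> j p w x x' [Rx|nx] [Rx'|nx'].
  + exact: (ok_uniq oR) Rx Rx'.
  + exact: mix Rx nx'.
  + exact/esym/(mix _ _ _ _ _ Rx').
  + case: nx nx' => [a [ga [Gc [E ->]]]] [a' [ga' [Gc' [E' ->]]]].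

    by subst a a'; rewrite (Prop_irrelevance ga ga') (Prop_irrelevance Gc Gc').
- move=> j p q d w x [/(ok_act oR d)|[a [ga [Gc [E ->]]]]]; first by left.
  have Gd i : cge a (wc (wact d w) i) by apply: Gc.
  have actE : act d (uval (p := q) (act (wb w) (z a ga)) Gc (wu w)) =
      uval (p := p) (act (wb (wact d w)) (z a ga)) Gd (wu (wact d w)).
    have -> : act (wb (wact d w)) (z a ga) = act d (act (wb w) (z a ga)) :=
      @actM (hU D (cge a)) _ _ _ (wb w) d (z a ga).
    exact: uval_act.
  (* A face that no longer starts at [a] avoids [a] altogether, and there [R] prescribes the
     value. *)
  have [E0|nE] := pselect (wc (wact d w) ord0 = a).
    by right; exists a, ga, Gd.
  left; rewrite actE; apply: (zP a ga); right; exact: chain_gt.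
- move=> j j' v p w x [/(ok_push oR v)|[a [ga [Gc [E ->]]]]]; first by left.
  by right; exists a, ga, Gc; rewrite uval_push.
Qed.

Lemma fill_all N : exists R : wrel, okrel N R /\ forall j p w x, start w x -> R j p w x.
Proof.
elim: N => [|N [R [oR sR]]]; first by exists start; split=> //; apply: start_ok.
have [R' [oR' RR']] := fill_step oR.
by exists R'; split=> // j p w x /sR/RR'.
Qed.

Lemma fill_end : exists x : hU D U n, res D VU n x = y /\ forall p a t, R0 a t -> act (a : splx n p) x = t.
Proof.
have [R [oR sR]] := fill_all M.
have [|h hP] := hU_of (U := U) (ok_uniq oR) (ok_act oR) (ok_push oR).
  by move=> j p w Uc; apply: (ok_tot oR); split=> //; right => i; right; apply: rM.
have hE p (a : splx n p) : act a (h n (idm _)) = h p a.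
  by rewrite -sfunP; congr (h p _); apply: Dext.
exists (h n (idm _)); split=> [|p a t Rt].
  apply: hU_ext => q x c Vc.
  rewrite -(sfunP (res D VU)) (uval_res VU _ Vc (fun i => VU (Vc i))) hE.
  refine (ok_uniq oR (hP _ q (@WS J B _ q x c (idm _)) (fun i => VU (Vc i))) _).
  by apply: sR; right; exists Vc.
rewrite hE; apply: hU_ext => q x c Uc; rewrite -sfunP.
refine (ok_uniq oR (hP _ q (@WS J B _ q (act x a) c (idm _)) Uc) _).
by apply: sR; left; exists (act x t), Uc; split=> //; apply: (pfun_act pR0).
Qed.
End Fill.

Lemma tfib_res : tfib (res D VU).
Proof. by move=> n R y pR RS SR Ry; apply: fill_end. Qed.
End AddObjects.

(** * Right Kan extensions *)

Section CGlue.
Variables (C D : category) (i : functor C D) (G : presheaf C) (d : D).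
Notation cm := (op (comma i d)).

Section Chains.
Variables (q : nat) (d1 d2 : functor (lin q) cm).
Variable tau : forall l : lin q, hom (d1 l) (d2 l).
Hypothesis tauN : forall (l l' : lin q) (h : hom l l'), fmap d2 h \c tau l = tau l' \c fmap d1 h.

Notation e1 := (compf (opf (comma_src i d)) d1).
Notation e2 := (compf (opf (comma_src i d)) d2).

Lemma src_tauN (l l' : lin q) (h : hom l l') :
  @comp (op C) _ _ _ (fmap e2 h) (chom (tau l)) = @comp (op C) _ _ _ (chom (tau l')) (fmap e1 h).
Proof. exact: (congr1 (fun v => chom v) (tauN h)). Qed.

Notation cob := (gob e1 e2).
Notation cgm l l' h a b E := (@gm (op C) q e1 e2 (fun l0 => chom (tau l0)) l l' h a b E).

Definition ccarr (l : lin q) (a : nat) : hom (i (cob l a)) d :=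
  match a return hom (i (cob l a)) d with 0 => carr (d1 l) | S _ => carr (d2 l) end.

Lemma ccarrP (l l' : lin q) (h : hom l l') a b (E : (a <= b)%N) :
  ccarr l a \c fmap i (cgm l l' h a b E) = ccarr l' b.
Proof.
case: a b E => [|a] [|b] //= _; try exact: chomP.
by rewrite fmapM compA chomP chomP.
Qed.

Variable t : functor (lin q) (lin 1).

(** The chain of [glue], presented as a chain in [C] with a family of arrows to [d], so that
    [cval_eq] can exchange equal arrows while the values stay in the same space. *)
Definition cglue : functor (lin q) cm :=
  @chain C D i d (lin q) (fun l => cob l (t l : 'I_2)) (fun l l' h => cgm l l' h _ _ (fmap t h))
    (fun l => @gm1 (op C) q e1 e2 (fun l => chom (tau l)) l _ (fmap t (idm l)))
    (fun l l' l'' h' h => @gmM (op C) q e1 e2 (fun l => chom (tau l)) src_tauN l l' l'' h' h _ _ _ (fmap t h) (fmap t h') (fmap t (h' \c h)))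
    (fun l => ccarr l (t l : 'I_2)) (fun l l' h => ccarrP h (fmap t h)).

Definition cval (s : holim (ran_diag i G d) q) (z : C) (v : hom z (csrc (d2 ord_max))) : G z q :=
  dmap G (a := cob ord_max (t ord_max : 'I_2)) (b := z)
    (@gto (op C) q e1 e2 (fun l => chom (tau l)) z ord_max (t ord_max : 'I_2) v) q
    (hsim s cglue q (idm _, idm _)).

Lemma cval_push (s : holim (ran_diag i G d) q) (z z' : C) (v : hom z (csrc (d2 ord_max))) (w : hom z' z) :
  dmap G (a := z) (b := z') w q (cval s v) = cval s (v \c w).
Proof.
rewrite /cval -[LHS](@dmapM _ G) /=; congr (dmap G _ q _).
exact: (@gto_push (op C)).
Qed.
End Chains.

Lemma cval_act q r (d1 d2 : functor (lin q) cm) (tau : forall l : lin q, hom (d1 l) (d2 l))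
    (tauN : forall (l l' : lin q) (h : hom l l'), fmap d2 h \c tau l = tau l' \c fmap d1 h)
    (a : @hom Delta r q) (t : functor (lin q) (lin 1)) (s : holim (ran_diag i G d) q) z
    (v : hom z (csrc (d2 ord_max)))
    (tauN' : forall (l l' : lin r) (h : hom l l'),
       fmap (compf d2 a) h \c tau (a l) = tau (a l') \c fmap (compf d1 a) h) :
  act a (cval tauN t s v) =
  @cval r (compf d1 a) (compf d2 a) (fun l => tau (a l)) tauN' (compf t a) (act a s) z
    (chom (fmap d2 (le_max (a ord_max))) \c v).
Proof.
rewrite /cval -sfunP.
have -> : act a (hsim s (cglue tauN t) q (idm _, idm _)) = hsim s (cglue tauN t) r (a, a).
  by rewrite -sfunP; congr (hsim s _ r (_, _)); apply: Dext.
rewrite [X in dmap G _ r X](@hsim_hval cm (ran_diag i G d) q s q (cglue tauN t) r a a).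
rewrite /hval -[LHS](@dmapM _ G).
have -> : hsim (act a s) (compf (cglue tauN t) a) r (idm _, idm _) =
    hsim (act a s) (@cglue r (compf d1 a) (compf d2 a) (fun l => tau (a l)) tauN' (compf t a)) r (idm _, idm _).
  apply: (@ran_cast C D i G d r (act a s) r (compf (cglue tauN t) a) (@cglue r (compf d1 a) (compf d2 a) (fun l => tau (a l)) tauN' (compf t a)) _ erefl).
  apply: functor_ext => x y h; apply: commaHom_ext => /=.
  have aux A B (E E' : (A <= B)%N) :
    @gm (op C) q (compf (opf (comma_src i d)) d1) (compf (opf (comma_src i d)) d2)
      (fun l => chom (tau l)) (a x) (a y) (fmap a h) A B E =
    @gm (op C) r (compf (opf (comma_src i d)) (compf d1 a)) (compf (opf (comma_src i d)) (compf d2 a))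
      (fun l => chom (tau (a l))) x y h A B E' by case: A B E E' => [|A] [|B].
  exact: aux.
have aux A B (E : (A <= B)%N) :
  @comp (op C) _ _ _
    (@gto (op C) q (compf (opf (comma_src i d)) d1) (compf (opf (comma_src i d)) d2)
      (fun l => chom (tau l)) z ord_max B v)
    (@gm (op C) q (compf (opf (comma_src i d)) d1) (compf (opf (comma_src i d)) d2)
      (fun l => chom (tau l)) (a ord_max) ord_max (le_max (a ord_max)) A B E) =
  @gto (op C) r (compf (opf (comma_src i d)) (compf d1 a)) (compf (opf (comma_src i d)) (compf d2 a))
      (fun l => chom (tau (a l))) z ord_max A (chom (fmap d2 (le_max (a ord_max))) \c v).
  rewrite (@gto_gm (op C) q (compf (opf (comma_src i d)) d1) (compf (opf (comma_src i d)) d2)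
    (fun l => chom (tau l)) (src_tauN tauN)).
  by case: A E.
by congr (dmap G _ r _); apply: aux.
Qed.

Lemma cval0 q (d1 d2 : functor (lin q) cm) (tau : forall l : lin q, hom (d1 l) (d2 l))
    (tauN : forall (l l' : lin q) (h : hom l l'), fmap d2 h \c tau l = tau l' \c fmap d1 h)
    (s : holim (ran_diag i G d) q) z (v : hom z (csrc (d2 ord_max))) :
  cval tauN (c0 q) s v = dmap G (a := csrc (d1 ord_max)) (b := z) (chom (tau ord_max) \c v) q
    (hsim s d1 q (idm _, idm _)).
Proof.
rewrite /cval; congr (dmap G _ q _).
apply: (@ran_cast C D i G d q s q (cglue tauN (c0 q)) d1 _ erefl).
by case: (d1) tau tauN => *; apply: functor_ext => x y h; apply: commaHom_ext.
Qed.

Lemma cval1 q (d1 d2 : functor (lin q) cm) (tau : forall l : lin q, hom (d1 l) (d2 l))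
    (tauN : forall (l l' : lin q) (h : hom l l'), fmap d2 h \c tau l = tau l' \c fmap d1 h)
    (s : holim (ran_diag i G d) q) z (v : hom z (csrc (d2 ord_max))) :
  cval tauN (c1 q) s v = dmap G (a := csrc (d2 ord_max)) (b := z) v q
    (hsim s d2 q (idm _, idm _)).
Proof.
rewrite /cval; congr (dmap G _ q _).
apply: (@ran_cast C D i G d q s q (cglue tauN (c1 q)) d2 _ erefl).
by case: (d2) tau tauN v => *; apply: functor_ext => x y h; apply: commaHom_ext.
Qed.

(* The chains only differ by their arrows to [d], which are equal but not convertible. *)
Lemma cval_eq q (d1 : functor (lin q) cm) (o : lin q -> C)
    (m : forall a b : lin q, hom a b -> hom (o b) (o a))
    (g g' : forall l, hom (i (o l)) d)
    (H : forall a b (u : hom a b), g a \c fmap i (m a b u) = g b)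
    (H' : forall a b (u : hom a b), g' a \c fmap i (m a b u) = g' b)
    f1 fM f1' fM'
    (d2 := @Functor (lin q) cm (fun l => CommaOb (g l))
      (fun a b u => @CommaHom _ _ i d (CommaOb (g b)) (CommaOb (g a)) (m a b u) (H a b u)) f1 fM)
    (d2' := @Functor (lin q) cm (fun l => CommaOb (g' l))
      (fun a b u => @CommaHom _ _ i d (CommaOb (g' b)) (CommaOb (g' a)) (m a b u) (H' a b u)) f1' fM')
    (tau : forall l : lin q, hom (d1 l) (d2 l))
    (tau' : forall l : lin q, hom (d1 l) (d2' l))
    tauN tauN' t (s : holim (ran_diag i G d) q) z (v : hom z (o ord_max)) :
  (forall l, g l = g' l) -> (forall l, chom (tau l) = chom (tau' l) :> hom (o l) (csrc (d1 l))) ->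
  @cval q d1 d2 tau tauN t s z v = @cval q d1 d2' tau' tauN' t s z v.
Proof.
move=> Eg; have {}Eg : g = g' by apply: functional_extensionality_dep.
subst g'; have EH : H = H' by apply: Prop_irrelevance.
subst H'; have E1 : f1 = f1' by apply: Prop_irrelevance.
subst f1'; have EM : fM = fM' by apply: Prop_irrelevance.
subst fM' => Et.
have Et' : tau = tau' by apply: functional_extensionality_dep => l; apply/commaHom_ext/Et.
by subst tau'; rewrite (Prop_irrelevance tauN tauN').
Qed.
End CGlue.

(** * The unit of right Kan extension along a fully faithful functor *)

Section Gam.
Variables (C D : category) (i : functor C D).

Section OneF.
Variable F : presheaf D.

Lemma gam_coneP (T : D) (x y : op (comma i T)) (u : hom x y) n (z : F T n) :
  dmap (ran_diag i (pullback i F) T) u n (dmap F (a := T) (carr x) n z) = dmap F (a := T) (carr y) n z.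
Proof. by rewrite -(chomP u); apply/esym/(@dmapM _ F). Qed.

Definition gam_cone (T : D) : cone (F T) (ran_diag i (pullback i F) T) :=
  @Cone (op (comma i T)) (F T) (ran_diag i (pullback i F) T) (fun x => dmap F (a := T) (carr x)) (@gam_coneP T).

Definition gam (T : D) : smap (F T) (ran i (pullback i F) T) := canon (gam_cone T).
End OneF.

Lemma hval_ran_map (G : presheaf C) a b (w : hom b a) n (s : holim (ran_diag i G a) n)
    (c : functor (lin n) (op (comma i b))) j (u : hom (c ord_max) j) :
  hval (ran_map i G w n s) u = hval s (c := compf (opf (comma_post i w)) c) (fmap (opf (comma_post i w)) u).
Proof. exact: (@hval_hpull (op (comma i b)) (op (comma i a)) (opf (comma_post i w)) (ran_diag i G a) (ran_diag i G b) (fun x => sid (G (csrc x)))). Qed.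

Lemma gam_nat (F : presheaf D) (a b : op D) (w : hom a b) n (x : F a n) :
  gam F b n (dmap F w n x) = ran_map i (pullback i F) w n (gam F a n x).
Proof.
apply: holim_ext => m y c; rewrite -!sfunP hval_ran_map !hval_canon /=.
by rewrite -[LHS](@dmapM _ F).
Qed.

Definition ran_dmor (F H : presheaf D) (f : dmor F H) (T : D) :
    dmor (ran_diag i (pullback i F) T) (ran_diag i (pullback i H) T) :=
  @DMor (op (comma i T)) (ran_diag i (pullback i F) T) (ran_diag i (pullback i H) T)
    (fun x => f (i (csrc x))) (fun x y u => @dfunP _ _ _ f _ _ (fmap i (chom u))).

Lemma gam_dmor (F H : presheaf D) (f : dmor F H) T n x :
  hmap (ran_dmor f T) n (gam F T n x) = gam H T n (f T n x).
Proof.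
apply: holim_ext => m y c; rewrite -!sfunP hval_hmap !hval_canon /=.
by rewrite (@dfunP _ _ _ f).
Qed.

Variable pre : forall a b, hom (i a) (i b) -> hom a b.
Hypothesis preK : forall a b (h : hom (i a) (i b)), fmap i (pre h) = h.
Hypothesis preK' : forall a b (h : hom a b), pre (fmap i h) = h.

Lemma pre_comp a b c (h : hom b c) (g : hom (i a) (i b)) : pre (fmap i h \c g) = h \c pre g.
Proof. by rewrite -[in LHS](preK g) -fmapM preK'. Qed.

Variable G : presheaf C.
Hypothesis hG : forall a, hep (G a).
Notation RG := (ran i G).

Lemma unit_coneP (S : C) (x y : op (comma i (i S))) (u : hom x y) n (z : G S n) :
  dmap (ran_diag i G (i S)) u n (dmap G (a := S) (pre (carr x)) n z) = dmap G (a := S) (pre (carr y)) n z.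
Proof.
rewrite -[LHS](@dmapM _ G) /=; congr (dmap G _ n z).
by rewrite -[LHS]preK' fmapM preK chomP.
Qed.

Definition unit_cone (S : C) : cone (G S) (ran_diag i G (i S)) :=
  @Cone (op (comma i (i S))) (G S) (ran_diag i G (i S)) (fun x => dmap G (a := S) (pre (carr x))) (@unit_coneP S).

Lemma unitP (a b : op C) (u : hom a b) n (x : G a n) :
  canon (unit_cone b) n (dmap G u n x) = dmap (pullback i RG) u n (canon (unit_cone a) n x).
Proof.
apply: holim_ext => m y c; rewrite -!sfunP hval_ran_map !hval_canon /=.
by rewrite -[LHS](@dmapM _ G) pre_comp.
Qed.

Definition unitd : dmor G (pullback i RG) :=
  @DMor (op C) G (pullback i RG) (fun S => canon (unit_cone S)) unitP.

(** Full faithfulness makes the identity of [i S] terminal in the comma category, hence initial in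
    the opposite category that indexes the homotopy limit. *)
Lemma unit_equiv S : sequiv (unitd S).
Proof.
have iniP (z : op (comma i (i S))) : idm (i S) \c fmap i (pre (carr z)) = carr z by rewrite comp1m preK.
pose ini (z : op (comma i (i S))) : @hom (op (comma i (i S))) (CommaOb (idm (i S))) z :=
  @CommaHom _ _ i (i S) z (CommaOb (idm (i S))) (pre (carr z)) (iniP z).
apply: (@canon_init (op (comma i (i S))) (ran_diag i G (i S)) (CommaOb (idm (i S))) ini) => //.
by move=> z u; apply: commaHom_ext; rewrite /= -(chomP u) /= comp1m preK'.
Qed.

Variable T : D.
Notation cT := (op (comma i T)).
Notation Z := (holim (ran_diag i G T)).

Definition unit_ran : dmor (ran_diag i G T) (ran_diag i (pullback i RG) T) :=
  @DMor cT (ran_diag i G T) (ran_diag i (pullback i RG) T)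
    (fun x => unitd (csrc x)) (fun x y u => unitP (chom u)).

Section AtX.
Variable x : cT.
Notation cS := (op (comma i (i (csrc x)))).
Notation post := (opf (comma_post i (carr x))).

Lemma kapP (y : cS) : carr x \c fmap i (pre (carr y)) = carr (post y).
Proof. by rewrite preK. Qed.
Definition kap (y : cS) : @hom cT x (post y) := @CommaHom _ _ i T (post y) x (pre (carr y)) (kapP y).

Lemma kapN (y y' : cS) (u : hom y y') : fmap post u \c kap y = kap y'.
Proof. by apply: commaHom_ext; rewrite /= -(chomP u) -[LHS]preK' fmapM preK. Qed.

Definition rtau n (w : wsimp (cyl Z) x n) (c : functor (lin n) cS) (l : lin n) :
    hom (wc w l) (compf post c l) :=
  kap (c l) \c (wu w \c fmap (wc w) (le_max l)).

Lemma rtauN n (w : wsimp (cyl Z) x n) (c : functor (lin n) cS) (l l' : lin n) (h : hom l l') :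
  fmap (compf post c) h \c rtau w c l = rtau w c l' \c fmap (wc w) h.
Proof.
transitivity (kap (c l') \c (wu w \c fmap (wc w) (le_max l))).
  rewrite -(kapN (fmap c h)); exact: compA.
rewrite /rtau -!compA -fmapM; congr (_ \c (_ \c fmap (wc w) _)).
exact: bool_irrelevance.
Qed.

Definition rval (z : cS) n (W : wsimp (Wsset (J := cT) (cyl Z) x) z n) : G (csrc z) n :=
  @cval C D i G T n (wc (wb W)) (compf post (wc W)) (rtau (wb W) (wc W)) (@rtauN n (wb W) (wc W))
    (wb (wb W)).2 (wb (wb W)).1 (csrc z) (chom (wu W)).

Lemma rtauN_act m n (a : @hom Delta m n) (w : wsimp (cyl Z) x n) (c : functor (lin n) cS)
    (l l' : lin m) (h : hom l l') :
  fmap (compf (compf post c) a) h \c rtau w c (a l) = rtau w c (a l') \c fmap (compf (wc w) a) h.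
Proof. exact: rtauN. Qed.

Lemma rtau_act m n (a : @hom Delta m n) (w : wsimp (cyl Z) x n) (c : functor (lin n) cS) (l : lin m) :
  rtau w c (a l) = rtau (wact a w) (compf c a) l.
Proof.
congr (kap _ \c _); apply: etrans (compA _ _ _); congr (wu w \c _).
apply: etrans (fmapM (wc w) (le_max (a ord_max) : @hom (lin n) _ _) (fmap a (le_max l))).
by congr (fmap (wc w) _); apply: bool_irrelevance.
Qed.

Lemma rval_act m n (a : @hom Delta m n) (w : wsimp (cyl Z) x n) (c : functor (lin n) cS) t s z
    (v : hom z (csrc (c (a ord_max)))) :
  @cval C D i G T m (compf (wc w) a) (compf (compf post c) a) (fun l => rtau w c (a l)) (rtauN_act a w c) t s z v =
  @cval C D i G T m (wc (wact a w)) (compf post (compf c a)) (rtau (wact a w) (compf c a))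
    (rtauN (wact a w) (compf c a)) t s z v.
Proof.
apply: (@cval_eq C D i G T m (compf (wc w) a) (fun l => csrc (c (a l))) (fun l l' h => chom (fmap c (fmap a h)))
  (fun l => carr x \c carr (c (a l))) (fun l => carr x \c carr (c (a l)))) => // l.
by rewrite rtau_act.
Qed.

Lemma rvalP (z : cS) m n (a : @hom Delta m n) (W : wsimp (Wsset (J := cT) (cyl Z) x) z n) :
  rval (wact a W) = act a (rval W).
Proof.
rewrite [RHS](@cval_act C D i G T n m _ _ _ _ a _ _ _ _ (rtauN_act a (wb W) (wc W))).
exact/esym/rval_act.
Qed.

Lemma rvalQ (z z' : cS) (v : hom z z') n (W : wsimp (Wsset (J := cT) (cyl Z) x) z n) :
  rval (wpush v W) = dmap (ran_diag i G (i (csrc x))) v n (rval W).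
Proof. exact/esym/(@cval_push C D i G T). Qed.

Definition psi : dmor (W cS (Wsset (J := cT) (cyl Z) x)) (ran_diag i G (i (csrc x))) :=
  @DMor cS (W cS (Wsset (J := cT) (cyl Z) x)) (ran_diag i G (i (csrc x)))
   (fun z => @SMap (W cS (Wsset (J := cT) (cyl Z) x) z) (G (csrc z)) (@rval z) (@rvalP z)) rvalQ.
End AtX.

Definition rphi (x : cT) : smap (Wsset (J := cT) (cyl Z) x) (RG (i (csrc x))) := holim_of (psi x).

Lemma hval_rphi (x : cT) n (w : wsimp (cyl Z) x n) (c : functor (lin n) (op (comma i (i (csrc x)))))
    (z : op (comma i (i (csrc x)))) (u : hom (c ord_max) z) :
  hval (rphi x n w) u = rval (@WS _ (Wsset (J := cT) (cyl Z) x) z n w c u).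
Proof. exact: hval_of. Qed.

Lemma rval_push (x x' : cT) (v : hom x x') n (w : wsimp (cyl Z) x n)
    (c : functor (lin n) (op (comma i (i (csrc x')))))
    (z : op (comma i (i (csrc x')))) (u : hom (c ord_max) z) :
  rval (@WS _ (Wsset (J := cT) (cyl Z) x') z n (wpush v w) c u) =
  rval (@WS _ (Wsset (J := cT) (cyl Z) x) (opf (comma_post i (fmap i (chom v))) z) n w
    (compf (opf (comma_post i (fmap i (chom v)))) c) (fmap (opf (comma_post i (fmap i (chom v)))) u)).
Proof.
apply: (@cval_eq C D i G T n (wc w) (fun l => csrc (c l)) (fun l l' h => chom (fmap c h))
  (fun l => carr x' \c carr (c l)) (fun l => carr x \c (fmap i (chom v) \c carr (c l)))) => l.
  by rewrite -(chomP v) compA.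
by rewrite /rtau /= pre_comp -!compA.
Qed.

Lemma rphiQ (x x' : cT) (v : hom x x') n (w : W cT (cyl Z) x n) :
  rphi x' n (wpush v w) = dmap (ran_diag i (pullback i RG) T) v n (rphi x n w).
Proof.
transitivity (ran_map i G (fmap i (chom v)) n (rphi x n w)); last by [].
apply: holim_ext => m y c.
rewrite -(sfunP (ran_map i G (fmap i (chom v)))) -!(sfunP (rphi _)) hval_ran_map.
have -> : act y (wpush v w : W cT (cyl Z) x' n) = wpush v (wact y w) := esym (wpushP v y w).
rewrite !hval_rphi; exact: (rval_push v (wact y w)).
Qed.

Lemma pre_compr a b c (h : hom (i b) (i c)) (g : hom a b) : pre (h \c fmap i g) = pre h \c g.
Proof. by rewrite -[in LHS](preK h) -fmapM preK'. Qed.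

Lemma rval0 (x : cT) n (s : Z n) (c : functor (lin n) cT) (v : hom (c ord_max) x)
    (c' : functor (lin n) (op (comma i (i (csrc x))))) z (u : hom (c' ord_max) z) :
  rval (@WS _ (Wsset (J := cT) (cyl Z) x) z n (@WS cT (cyl Z) x n (s, c0 n) c v) c' u) =
  unit_cone (csrc x) z n (hval s v).
Proof.
rewrite /rval cval0 -[RHS](@dmapM _ G); congr (dmap G _ n _) => /=.
rewrite -(chomP u) pre_compr /= [fmap c _](fmap_id c) comp1m.
by rewrite compA.
Qed.

Lemma rval1 (x : cT) n (s : Z n) (c : functor (lin n) cT) (v : hom (c ord_max) x)
    (c' : functor (lin n) (op (comma i (i (csrc x))))) z (u : hom (c' ord_max) z) :
  rval (@WS _ (Wsset (J := cT) (cyl Z) x) z n (@WS cT (cyl Z) x n (s, c1 n) c v) c' u) =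
  hval (ran_map i G (carr x) n s) u.
Proof. by rewrite /rval cval1 hval_ran_map. Qed.

(** Values of both maps are indexed by a chain [c] over [T] and a chain [c'] over its last object.
    [hmap unit_ran] reads the section on [c], [gam] reads it on [c'] composed down to [T], and the
    homotopy reads it on the chain glued from both. *)
Lemma ran_htpy : homotopic (hmap unit_ran) (gam RG T).
Proof.
pose phi : dmor (W cT (cyl Z)) (ran_diag i (pullback i RG) T) :=
  @DMor cT (W cT (cyl Z)) (ran_diag i (pullback i RG) T) rphi rphiQ.
have phiE e n (s : Z n) m (y : splx n m) (c : functor (lin m) cT) :
    hval (p := m) (act y (holim_of phi n (s, cst n e))) (idm (c ord_max)) =
    rphi (c ord_max) m (@WS cT (cyl Z) _ m (act y s, cst m e) c (idm _)).
  rewrite -(sfunP (holim_of phi)) hval_of; congr (rphi _ m (@WS cT (cyl Z) _ m (_, _) c _)).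
  exact: cst_act.
have actE e x n (s : Z n) m (y : splx n m) (c : functor (lin n) cT) (v : hom (c ord_max) x) :
    act y (@WS cT (cyl Z) x n (s, cst n e) c v : Wsset (J := cT) (cyl Z) x n) =
    @WS cT (cyl Z) x m (act y s, cst m e) (compf c y) (v \c fmap c (le_max ((y : @hom Delta m n) ord_max))).
  by rewrite -(cst_act y e).
exists (holim_of phi) => n s; split; apply: holim_ext => m y c; rewrite phiE.
  rewrite -(sfunP (hmap unit_ran)) hval_hmap; apply: holim_ext => q y' c'.
  rewrite -(sfunP (rphi _)) hval_rphi actE rval0.
  by rewrite -(sfunP (unit_ran _)) hval_canon hval_act.
apply: holim_ext => q y' c'.
rewrite -(sfunP (rphi _)) hval_rphi actE rval1 -(sfunP (gam RG T)) hval_canon.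
by rewrite -(sfunP (ran_map i G _)).
Qed.

Lemma hep_ran T' : hep (RG T').
Proof. by apply: hep_holim => x; apply: hG. Qed.

Lemma gam_ran_equiv : sequiv (gam RG T).
Proof.
have h2 : hep (holim (ran_diag i (pullback i RG) T)) by apply: hep_holim => x; apply: hep_ran.
apply: sequiv_htpy ran_htpy _ => //; first exact: hep_ran.
apply: hmap_sequiv => x; [exact: hG | exact: hep_ran | exact: unit_equiv].
Qed.
End Gam.

(* The unit is invertible on [ran i G]: the homotopy is built from the chains
   that run first through the comma category of [T] and then through that of an
   object of [C] over [T]. *)
Lemma image_gam (C D : category) (i : functor C D) (pre : forall a b, hom (i a) (i b) -> hom a b) :
  (forall a b (h : hom (i a) (i b)), fmap i (pre a b h) = h) ->
  (forall a b (h : hom a b), pre a b (fmap i h) = h) ->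
  forall (F : presheaf D) (G : presheaf C), (forall a, hep (F a)) -> (forall a, hep (G a)) ->
  dequiv F (ran i G) -> forall T, sequiv (gam i F T).
Proof.
move=> preK preK' F G hF hG [H [kH [[f ef] [g eg]]]] T.
have hH a : hep (H a) by apply: kan_hep.
have hR a : hep (ran i G a) by apply: hep_ran.
have hh (E : presheaf D) : (forall a, hep (E a)) -> hep (holim (ran_diag i (pullback i E) T)).
  by move=> hE; apply: hep_holim => x; apply: hE.
have e1 : sequiv (gam i H T).
  refine (@sequiv_cancel_post _ _ _ _ (hmap (ran_dmor i g T)) (hh _ hH) _ _).
    by apply: hmap_sequiv => x; [apply: hH | apply: hR | apply: eg].
  apply: sequiv_ext (sequiv_comp (hH T) (hh _ hR) (eg T) (gam_ran_equiv preK preK' hG T)) => n x.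
  exact/esym/gam_dmor.
refine (@sequiv_cancel_pre _ _ _ (f T) _ (hF T) (ef T) _).
have e2 : sequiv (hmap (ran_dmor i f T)).
  by apply: hmap_sequiv => x; [apply: hH | apply: hF | apply: ef].
apply: sequiv_ext (sequiv_comp (hH T) (hh _ hF) e1 e2) => n x.
exact: gam_dmor.
Qed.

(** * Convex subtrees *)

Local Open Scope order_scope.

(** The converse of [free_antichain]. Grafting preserves antichains: the grafted edges lie above the
    input that they replace, and edges below a common edge are comparable. *)
Lemma free_op_anti (T : tree) (s : seq T) (e : T) : free_op s e ->
  [/\ {in s, forall x, e <= x}, uniq s & {in s &, forall x y, x <= y -> x = y}].
Proof.
elim=> [{}e|{}e _|{}s t {}e st _ [h1 h2 h3]|{}s t x {}e _ [h1 h2 h3] _ [k1 k2 k3]].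
- by split=> // [x|x y]; rewrite !inE => /eqP-> // /eqP->.
- split=> [x||x y]; rewrite ?enum_uniq // !mem_enum !inE.
    by case/andP => /ltW.
  move=> /andP[ex _] /andP[_ /forallP H] xy.
  by apply/eqP; move: (H x); rewrite ex xy.
- split=> [x|| x y]; rewrite -?(perm_uniq st) // -!(perm_mem st); [exact: h1 | exact: h3].
- have xs y : y \in s -> x <= y -> False.
    move=> ys xy; have E : x = y by apply: h3; rewrite ?inE ?eqxx ?ys ?orbT.
    by move: h2; rewrite /= E ys.
  have ys y z : y \in s -> z \in t -> y <= z -> False.
    move=> ys zt yz; case/orP: (tlinP yz (k1 _ zt)) => [yx|xy]; last exact: xs xy.
    have E : y = x by apply: h3; rewrite ?inE ?eqxx ?ys ?orbT.
    by apply: (xs y ys); rewrite E.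
  have zs y z : y \in s -> z \in t -> z <= y -> False.
    by move=> ys' zt zy; apply: (xs y ys'); apply: le_trans (k1 _ zt) zy.
  split=> [y||y z].
  + rewrite mem_cat => /orP[yt|ys']; last by apply: h1; rewrite inE ys' orbT.
    by apply: le_trans (k1 _ yt); apply: h1; rewrite inE eqxx.
  + move: h2 => /= /andP[_ Us]; rewrite cat_uniq k2 Us andbT /=.
    by apply/hasPn => y ys'; apply/negP => yt; apply: (ys y y).
  + rewrite !mem_cat => /orP[yt|ys'] /orP[zt|zs'] yz.
    * exact: k3.
    * by case: (zs z y).
    * by case: (ys y z).
    * by apply: h3; rewrite ?inE ?ys' ?zs' ?orbT.
Qed.

Section ClosedMaps.
Variables (S T : tree) (f : treemap S T).
Hypothesis Sc : closed S.

Lemma above_anti (e : S) :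
  [/\ {in above e, forall x, f e <= f x}, {in above e &, injective f} &
      {in above e &, forall x y, f x <= f y -> x = y}].
Proof.
have eL : e \notin leaves S by rewrite (eqP Sc) inE.
have [h1 h2 h3] := free_op_anti (ofunP f eL).
split.
- by move=> x xe; apply: h1; apply: map_f; rewrite mem_enum.
- exact/dinjectiveP.
- move=> x y xe ye xy; apply: (dinjectiveP _ _ h2) => //.
  by apply: h3; rewrite ?map_f ?mem_enum.
Qed.

Lemma aboveP (U : tree) (e x : U) : reflect (e < x /\ forall y : U, e < y -> y <= x -> y = x) (x \in above e).
Proof.
rewrite inE; apply: (iffP andP) => -[ex H]; split=> //.
  by move=> y ey yx; apply/eqP; move/forallP: H => /(_ y); rewrite ey yx.
by apply/forallP => y; apply/implyP => /andP[ey yx]; apply/eqP/H.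
Qed.

Lemma ctree_mono (x y : S) : x <= y -> f x <= f y.
Proof.
have [n] := ubnP #|[set z : S | (x <= z) && (z <= y)]|; elim: n x => // n IH x le_n.
rewrite le_eqVlt => /orP[/eqP-> //|xy].
have [z zx zy] := above_ex xy; have [h _ _] := above_anti x.
apply: le_trans (h z zx) _; apply: IH => //.
have [xz _] := aboveP _ _ zx.
rewrite -ltnS; apply: leq_trans le_n; rewrite ltnS; apply: proper_card; apply/properP; split.
  by apply/subsetP => w; rewrite !inE => /andP[zw ->]; rewrite (le_trans (ltW xz) zw).
exists x; rewrite !inE ?lexx ?(ltW xy) // negb_and.
by rewrite (lt_geF xz).
Qed.

(** For incomparable edges, take a largest common lower bound [e]. The branches towards [x] and [y]
    directly above [e] have comparable images, so they coincide, against the choice of [e]. *)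
Lemma ctree_indep (x y : S) : f x <= f y -> x >=< y.
Proof.
move=> fxy; apply: contraT => nc.
have Pr : (root S <= x) && (root S <= y) by rewrite !rootP.
have [e /andP[ex ey] emax] :=
  @arg_maxnP S (root S) (fun e => (e <= x) && (e <= y)) (fun e : S => #|[set z : S | z <= e]|) Pr.
have nex : e < x.
  rewrite lt_neqAle ex andbT; apply: contraNneq nc => Ee.
  by rewrite /Order.comparable -Ee ey.
have ney : e < y.
  rewrite lt_neqAle ey andbT; apply: contraNneq nc => Ee.
  by rewrite /Order.comparable -Ee ex orbT.
have [x' x'e x'x] := above_ex nex; have [y' y'e y'y] := above_ex ney.
have [h1 h2 h3] := above_anti e.
have fx' := ctree_mono x'x; have fy' := ctree_mono y'y.
have E : x' = y'.
  case/orP: (tlinP (le_trans fx' fxy) fy') => h; first exact: h3.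
  by apply/esym/h3.
have [lt _] := aboveP _ _ x'e.
have := emax x'; rewrite x'x E y'y => /(_ isT) /=; rewrite leqNgt => /negP[].
apply: proper_card; apply/properP; split.
  by apply/subsetP => w; rewrite !inE -E => we; apply: le_trans we (ltW lt).
by exists y'; rewrite !inE ?lexx // -E lt_geF.
Qed.
End ClosedMaps.

Section SubEdges.
Variables (T : tree) (A : {set T}).

Definition sub_edge : Type := {x : T | x \in A}.
HB.instance Definition _ := Finite.copy sub_edge {x : T | x \in A}.
HB.instance Definition _ := SubFinite.copy sub_edge {x : T | x \in A}.
HB.instance Definition _ := [SubChoice_isSubPOrder of sub_edge by <: with tdisp T].

Lemma sub_edge_le (x y : sub_edge) : (x <= y) = (val x <= val y).
Proof. by rewrite leEsub. Qed.
End SubEdges.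

Section Convex.
Variable T : tree.

Definition convex (A : {set T}) : Prop :=
  (exists2 r, r \in A & forall x, x \in A -> r <= x) /\
  forall x y z, x \in A -> z \in A -> x <= y -> y <= z -> y \in A.

Section TreeOf.
Variables (A : {set T}) (Aconv : convex A).

Lemma sub_root_ex : exists r : sub_edge A, forall x : sub_edge A, r <= x.
Proof.
case: Aconv => [[r rA rmin] _]; exists (exist _ r rA) => x.
by rewrite sub_edge_le; apply/rmin/valP.
Qed.
Definition sub_root : sub_edge A := sval (cid sub_root_ex).

Lemma sub_lin (x y z : sub_edge A) : y <= x -> z <= x -> (y <= z) || (z <= y).
Proof. by rewrite !sub_edge_le; apply: tlinP. Qed.

Lemma sub_leaves (l x : sub_edge A) : l \in (set0 : {set sub_edge A}) -> l <= x -> x = l.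
Proof. by rewrite inE. Qed.

Definition tree_of : tree := @Tree _ (sub_edge A) sub_root (svalP (cid sub_root_ex)) sub_lin set0 sub_leaves.

Lemma tree_of_closed : closed tree_of. Proof. exact: eqxx. Qed.

Lemma tree_of_le (x y : tree_of) : (x <= y) = (val x <= val y).
Proof. exact: sub_edge_le. Qed.

(** By convexity no intermediate edge of [T] is lost, so valences cannot grow in the subtree. *)
Lemma above_of (e x : tree_of) : (x \in above e) = (val x \in above (val e)).
Proof.
apply/aboveP/aboveP => -[].
  rewrite !lt_neqAle !tree_of_le => /andP[ne ex] H; split.
    by rewrite ex andbT; apply: contraNneq ne => E; apply/eqP/val_inj.
  move=> y ey yx; have yA : y \in A.
    by case: Aconv => _ c; apply: (c (val e) y (val x)) => //; [exact: valP | exact: valP | exact: ltW].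
  pose y' : tree_of := exist _ y yA; have E : y' = x.
    apply: H; rewrite ?lt_neqAle !tree_of_le //= (ltW ey) andbT.
    by apply/negP => /eqP Ee; move: ey; rewrite Ee ltxx.
  by rewrite -E.
rewrite !lt_neqAle !tree_of_le => /andP[ne ex] H; split.
  by rewrite ex andbT; apply: contraNneq ne => ->.
move=> y; rewrite lt_neqAle !tree_of_le => /andP[ney ey] yx.
by apply/val_inj/H => //; rewrite lt_neqAle ey andbT; apply: contraNneq ney => E; apply/eqP/val_inj.
Qed.

Lemma card_above_of (e : tree_of) : (#|above e| <= #|above (val e)|)%N.
Proof.
rewrite -(card_imset _ val_inj); apply: subset_leq_card; apply/subsetP => y.
by case/imsetP => x xe ->; rewrite -above_of.
Qed.

Lemma dendr_of j : dendroidal j T -> dendroidal j tree_of.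
Proof. by move/forallP => H; apply/forallP => e; apply: leq_nle (H (val e)); apply: card_above_of. Qed.
End TreeOf.
End Convex.

Section Embed.
Variables (T X Y : tree) (vX : X -> T) (vY : Y -> T).
Hypotheses (Yc : closed Y).
Hypothesis eX : forall x x', (vX x <= vX x') = (x <= x').
Hypothesis eY : forall y y', (vY y <= vY y') = (y <= y').
Hypothesis XY : forall x, exists y, vY y = vX x.

Definition emb_fun (x : X) : Y := sval (cid (XY x)).
Lemma emb_funE x : vY (emb_fun x) = vX x. Proof. exact: (svalP (cid (XY x))). Qed.

Lemma emb_homo : {homo emb_fun : x y / x <= y}.
Proof. by move=> x y; rewrite -eX -eY !emb_funE. Qed.
Lemma emb_indep x y : x >< y -> emb_fun x >< emb_fun y.
Proof. by rewrite /Order.comparable -!eX -!eY !emb_funE. Qed.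
Definition emb : treemap X Y := @cmap X Y emb_fun Yc emb_homo emb_indep.
Lemma embE x : vY (emb x) = vX x. Proof. exact: emb_funE. Qed.
End Embed.

Lemma emb_inj (T X : tree) (v : X -> T) : (forall x x', (v x <= v x') = (x <= x')) -> injective v.
Proof. by move=> e x y E; apply: le_anti; rewrite -!e E lexx. Qed.

Section Over.
Variables (j : option nat) (T : tree) (F : presheaf (Omegac j)).

(* Closed trees embedded in [T] as ordered sets; the maps over [T] between them are
   determined by inclusion of the images. *)
Record ov := Ov { ovt :> ctree j; ovv : ovt -> T; ovP : forall x x', (ovv x <= ovv x') = (x <= x') }.

Definition osub (X Y : ov) : Prop := forall x : X, exists y : Y, ovv y = ovv x.

Definition ovm (X Y : ov) (s : osub X Y) : @hom (Omegac j) X Y :=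
  emb (ctr_closed Y) (@ovP X) (@ovP Y) s.

Lemma ovmE (X Y : ov) (s : osub X Y) x : ovv (ovm s x) = ovv x.
Proof. exact: embE. Qed.

Lemma ov_inj (X : ov) : injective (@ovv X). Proof. exact: (emb_inj (@ovP X)). Qed.

Lemma over_eq (S : ctree j) (Y : ov) (h h' : @hom (Omegac j) S Y) :
  (forall x, ovv (h x) = ovv (h' x)) -> h = h'.
Proof. by move=> E; apply: treemap_ext => x; apply/ov_inj/E. Qed.

Lemma dmap_over (X Y : ov) (s : osub X Y) (h : @hom (Omegac j) X Y) n (x : F Y n) :
  (forall x, ovv (h x) = ovv x) -> dmap F (a := Y) (b := X) h n x = dmap F (a := Y) (b := X) (ovm s) n x.
Proof. by move=> E; congr (dmap F _ n x); apply: over_eq => y; rewrite E ovmE. Qed.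

Lemma dmap_ovm (X Y Z : ov) (s : osub X Y) (s' : osub Y Z) (s'' : osub X Z) n (x : F Z n) :
  dmap F (a := Y) (b := X) (ovm s) n (dmap F (a := Z) (b := Y) (ovm s') n x) =
  dmap F (a := Z) (b := X) (ovm s'') n x.
Proof.
rewrite -[LHS](@dmapM _ F); congr (dmap F _ n x); apply: over_eq => y.
by rewrite [LHS]ovmE !ovmE.
Qed.

Lemma dmap_ovm1 (X : ov) (s : osub X X) n (x : F X n) :
  dmap F (a := X) (b := X) (ovm s) n x = x.
Proof.
rewrite -[RHS](@dmap1 _ F); congr (dmap F _ n x); apply: over_eq => y; exact: ovmE.
Qed.

Lemma ov_iso (X Y : ov) (s : osub X Y) (s' : osub Y X) : sequiv (dmap F (a := Y) (b := X) (ovm s)).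
Proof.
apply: (@sequiv_inv _ _ _ (dmap F (a := X) (b := Y) (ovm s'))); apply: htpy_refl => n x /=.
  have sY : osub Y Y by move=> y; exists y.
  by rewrite (dmap_ovm _ _ sY) dmap_ovm1.
have sX : osub X X by move=> y; exists y.
by rewrite (dmap_ovm _ _ sX) dmap_ovm1.
Qed.
End Over.

Section Conv.
Variables (j : option nat) (T : ctree j).

Definition cset : Type := {A : {set T} | convex A}.

Definition cvcat : category :=
  full (C := @precat {set T} (fun A B => A \subset B) (@subxx _ _)
       (fun B A C => @subset_trans _ A B C)) (fun A : cset => sval A).

Definition ct (A : cset) : ctree j :=
  CTree (tree_of_closed (proj2_sig A)) (dendr_of (proj2_sig A) (ctr_dendr T)).

Definition cov (A : cset) : ov j T :=
  @Ov j T (ct A) (fun x => val x) (fun x x' => esym (tree_of_le x x')).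

Lemma cov_sub (A B : cset) : sval A \subset sval B -> osub (cov A) (cov B).
Proof. by move=> /subsetP s [x xA]; exists (exist _ x (s x xA)). Qed.

Definition cvf : functor cvcat (Omegac j).
refine (@Functor cvcat (Omegac j) (fun A => ct A) (fun A B h => ovm (cov_sub h)) _ _).
- by move=> A; apply: (@over_eq j T (ct A) (cov A)) => x; rewrite ovmE.
- move=> A B E g f; apply: (@over_eq j T (ct A) (cov E)) => x.
  by rewrite ovmE [RHS]ovmE ovmE.
Defined.

Definition J : category := op cvcat.
Definition Dg (F : presheaf (Omegac j)) : diagram J := pullback cvf F.

Lemma J_thin (x y : J) (u v : hom x y) : u = v.
Proof. exact: bool_irrelevance. Qed.

Lemma cset_eq (A B : cset) : sval A = sval B -> A = B.
Proof. by case: A B => [A cA] [B cB] /= E; apply: eq_exist. Qed.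

Definition crank (A : J) : nat := #|sval A|.

Lemma J_rlt (x y : J) : hom x y -> x = y \/ (crank y < crank x)%N.
Proof.
move=> h; have h' : sval y \subset sval x by [].
case: (eqVproper h') => [E|p]; first by left; apply/esym/cset_eq.
by right; apply: proper_card.
Qed.

Lemma cgeE (A B : J) : cge A B <-> (sval B \subset sval A).
Proof. by split=> [[u _]|h]; [exact: u | exists h]. Qed.

Lemma convexT : convex [set: T].
Proof.
split; last by move=> x y z _ _ _ _; rewrite inE.
by exists (root T) => [|x _]; [rewrite inE | apply: rootP].
Qed.
Definition A0 : J := exist _ [set: T] convexT.

Definition idov : ov j T := @Ov j T T id (fun _ _ => erefl).

Lemma sub_idov X : osub X idov. Proof. by move=> x; exists (ovv x). Qed.
Lemma idov_A0 : osub idov (cov A0). Proof. by move=> x; exists (exist _ x (in_setT x)). Qed.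

Lemma A0_ge A : cge A0 A. Proof. by apply/cgeE; apply/subsetP => x _; rewrite inE. Qed.

Definition croot (A : cset) : T := val (root (ct A)).
Lemma crootP (A : cset) : croot A \in sval A. Proof. exact: (valP (root (ct A) : sub_edge _)). Qed.
Lemma croot_min (A : cset) x : x \in sval A -> croot A <= x.
Proof. by move=> xA; have := rootP (exist _ x xA : ct A); rewrite tree_of_le. Qed.

Lemma cconv (A : cset) x y z : x \in sval A -> z \in sval A -> x <= y -> y <= z -> y \in sval A.
Proof. by have [_ c] := proj2_sig A; apply: c. Qed.

(* Height at most one. *)
Definition flat (A : cset) : Prop :=
  forall x y z, x \in sval A -> y \in sval A -> z \in sval A -> x < y -> ~~ (y < z).

Lemma flat_convex (A : cset) (B : {set T}) : flat A -> B \subset sval A -> croot A \in B -> convex B.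
Proof.
move=> fA /subsetP BA rB; split=> [|x y z xB zB xy yz].
  by exists (croot A) => // x xB; apply/croot_min/BA.
have yA : y \in sval A by apply: cconv xy yz; apply: BA.
have [<-//|nxy] := eqVneq x y; have [->//|nyz] := eqVneq y z.
have := fA x y z (BA _ xB) yA (BA _ zB).
by rewrite !lt_neqAle nxy nyz xy yz => /(_ isT).
Qed.

Variable k : option nat.
Definition kd (A : J) : Prop := dendroidal k (ct A).
Definition Vk (A B : J) : Prop := cge A B /\ kd B.

Lemma kdP (A : cset) : kd A <-> forall e, e \in sval A -> nle #|[set x in sval A | x \in above e]| k.
Proof.
have E (e : ct A) : #|above e| = #|[set x in sval A | x \in above (val e)]|.
  rewrite -(card_imset _ val_inj); apply: eq_card => x; rewrite inE.
  apply/imsetP/andP => [[y ye ->]|[xA xe]]; first by rewrite -above_of; split=> //; apply: valP.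
  by exists (exist _ x xA) => //; rewrite above_of.
split=> [/forallP H e eA|H]; first by have := H (exist _ e eA); rewrite E.
by apply/forallP => e; rewrite E; apply/H/valP.
Qed.

Lemma kd_sub (A B : cset) : kd A -> sval B \subset sval A -> kd B.
Proof.
move=> /kdP H /subsetP BA; apply/kdP => e eB; apply: leq_nle (H e (BA _ eB)).
by apply/subset_leq_card/subsetP => x; rewrite !inE => /andP[/BA-> ->].
Qed.

Lemma flat_sub (A B : cset) : flat A -> sval B \subset sval A -> flat B.
Proof. by move=> fA /subsetP BA x y z xB yB zB; apply: fA; apply: BA. Qed.
End Conv.

(** * Corollas *)

Definition kcone (j : option nat) (T : ctree j) (F : presheaf (Omegac j)) (A : J T) (U : J T -> Prop)
    (UA : forall x, U x -> cge A x) : cone (Dg T F A) (dcomp (Dg T F) (sinc U)) :=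
  @ucone (J T) (Dg T F) (@J_thin j T) A U UA.

Lemma kcone_leg (j : option nat) (T : ctree j) (F : presheaf (Omegac j)) (A : J T) (U : J T -> Prop)
    (UA : forall x, U x -> cge A x) (B : subc U) n x (s : osub (cov (sval B)) (cov A)) :
  leg (kcone F UA) B n x = dmap F (a := ct A) (b := ct (sval B)) (ovm s) n x.
Proof. by apply: (@dmap_over j T F (cov (sval B)) (cov A)) => y; apply: ovmE. Qed.

Section Flat.
Variables (k j : option nat) (hk : nle 1 k) (hkj : kle k j) (T : ctree j) (F : presheaf (Omegac j)).
Hypothesis hF : forall X, hep (F X).
Variables (A : J T) (fA : flat A).

Variables (n : nat) (tip : 'I_n -> T).
Hypothesis tip_inj : injective tip.
Hypothesis tipP : forall i, tip i \in sval A /\ tip i != croot A.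
Hypothesis tip_surj : forall x, x \in sval A -> x != croot A -> exists i, tip i = x.

Lemma tip_gt i : croot A < tip i.
Proof. by have [iA ir] := tipP i; rewrite lt_neqAle eq_sym ir croot_min. Qed.
Lemma tip_le i x : x \in sval A -> tip i <= x -> x = tip i.
Proof.
move=> xA ix; have := fA (crootP A) (tipP i).1 xA (tip_gt i).
by rewrite lt_neqAle ix andbT negbK => /eqP.
Qed.
Lemma tip_above i : tip i \in above (croot A).
Proof.
apply/aboveP; split=> [|y ry yi]; first exact: tip_gt.
have yA : y \in sval A by apply: cconv (ltW ry) yi; [exact: crootP | exact: (tipP i).1].
have := fA (crootP A) yA (tipP i).1 ry.
by rewrite lt_neqAle yi andbT negbK => /eqP.
Qed.

Definition vst (S : finType) (h : S -> 'I_n) (x : star S) : T := if x is Some s then tip (h s) else croot A.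

Lemma vst_le (S : finType) (h : S -> 'I_n) (x x' : star S) : injective h ->
  (vst h x <= vst h x') = (x <= x').
Proof.
move=> hi; rewrite star_leE; case: x x' => [s|] [s'|] /=; rewrite ?lexx //.
- apply/idP/eqP => [le|[->]//]; congr Some; apply/hi/tip_inj/esym.
  exact: tip_le (tipP _).1 le.
- by rewrite (lt_geF (tip_gt _)).
- by rewrite ltW ?tip_gt.
Qed.

Variable hnj : nle n j.

Definition ovC : ov j T :=
  @Ov j T (cbarn hnj) (@vst 'I_n id) (fun x x' => vst_le x x' (fun _ _ => id)).

Definition ovCI (I : powerset_le k n) : ov j T :=
  @Ov j T (cbarI hkj I) (@vst (leaves_of I) (fun s => sval s)) (fun x x' => vst_le x x' val_inj).

Definition Rset (I : powerset_le k n) : {set T} := croot A |: [set tip i | i in sval I].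

Lemma RsetP (I : powerset_le k n) x : reflect (exists y : ovCI I, ovv y = x) (x \in Rset I).
Proof.
rewrite !inE; apply: (iffP orP) => [[/eqP->|/imsetP[i iI ->]]|[[s|] <-]].
- by exists None.
- by exists (Some (exist _ i iI)).
- by right; apply/imsetP; exists (sval s) => //; apply: valP.
- by left.
Qed.

Lemma Rset_sub I : Rset I \subset sval A.
Proof. by apply/subsetP => x /RsetP[[s|] <-]; [exact: (tipP _).1 | exact: crootP]. Qed.

Lemma Rset_convex I : convex (Rset I).
Proof. by apply: flat_convex fA (Rset_sub I) _; rewrite !inE eqxx. Qed.

Definition Rcset (I : powerset_le k n) : cset T := exist _ (Rset I) (@Rset_convex I).

Lemma R_Vk I : Vk k A (Rcset I).
Proof.
split; first by apply/cgeE/Rset_sub.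
apply/kdP => e eR; apply: leq_nle (svalP I).
apply: (@leq_trans #|[set tip i | i in sval I]|); last exact: leq_imset_card.
apply/subset_leq_card/subsetP => x; rewrite inE => /andP[xR /aboveP[lt _]].
move: xR; rewrite !inE => /orP[/eqP E|//]; rewrite {}E in lt.
by have := croot_min (subsetP (Rset_sub I) _ eR); rewrite (lt_geF lt).
Qed.

Definition Lset (B : cset T) : {set 'I_n} := [set i | tip i \in sval B].

(** If [B] contains the root of [A], its tips are bounded by the valence there. Otherwise [B] is a
    single tip, and $k\ge1$ is what admits it. *)
Lemma L_card (B : subc (Vk k A)) : nle #|Lset (sval B)| k.
Proof.
case: B => B [/cgeE BA /kdP kB] /=.
have [rB|nrB] := boolP (croot A \in sval B).
  apply: leq_nle (kB _ rB); rewrite -(card_imset _ tip_inj).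
  apply/subset_leq_card/subsetP => x /imsetP[i + ->].
  by move=> iB; rewrite inE tip_above andbT; move: iB; rewrite inE.
apply: leq_nle hk; apply/card_le1_eqP => i i'; rewrite !inE => iB i'B.
have bB := crootP B; have bA := subsetP BA _ bB.
have br : croot B != croot A by apply: contraNneq nrB => <-.
have [l El] := tip_surj bA br.
have E x : x \in sval B -> x = croot B.
  by move=> xB; rewrite -El; apply: tip_le; [exact: (subsetP BA) | rewrite El croot_min].
by apply: tip_inj; rewrite (E _ iB) (E _ i'B).
Qed.

Definition Lps (B : subc (Vk k A)) : powerset_le k n := exist _ (Lset (sval B)) (L_card B).

Definition Rf : functor (op (powerset_le k n)) (subc (Vk k A)).
refine (@Functor (op (powerset_le k n)) (subc (Vk k A)) (fun I => exist _ (Rcset I) (R_Vk I))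
  (fun I I' h => (_ : Rset I' \subset Rset I)) _ _).
- by move=> I; apply: bool_irrelevance.
- by move=> *; apply: bool_irrelevance.
Unshelve.
by apply/setUS/imsetS; apply: h.
Defined.

Definition Lf : functor (subc (Vk k A)) (op (powerset_le k n)).
refine (@Functor (subc (Vk k A)) (op (powerset_le k n)) Lps
  (fun B B' h => (_ : Lset (sval B') \subset Lset (sval B))) _ _).
- by move=> I; apply: bool_irrelevance.
- by move=> *; apply: bool_irrelevance.
Unshelve.
by apply/subsetP => i; rewrite !inE; apply: (subsetP h).
Defined.

Lemma sub_CI_R I : osub (ovCI I) (cov (Rcset I)).
Proof.
move=> y; have yR : ovv y \in Rset I by apply/RsetP; exists y.
by exists (exist _ (ovv y) yR).
Qed.

Lemma sub_B_CI (B : subc (Vk k A)) : osub (cov (sval B)) (ovCI (Lps B)).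
Proof.
case: B => B BV [x xB] /=; have [/cgeE BA _] := BV.
have [->|xr] := eqVneq x (croot A); first by exists None.
have [i E] := tip_surj (subsetP BA _ xB) xr.
have iL : i \in Lset B by rewrite inE E.
by exists (Some (exist _ i iL)).
Qed.

Lemma sub_CI (I I' : powerset_le k n) (h : hom I I') : osub (ovCI I) (ovCI I').
Proof. by case=> [s|]; [exists (Some (leaf_incl h s)) | exists None]. Qed.

Lemma corolla_diag_map (I I' : powerset_le k n) (h : hom I I') m (x : F (cbarI hkj I') m) :
  dmap (corolla_diag hkj n F) (a := I') (b := I) h m x =
  dmap F (a := ovCI I') (b := ovCI I) (ovm (sub_CI h)) m x.
Proof. by apply: (@dmap_over j T F (ovCI I) (ovCI I')) => -[s|]. Qed.

Definition fCI (I : op (powerset_le k n)) : smap (Dg T F (Rcset I)) (corolla_diag hkj n F I) :=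
  dmap F (a := cov (Rcset I)) (b := ovCI I) (ovm (@sub_CI_R I)).

Definition gCI (B : subc (Vk k A)) : smap (corolla_diag hkj n F (Lps B)) (Dg T F (sval B)) :=
  dmap F (a := ovCI (Lps B)) (b := cov (sval B)) (ovm (@sub_B_CI B)).

Lemma osub_trans (X Y Z : ov j T) : osub X Y -> osub Y Z -> osub X Z.
Proof. by move=> s s' x; have [y <-] := s x; apply: s'. Qed.

Lemma fCI_nat (I I' : op (powerset_le k n)) (u : hom I I') m (x : dcomp (Dg T F) (sinc (Vk k A)) (Rf I) m) :
  fCI I' m (dmap (dcomp (Dg T F) (sinc (Vk k A))) (fmap Rf u) m x) = dmap (corolla_diag hkj n F) u m (fCI I m x).
Proof.
rewrite corolla_diag_map /fCI.
have s : osub (ovCI I') (cov (Rcset I)) := osub_trans (@sub_CI I' I u) (@sub_CI_R I).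
transitivity (dmap F (a := cov (Rcset I)) (b := ovCI I') (ovm s) m x).
  exact: (@dmap_ovm j T F (ovCI I') (cov (Rcset I')) (cov (Rcset I))).
by apply/esym; exact: (@dmap_ovm j T F (ovCI I') (ovCI I) (cov (Rcset I))).
Qed.

Lemma gCI_nat (B B' : subc (Vk k A)) (u : hom B B') m (x : corolla_diag hkj n F (Lf B) m) :
  gCI B' m (dmap (corolla_diag hkj n F) (fmap Lf u) m x) = dmap (dcomp (Dg T F) (sinc (Vk k A))) u m (gCI B m x).
Proof.
rewrite (corolla_diag_map (fmap Lf u)) /gCI.
have s : osub (cov (sval B')) (ovCI (Lps B)) := osub_trans (@sub_B_CI B') (sub_CI (fmap Lf u)).
transitivity (dmap F (a := ovCI (Lps B)) (b := cov (sval B')) (ovm s) m x).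
  exact: (@dmap_ovm j T F (cov (sval B')) (ovCI (Lps B')) (ovCI (Lps B))).
by apply/esym; exact: (@dmap_ovm j T F (cov (sval B')) (cov (sval B)) (ovCI (Lps B))).
Qed.

Lemma flat_tau (B : subc (Vk k A)) : sval (sval B) \subset Rset (Lps B).
Proof.
apply/subsetP => x xB; apply/RsetP; have [y E] := @sub_B_CI B (exist _ x xB).
by exists y; rewrite E.
Qed.

Lemma flat_eps (I : powerset_le k n) : sval I \subset Lset (Rcset I).
Proof. by apply/subsetP => i iI; rewrite !inE imset_f ?orbT. Qed.

Definition flat_pull : smap (hU (Dg T F) (Vk k A)) (holim (corolla_diag hkj n F)) :=
  @hpull (op (powerset_le k n)) (subc (Vk k A)) Rf (dcomp (Dg T F) (sinc (Vk k A))) (corolla_diag hkj n F)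
    fCI fCI_nat.

(** Adding the root to [B] gives the subcorolla on its tips, so the subcorollas through the root
    suffice to compute the limit. *)
Lemma flat_pull_equiv : sequiv flat_pull.
Proof.
apply: (@holim_adj (op (powerset_le k n)) (subc (Vk k A)) Rf Lf (dcomp (Dg T F) (sinc (Vk k A)))
  (corolla_diag hkj n F) fCI fCI_nat gCI gCI_nat (fun B => flat_tau B) _ _ (fun I => flat_eps I)).
- by move=> *; apply: bool_irrelevance.
- move=> B m x; exact: (@dmap_ovm j T F (cov (sval B)) (ovCI (Lps B)) (cov (Rcset (Lps B)))).
- by move=> *; apply: bool_irrelevance.
- move=> I m x; refine (etrans _ (esym (@corolla_diag_map I (Lf (Rf I)) (flat_eps I) m x))).
  exact: (@dmap_ovm j T F (ovCI I) (cov (Rcset I)) (ovCI (Lps (Rf I)))).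
Qed.

Lemma ovC_A : osub ovC (cov A).
Proof. by case=> [i|]; [exists (exist _ (tip i) (tipP i).1) | exists (exist _ (croot A) (crootP A))]. Qed.

Lemma A_ovC : osub (cov A) ovC.
Proof.
case=> x xA /=; have [->|xr] := eqVneq x (croot A); first by exists None.
by have [i <-] := tip_surj xA xr; exists (Some i).
Qed.

Lemma Vk_ge B : Vk k A B -> cge A B. Proof. by case. Qed.

Lemma flat_square m (x : Dg T F A m) :
  flat_pull m (canon (kcone F Vk_ge) m x) =
  canon (corolla_cone hkj hnj F) m (dmap F (a := cov A) (b := ovC) (ovm ovC_A) m x).
Proof.
apply: holim_ext => q y c; rewrite -!sfunP hval_hpull !hval_canon.
set I := c ord_max; have s : osub (ovCI I) (cov A) := osub_trans (@sub_CI_R I) (@cov_sub j T (Rcset I) A (Rset_sub I)).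
have s' : osub (ovCI I) ovC by case=> [t|]; [exists (Some (sval t)) | exists None].
transitivity (dmap F (a := cov A) (b := ovCI I) (ovm s) q (act (s := F (cov A)) y x)).
  rewrite (@kcone_leg j T F A _ Vk_ge (Rf I) q _ (@cov_sub j T (Rcset I) A (Rset_sub I))).
  exact: (@dmap_ovm j T F (ovCI I) (cov (Rcset I)) (cov A)).
rewrite /= /corolla_leg.
transitivity (dmap F (a := ovC) (b := ovCI I) (ovm s') q
  (dmap F (a := cov A) (b := ovC) (ovm ovC_A) q (act (s := F (cov A)) y x))).
  by apply/esym; exact: (@dmap_ovm j T F (ovCI I) ovC (cov A)).
rewrite (sfunP (dmap F (a := cov A) (b := ovC) (ovm ovC_A)) y x).
apply/esym; refine (@dmap_over j T F (ovCI I) ovC s' (star_map (leaf_val_inj (I := I))) q _ _).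
by case.
Qed.

Lemma flat_corolla : sequiv (canon (kcone F Vk_ge)) <-> sequiv (canon (corolla_cone hkj hnj F)).
Proof.
have i : sequiv (dmap F (a := cov A) (b := ovC) (ovm ovC_A)) by apply: ov_iso; apply: A_ovC.
have hH : hep (holim (corolla_diag hkj n F)) by apply: hep_holim => I; apply: hF.
have hV : hep (hU (Dg T F) (Vk k A)) by apply: hD_hU => B; apply: hF.
have E : scomp flat_pull (canon (kcone F Vk_ge)) =
    scomp (canon (corolla_cone hkj hnj F)) (dmap F (a := cov A) (b := ovC) (ovm ovC_A)).
  by apply: smap_ext => m x; exact: (flat_square x).
split=> e.
  have e' := sequiv_comp (@hF (ct A)) hH e flat_pull_equiv.
  refine (@sequiv_cancel_pre _ _ _ _ (canon (corolla_cone hkj hnj F)) (@hF (cbarn hnj)) i _).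
  by rewrite -E.
have e' := sequiv_comp (@hF (ct A)) hH i e.
refine (@sequiv_cancel_post _ _ _ (canon (kcone F Vk_ge)) _ hV flat_pull_equiv _).
by rewrite E.
Qed.
End Flat.

(** * The Segal condition *)

Lemma ctree_le (S T : tree) (f : treemap S T) (Sc : closed S) x y :
  injective f -> (f x <= f y) = (x <= y).
Proof.
move=> fi; apply/idP/idP => [le|]; last exact: (ctree_mono f Sc).
have /orP[//|yx] := ctree_indep Sc le.
have E : f x = f y by apply: le_anti; rewrite le (ctree_mono f Sc yx).
by rewrite (fi _ _ E).
Qed.

Section Elem.
Variable X : elem.
Notation U := (elem_tree X : tree).

Definition is_cor : bool := if X is El_corolla _ then true else false.

Lemma elem_flat (a b c : U) : a < b -> ~~ (b < c).
Proof.
case: X a b c => [|n] a b c /=; first by rewrite [a]ord1 [b]ord1 ltxx.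
rewrite !lt_neqAle !star_leE; case: a => [a|] /=; first by case: eqP.
by case: b => [b|] // _; case: eqP.
Qed.

Lemma elem_eta (a b : U) : ~~ is_cor -> a = b.
Proof. by rewrite /is_cor; case: X a b => // a b _; rewrite [a]ord1 [RHS]ord1. Qed.

Lemma elem_above (e : U) : is_cor -> (e \in above (root U)) = (e != root U).
Proof.
rewrite /is_cor; case: X e => // n e _; apply/aboveP/idP => [[lt _]|ne].
  by apply: contraTneq lt => ->; rewrite ltxx.
split; first by rewrite lt_neqAle eq_sym ne star_leE.
case: e ne => // e _ [y|] //; first by rewrite star_leE /= => _ /eqP.
Qed.

Lemma elem_leaf (e : U) : e \notin leaves U -> is_cor /\ e = root U.
Proof.
rewrite /is_cor; case: X e => [|n] /= e; first by rewrite inE.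
by case: e => [i|] //= /imsetP[]; exists i.
Qed.

Lemma elem_root_leaf : is_cor -> root U \notin leaves U.
Proof. by rewrite /is_cor; case: X => //= n _; apply/imsetP => -[]. Qed.
End Elem.

Section El.
Variables (j : option nat) (T : ctree j) (F : presheaf (Omegac j)).
Hypothesis hF : forall X, hep (F X).
Variable A : J T.
Notation E := (elOver (ct A)).

Definition elt (x : E) : Omega := elem_tree (csrc (sval x)).
Definition elf (x : E) : treemap (elt x) (ct A) := carr (sval x).
Definition elv (x : E) (e : elt x) : T := val (elf x e).
Definition isC (x : E) : bool := is_cor (csrc (sval x)).

Lemma elf_inj x : injective (elf x). Proof. exact: (svalP x).1.1. Qed.

Lemma elf_conv x (e0 e2 : elt x) (e' : ct A) : elf x e0 <= e' -> e' <= elf x e2 -> exists e, elf x e = e'.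
Proof. exact: (svalP x).1.2. Qed.

Lemma elf_le x (e e' : elt x) : (elf x e <= elf x e') = ((e : cl (elt x)) <= e').
Proof. exact: (ctree_le (f := cl_adj (ctr_closed (ct A)) (elf x)) (cl_closed _) _ _ (@elf_inj x)). Qed.

Lemma elv_le x (e e' : cl (elt x)) : (elv e <= elv e') = (e <= e').
Proof. by rewrite -elf_le [RHS]tree_of_le. Qed.

Definition elov (x : E) : ov j T := @Ov j T (el_cl (ct A) x) (@elv x) (@elv_le x).

Definition elS (x : E) : {set T} := [set elv e | e : elt x].
Definition elroot (x : E) : T := elv (root (elt x)).

Lemma elS_in x (e : elt x) : elv e \in elS x. Proof. exact: imset_f. Qed.

Lemma elS_sub x : elS x \subset sval A.
Proof. by apply/subsetP => _ /imsetP[e _ ->]; apply: (valP (elf x e : sub_edge _)). Qed.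

Lemma elroot_min x y : y \in elS x -> elroot x <= y.
Proof. by case/imsetP => e _ ->; rewrite elv_le; apply: (rootP (t := cl (elt x))). Qed.
Lemma elrootP x : elroot x \in elS x. Proof. exact: elS_in. Qed.

Lemma elt_flat x (a b c : elt x) : a < b -> ~~ (b < c).
Proof. exact: elem_flat. Qed.

Lemma elv_lt x (a b : elt x) : (elv a < elv b) = (a < b).
Proof. by rewrite !lt_neqAle elv_le (inj_eq (@emb_inj _ (cl (elt x)) _ (@elv_le x))). Qed.

Lemma elS_convex x : convex (elS x).
Proof.
split; first by exists (elroot x); [exact: elrootP | exact: elroot_min].
move=> a y c /imsetP[e _ ->] /imsetP[e' _ ->] le le'.
have yA : y \in sval A.
  by apply: cconv le le'; apply: (valP (elf x _ : sub_edge _)).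
have [||z zE] := @elf_conv x e e' (exist _ y yA); rewrite ?tree_of_le //.
by apply/imsetP; exists z => //; rewrite /elv zE.
Qed.

Definition elset (x : E) : cset T := exist _ (elS x) (elS_convex x).

Lemma elset_flat x : flat (elset x).
Proof. by move=> a b c /imsetP[a' _ ->] /imsetP[b' _ ->] /imsetP[c' _ ->]; rewrite !elv_lt; apply: elt_flat. Qed.

Lemma croot_elset x : croot (elset x) = elroot x.
Proof. by apply: le_anti; rewrite elroot_min ?crootP // croot_min // elrootP. Qed.

Lemma elS_eta x y : ~~ isC x -> y \in elS x -> y = elroot x.
Proof.
by move=> nC /imsetP[e _ ->]; congr elv; apply: elem_eta.
Qed.

Lemma el_homE (x y : E) (u : hom x y) e : elf y (chom u e) = elf x e.
Proof. exact: (congr1 (fun f : treemap _ _ => f e) (chomP u)). Qed.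

Lemma el_thin (x y : E) (u v : hom x y) : u = v.
Proof.
apply: commaHom_ext; apply: treemap_ext => e; apply: (@elf_inj y).
by rewrite [LHS]el_homE [RHS]el_homE.
Qed.

Lemma el_hom_sub (x y : E) (u : hom x y) : elS x \subset elS y.
Proof.
apply/subsetP => _ /imsetP[e _ ->]; apply/imsetP; exists (chom u e) => //.
by rewrite /elv el_homE.
Qed.

Lemma el_card x : isC x -> #|above (elf x (root (elt x)))|.+1 = #|elt x|.
Proof.
move: (svalP x).2; rewrite /isC /elf /elt; case: (sval x) => -[|n] f //= -> _.
by rewrite card_option card_ord.
Qed.

Lemma el_above x (e : elt x) : isC x -> (e \in above (root (elt x))) = (e != root (elt x)).
Proof. exact: elem_above. Qed.

Lemma el_leaf x (e : elt x) : e \notin leaves (elt x) -> isC x /\ e = root (elt x).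
Proof. exact: elem_leaf. Qed.
Lemma el_root_leaf x : isC x -> root (elt x) \notin leaves (elt x).
Proof. exact: elem_root_leaf. Qed.

(** Convexity puts the image inside the root and the edges directly above it; the valence condition
    in [elOb] forces equality by counting. *)
Lemma el_img x (c : ct A) : isC x -> (exists e, elf x e = c) <->
  c = elf x (root (elt x)) \/ c \in above (elf x (root (elt x))).
Proof.
move=> cx; have sub e : e != root (elt x) -> elf x e \in above (elf x (root (elt x))).
  move=> ne; have lt : (root (elt x) : cl (elt x)) < e by rewrite lt_neqAle eq_sym ne rootP.
  apply/aboveP; split=> [|y ry ye].
    by rewrite lt_neqAle elf_le rootP (inj_eq (@elf_inj x)) eq_sym ne.
  have [z zE] := elf_conv (ltW ry) ye; rewrite -zE; congr (elf x _).
  apply/eqP; apply: contraTT ry; rewrite -zE elf_le in ye * => nz.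
  apply/negP => rz; have := @elt_flat x (root (elt x)) z e.
  rewrite [z < e]lt_neqAle nz ye => H; suff /H : root (elt x) < z by [].
  by move: rz; rewrite !lt_neqAle elf_le (inj_eq (@elf_inj x)).
split=> [[e <-]|[->|cA]]; last 2 first.
- by exists (root (elt x)).
- have sE : elf x @: [set~ root (elt x)] = above (elf x (root (elt x))).
    apply/eqP; rewrite eqEcard; apply/andP; split.
      by apply/subsetP => _ /imsetP[e ne ->]; apply: sub; move: ne; rewrite !inE.
    by rewrite card_imset; [rewrite cardsC1 -(el_card cx) | exact: elf_inj].
  by move: cA; rewrite -sE => /imsetP[e _ ->]; exists e.
by have [->|ne] := eqVneq e (root (elt x)); [left | right; apply: sub].
Qed.

Lemma el_hom_ex (x y : E) : (if isC x then isC y /\ elroot x = elroot y else elroot x \in elS y) ->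
  exists u : hom x y, True.
Proof.
move=> xy0.
have xC : isC x -> isC y /\ elroot x = elroot y by move: xy0; case: ifP.
have xy c : c \in elS x -> c \in elS y.
  case: ifP xy0 => [cx [cy rxy]|nx rx]; last by move/elS_eta; rewrite nx => ->.
  case/imsetP => e _ ->; have := (el_img (elf x e) cx).1 (ex_intro _ e erefl).
  have -> : elf x (root (elt x)) = elf y (root (elt y)) by apply: val_inj.
  by move/(el_img (elf x e) cy).2 => [e' E']; apply/imsetP; exists e' => //; rewrite /elv E'.
have hex (e : elt x) : exists e' : elt y, elf y e' = elf x e.
  have /imsetP[e' _ e'E] := xy _ (elS_in e).
  by exists e'; apply: val_inj.
pose h e := sval (cid (hex e)).
have hE e : elf y (h e) = elf x e := proj2_sig (cid (hex e)).
have hP e : e \notin leaves (elt x) -> free_op [seq h x | x <- enum (above e)] (h e).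
  move=> /el_leaf[cx ->]; have [cy rxy] := xC cx.
  have hi : injective h by move=> a b ab; apply: (@elf_inj x); rewrite -!hE ab.
  have hr : h (root (elt x)) = root (elt y).
    by apply: (@elf_inj y); rewrite hE; apply: val_inj; exact: rxy.
  have cxy : #|elt x| = #|elt y| by rewrite -!el_card // -hE hr.
  have [h' hK h'K] := inj_card_bij hi (eq_leq (esym cxy)).
  rewrite hr.
  apply: free_perm (free_gen (el_root_leaf cy)).
  apply: uniq_perm; rewrite ?enum_uniq // ?map_inj_uniq ?enum_uniq // => z.
  rewrite mem_enum el_above //; apply/idP/mapP => [nz|[z' + ->]].
    exists (h' z); rewrite ?h'K // mem_enum el_above //.
    by apply: contraNneq nz => Ez; rewrite -(h'K z) Ez hr.
  by rewrite mem_enum el_above // -hr (inj_eq hi).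
pose hm : treemap (elt x) (elt y) := TreeMap hP.
have hmP : carr (sval y) \c fmap (fullf elem_tree) (hm : hom (csrc (sval x)) (csrc (sval y))) = carr (sval x).
  by apply: treemap_ext => e; exact: hE.
by exists (CommaHom hmP).
Qed.

Definition Vf (B : J T) : Prop := cge A B /\ flat B.

(** The least elementary subtree around a flat [B]: the full corolla at its root, or a bare edge if
    [B] is a single edge. *)
Definition Lspec (B : cset T) (x : E) : Prop :=
  sval B \subset elS x /\
  if isC x then elroot x = croot B /\ exists2 b, b \in sval B & b != croot B
  else elS x \subset sval B.

Lemma el_eta (e : ct A) : exists x : E, ~~ isC x /\ elroot x = val e.
Proof.
have fP (i : eta) : i \notin leaves eta -> free_op (T := ct A) [seq e | x <- enum (above i)] e by rewrite inE.
pose x : comma (fullf elem_tree) (ct A) := @CommaOb _ _ (fullf elem_tree) (ct A : Omega) El_eta (TreeMap (T' := ct A) fP).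
have xP : elOb x.
  do 2 split=> //; first by move=> a b _; rewrite [a]ord1 [b]ord1.
  by move=> e0 e2 e' h1 h2; exists ord0; apply: le_anti; rewrite h1 h2.
by exists (exist _ x xP).
Qed.

Lemma el_cor (e : ct A) : exists x : E, [/\ isC x, elroot x = val e & forall c, c \in above e -> val c \in elS x].
Proof.
pose n := #|above e|.
pose ev (i : 'I_n) : ct A := enum_val i.
pose f (y : star 'I_n) : ct A := if y is Some i then ev i else e.
have fA i : ev i \in above e by apply: enum_valP.
have eS z : z \in above e -> exists i, ev i = z.
  by move=> ze; exists (enum_rank_in ze z); apply: enum_rankK_in.
have fi : injective f.
  have ne i : e <> ev i.
    by move=> E'; have /aboveP[] := fA i; rewrite -E' ltxx.
  case=> [a|] [b|] //= E'; [by rewrite (enum_val_inj E') | by case: (ne a); rewrite E' | by case: (ne b)].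
have cA (y : corolla n) : (y \in above (None : corolla n)) = (y != None).
  exact: (@elem_above (El_corolla n)).
have fP (i : corolla n) : i \notin leaves (corolla n) -> free_op (T := ct A) [seq f x | x <- enum (above i)] (f i).
  case: i => [i|] //=; first by case/imsetP; exists i.
  move=> _; apply: free_perm (free_gen _); last by rewrite inE.
  apply: uniq_perm; rewrite ?enum_uniq // ?map_inj_uniq ?enum_uniq // => z.
  rewrite mem_enum; apply/idP/mapP => [ze|[y + ->]].
    have [i <-] := eS z ze; exists (Some i) => //.
    have : (Some i : corolla n) \in above (None : corolla n) by rewrite cA.
    by rewrite -mem_enum.
  rewrite mem_enum => yA; have : y != None by rewrite -cA.
  by case: y {yA} => // i _; apply: fA.
pose x : comma (fullf elem_tree) (ct A) :=
  @CommaOb _ _ (fullf elem_tree) (ct A : Omega) (El_corolla n) (TreeMap (T := corolla n) (T' := ct A) fP).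
have xP : elOb x.
  split=> //=; split=> // a b c /=.
  case: b => [i|] /=; last first.
    move=> ac ce; exists None => /=; apply: le_anti; rewrite ce andbT.
    apply: le_trans ac; case: a => [i|] //=.
    by have /aboveP[/ltW] := fA i.
  have /aboveP[ei iM] := fA i => ac ci.
  have ec : e <= c.
    apply: le_trans ac; case: a => [i'|] //=.
    by have /aboveP[/ltW] := fA i'.
  have [->|ne] := eqVneq c e; first by exists None.
  by exists (Some i); rewrite /= (iM c) // lt_neqAle eq_sym ne.
exists (exist _ x xP); split=> // c ce.
by have [i <-] := eS c ce; apply/imsetP; exists (Some i : corolla n).
Qed.

Lemma Lspec_ex (B : subc Vf) : exists x, Lspec (sval B) x.
Proof.
case: B => B [/cgeE /subsetP BA fB] /=.
have rA := BA _ (crootP B); pose e : ct A := exist _ (croot B) rA.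
have [/existsP[b /andP[bB br]]|nb] := boolP [exists b, (b \in sval B) && (b != croot B)].
  have [x [xC xr xS]] := el_cor e; exists x; split; last by rewrite xC; split=> //; exists b.
  apply/subsetP => c cB; have [->|cr] := eqVneq c (croot B).
    by rewrite -[croot B]/(val e) -xr elrootP.
  have lt : croot B < c by rewrite lt_neqAle eq_sym cr croot_min.
  apply: (xS (exist _ c (BA _ cB))); rewrite above_of; apply/aboveP; split=> // y ry yc.
  have yB : y \in sval B by apply: cconv (ltW ry) yc => //; exact: crootP.
  have := fB _ _ _ (crootP B) yB cB ry.
  by rewrite lt_neqAle yc andbT negbK => /eqP.
have BE c : c \in sval B -> c = croot B.
  by move=> cB; apply/eqP; apply: contraNT nb => cr; apply/existsP; exists c; rewrite cB.
have [x [xC xr]] := el_eta e; exists x; split.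
  by apply/subsetP => c /BE ->; rewrite -[croot B]/(val e) -xr elrootP.
rewrite (negbTE xC); apply/subsetP => c /(elS_eta xC) ->; by rewrite xr; apply: crootP.
Qed.

Definition Lel (B : subc Vf) : E := sval (cid (Lspec_ex B)).
Lemma LelP B : Lspec (sval B) (Lel B). Proof. exact: (svalP (cid (Lspec_ex B))). Qed.

(** A subset [B'] with at least two edges has the same root as [B], since otherwise [B] would have
    three levels. *)
Lemma Lel_hom (B B' : subc Vf) (u : hom B B') : exists v : hom (Lel B') (Lel B), True.
Proof.
have s : {subset sval (sval B') <= sval (sval B)} by apply/subsetP; apply: u.
have [/subsetP BL LB] := LelP B; have [/subsetP BL' LB'] := LelP B'; apply: el_hom_ex.
case: ifP LB' => [_ [rE' [b bB br]]|_ /subsetP sub]; last by apply/BL/s/sub/elrootP.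
have lt : croot (sval B') < b by rewrite lt_neqAle eq_sym br croot_min.
have rE : croot (sval B') = croot (sval B).
  apply/eqP; apply: contraTT (lt) => ne; apply: (proj2_sig B).2 (crootP _) _ _ _.
  - exact/s/crootP.
  - exact: s.
  - by rewrite lt_neqAle eq_sym ne croot_min // s ?crootP.
case: (boolP (isC (Lel B))) LB => [_ [-> _]|nC /subsetP sub]; first by rewrite rE' rE.
have E1 := elS_eta nC (BL _ (s _ bB)).
have E2 := elS_eta nC (BL _ (s _ (crootP _))).
by move: lt; rewrite E1 E2 ltxx.
Qed.

Definition LelF : functor (subc Vf) (op E).
refine (@Functor (subc Vf) (op E) Lel (fun B B' u => sval (cid (Lel_hom u))) _ _).
- by move=> *; apply: el_thin.
- by move=> *; apply: el_thin.
Defined.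

Lemma elset_Vf (x : E) : Vf (elset x).
Proof. by split; [apply/cgeE/elS_sub | exact: elset_flat]. Qed.

Definition RelF : functor (op E) (subc Vf).
refine (@Functor (op E) (subc Vf) (fun x => exist _ (elset x) (elset_Vf x))
  (fun x y u => (el_hom_sub u : elS y \subset elS x)) _ _).
- by move=> *; apply: bool_irrelevance.
- by move=> *; apply: bool_irrelevance.
Defined.

Lemma sub_el_R (x : E) : osub (elov x) (cov (elset x)).
Proof. by move=> e; exists (exist _ (elv e) (elS_in e)). Qed.

Lemma sub_L_el (B : subc Vf) : osub (cov (sval B)) (elov (Lel B)).
Proof.
case=> b bB; have [/subsetP /(_ b bB)] := LelP B.
by case/imsetP => e _ E' _; exists e.
Qed.

Lemma sub_el_hom (x y : E) (u : hom x y) : osub (elov x) (elov y).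
Proof. by move=> e; exists (chom u e); rewrite /= /elv el_homE. Qed.

Definition Ed : diagram (op E) := pullback (el_cl (ct A)) F.

Lemma Ed_map (x y : op E) (u : hom x y) m (z : Ed x m) :
  dmap Ed u m z = dmap F (a := elov x) (b := elov y) (ovm (@sub_el_hom y x u)) m z.
Proof.
apply: (@dmap_over j T F (elov y) (elov x)) => e.
by rewrite /= /elv el_homE.
Qed.

Definition fel (x : op E) : smap (Dg T F (elset x)) (Ed x) :=
  dmap F (a := cov (elset x)) (b := elov x) (ovm (@sub_el_R x)).
Definition gel (B : subc Vf) : smap (Ed (Lel B)) (Dg T F (sval B)) :=
  dmap F (a := elov (Lel B)) (b := cov (sval B)) (ovm (@sub_L_el B)).

Lemma fel_nat (x y : op E) (u : hom x y) m (z : dcomp (Dg T F) (sinc Vf) (RelF x) m) :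
  fel y m (dmap (dcomp (Dg T F) (sinc Vf)) (fmap RelF u) m z) = dmap Ed u m (fel x m z).
Proof.
rewrite Ed_map.
have s : osub (elov y) (cov (elset x)) := osub_trans (@sub_el_hom y x u) (@sub_el_R x).
transitivity (dmap F (a := cov (elset x)) (b := elov y) (ovm s) m z).
  exact: (@dmap_ovm j T F (elov y) (cov (elset y)) (cov (elset x))).
by apply/esym; exact: (@dmap_ovm j T F (elov y) (elov x) (cov (elset x))).
Qed.

Lemma gel_nat (B B' : subc Vf) (u : hom B B') m (z : Ed (LelF B) m) :
  gel B' m (dmap Ed (fmap LelF u) m z) = dmap (dcomp (Dg T F) (sinc Vf)) u m (gel B m z).
Proof.
rewrite (Ed_map (fmap LelF u)).
have s : osub (cov (sval B')) (elov (Lel B)) := osub_trans (@sub_L_el B') (sub_el_hom (fmap LelF u)).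
transitivity (dmap F (a := elov (Lel B)) (b := cov (sval B')) (ovm s) m z).
  exact: (@dmap_ovm j T F (cov (sval B')) (elov (Lel B')) (elov (Lel B))).
by apply/esym; exact: (@dmap_ovm j T F (cov (sval B')) (cov (sval B)) (elov (Lel B))).
Qed.

Definition el_pull : smap (hU (Dg T F) Vf) (holim Ed) :=
  @hpull (op E) (subc Vf) RelF (dcomp (Dg T F) (sinc Vf)) Ed fel fel_nat.

(** For $x=C_0$ the set of edges is a single edge, from which only $\eta$ is rebuilt. The arrow
    between them is invertible only after closure, which is why [holim_adj_op] is the form
    needed. *)
Lemma el_ep (x : op E) : exists u : hom x (LelF (RelF x)), True.
Proof.
apply: el_hom_ex; have [/subsetP BL LB] := LelP (RelF x).
case: ifP LB => [_ [rE [b bB br]]|_ /subsetP sub]; last exact/sub/elrootP.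
rewrite rE croot_elset; split=> //; apply: contraNT br => nC.
by rewrite croot_elset; apply/eqP/elS_eta.
Qed.

Lemma el_pull_equiv : sequiv el_pull.
Proof.
have tau (B : subc Vf) : hom (RelF (LelF B)) B := (LelP B).1.
apply: (@holim_adj_op (op E) (subc Vf) RelF LelF (dcomp (Dg T F) (sinc Vf)) Ed fel fel_nat gel gel_nat
  tau _ _ _ (fun x => sval (cid (el_ep x)))).
- by move=> *; apply: bool_irrelevance.
- move=> B m x; exact: (@dmap_ovm j T F (cov (sval B)) (elov (Lel B)) (cov (elset (Lel B)))).
- by move=> x; apply: hF.
- by move=> *; apply: el_thin.
- move=> x m z; rewrite Ed_map.
  set u := sval _; set y : op E := LelF (RelF x) in u *.
  have s1 : osub (cov (elset x)) (elov x) := osub_trans (@sub_L_el (RelF x)) (sub_el_hom u).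
  have s2 : osub (elov x) (elov x) by move=> e; exists e.
  transitivity (dmap F (a := cov (elset x)) (b := elov x) (ovm (@sub_el_R x)) m
    (dmap F (a := elov x) (b := cov (elset x)) (ovm s1) m z)).
    congr (dmap F _ m _).
    exact: (@dmap_ovm j T F (cov (elset x)) (elov y) (elov x)).
  transitivity (dmap F (a := elov x) (b := elov x) (ovm s2) m z).
    exact: (@dmap_ovm j T F (elov x) (cov (elset x)) (elov x)).
  exact: (@dmap_ovm1 j T F (elov x)).
Qed.

Lemma Vf_ge B : Vf B -> cge A B. Proof. by case. Qed.

Lemma el_square m (z : Dg T F A m) :
  el_pull m (canon (kcone F Vf_ge) m z) = canon (segal_cone F (ct A)) m z.
Proof.
apply: holim_ext => q y c; rewrite -!sfunP hval_hpull !hval_canon.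
set x := c ord_max; have s : osub (elov x) (cov A) := osub_trans (@sub_el_R x) (@cov_sub j T (elset x) A (elS_sub x)).
transitivity (dmap F (a := cov A) (b := elov x) (ovm s) q (act (s := F (cov A)) y z)).
  rewrite (@kcone_leg j T F A _ Vf_ge (RelF x) q _ (@cov_sub j T (elset x) A (elS_sub x))).
  exact: (@dmap_ovm j T F (elov x) (cov (elset x)) (cov A)).
by apply/esym; apply: (@dmap_over j T F (elov x) (cov A)).
Qed.

Lemma segal_flat : segal F -> sequiv (canon (kcone F Vf_ge)).
Proof.
move=> /(_ (ct A)) e.
have E' : scomp el_pull (canon (kcone F Vf_ge)) = canon (segal_cone F (ct A)).
  by apply: smap_ext => m z; exact: (el_square z).
refine (@sequiv_cancel_post _ _ _ (canon (kcone F Vf_ge)) _ (@hD_hU _ _ _ Vf) el_pull_equiv _).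
  by move=> B; apply: hF.
by rewrite E'.
Qed.
End El.

Section Objects.
Variables (k j : option nat) (T : ctree j) (F : presheaf (Omegac j)).
Hypothesis hF : forall X, hep (F X).

Lemma hDg A : hep (Dg T F A). Proof. exact: hF. Qed.

(** Discarding the objects of [U] outside [V] does not change the limit; the number of edges of [A]
    bounds the ranks. *)
Lemma obj_equiv_sub (A : J T) (U V : J T -> Prop) (Ua : forall x, U x -> cge A x) (Va : forall x, V x -> cge A x) :
  (forall x, V x -> U x) -> (forall x y, U x -> hom x y -> U y) -> (forall x y, V x -> hom x y -> V y) ->
  (forall a, U a -> ~ V a -> obj_equiv (Dg T F) (@J_thin j T) a) ->
  sequiv (canon (kcone F Ua)) <-> sequiv (canon (kcone F Va)).
Proof.
move=> VU Uup Vup eUV.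
have rM x : U x -> (crank x < (crank A).+1)%N.
  by move=> /Ua/cgeE/subset_leq_card.
have tr : sequiv (res (Dg T F) VU).
  exact: tfib_sequiv (@tfib_res _ _ hDg (@J_thin j T) _ (@J_rlt j T) _ _ VU Uup Vup _ rM eUV).
have E : scomp (res (Dg T F) VU) (canon (kcone F Ua)) = canon (kcone F Va).
  by apply: smap_ext => m x; exact: canon_res.
split=> e; last first.
  refine (@sequiv_cancel_post _ _ _ _ _ (@hD_hU _ _ hDg U) tr _); by rewrite E.
by rewrite -E; apply: sequiv_comp => //; [exact: hDg | exact: (@hD_hU _ _ hDg V)].
Qed.

Lemma cge_up (A x y : J T) : cge A x -> hom x y -> cge A y.
Proof. by move=> /cgeE h u; apply/cgeE; exact: subset_trans u h. Qed.

Lemma cgt_up (A x y : J T) : cgt A x -> hom x y -> cgt A y.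
Proof.
case=> ge ne u; split; first exact: cge_up ge u.
move=> E; apply: ne; apply: cset_eq; apply/eqP; rewrite eqEsubset; apply/andP; split.
  by rewrite E; exact: u.
exact/cgeE.
Qed.

Lemma flat_kd (A : J T) : flat A -> kd k A <-> nle #|sval A :\ croot A| k.
Proof.
move=> fA; rewrite kdP; split=> [/(_ _ (crootP A)) H|H e eA].
  apply: leq_nle H; apply/subset_leq_card/subsetP => x; rewrite in_setD1 => /andP[xr xA].
  rewrite inE xA; apply/aboveP; split; first by rewrite lt_neqAle eq_sym xr croot_min.
  move=> y ry yx; have yA : y \in sval A by apply: cconv (ltW ry) yx => //; exact: crootP.
  by have := fA _ _ _ (crootP A) yA xA ry; rewrite lt_neqAle yx andbT negbK => /eqP.
apply: leq_nle H; apply/subset_leq_card/subsetP => x; rewrite inE => /andP[xA /aboveP[ex _]].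
rewrite in_setD1 xA andbT; apply: contraTneq ex => ->; by rewrite (le_gtF (croot_min eA)).
Qed.
End Objects.

Section ObjectEquiv.
Variables (k j : option nat) (hk : nle 1 k) (hkj : kle k j) (T : ctree j) (F : presheaf (Omegac j)).
Hypothesis hF : forall X, hep (F X).
Hypothesis sF : segal F.
Hypothesis corF : forall n (hkn : ~~ nle n k) (hnj : nle n j), sequiv (canon (corolla_cone hkj hnj F)).

Lemma flat_card_j (A : J T) : flat A -> nle #|sval A :\ croot A| j.
Proof. by move=> fA; apply/(flat_kd j fA); apply: (ctr_dendr (ct A)). Qed.

Lemma flat_obj (A : J T) : flat A -> ~ kd k A -> sequiv (canon (kcone F (@Vk_ge k j T A))).
Proof.
move=> fA nkA; have hnj := flat_card_j fA.
have hkn : ~~ nle #|sval A :\ croot A| k by apply/negP => /(flat_kd k fA).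
have tP i : enum_val i \in sval A /\ enum_val (A := sval A :\ croot A) i != croot A.
  by have := enum_valP i; rewrite in_setD1 => /andP[-> ->].
apply/(flat_corolla hk hkj hF fA (tip := fun i => enum_val (A := sval A :\ croot A) i) enum_val_inj tP _ hnj).
  move=> x xA xr; have xt : x \in sval A :\ croot A by rewrite in_setD1 xr.
  by exists (enum_rank_in xt x); apply: enum_rankK_in.
exact: corF.
Qed.

Lemma obj_equiv_all N (A : J T) : (crank A < N)%N -> ~ flat A \/ ~ kd k A -> obj_equiv (Dg T F) (@J_thin j T) A.
Proof.
elim: N A => // N IH A; rewrite ltnS => lA nA.
have lt B : cgt A B -> (crank B < N)%N.
  move=> [[u _] ne]; case: (J_rlt u) => [E|h]; first by case: ne.
  exact: leq_trans h lA.
(* The subtrees discarded below are not [k]-dendroidal in the flat case and not flat in the other,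
   so the induction hypothesis applies to them. *)
have [fA|nfA] := pselect (flat A).
  have nkA : ~ kd k A by case: nA.
  apply/(obj_equiv_sub hF (@gt_ge _ A) (@Vk_ge k j T A)); last exact: flat_obj.
  - by move=> B [ge kB]; split=> // E; apply: nkA; rewrite E.
  - exact: cgt_up.
  - by move=> x y [ge kx] u; split; [exact: cge_up u | exact: kd_sub kx u].
  - move=> B gB nB; apply: IH; first exact: lt.
    by right=> kB; apply: nB; split=> //; case: gB.
apply/(obj_equiv_sub hF (@gt_ge _ A) (@Vf_ge j T A)); last exact: segal_flat.
- by move=> B [ge kB]; split=> // E; apply: nfA; rewrite E.
- exact: cgt_up.
- by move=> x y [ge kx] u; split; [exact: cge_up u | exact: flat_sub kx u].
- move=> B gB nB; apply: IH; first exact: lt.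
  by left=> kB; apply: nB; split=> //; case: gB.
Qed.

Lemma kappa : sequiv (canon (kcone F (@Vk_ge k j T (A0 T)))).
Proof.
apply/(@obj_equiv_sub _ _ F hF (A0 T) (cge (A0 T)) (Vk k (A0 T)) (fun _ h => h) (@Vk_ge k j T (A0 T))).
- by move=> B [].
- exact: cge_up.
- by move=> x y [ge kx] u; split; [exact: cge_up u | exact: kd_sub kx u].
- move=> B gB nB; apply: (obj_equiv_all (ltnSn _)).
  by right=> kB; apply: nB.
exact: ge_equiv.
Qed.
End ObjectEquiv.

(** * Convex hulls of maps of trees *)

Section LiftTree.
Variables (j : option nat) (T S : ctree j) (f : @hom (Omegac j) S T) (Y : ov j T).
Hypothesis im : forall s : S, exists y : Y, ovv y = f s.

Definition lift_fun (s : S) : Y := sval (cid (im s)).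
Lemma lift_funE s : ovv (lift_fun s) = f s. Proof. exact: (svalP (cid (im s))). Qed.

Lemma lift_homo : {homo lift_fun : x y / x <= y}.
Proof. by move=> x y xy; rewrite -(@ovP _ _ Y) !lift_funE; apply: (ctree_mono f (ctr_closed S)). Qed.

Lemma lift_indep (x y : S) : x >< y -> lift_fun x >< lift_fun y.
Proof.
move=> xy; apply: contra xy; rewrite /Order.comparable -!(@ovP _ _ Y) !lift_funE => /orP[le|le].
  exact: (ctree_indep (ctr_closed S) le).
by rewrite orbC; exact: (ctree_indep (ctr_closed S) le).
Qed.

Definition lift : @hom (Omegac j) S Y := @cmap S Y lift_fun (ctr_closed Y) lift_homo lift_indep.
Lemma liftE s : ovv (lift s) = f s. Proof. exact: lift_funE. Qed.
End LiftTree.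

Section Hull.
Variables (k : option nat) (S T : tree) (f : treemap S T) (Sc : closed S) (Sk : dendroidal k S).

Definition hull : {set T} := [set y | [exists s, f s <= y] && [exists s, y <= f s]].

Lemma hullP y : reflect (exists s s', f s <= y /\ y <= f s') (y \in hull).
Proof.
rewrite inE; apply: (iffP andP) => [[/existsP[s ?] /existsP[s' ?]]|[s [s' [h h']]]].
  by exists s, s'.
by split; apply/existsP; [exists s | exists s'].
Qed.

Lemma hull_im s : f s \in hull.
Proof. by apply/hullP; exists s, s. Qed.

Lemma hull_convex : convex hull.
Proof.
split=> [|x y z /hullP[s [_ [sx _]]] /hullP[_ [s' [_ zs']]] xy yz].
  exists (f (root S)) => [|x /hullP[s [_ [sx _]]]]; first exact: hull_im.
  by apply: le_trans sx; apply: (ctree_mono f Sc); apply: rootP.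
by apply/hullP; exists s, s'; split; [exact: le_trans sx xy | exact: le_trans yz zs'].
Qed.

(* Above an edge [e] of the hull, let [s] be maximal with [f s <= e]; every
   edge of the hull directly above [e] then lies below [f y] for some [y] in
   [above s]. *)
Lemma hull_dendr e : e \in hull -> nle #|[set x in hull | x \in above e]| k.
Proof.
move=> /hullP[s0 [_ [s0e _]]].
have [s /= se smax] := @arg_maxnP S s0 (fun s => f s <= e) (fun s => #|[set z : S | z <= s]|) s0e.
have ex c : c \in [set x in hull | x \in above e] -> exists2 y, y \in above s & c <= f y.
  rewrite inE => /andP[/hullP[_ [s' [_ cs']]] /aboveP[ec cmin]].
  have les : f s <= f s' by apply: le_trans se (le_trans (ltW ec) cs').
  (* [s] and [s'] are comparable since their images are, and $s'\le s$ would put [c] below [e]. *)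
  have lt : s < s'.
    have /orP[|s's] := ctree_indep Sc les.
      rewrite le_eqVlt => /orP[/eqP E|//].
      by have := lt_le_trans ec cs'; rewrite -E (le_gtF se).
    have := lt_le_trans ec (le_trans cs' (ctree_mono f Sc s's)).
    by rewrite (le_gtF se).
  have [y ya ys'] := above_ex lt; exists y => //.
  have fys' := ctree_mono f Sc ys'.
  have [sy _] := aboveP _ _ ya.
  have nye : ~~ (f y <= e).
    apply/negP => ye; have := smax y ye; rewrite leqNgt => /negP; apply.
    apply/proper_card/properP; split.
      by apply/subsetP => z; rewrite !inE => zs; apply: le_trans zs (ltW sy).
    by exists y; rewrite !inE ?lexx // (lt_geF sy).
  have ey : e < f y.
    have /orP[|h] := tlinP (le_trans (ltW ec) cs') fys'; last by rewrite h in nye.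
    by rewrite le_eqVlt => /orP[/eqP E|//]; rewrite -E lexx in nye.
  have /orP[//|yc] := tlinP cs' fys'.
  by rewrite (cmin _ ey yc).
(* The default [s] is never taken on the relevant edges, by [ex]. *)
pose h c := odflt s [pick y in above s | c <= f y].
have hP c : c \in [set x in hull | x \in above e] -> h c \in above s /\ c <= f (h c).
  move=> /ex[y ya cy]; rewrite /h; case: pickP => [z /andP[-> ->]//|/(_ y)].
  by rewrite ya cy.
have hi : {in [set x in hull | x \in above e] &, injective h}.
  move=> c c' cP c'P E; have [_ cy] := hP _ cP; have [_ c'y] := hP _ c'P.
  move: cP c'P; rewrite inE => /andP[_ /aboveP[ec cmin]]; rewrite inE => /andP[_ /aboveP[ec' c'min]].
  rewrite -E in c'y.
  have /orP[le|le] := tlinP cy c'y; first exact: c'min.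
  by apply/esym/cmin.
apply: leq_nle (forallP Sk s); rewrite -(card_in_imset hi).
by apply/subset_leq_card/subsetP => _ /imsetP[c cP ->]; case: (hP c cP).
Qed.
End Hull.

Section Comma.
Variables (k j : option nat) (hk : nle 1 k) (hkj : kle k j) (T : ctree j) (F : presheaf (Omegac j)).
Hypothesis hF : forall X, hep (F X).
Notation I := (incl hkj).
Notation V := (Vk k (A0 T)).
Notation K := (comma I T).

Definition ctk (B : subc V) : ctree k :=
  CTree (tree_of_closed (proj2_sig (sval B))) (proj2 (proj2_sig B)).

Definition ovk (B : subc V) : ov j T :=
  @Ov j T (I (ctk B)) (fun x : tree_of _ => val x) (fun x x' => esym (tree_of_le x x')).

Lemma ovk_sub (B B' : subc V) : sval (sval B) \subset sval (sval B') -> osub (ovk B) (ovk B').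
Proof. by move=> /subsetP s [x xA]; exists (exist _ x (s x xA)). Qed.
Lemma ct_ovk (B : subc V) : osub (cov (sval B)) (ovk B).
Proof. by move=> x; exists x. Qed.
Definition Rob (B : subc V) : K := @CommaOb _ _ I T (ctk B) (ovm (@sub_idov j T (ovk B))).

Lemma RhomP (B B' : subc V) (u : hom B B') :
  carr (Rob B) \c fmap I (ovm (ovk_sub (u : sval (sval B') \subset sval (sval B))) : @hom (Omegac k) (ctk B') (ctk B)) = carr (Rob B').
Proof. by apply: (@over_eq j T _ (idov T)) => x; rewrite [LHS]ovmE [LHS]ovmE [RHS]ovmE. Qed.

Lemma over_k (S : ctree k) (B : subc V) (h h' : @hom (Omegac k) S (ctk B)) :
  (forall x, val (h x) = val (h' x)) -> h = h'.
Proof. exact: (@over_eq j T (I S) (ovk B)). Qed.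

Definition RK : functor (subc V) (op K).
refine (@Functor (subc V) (op K) Rob (fun B B' u => @CommaHom _ _ I T (Rob B') (Rob B) (ovm (ovk_sub (u : sval (sval B') \subset sval (sval B))) : @hom (Omegac k) (ctk B') (ctk B)) (RhomP u)) _ _).
- by move=> B; apply: commaHom_ext; apply: over_k => x; apply: (ovmE (ovk_sub _)).
- move=> B B' B'' g f; apply: commaHom_ext; apply: over_k => x.
  by rewrite [LHS](ovmE (ovk_sub _)); apply/esym; rewrite [LHS](ovmE (ovk_sub _)) [LHS](ovmE (ovk_sub _)).
Defined.

Definition hcs (x : K) : cset T := exist _ (hull (carr x)) (hull_convex (carr x) (ctr_closed (csrc x))).

Lemma hcs_V x : V (hcs x).
Proof.
split; first exact: A0_ge.
by apply/kdP => e; apply: (hull_dendr (ctr_closed (csrc x)) (ctr_dendr (csrc x))).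
Qed.

Definition Lob (x : K) : subc V := exist _ (hcs x) (hcs_V x).

Lemma Lob_hom (x y : K) (u : hom x y) : hull (carr x) \subset hull (carr y).
Proof.
have uE s : carr y (chom u s) = carr x s by exact: (congr1 (fun f : treemap _ _ => f s) (chomP u)).
by apply/subsetP => e /hullP[s [s' []]]; rewrite -!uE => h h'; apply/hullP; exists (chom u s), (chom u s').
Qed.

Definition LK : functor (op K) (subc V).
refine (@Functor (op K) (subc V) Lob (fun x y u => (Lob_hom u : hull (carr y) \subset hull (carr x))) _ _).
- by move=> *; apply: bool_irrelevance.
- by move=> *; apply: bool_irrelevance.
Defined.

Definition DK : diagram (op K) := ran_diag I (pullback I F) T.
Definition EK : diagram (subc V) := dcomp (Dg T F) (sinc V).

Definition fK (B : subc V) : smap (DK (RK B)) (EK B) :=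
  dmap F (a := ovk B) (b := cov (sval B)) (ovm (@ct_ovk B)).

Lemma liftP (x : K) (s : I (csrc x)) : exists y : cov (hcs x), ovv y = carr x s.
Proof. by exists (exist _ (carr x s) (hull_im _ s)). Qed.

Definition gK (x : op K) : smap (EK (LK x)) (DK x) :=
  dmap F (a := cov (hcs x)) (b := I (csrc x)) (lift (@liftP x)).

Lemma liftkP (x : K) (s : I (csrc x)) : exists y : ovk (Lob x), ovv y = carr x s.
Proof. by exists (exist _ (carr x s) (hull_im _ s)). Qed.

Lemma tauKP (x : K) : carr (Rob (Lob x)) \c fmap I (lift (@liftkP x) : @hom (Omegac k) (csrc x) (ctk (Lob x))) = carr x.
Proof. by apply: (@over_eq j T _ (idov T)) => s; rewrite [LHS]ovmE [LHS]liftE. Qed.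

Definition tauK (x : op K) : hom (RK (LK x)) x := CommaHom (tauKP x).

(* Maps into a tree embedded in [T] are determined by their composite to [T]. *)
Lemma dmap2 (Y : ov j T) (S A B : ctree j) (a : @hom (Omegac j) A Y) (b : @hom (Omegac j) S A)
   (a' : @hom (Omegac j) B Y) (b' : @hom (Omegac j) S B) m (z : F Y m) :
  (forall s, ovv (a (b s)) = ovv (a' (b' s))) ->
  dmap F (a := A) (b := S) b m (dmap F (a := Y) (b := A) a m z) =
  dmap F (a := B) (b := S) b' m (dmap F (a := Y) (b := B) a' m z).
Proof.
move=> E; rewrite -[LHS](@dmapM _ F) -[RHS](@dmapM _ F); congr (dmap F _ m z).
exact: (@over_eq j T S Y).
Qed.

Lemma fK_nat (B B' : subc V) (u : hom B B') m (z : DK (RK B) m) :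
  fK B' m (dmap DK (fmap RK u) m z) = dmap EK u m (fK B m z).
Proof.
apply: (@dmap2 (ovk B)) => s.
by rewrite [LHS](ovmE (ovk_sub _)) [LHS]ovmE [RHS]ovmE [RHS]ovmE.
Qed.

Lemma gK_nat (x y : op K) (u : hom x y) m (z : EK (LK x) m) :
  gK y m (dmap EK (fmap LK u) m z) = dmap DK u m (gK x m z).
Proof.
apply: (@dmap2 (cov (hcs x))) => s.
rewrite [LHS]ovmE [LHS]liftE [RHS]liftE; apply/esym.
exact: (congr1 (fun f : treemap _ _ => f s) (chomP u)).
Qed.

Definition comma_pull : smap (holim DK) (hU (Dg T F) V) :=
  @hpull (subc V) (op K) RK DK EK fK fK_nat.

Lemma comma_ep (B : subc V) : sval (sval B) \subset hull (carr (Rob B)).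
Proof.
apply/subsetP => x xB.
have E : (carr (Rob B) : treemap _ _) (exist _ x xB) = x.
  exact: (@ovmE j T (ovk B) (idov T) (@sub_idov j T (ovk B)) (exist _ x xB)).
by rewrite -{1}E; apply: hull_im.
Qed.

Lemma comma_pull_equiv : sequiv comma_pull.
Proof.
apply: (@holim_adj (subc V) (op K) RK LK DK EK fK fK_nat gK gK_nat tauK _ _ (fun B => comma_ep B)).
- move=> x y u; apply: commaHom_ext; apply: (@over_k _ (Lob x)) => s.
  transitivity ((carr x : treemap _ _) (chom u s)); first exact: (@liftE j T _ _ (ovk (Lob x)) (@liftkP x) (chom u s)).
  transitivity ((carr y : treemap _ _) s); first exact: (congr1 (fun f : treemap _ _ => f s) (chomP u)).
  apply/esym; transitivity (val (lift (@liftkP y) s)); last exact: (@liftE j T _ _ (ovk (Lob y)) (@liftkP y) s).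
  exact: (@ovmE j T (ovk (Lob y)) (ovk (Lob x)) _ (lift (@liftkP y) s)).
- move=> x m z; rewrite -[LHS](@dmapM _ F); congr (dmap F _ m z).
  by apply: (@over_eq j T _ (ovk (Lob x))) => s; rewrite [LHS]ovmE [LHS]liftE [RHS]liftE.
- by move=> *; apply: bool_irrelevance.
- move=> B m z; rewrite -[LHS](@dmapM _ F); congr (dmap F _ m z).
  apply: (@over_eq j T _ (cov (hcs (Rob B)))) => s; rewrite [LHS]liftE [RHS]ovmE.
  transitivity (ovv (ovm (@ct_ovk B) s : ovk B)); last exact: ovmE.
  exact: (@ovmE j T (ovk B) (idov T) (@sub_idov j T (ovk B))).
Qed.

Lemma gam_square m (z : F T m) :
  comma_pull m (gam I F T m z) =
  canon (kcone F (@Vk_ge k j T (A0 T))) m (dmap F (a := idov T) (b := cov (A0 T)) (ovm (@sub_idov j T (cov (A0 T)))) m z).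
Proof.
apply: holim_ext => q y c; rewrite -!sfunP hval_hpull !hval_canon.
set B := c ord_max.
rewrite (@kcone_leg j T F (A0 T) _ (@Vk_ge k j T (A0 T)) B q _ (@cov_sub j T (sval B) (A0 T) (proj1 (cgeE _ _) (A0_ge _)))).
apply: (@dmap2 (idov T)) => s.
by rewrite [LHS]ovmE [LHS]ovmE [RHS]ovmE [RHS]ovmE.
Qed.

Lemma gam_kappa : sequiv (gam I F T) <-> sequiv (canon (kcone F (@Vk_ge k j T (A0 T)))).
Proof.
pose i := dmap F (a := idov T) (b := cov (A0 T)) (ovm (@sub_idov j T (cov (A0 T)))).
have ei : sequiv i by apply: ov_iso; apply: idov_A0.
have hV : hep (hU (Dg T F) V) by apply: hD_hU => B; apply: hF.
have hK : hep (holim DK) by apply: hep_holim => x; apply: hF.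
have E : scomp comma_pull (gam I F T) = scomp (canon (kcone F (@Vk_ge k j T (A0 T)))) i.
  by apply: smap_ext => m z; exact: (gam_square z).
split=> e.
  apply: (@sequiv_cancel_pre _ _ _ _ _ (@hF (ct (A0 T))) ei); rewrite -E.
  exact: (sequiv_comp (@hF T) hV e comma_pull_equiv).
refine (@sequiv_cancel_post _ _ _ (gam I F T) _ hK comma_pull_equiv _); rewrite E.
exact: (sequiv_comp (@hF T) hV ei e).
Qed.
End Comma.

(** * Restriction to smaller valence and the image of right Kan extension *)

Section Restrict.
Variables (k j : option nat) (hk : nle 1 k) (hkj : kle k j) (F : presheaf (Omegac j)).
Notation I := (incl hkj).

Section Irr.
Variable T : ctree k.
Notation E := (elOver T).
Notation elpr := (forall x : E, dendroidal j (cl (elem_tree (csrc (sval x))))).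
Definition elob (pr : elpr) (x : op E) : sset := F (CTree (cl_closed (elem_tree (csrc (sval x)))) (pr x)).
Definition elmap (pr : elpr) (x y : op E) (u : hom x y) : smap (elob pr x) (elob pr y) :=
  dmap F (a := CTree (cl_closed _) (pr x)) (b := CTree (cl_closed _) (pr y)) (cl_map (chom u)).
Definition elleg (pr : elpr) (x : op E) : smap (F (I T)) (elob pr x) :=
  dmap F (a := I T) (b := CTree (cl_closed _) (pr x)) (cl_adj (ctr_closed T) (carr (sval x))).

(** The two Segal diagrams differ only in the proofs that elementary trees are [j]-dendroidal; with
    these proofs as parameters, proof irrelevance identifies the diagrams. *)
Lemma segal_irr (pr pr' : elpr) m1 mM lP m1' mM' lP' :
  sequiv (canon (@Cone (op E) _ (@Diagram (op E) (elob pr) (elmap pr) m1 mM) (elleg pr) lP)) ->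
  sequiv (canon (@Cone (op E) _ (@Diagram (op E) (elob pr') (elmap pr') m1' mM') (elleg pr') lP')).
Proof.
have E : pr = pr' by apply: Prop_irrelevance.
case: _ / E m1' mM' lP' => m1' mM'.
case: _ / (Prop_irrelevance m1 m1') => {m1'}; case: _ / (Prop_irrelevance mM mM') => {mM'} lP'.
by rewrite (Prop_irrelevance lP lP').
Qed.
End Irr.

Lemma segal_restrict : segal F -> segal (pullback I F).
Proof.
move=> sF T.
exact: (@segal_irr T (@el_dendr j (I T)) (fun x => dendr_kle hkj (el_dendr x)) _ _ _ _ _ _ (sF (I T))).
Qed.

Notation lpr := (forall n, dendroidal j (cl (lintree n))).
Definition lob (pr : lpr) (n : op Delta) : sset := F (CTree (cl_closed (lintree n)) (pr n)).
Definition lmap (pr : lpr) (m n : op Delta) (u : hom m n) : smap (lob pr m) (lob pr n) :=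
  dmap F (a := CTree (cl_closed (lintree m)) (pr m)) (b := CTree (cl_closed (lintree n)) (pr n)) (r_map u).

Lemma complete_irr (pr pr' : lpr) m1 mM m1' mM' :
  @Diagram (op Delta) (lob pr) (lmap pr) m1 mM = @Diagram (op Delta) (lob pr') (lmap pr') m1' mM'.
Proof.
have E : pr = pr' by apply: Prop_irrelevance.
case: _ / E m1' mM' => m1' mM'.
by rewrite (Prop_irrelevance m1 m1') (Prop_irrelevance mM mM').
Qed.

Lemma r_restrict : pullback (r hk) (pullback I F) = pullback (r (nle_trans hk hkj)) F.
Proof. exact: (@complete_irr (fun n => dendr_kle hkj (lin_dendr hk n)) (lin_dendr (nle_trans hk hkj))). Qed.

Lemma Op_un_restrict : Op_un (nle_trans hk hkj) F -> Op_un hk (pullback I F).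
Proof.
case=> kF sF cF; split; [by move=> x; apply: kF | exact: segal_restrict | by rewrite r_restrict].
Qed.

Hypothesis hF : Op_un (nle_trans hk hkj) F.

Lemma hepF X : hep (F X). Proof. by apply: kan_hep; apply: op_un_kan hF X. Qed.

Definition gam_mor : dmor F (ran I (pullback I F)) :=
  @DMor (op (Omegac j)) F (ran I (pullback I F)) (gam I F) (fun a b u n x => gam_nat I u x).

Lemma corollas_image :
  (forall (n : nat) (hkn : ~~ nle n k) (hnj : nle n j), sequiv (canon (corolla_cone hkj hnj F))) ->
  exists G : presheaf (Omegac k), Op_un hk G /\ dequiv F (ran I G).
Proof.
move=> corF; exists (pullback I F); split; first exact: Op_un_restrict.
(* The span has apex [F], with the identity and the unit as its legs. *)
exists F; split; first exact: op_un_kan hF.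
split.
  exists (@DMor (op (Omegac j)) F F (fun a => sid (F a)) (fun _ _ _ _ _ => erefl)) => a.
  by apply: (@sequiv_inv _ _ _ (sid (F a))); apply: htpy_refl.
exists gam_mor => T; apply/(gam_kappa hkj T hepF).
exact: (kappa hk T hepF (op_un_segal hF) corF).
Qed.

Lemma image_corollas (G : presheaf (Omegac k)) : Op_un hk G -> dequiv F (ran I G) ->
  forall (n : nat) (hnj : nle n j), sequiv (canon (corolla_cone hkj hnj F)).
Proof.
move=> hG d n hnj; pose T := cbarn hnj.
have hGG a : hep (G a) by apply: kan_hep; apply: op_un_kan hG a.
have e : sequiv (gam I F T).
  by apply: (@image_gam (Omegac k) (Omegac j) I (fun a b h => h) _ _ F G hepF hGG d T).
have {}e := (gam_kappa hkj T hepF).1 e.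
have rE : croot (A0 T) = None.
  have := croot_min (A := A0 T) (in_setT (None : T)).
  by rewrite star_leE orbb => /eqP.
have fA : flat (A0 T).
  move=> x y z _ _ _; rewrite !lt_neqAle !star_leE; case: y => [y|]; first by rewrite /= andNb.
  by case: x => [x|]; rewrite ?eqxx // andbF.
apply: (flat_corolla hk hkj hepF fA (tip := fun i => Some i : T) _ _ _ hnj).1 e.
- by move=> x y [].
- by move=> i; rewrite rE in_setT.
- by move=> [x|] _; rewrite rE // => _; exists x.
Qed.
End Restrict.

(** * Multimorphisms *)

Local Close Scope order_scope.

Section MkHofib.
Variables (X Y : sset) (f : smap X Y) (y : Y 0) (K : sset) (u : smap K X) (H : smap (cyl K) Y).
Hypothesis H0 : forall p k, H p (k, c0 p) = f p (u p k).
Hypothesis H1 : forall p k, H p (k, c1 p) = atp y p.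

Lemma mkhofib_src n (k : K n) p (t : splx n p) : curry H n k p (t, c0 p) = f p (act t (u n k)).
Proof. by rewrite /= H0 sfunP. Qed.
Lemma mkhofib_tgt n (k : K n) p (t : splx n p) : curry H n k p (t, c1 p) = act (cst p (ord0 : 'I_1)) y.
Proof. by rewrite /= H1. Qed.

Definition mkhofib : smap K (hofib f y).
refine (@SMap K (hofib f y) (fun n k => HofibSimp (mkhofib_src k) (mkhofib_tgt k)) _).
move=> m n a k; apply: hofib_ext => [|p z] /=; first exact: sfunP.
by rewrite -(@actM K).
Defined.
End MkHofib.

Definition hpt (X Y : sset) (f : smap X Y) (y : Y 0) : smap (hofib f y) X :=
  @SMap (hofib f y) X (fun n h => hf_pt h) (fun _ _ _ _ => erefl).

Lemma hpath_at (X Y : sset) (f : smap X Y) (y : Y 0) n (h : hofib f y n) p (x : splx n p) t :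
  hf_path h p (x, t) = hf_path (act x h : hofib f y p) p (idm _, t).
Proof. exact: maps_at. Qed.

Lemma hpath0 (X Y : sset) (f : smap X Y) (y : Y 0) n (h : hofib f y n) :
  hf_path h n (idm _, c0 n) = f n (hf_pt h).
Proof. by rewrite hf_src act1. Qed.

Definition hpath (X Y : sset) (f : smap X Y) (y : Y 0) : smap (hofib f y) (maps I1 Y) :=
  @SMap (hofib f y) (maps I1 Y) (fun n h => hf_path h) (fun _ _ _ _ => erefl).

Section Square.
Variables (A A' B B' : sset) (f : smap A B) (f' : smap A' B') (al : smap A A') (be : smap B B').
Hypothesis sq : forall n x, f' n (al n x) = be n (f n x).
Variable z : B 0.

Lemma ind0 p k : scomp be (uncurry (hpath f z)) p (k, c0 p) = f' p (scomp al (hpt f z) p k).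
Proof. by rewrite /= hpath0 sq. Qed.
Lemma ind1 p k : scomp be (uncurry (hpath f z)) p (k, c1 p) = atp (be 0 z) p.
Proof. by rewrite /= hf_tgt sfunP. Qed.
Definition ind : smap (hofib f z) (hofib f' (be 0 z)) := mkhofib ind0 ind1.

Lemma ind_path n h p x t : hf_path (ind n h) p (x, t) = be p (hf_path h p (x, t)).
Proof. exact: (congr1 (be p) (esym (hpath_at h x t))). Qed.

Variable w : hofib f' (be 0 z) 0.
Notation E := (hofib ind w).
Notation G := (hofib al (hf_pt w)).

Lemma forget0 p k : scomp (hpt f' (be 0 z)) (uncurry (hpath ind w)) p (k, c0 p) = al p (scomp (hpt f z) (hpt ind w) p k).
Proof. by rewrite /= hpath0. Qed.
Lemma forget1 p k : scomp (hpt f' (be 0 z)) (uncurry (hpath ind w)) p (k, c1 p) = atp (hf_pt w) p.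
Proof. by rewrite /= hf_tgt. Qed.
Definition forget : smap E G := mkhofib forget0 forget1.

Lemma forget_path n h p x t : hf_path (forget n h) p (x, t) = hf_pt (hf_path h p (x, t)).
Proof. exact: (congr1 (hpt f' (be 0 z) p) (esym (hpath_at h x t))). Qed.

(** A point of [E] contains a path in [B] and a square over it in [B']. At each time of the path,
    the transverse direction of the square is a path in [B'] that starts at the image of the point
    of [B]; together they form the map [qm] to [psp be]. *)
Definition qm_pt : smap (cyl E) B := uncurry (scomp (hpath f z) (hpt ind w)).
Definition qm_path : smap (cyl (cyl E)) B' := swap (uncurry (scomp (hpath f' (be 0 z)) (uncurry (hpath ind w)))).

Lemma qm0 p k : qm_path p (k, c0 p) = be p (qm_pt p k).
Proof. by rewrite /= hpath0 ind_path. Qed.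
Definition qm : smap (cyl E) (psp be) := mkpsp qm0.

Definition q0_path : smap (cyl G) B' := scomp f' (uncurry (hpath al (hf_pt w))).
Lemma q00 p k : q0_path p (k, c0 p) = be p (scomp f (hpt al (hf_pt w)) p k).
Proof. by rewrite /= hpath0 sq. Qed.
Definition q0 : smap G (psp be) := mkpsp q00.

Definition q1 p : psp be p := pconst be p (atp z p).

Lemma q0_forget p (e : E p) : q0 p (forget p e) = qm p (e, c0 p).
Proof.
apply: psp_ext => [|q x t]; first exact: esym (hpath0 _).
transitivity (hf_path (hf_path e q (x, t)) q (idm _, c0 q)).
  by rewrite hpath0; congr (f' q (hf_pt (hf_path e q (_, _)))); apply: Dext.
rewrite /=; congr (hf_path _ q (_, _)); last exact: Dext.
by congr (hf_path e q (_, _)); apply: Dext.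
Qed.

Lemma q1_tgt p (e : E p) : qm p (e, c1 p) = q1 p.
Proof.
apply: psp_ext => [|q x t]; first exact: (hf_tgt (hf_pt e)).
rewrite /= [compf (cst p ord_max) x](cst_act x (ord_max : 'I_2)) hf_tgt.
by rewrite -(sfunP be) atp_act sfunP.
Qed.

Definition wpath p (s : I1 p) : B' p := hf_path (atp (Y := hofib f' (be 0 z)) w p) p (idm _, s).

Lemma wpath_act p q (a : @hom Delta p q) s : wpath (act a s) = act a (wpath s).
Proof.
rewrite /wpath -sfunP [in RHS]hpath_at (@atp_act (hofib f' (be 0 z))).
by congr (hf_path _ p (_, _)); apply: Dext.
Qed.

Lemma qm_end p k : pend be p (qm p k) = wpath k.2.
Proof. by rewrite mkpsp_end /= hf_tgt. Qed.

Lemma q0_end p g : pend be p (q0 p g) = wpath (c0 p).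
Proof. by rewrite mkpsp_end /= hf_tgt /wpath hpath0. Qed.

Lemma q1_end p : pend be p (q1 p) = wpath (c1 p).
Proof. by rewrite pconst_end /wpath hf_tgt sfunP. Qed.

Lemma q1_act p q (a : @hom Delta p q) : act a (q1 q) = q1 p.
Proof. by rewrite /q1 -(sfunP (pconst be)) atp_act. Qed.

Lemma q0_pathE p g t : ppath be p (q0 p g) p (idm _, t) = f' p (hf_path g p (idm _, t)).
Proof. by rewrite /=; congr (f' p (hf_path g p (_, _))); apply: Dext. Qed.

Lemma qm_pathE p e s t : ppath be p (qm p (e, s)) p (idm _, t) = hf_path (hf_path e p (idm _, t)) p (idm _, s).
Proof.
rewrite /=; congr (hf_path _ p (_, _)); last exact: Dext.
by congr (hf_path e p (_, _)); apply: Dext.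
Qed.

Lemma q1_pathE p t : ppath be p (q1 p) p (idm _, t) = atp (be 0 z) p.
Proof. by rewrite /= atp_act sfunP. Qed.

Hypothesis Sbe : weq be.

(* A lift amounts to a path in [B] with a filling in [B'], that is, to a map to
   the path space of [be], which exists since [be] is an equivalence. *)
Lemma tfib_forget : tfib forget.
Proof.
move=> n R y [Ru Ra] RS SR Ry.
pose S p (k : cyl (splx n) p) (q : psp be p) :=
  [\/ exists2 e, R p k.1 e & q = qm p (e, k.2),
      k.2 = c0 p /\ q = q0 p (act k.1 y) | k.2 = c1 p /\ q = q1 p].
pose psi : smap (cyl (splx n)) B' := @SMap (cyl (splx n)) B' (fun p k => wpath k.2) (fun _ _ a k => wpath_act a k.2).
have [||h [hS hE]] := @lift_plain _ _ _ Sbe (cyl (splx n)) S psi.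
- split=> [p k q q'|p q a k v].
    have n01 : k.2 = c0 p -> k.2 = c1 p -> False by move=> -> /c0_neq_c1.
    have m0 e : R p k.1 e -> k.2 = c0 p -> qm p (e, k.2) = q0 p (act k.1 y).
      by move=> /Ry <- ->; rewrite q0_forget.
    have m1 e : k.2 = c1 p -> qm p (e, k.2) = q1 p by move=> ->; apply: q1_tgt.
    case=> [[e Re ->]|[E1 ->]|[E1 ->]] [[e' Re' ->]|[E2 ->]|[E2 ->]] //; try by case: n01.
    + by rewrite (Ru _ _ _ _ Re Re').
    + exact: m0.
    + exact: m1.
    + exact/esym/m0.
    + exact/esym/m1.
  case=> [[e Re ->]|[E1 ->]|[E1 ->]].
  + by constructor 1; exists (act a e); [apply: Ra | rewrite -(sfunP qm)].
  + by constructor 2; split; [rewrite /= E1; exact: cst_act | rewrite -(sfunP q0) -(@actM G)].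
  + by constructor 3; split; [rewrite /= E1; exact: cst_act | exact: q1_act].
- move=> p k q [[e _ ->]|[E1 ->]|[E1 ->]]; rewrite ?qm_end ?q0_end ?q1_end //= ?E1 //.
have h0 p (t : splx n p) : h p (t, c0 p) = q0 p (act t y) by apply: hS; constructor 2.
have h1 p (t : splx n p) : h p (t, c1 p) = q1 p by apply: hS; constructor 3.
have hR p (t : splx n p) s e : R p t e -> h p (t, s) = qm p (e, s).
  by move=> Re; apply: hS; constructor 1; exists e.
have g0 p k : scomp (ppt be) h p (k, c0 p) = f p (yon (hf_pt y) p k) by rewrite /= h0.
have g1 p k : scomp (ppt be) h p (k, c1 p) = atp z p by rewrite /= h1.
pose X := mkhofib g0 g1.
(* Exchanging the two path parameters turns the lift into a path of points of [hofib f' (be 0 z)]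
   over the path of [y] in [A']. *)
pose sg : smap (cyl (cyl (splx n))) B' := swap (uncurry (scomp (ppath be) h)).
have s0 p k : sg p (k, c0 p) = f' p ((hf_path y : smap (cyl (splx n)) A') p k).
  case: k => k t; transitivity (ppath be p (h p (k, c0 p)) p (idm _, t)) => //.
  by rewrite h0 q0_pathE [in RHS]hpath_at.
have s1 p k : sg p (k, c1 p) = atp (be 0 z) p.
  case: k => k t; transitivity (ppath be p (h p (k, c1 p)) p (idm _, t)) => //.
  by rewrite h1 q1_pathE.
pose P := mkhofib (f := f') s0 s1.
have Psrc p (t : splx n p) : P p (t, c0 p) = ind p (act t (X n (idm _))).
  apply: hofib_ext => [|q [x' s]]; first by rewrite /= hf_src; congr (al p _); rewrite -(@actM A); congr (act _ _); apply: Dext.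
  rewrite ind_path; transitivity (ppath be q (h q (t \c x', s)) q (idm _, c0 q)).
    by rewrite /=; congr (sfun (sval (h q (_, _))).2 q (_, _)); apply: Dext.
  rewrite psp_start; congr (be q (ppt be q (h q (_, _)))); exact: Dext.
have Ptgt p (t : splx n p) : P p (t, c1 p) = act (cst p (ord0 : 'I_1)) w.
  apply: hofib_ext => [|q [x' s]]; first by rewrite /= hf_tgt.
  transitivity (pend be q (h q (t \c x', s))).
    by rewrite /=; congr (sfun (sval (h q (_, _))).2 q (_, _)); apply: Dext.
  rewrite hE [RHS]hpath_at /wpath; congr (hf_path _ q _).
  exact: (esym (@atp_act (hofib f' (be 0 z)) w q p x')).
pose x : E n := @HofibSimp _ _ ind w n (X n (idm _)) P Psrc Ptgt.
exists x; split.
  apply: hofib_ext => [|p [t s]]; first by rewrite /= act1.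
  by rewrite forget_path.
move=> p a e Re; have Ee := Ry _ _ _ Re.
apply: hofib_ext => [|q [t s]].
  apply: hofib_ext => [|q [t s]].
    transitivity (act a (hf_pt y)); first by rewrite /= act1.
    by have := congr1 (@hf_pt _ _ _ _ _) Ee.
  rewrite [RHS]hpath_at.
  transitivity (ppt be q (h q (a \c t, s))).
    by rewrite /=; congr (sval (h q (_, _))).1; apply: Dext.
  by rewrite (hR _ _ _ _ (Ra _ _ t _ _ Re)).
apply: hofib_ext => [|r [t' s']].
  by rewrite -[RHS]forget_path Ee.
rewrite [RHS]hpath_at -(sfunP (hf_path e)).
transitivity (ppath be r (h r (a \c (t \c t'), s')) r (idm _, act t' s)).
  by rewrite /=; congr (sfun (sval (h r (_, _))).2 r (_, _)); apply: Dext.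
rewrite (hR _ _ _ _ (Ra _ _ (t \c t') _ _ Re)) qm_pathE; congr (hf_path _ r _).
by rewrite [in RHS]hpath_at.
Qed.
End Square.

Lemma contr_tfib_src (E G : sset) (p : smap E G) : tfib p -> contr G -> contr E.
Proof.
move=> tp cG n R [Ru Ra] RS SR.
have [|||y yP] := cG n (fun q a v => exists2 e, R q a e & v = p q e).
- split=> [q k v v' [e Re ->] [e' Re' ->]|m q a k v [e Re ->]]; first by rewrite (Ru _ _ _ _ Re Re').
  by exists (act a e); [exact: Ra | rewrite sfunP].
- by move=> q a v [e /RS].
- by move=> q a /SR[e Re]; exists (p q e), e.
have [|x [_ xP]] := tp n R y (PFun Ru Ra) RS SR; last by exists x.
by move=> q a e Re; apply/esym/yP; exists e.
Qed.

(** The boundary lifts to [E], starting from the empty partial lift; it is filled there and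
    projected. *)
Lemma contr_tfib_tgt (E G : sset) (p : smap E G) : tfib p -> contr E -> contr G.
Proof.
move=> tp cE n R pR RS SR.
have [zA zAR] := bdry_map pR SR.
have [||h [_ hP]] := lift_plain tp (K := bdry n) (R := fun _ _ _ => False) (psi := zA) => //.
have [|||x xP] := cE n (fun q a v => exists na : ~ surj a, v = h q (exist _ a na)).
- split=> [q k v v' [na ->] [na' ->]|m q a k v [nk ->]]; first by rewrite (Prop_irrelevance na na').
  exists (nonsurj_act (a := a) nk); rewrite -sfunP; congr (h m _); exact: bdry_eq.
- by move=> q a v [].
- by move=> q a na; exists (h q (exist _ a na)), na.
exists (p n x) => q a t Rt; have na := RS _ _ _ Rt.
have -> : t = zA q (exist _ a na) by case: pR => Ru _; exact: (Ru _ _ _ _ Rt (zAR q (exist _ a na))).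
by rewrite -hP -sfunP; congr (p q _); apply: xP; exists na.
Qed.

Section HepHofib.
Variables (X Y : sset) (f : smap X Y) (y : Y 0).

Lemma psp_to_hofib (K : sset) (h : smap K (psp f)) : (forall p k, pend f p (h p k) = atp y p) ->
  exists g : smap K (hofib f y), forall p k, hofib_psp f y p (g p k) = h p k.
Proof.
move=> hE.
have g0 p k : uncurry (scomp (ppath f) h) p (k, c0 p) = f p (scomp (ppt f) h p k) by rewrite -psp_start.
have g1 p k : uncurry (scomp (ppath f) h) p (k, c1 p) = atp y p by rewrite -(hE p k).
exists (mkhofib g0 g1) => p k; apply: psp_ext => [|q x t] //.
by rewrite /= sfunP /=; congr (sfun (sval (h p k)).2 q (_, _)); apply: Dext.
Qed.

Lemma hep_hofib : hep X -> hep Y -> hep (hofib f y).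
Proof.
move=> hX hY n e R [Ru Ra] RA AR.
pose psi : smap (cyl (splx n)) Y :=
  @SMap (cyl (splx n)) Y (fun p _ => atp y p) (fun p q a _ => esym (atp_act y a)).
have [||||||H [HP HO]] := @psp_fib _ _ f hX hY (splx n) (fun p k => ~ surj k) e
  (fun p k v => exists2 h, R p k h & v = hofib_psp f y p h) psi.
- split=> [q k v v' [h Rh ->] [h' Rh' ->]|m q a k v [h Rh ->]]; first by rewrite (Ru _ _ _ _ Rh Rh').
  by exists (act a h); [exact: Ra | rewrite sfunP].
- by move=> p q a k; apply: nonsurj_act.
- by move=> p k t v [h /RA].
- by move=> p k; have [|h Rh] := AR p (k, cst p e); [left | exists (hofib_psp f y p h), h].
- by move=> p k t nk; have [|h Rh] := AR p (k, t); [right | exists (hofib_psp f y p h), h].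
- by move=> p k v [h _ ->]; apply: hofib_psp_end.
have [g gP] := psp_to_hofib HO.
by exists g => p k h Rh; apply: (@hofib_psp_inj _ _ f y); rewrite gP; apply: HP; exists h.
Qed.
End HepHofib.

Section SquareEquiv.
Variables (A A' B B' : sset) (f : smap A B) (f' : smap A' B') (al : smap A A') (be : smap B B').
Hypothesis sq : forall n x, f' n (al n x) = be n (f n x).
Hypotheses (hA : hep A) (hA' : hep A') (hB : hep B) (hB' : hep B').
Hypothesis Sbe : weq be.

Lemma weq_ind z : weq al -> weq (ind sq z).
Proof.
move=> Sal; apply: contr_weq; [exact: hep_hofib hA hB | exact: hep_hofib hA' hB' |].
move=> w; refine (@contr_tfib_src _ _ (forget sq w) _ (@weq_contr _ _ al Sal (hf_pt w))).
exact: tfib_forget.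
Qed.

Lemma path_rev (b b' : B' 0) (g : maps I1 B' 0) : g 0 (idm _, c0 0) = b -> g 0 (idm _, c1 0) = b' ->
  exists g' : maps I1 B' 0, forall p t, g' p (t, c0 p) = atp b' p /\ g' p (t, c1 p) = atp b p.
Proof.
move=> gb gb'.
have E e p (t : splx 0 p) : g p (t, cst p e) = act t (g 0 (idm _, cst 0 e)).
  by rewrite -sfunP; congr (g p (_, _)); apply: Dext.
have [|H HP] := @htpy_sym (splx 0) B' (yon b) (yon b') hB'.
  by exists g => p t; rewrite (E ord0 p t) (E ord_max p t) gb gb'.
exists H => p t; have [-> ->] := HP p t.
by split; rewrite /= /atp; congr (act _ _); apply: Dext => i; rewrite [LHS]ord1 [RHS]ord1.
Qed.

(** Every [v] of [A'] underlies a point of some homotopy fibre of [f'] over the image of [be]: as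
    [be] is an equivalence, its image meets the component of [f' 0 v]. *)
Lemma ind_weq : (forall z, weq (ind sq z)) -> weq al.
Proof.
move=> Si; apply: contr_weq => // v.
have [||||q [qE _]] := Sbe (n := 0) (R := fun _ _ _ => False) (y := f' 0 v).
- by split.
- by [].
- by move=> p a []; apply: surj0.
- by [].
have [g gP] := path_rev (psp_start q) (etrans (esym erefl) qE).
have src p (t : splx 0 p) : g p (t, c0 p) = f' p (act t v).
  rewrite (gP p t).1 sfunP /atp; congr (act _ _); apply: Dext => i; by rewrite [LHS]ord1 [RHS]ord1.
have tgt p (t : splx 0 p) : g p (t, c1 p) = act (cst p (ord0 : 'I_1)) (be 0 (ppt be 0 q)) := (gP p t).2.
pose w : hofib f' (be 0 (ppt be 0 q)) 0 := HofibSimp src tgt.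
refine (@contr_tfib_tgt _ _ (forget sq w) _ (@weq_contr _ _ _ (Si _) w)).
exact: tfib_forget.
Qed.
End SquareEquiv.

Lemma idpair_act m p (a : @hom Delta m p) (t : I1 p) :
  act a ((idm _, t) : sprod (splx p) I1 p) = (a, act a t).
Proof. by congr (_, _); apply: Dext. Qed.

Lemma hep_spow (I : Type) (X : sset) : hep X -> hep (spow I X).
Proof.
move=> hX n e R [Ru Ra] RA AR.
have hH (i : I) : exists H : smap (cyl (splx n)) X, forall p z v, R p z v -> H p z = v i.
  have [|||H HP] := hX n e (fun p z x => exists2 v, R p z v & x = v i).
  - split=> [p z x x' [v Rv ->] [v' Rv' ->]|p q a z x [v Rv ->]]; first by rewrite (Ru _ _ _ _ Rv Rv').
    by exists (act a v); [exact: Ra | ].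
  - by move=> p z x [v /RA].
  - by move=> p z /AR[v Rv]; exists (v i), v.
  by exists H => p z v Rv; apply: HP; exists v.
pose h i := sval (cid (hH i)).
have hP m p (a : @hom Delta m p) z : (fun i => h i m (act a z)) = act a ((fun i => h i p z) : spow I X p).
  by apply: funext => i; rewrite sfunP.
exists (@SMap (cyl (splx n)) (spow I X) (fun p z i => h i p z) hP) => p z v Rv.
by apply: funext => i; apply: (svalP (cid (hH i))).
Qed.

Section MulHolim.
Variables (k j : option nat) (hk : nle 1 k) (hkj : kle k j) (n : nat) (hnj : nle n j) (F : presheaf (Omegac j)).
Notation F0 := (F (cbar0 j)).
Notation P := (powerset_le k n).
Notation D := (corolla_diag hkj n F).

Definition edge_fun (I I' : P) (h : hom I I') : cbarI hkj I -> cbarI hkj I' := omap (leaf_incl h).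
Definition edge_val (I : P) : cbarI hkj I -> cbarn hnj := omap (fun i : leaves_of I => val i).

Lemma edge_valE (I I' : P) (h : hom I I') e : edge_val (edge_fun h e) = edge_val e.
Proof. by case: e. Qed.

Lemma edge_val_inj (I : P) : injective (@edge_val I).
Proof. by move=> [a|] [b|] //= [/val_inj ->]. Qed.

Definition edges_map (I I' : op P) (h : hom I I') : smap (spow (cbarI hkj I) F0) (spow (cbarI hkj I') F0) :=
  @SMap (spow (cbarI hkj I) F0) (spow (cbarI hkj I') F0) (fun m x e => x (edge_fun h e)) (fun _ _ _ _ => erefl).

(* The homotopy limit of the powers [F(C_0)^(I+1)] is [F(C_0)^(n+1)]: the inverse
   evaluates at the subcorollas with at most one leaf. *)
Definition edges_diag : diagram (op P).
refine (@Diagram (op P) (fun I => spow (cbarI hkj I) F0) edges_map _ _).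
- by move=> I m x; apply: funext => e /=; congr (x _); apply: edge_val_inj; rewrite edge_valE.
- by move=> I I' I'' h h' m x; apply: funext => e /=; congr (x _); apply: edge_val_inj; rewrite !edge_valE.
Defined.

Definition edges_leg (I : op P) : smap (spow (cbarn hnj) F0) (edges_diag I) :=
  @SMap (spow (cbarn hnj) F0) (edges_diag I) (fun m x e => x (edge_val e)) (fun _ _ _ _ => erefl).

Lemma edges_coneP (I I' : op P) (h : hom I I') m x :
  dmap edges_diag h m (edges_leg I m x) = edges_leg I' m x.
Proof. by apply: funext => e /=; rewrite edge_valE. Qed.

Definition edges_cone : cone (spow (cbarn hnj) F0) edges_diag := Cone edges_coneP.

Lemma to_edges_nat (I I' : op P) (h : hom I I') m (x : D I m) :
  to_edges F (cbarI hkj I') m (dmap D h m x) = dmap edges_diag h m (to_edges F (cbarI hkj I) m x).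
Proof.
apply: funext => e /=; rewrite -[LHS](@dmapM _ F); congr (dmap F _ m x).
exact: treemap_ext.
Qed.

Definition edges_mor : dmor D edges_diag :=
  @DMor (op P) D edges_diag (fun I => to_edges F (cbarI hkj I)) to_edges_nat.

Notation al := (canon (corolla_cone hkj hnj F)).
Notation be := (canon edges_cone).
Notation f0 := (to_edges F (cbarn hnj)).
Notation f1 := (hmap edges_mor).

Lemma edges_sq m x : f1 m (al m x) = be m (f0 m x).
Proof.
apply: holim_ext => q y c; rewrite -!sfunP hval_hmap !hval_canon.
apply: funext => e /=; rewrite -[LHS](@dmapM _ F); congr (dmap F _ q _).
exact: treemap_ext.
Qed.

Variables (X : 'I_n -> colour F) (Y : colour F).
Notation M := (mul_diag hkj X Y).
Definition col : spow (cbarn hnj) F0 0 := @colours j F 'I_n (card_corolla hnj) X Y.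
Definition colI (I : P) : spow (cbarI hkj I) F0 0 := @colours j F (leaves_of I) (card_leaves hkj I) (fun i => X (val i)) Y.

Arguments colI I : clear implicits.

Lemma col_leg (I : op P) : edges_leg I 0 col = colI I.
Proof. by apply: funext => -[]. Qed.

Lemma hval_atp q (c : functor (lin q) (op P)) I (u : hom (c ord_max) I) :
  hval (atp (be 0 col) q) u = atp (Y := edges_diag I) (colI I) q.
Proof. by rewrite /atp -sfunP hval_canon -col_leg. Qed.

Definition pt_mor : dmor M D :=
  @DMor (op P) M D (fun I => hpt (to_edges F (cbarI hkj I)) (colI I)) (fun _ _ _ _ _ => erefl).

Lemma th_pathP I m p (a : @hom Delta m p) (w : W (op P) (cyl (holim M)) I p) :
  hf_path (hval (wb (wact a w)).1 (wu (wact a w)) : M I m) m (idm _, (wb (wact a w)).2) =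
  act a (hf_path (hval (wb w).1 (wu w) : M I p) p (idm _, (wb w).2)).
Proof.
rewrite -sfunP idpair_act [in RHS]hpath_at.
have -> : hval (wb (wact a w)).1 (wu (wact a w)) = act a (hval (wb w).1 (wu w)) :> M I m by rewrite hval_act.
by [].
Qed.

Definition th_dmor : dmor (W (op P) (cyl (holim M))) edges_diag.
refine (@DMor (op P) (W (op P) (cyl (holim M))) edges_diag
  (fun I => @SMap (W (op P) (cyl (holim M)) I) (edges_diag I)
     (fun p w => hf_path (hval (wb w).1 (wu w) : M I p) p (idm _, (wb w).2)) (@th_pathP I)) _).
move=> I I' u p w.
exact: (congr1 (fun v : M I' p => hf_path v p (idm _, (wb w).2)) (esym (hval_push (F := M) (wb w).1 (wu w) u))).
Defined.

Lemma th0 p (s : holim M p) : holim_of th_dmor p (s, c0 p) = f1 p (hmap pt_mor p s).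
Proof.
apply: holim_ext => q x c; rewrite -!sfunP hval_of !hval_hmap.
have E : act x ((s, c0 p) : cyl (holim M) p) = (act x s, c0 q) by congr (_, _); apply: cst_act.
by rewrite E; exact: hpath0.
Qed.

Lemma th1 p (s : holim M p) : holim_of th_dmor p (s, c1 p) = atp (be 0 col) p.
Proof.
apply: holim_ext => q x c; rewrite -!sfunP hval_of atp_act hval_atp.
have E : act x ((s, c1 p) : cyl (holim M) p) = (act x s, c1 q) by congr (_, _); apply: cst_act.
by rewrite E; exact: hf_tgt.
Qed.

(** Homotopy limits commute strictly with homotopy fibres: [th] is an isomorphism with inverse [xi],
    since both sides consist of a section of [D] and a path of sections of [edges_diag]. *)
Definition th : smap (holim M) (hofib f1 (be 0 col)) := mkhofib th0 th1.

Notation H := (hofib f1 (be 0 col)).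

Lemma xi_ptP I m p (a : @hom Delta m p) (w : W (op P) H I p) :
  hval (hf_pt (wb (wact a w))) (wu (wact a w)) = act a (hval (F := D) (hf_pt (wb w)) (wu w)).
Proof. by rewrite hval_act. Qed.
Definition xi_pt I : smap (W (op P) H I) (D I) :=
  @SMap (W (op P) H I) (D I) (fun p w => hval (hf_pt (wb w)) (wu w)) (@xi_ptP I).

Lemma xi_pathP I m p (a : @hom Delta m p) (w : cyl (W (op P) H I) p) :
  hval (hf_path (wb (wact a w.1)) m (idm _, act a w.2)) (wu (wact a w.1)) =
  act a (hval (F := edges_diag) (hf_path (wb w.1) p (idm _, w.2)) (wu w.1)).
Proof.
by rewrite hval_act -(sfunP (hf_path (wb w.1))) idpair_act [in RHS]hpath_at.
Qed.
Definition xi_path I : smap (cyl (W (op P) H I)) (edges_diag I) :=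
  @SMap (cyl (W (op P) H I)) (edges_diag I)
    (fun p w => hval (hf_path (wb w.1) p (idm _, w.2)) (wu w.1)) (@xi_pathP I).

Lemma xi0 I p w : xi_path I p (w, c0 p) = to_edges F (cbarI hkj I) p (xi_pt I p w).
Proof. by rewrite /= hpath0 hval_hmap. Qed.
Lemma xi1 I p w : xi_path I p (w, c1 p) = atp (colI I : edges_diag I 0) p.
Proof. by rewrite /= hf_tgt hval_atp. Qed.

Definition xi_I I : smap (W (op P) H I) (M I) := mkhofib (@xi0 I) (@xi1 I).

Definition xi_dmor : dmor (W (op P) H) M.
refine (@DMor (op P) (W (op P) H) M xi_I _).
move=> I I' u p w; apply: hofib_ext => [|q [x t]].
  exact: (esym (hval_push (F := D) (hf_pt (wb w)) (wu w) u)).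
transitivity (xi_path I' q (dmap (W (op P) H) u q (act x w), t)); first by rewrite sfunP.
exact: (esym (hval_push (F := edges_diag) (hf_path (wb (act x w : W (op P) H I q)) q (idm _, t))
  (wu (act x w : W (op P) H I q)) u)).
Defined.

Definition xi : smap H (holim M) := holim_of xi_dmor.

Lemma th_path r (s : holim M r) t : hf_path (th r s) r (idm _, t) = holim_of th_dmor r (s, t).
Proof. exact: (congr1 (fun v => holim_of th_dmor r (v, t)) (@act1 (holim M) r s)). Qed.

Lemma xi_path_at I q (w : W (op P) H I q) t : hf_path (xi_I I q w) q (idm _, t) = xi_path I q (w, t).
Proof. exact: (congr1 (fun v => xi_path I q (v, t)) (@act1 (W (op P) H I) q w)). Qed.

Lemma xi_th m (s : holim M m) : xi m (th m s) = s.
Proof.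
apply: holim_ext => q y c; rewrite -(sfunP xi) -(sfunP th) hval_of.
set s' := act y s; apply: hofib_ext => [|r [x t]].
  exact: (hval_hmap pt_mor).
have E : act x (hval s' (idm (c ord_max))) = hval (act x s') (c := compf c x)
  (idm (c ord_max) \c fmap c (le_max (x ord_max))) :> M _ r := hval_act x s' (idm (c ord_max)).
rewrite [RHS]hpath_at E.
transitivity (hval (F := edges_diag) (hf_path (act x (th q s') : H r) r (idm _, t)) (c := compf c x)
  (idm (c ord_max) \c fmap c (le_max (x ord_max)))); first by [].
by rewrite -(sfunP th) th_path hval_of.
Qed.

Lemma th_xi m (h : H m) : th m (xi m h) = h.
Proof.
apply: hofib_ext => [|p [x t]].
  apply: holim_ext => q y c; rewrite -!sfunP hval_hmap hval_of.
  by [].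
rewrite [RHS]hpath_at; set h' := act x h.
transitivity (holim_of th_dmor p (xi p h', t)); first by rewrite /h' sfunP.
apply: holim_ext => q y c; rewrite -!sfunP hval_of.
transitivity (hf_path (hval (xi q (act y h')) (idm (c ord_max)) : M _ q) q (idm _, act y t)).
  by rewrite (sfunP xi).
rewrite hval_of [LHS]xi_path_at.
by rewrite idpair_act [in RHS]hpath_at.
Qed.

Lemma th_canon m (s : mul (card_corolla hnj) X Y m) :
  th m (canon (mul_cone hkj hnj X Y) m s) = ind edges_sq col m s.
Proof.
apply: hofib_ext => [|p [x t]].
  by apply: holim_ext => q y c; rewrite -!sfunP hval_hmap !hval_canon.
rewrite ind_path hpath_at -(sfunP th) th_path -(sfunP (canon _)) [in RHS]hpath_at.
set s' := act x s.
apply: holim_ext => q y c; rewrite -!sfunP hval_of hval_canon.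
transitivity (hf_path (hval (canon (mul_cone hkj hnj X Y) q (act y s')) (idm (c ord_max)) : M _ q) q (idm _, act y t)).
  by rewrite (sfunP (canon (mul_cone hkj hnj X Y))).
rewrite hval_canon idpair_act [in RHS]hpath_at.
by [].
Qed.

Lemma th_sequiv : sequiv th.
Proof.
apply: (@sequiv_inv _ _ _ xi); apply: htpy_refl => m s; [exact: xi_th | exact: th_xi].
Qed.

Hypothesis hF : forall T, hep (F T).

Lemma hep_edges I : hep (edges_diag I).
Proof. exact: (hep_spow (@hF (cbar0 j))). Qed.

Lemma mul_ind : sequiv (canon (mul_cone hkj hnj X Y)) <-> sequiv (ind edges_sq col).
Proof.
have E : scomp th (canon (mul_cone hkj hnj X Y)) = ind edges_sq col.
  by apply: smap_ext => m s; exact: th_canon.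
have hH : hep H by apply: hep_hofib; apply: hep_holim => I; [exact: hF | exact: hep_edges].
have hM : hep (holim M) by apply: hep_holim => I; apply: hep_hofib; [exact: hF | exact: hep_edges].
split=> e; last first.
  by refine (@sequiv_cancel_post _ _ _ _ _ hM th_sequiv _); rewrite E.
rewrite -E; apply: sequiv_comp th_sequiv => //; apply: hep_hofib; first exact: hF.
exact: (hep_spow (@hF (cbar0 j))).
Qed.

Definition rho_set (e : cbarn hnj) : {set 'I_n} := if e is Some i then [set i] else set0.
Lemma rho_card e : nle #|rho_set e| k.
Proof. by apply: leq_nle hk; case: e => [i|] /=; rewrite ?cards1 ?cards0. Qed.
Definition rho_ob (e : cbarn hnj) : op P := exist _ (rho_set e) (rho_card e).

Definition rho_edge (e : cbarn hnj) : cbarI hkj (rho_ob e) :=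
  match e return cbarI hkj (rho_ob e) with
  | Some i => Some (exist _ i (set11 i))
  | None => None
  end.

Lemma rho_edgeE e : edge_val (rho_edge e) = e. Proof. by case: e. Qed.

Lemma constM (C : category) (a : C) : idm a = idm a \c idm a. Proof. by rewrite comp1m. Qed.
Definition constc (C : category) (a : C) q : functor (lin q) C :=
  @Functor (lin q) C (fun _ => a) (fun _ _ _ => idm a) (fun _ => erefl) (fun _ _ _ _ _ => constM a).

Lemma rhoP m p (a : @hom Delta m p) (s : holim edges_diag p) :
  (fun e => hval (p := m) (act a s) (c := constc (rho_ob e) m) (idm (rho_ob e)) (rho_edge e)) =
  act a ((fun e => hval s (c := constc (rho_ob e) p) (idm (rho_ob e)) (rho_edge e)) : spow (cbarn hnj) F0 p).
Proof.
apply: funext => e.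
have E : act a (hval s (c := constc (rho_ob e) p) (idm (rho_ob e))) =
    hval (F := edges_diag) (p := m) (act a s) (c := constc (rho_ob e) m) (idm (rho_ob e)) :> edges_diag (rho_ob e) m.
  by rewrite hval_act; apply: hval_eq => //=; rewrite comp1m.
exact: (congr1 (fun v : edges_diag (rho_ob e) m => v (rho_edge e)) (esym E)).
Qed.

Definition rho : smap (holim edges_diag) (spow (cbarn hnj) F0) :=
  @SMap (holim edges_diag) (spow (cbarn hnj) F0)
    (fun m s e => hval s (c := constc (rho_ob e) m) (idm (rho_ob e)) (rho_edge e)) rhoP.

Lemma rho_be m x : rho m (be m x) = x.
Proof. by apply: funext => e; rewrite /= hval_canon /= rho_edgeE. Qed.

(* A chain ending above an edge [e] of [cbarI I] maps to the constant chain at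
   the smallest subcorolla containing [e]. *)
Lemma rho_sub (I : P) (e : cbarI hkj I) : rho_set (edge_val e) \subset sval I.
Proof. by case: e => [i|] /=; rewrite ?sub1set ?sub0set //; apply: valP. Qed.

Section Btau.
Variables (q : nat) (c : functor (lin q) (op P)) (I : op P) (u : hom (c ord_max) I) (e : cbarI hkj (I : P)).

Lemma btau_sub (i : lin q) : rho_set (edge_val e) \subset sval (c i).
Proof. apply: subset_trans (rho_sub e) (subset_trans (u : _ \subset _) _); exact: (fmap c (le_max i)). Qed.

Definition btau (i : lin q) : hom (c i) (constc (rho_ob (edge_val e)) q i) := btau_sub i.
End Btau.

Lemma btauN q (c : functor (lin q) (op P)) (I : op P) (u : hom (c ord_max) I) (e : cbarI hkj (I : P))
  (i i' : lin q) (h : hom i i') :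
  fmap (constc (rho_ob (edge_val e)) q) h \c btau u e i = btau u e i' \c fmap c h.
Proof. exact: bool_irrelevance. Qed.

Definition bval q (s : holim edges_diag q) (t : I1 q) (c : functor (lin q) (op P)) (I : op P)
    (u : hom (c ord_max) I) (e : cbarI hkj (I : P)) : F0 q :=
  gval (@btauN q c I u e) t s (idm (rho_ob (edge_val e))) (rho_edge (edge_val e)).

Lemma bval_edge q s t (c : functor (lin q) (op P)) (I I' : op P) (u : hom (c ord_max) I) (u' : hom (c ord_max) I') e e' :
  edge_val e = edge_val e' -> @bval q s t c I u e = @bval q s t c I' u' e'.
Proof.
rewrite /bval /gval => E; move: (btauN u e) (btauN u' e'); rewrite /btau.
move: (btau_sub u e) (btau_sub u' e'); rewrite E => h h'.
rewrite (Prop_irrelevance h h') => N N'; by rewrite (Prop_irrelevance N N').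
Qed.

Lemma bval_act m q (a : @hom Delta m q) s t (c : functor (lin q) (op P)) (I : op P) (u : hom (c ord_max) I) e :
  @bval m (act a s) (act a t) (compf c a) I (u \c fmap c (le_max (a ord_max))) e =
  act a (@bval q s t c I u e).
Proof.
have E : gval (@btauN m (compf c a) I (u \c fmap c (le_max (a ord_max))) e) (act a t) (act a s) (idm (rho_ob (edge_val e))) =
    act a (gval (@btauN q c I u e) t s (idm (rho_ob (edge_val e)))) :> edges_diag (rho_ob (edge_val e)) m.
  by rewrite /gval hval_act; apply: hval_eq => *; exact: bool_irrelevance.
exact: (congr1 (fun v : edges_diag (rho_ob (edge_val e)) m => v (rho_edge (edge_val e))) E).
Qed.

Lemma bval0 q s (c : functor (lin q) (op P)) (I : op P) (u : hom (c ord_max) I) e :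
  @bval q s (c0 q) c I u e = hval s u e.
Proof.
have v : hom I (rho_ob (edge_val e)) := rho_sub e.
have E : gval (@btauN q c I u e) (c0 q) s (idm (rho_ob (edge_val e))) =
    dmap edges_diag v q (hval s u) by rewrite gval0 hval_push; apply: (congr1 (fun w => hval s w)); apply: bool_irrelevance.
rewrite /bval E /=; congr (hval s u _); apply: edge_val_inj.
by rewrite edge_valE rho_edgeE.
Qed.

Lemma bval1 q s (c : functor (lin q) (op P)) (I : op P) (u : hom (c ord_max) I) e :
  @bval q s (c1 q) c I u e = rho q s (edge_val e).
Proof. by rewrite /bval gval1. Qed.

Lemma bphiP (I : op P) m q (a : @hom Delta m q) (w : W (op P) (cyl (holim edges_diag)) I q) :
  (fun e => bval (wb (wact a w)).1 (wb (wact a w)).2 (wu (wact a w)) e) =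
  act a ((fun e => bval (wb w).1 (wb w).2 (wu w) e) : edges_diag I q).
Proof. by apply: funext => e; exact: (bval_act a (wb w).1 (wb w).2 (wu w) e). Qed.

Definition bphi : dmor (W (op P) (cyl (holim edges_diag))) edges_diag.
refine (@DMor (op P) (W (op P) (cyl (holim edges_diag))) edges_diag
  (fun I => @SMap (W (op P) (cyl (holim edges_diag)) I) (edges_diag I)
    (fun q w e => bval (wb w).1 (wb w).2 (wu w) e) (@bphiP I)) _).
by move=> I I' h q w; apply: funext => e; apply: bval_edge; rewrite edge_valE.
Defined.

Lemma edges_equiv : sequiv be.
Proof.
apply: (@sequiv_inv _ _ _ rho); first by apply: htpy_refl => m x; apply: rho_be.
apply: htpy_sym; first by apply: hep_holim => I; apply: hep_edges.
exists (holim_of bphi) => m s; split; apply: holim_ext => q y c; rewrite -!sfunP hval_of.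
  by apply: funext => e; rewrite /= [compf _ y](cst_act y (ord0 : 'I_2)) bval0.
rewrite hval_canon; apply: funext => e.
by rewrite /= [compf _ y](cst_act y (ord_max : 'I_2)) bval1.
Qed.
End MulHolim.

(** The map on bases is an equivalence by [edges_equiv], so the map of total spaces is one exactly
    when all induced maps of homotopy fibres are; [mul_ind] identifies these with the maps on
    [Mul]. *)
Lemma corolla_mul (k j : option nat) (hk : nle 1 k) (hkj : kle k j) (n : nat) (hnj : nle n j)
    (F : presheaf (Omegac j)) : (forall T, hep (F T)) ->
  sequiv (canon (corolla_cone hkj hnj F)) <->
  forall (X : 'I_n -> colour F) (Y : colour F), sequiv (canon (mul_cone hkj hnj X Y)).
Proof.
move=> hF.
have hB : hep (spow (cbarn hnj) (F (cbar0 j))) by apply: hep_spow; exact: hF.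
pose E := edges_diag hkj hnj F.
have hE I : hep (E I) by apply: hep_edges.
have hA : hep (F (cbarn hnj)) by apply: hF.
have hD : hep (holim (corolla_diag hkj n F)) by apply: hep_holim => I; apply: hF.
have hEh : hep (holim E) by apply: hep_holim => I; apply: hE.
have Sbe : weq (canon (edges_cone hkj hnj F)) := sequiv_weq hB hEh (edges_equiv hk hkj hnj hF).
pose sq := @edges_sq k j hkj n hnj F.
split=> [e X Y|e].
  apply/mul_ind => //; apply: weq_sequiv; [exact: hep_hofib hA hB | exact: hep_hofib hD hEh |].
  have Sal := sequiv_weq hA hD e.
  refine (@weq_ind _ _ _ _ _ _ _ _ sq hA hD hB hEh Sbe (@col j n hnj F X Y) _).
  exact: Sal.
apply: (weq_sequiv hA hD); apply: (ind_weq (sq := sq) hA hD hEh Sbe) => z.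
(* Every point of the base is a tuple of colours, one for each edge of the corolla. *)
have -> : z = @col j n hnj F (fun i => z (Some i)) (z None) by apply: funext => -[].
apply: sequiv_weq; [exact: hep_hofib hA hB | exact: hep_hofib hD hEh |].
by apply/mul_ind.
Qed.

Theorem corollary5p19
  (k j : option nat) (hk : nle 1 k) (hkj : kle k j)
  (F : presheaf (Omegac j)) (hF : Op_un (nle_trans hk hkj) F) :
  let in_image_of_Rk :=
    exists G : presheaf (Omegac k), Op_un hk G /\ dequiv F (ran (incl hkj) G) in
  let corollas_are_limits :=
    forall (n : nat) (hkn : ~~ nle n k) (hnj : nle n j),
      sequiv (canon (corolla_cone hkj hnj F)) in
  let multimorphisms_are_limits :=
    forall (n : nat) (hkn : ~~ nle n k) (hnj : nle n j)
           (X : 'I_n -> colour F) (Y : colour F),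
      sequiv (canon (mul_cone hkj hnj X Y)) in
  (in_image_of_Rk <-> corollas_are_limits) /\
  (corollas_are_limits <-> multimorphisms_are_limits).
Proof.
move=> in_image corollas multis.
have hepF T : hep (F T) by apply: kan_hep; apply: op_un_kan hF T.
split; split.
- by case=> G [hG d] n _ hnj; exact: (image_corollas hF hG d hnj).
- exact: corollas_image hF.
- by move=> cF n hkn hnj; apply/(corolla_mul hk hkj hnj hepF)/cF.
- by move=> mF n hkn hnj; apply/(corolla_mul hk hkj hnj hepF) => X Y; apply: mF.
Qed.
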